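(* Let $\Sigma_g$ be a closed surface of genus $g\ge 3$ with fundamental group $\Gamma_g$, and let $A$ be a $(2g-3)$-subgroup of $\Gamma_g$. There is a subset $T_{\mathrm{sing}}\subset\mathcal{T}_g$, which is a union of countably many algebraic subsets of positive codimension in $\mathcal{T}_g$, such that for every $[d]\in\mathcal{T}_g$ and every $\epsilon>0$ there exists a neighborhood $V_g^\epsilon(d)$ of $[d]$ in $\mathcal{T}_g$ such that for every $[d']\in V_g^\epsilon(d)\setminus T_{\mathrm{sing}}$, the lattice $\psi_{d'}(\Gamma_g)$ has trace growth greater than $n^{2\delta_{\psi_d(A)}-\epsilon}$.
   Context: A standard generating set of $\Gamma_g$ is a generating set $(\eta_i)_{i=1}^{2g}$ satisfying the single relation $\prod_{i=1}^g[\eta_{2i-1},\eta_{2i}]=e$. The (free) subgroup generated by $\eta_1,\dots,\eta_{2g-3}$ is called a $(2g-3)$-subgroup (it is convex-cocompact in every lattice embedding). $\mathcal{T}_g$ is the Teichmüller space of $\Sigma_g$; each point $[d]$ determines (via Fricke coordinates, i.e. a fixed normalization of the holonomy) a lattice embedding $\psi_d:\Gamma_g\to\operatorname{PSL}(2,\mathbb{R})$ with $\mathbf{H}^2/\psi_d(\Gamma_g)$ isometric to $(\Sigma_g,d)$. For a Fuchsian group $G$ and $o\in\mathbf{H}^2$, the critical exponent is $\delta_G=\inf\{s: \sum_{\gamma\in G}e^{-s\,d(o,\gamma o)}<\infty\}$. For a group $\Gamma\le\operatorname{PSL}(2,\mathbb{R})$, $\mathrm{Tr}(\Gamma)$ is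 the set of traces of all lifts to $\operatorname{SL}(2,\mathbb{R})$ of elements of $\Gamma$; ''$\Gamma$ has trace growth greater than $n^{\alpha}$'' means there is $c>0$ with $\#(\mathrm{Tr}(\Gamma)\cap[-n,n])\ge c\,n^{\alpha}$ for all sufficiently large $n$. *)

(* Defs.v *)
From Stdlib Require Import Reals Lra List Relations.
Import ListNotations.
Open Scope R_scope.

(** * 2x2 real matrices (lifts of elements of PSL(2,R) to SL(2,R)) *)
Record Mat2 := mkMat2 { m11 : R; m12 : R; m21 : R; m22 : R }.

Definition mmul (A B : Mat2) : Mat2 :=
  mkMat2 (m11 A * m11 B + m12 A * m21 B) (m11 A * m12 B + m12 A * m22 B)
         (m21 A * m11 B + m22 A * m21 B) (m21 A * m12 B + m22 A * m22 B).
Definition mid : Mat2 := mkMat2 1 0 0 1.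
Definition mneg (A : Mat2) : Mat2 := mkMat2 (- m11 A) (- m12 A) (- m21 A) (- m22 A).
Definition mdet (A : Mat2) : R := m11 A * m22 A - m12 A * m21 A.
(* adjugate = inverse for determinant-one matrices *)
Definition madj (A : Mat2) : Mat2 := mkMat2 (m22 A) (- m12 A) (- m21 A) (m11 A).
Definition mtr (A : Mat2) : R := m11 A + m22 A.
(* equality in PSL(2,R) of two SL(2,R) lifts *)
Definition pm_eq (A B : Mat2) : Prop := A = B \/ A = mneg B.
Definition close (eps : R) (A B : Mat2) : Prop :=
  Rabs (m11 A - m11 B) < eps /\ Rabs (m12 A - m12 B) < eps /\
  Rabs (m21 A - m21 B) < eps /\ Rabs (m22 A - m22 B) < eps.

(* (i,false) = eta_i,  (i,true) = eta_i^{-1} *)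
Definition letter := (nat * bool)%type.
Definition word := list letter.
Definition linv (l : letter) : letter := (fst l, negb (snd l)).
Definition winv (w : word) : word := rev (map linv w).
Definition wf_word (g : nat) (w : word) : Prop := Forall (fun l => (fst l < 2 * g)%nat) w.

Definition comm_word (i : nat) : word :=
  [(2 * i, false); (2 * i + 1, false); (2 * i, true); (2 * i + 1, true)]%nat.
Definition relator (g : nat) : word := flat_map comm_word (seq 0 g).

(* equality in Gamma_g = < eta | relator >  *)
Inductive elem_step (g : nat) : word -> word -> Prop :=
| step_cancel : forall (u v : word) (l : letter), elem_step g (u ++ v) (u ++ l :: linv l :: v)
| step_rel : forall (u v : word), elem_step g (u ++ v) (u ++ relator g ++ v).
Definition geq (g : nat) : word -> word -> Prop := clos_refl_sym_trans word (elem_step g).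
Definition trivial (g : nat) (w : word) : Prop := geq g w [].

Definition subst (ws : nat -> word) (u : word) : word :=
  flat_map (fun l : letter => if snd l then winv (ws (fst l)) else ws (fst l)) u.

Definition standard_gen_set (g : nat) (ws : nat -> word) : Prop :=
  (forall i, (i < 2 * g)%nat -> wf_word g (ws i)) /\
  trivial g (subst ws (relator g)) /\
  (forall j, (j < 2 * g)%nat -> exists u, wf_word g u /\ geq g [(j, false)] (subst ws u)).

Definition rep := nat -> Mat2.
Definition eval_letter (rho : rep) (l : letter) : Mat2 :=
  if snd l then madj (rho (fst l)) else rho (fst l).
Fixpoint eval (rho : rep) (w : word) : Mat2 :=
  match w with [] => mid | l :: w' => mmul (eval_letter rho l) (eval rho w') end.

(* discrete faithful representation Gamma_g -> PSL(2,R), given by SL(2,R) lifts of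
   the images of the generators *)
Definition is_DF (g : nat) (rho : rep) : Prop :=
  (forall i, (i < 2 * g)%nat -> mdet (rho i) = 1) /\
  pm_eq (eval rho (relator g)) mid /\
  (exists eps, eps > 0 /\ forall w, wf_word g w ->
      (close eps (eval rho w) mid \/ close eps (eval rho w) (mneg mid)) ->
      pm_eq (eval rho w) mid) /\
  (forall w, wf_word g w -> pm_eq (eval rho w) mid -> trivial g w).

(** * Teichmueller space in Fricke coordinates:
    discrete faithful reps normalized so that psi(eta_0) = diag(l,1/l), l>1
    (repelling fixed point 0, attracting fixed point oo), and the attracting
    fixed point of psi(eta_1) is 1; lifts of generators have positive trace. *)
Definition Teich (g : nat) (rho : rep) : Prop :=
  is_DF g rho /\
  (forall i, (i < 2 * g)%nat -> mtr (rho i) > 0) /\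
  (forall i, (2 * g <= i)%nat -> rho i = mid) /\
  m12 (rho 0%nat) = 0 /\ m21 (rho 0%nat) = 0 /\ m11 (rho 0%nat) > 1 /\
  m11 (rho 1%nat) + m12 (rho 1%nat) = m21 (rho 1%nat) + m22 (rho 1%nat) /\
  (m21 (rho 1%nat) + m22 (rho 1%nat)) ^ 2 > 1.

Definition near (g : nat) (r : R) (rho rho' : rep) : Prop :=
  forall i, (i < 2 * g)%nat -> close r (rho i) (rho' i).

Definition entry (k : nat) (A : Mat2) : R :=
  match k with 0 => m11 A | 1 => m12 A | 2 => m21 A | _ => m22 A end.
Definition coord (g : nat) (rho : rep) (n : nat) : R :=
  if Nat.ltb n (8 * g) then entry (Nat.modulo n 4) (rho (Nat.div n 4)) else 0.

Inductive poly : Type :=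
| PVar (n : nat) | PConst (c : R) | PAdd (p q : poly) | PMul (p q : poly).
Fixpoint peval (x : nat -> R) (p : poly) : R :=
  match p with
  | PVar n => x n | PConst c => c
  | PAdd p q => peval x p + peval x q | PMul p q => peval x p * peval x q
  end.

Definition algebraic_subset (g : nat) (Z : rep -> Prop) : Prop :=
  exists ps : list poly, forall rho,
    Z rho <-> (Teich g rho /\ Forall (fun p => peval (coord g rho) p = 0) ps).
(* positive codimension in T_g (the manifold T_g of dim 6g-6): empty interior in T_g *)
Definition positive_codim (g : nat) (Z : rep -> Prop) : Prop :=
  ~ exists rho r, Z rho /\ r > 0 /\
      forall rho', Teich g rho' -> near g r rho rho' -> Z rho'.

(* cosh d(i, M i) = (a^2+b^2+c^2+d^2)/2 for M in SL(2,R) *)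
Definition hdist_o (M : Mat2) : R :=
  let x := (m11 M ^ 2 + m12 M ^ 2 + m21 M ^ 2 + m22 M ^ 2) / 2 in
  ln (x + sqrt (x * x - 1)).
Definition pm_nodup (l : list Mat2) : Prop :=
  ForallOrdPairs (fun A B => ~ pm_eq A B) l.
Definition poincare_converges (G : Mat2 -> Prop) (s : R) : Prop :=
  exists B, forall l : list Mat2, Forall G l -> pm_nodup l ->
    fold_right (fun M acc => exp (- s * hdist_o M) + acc) 0 l <= B.
Definition is_inf (E : R -> Prop) (x : R) : Prop :=
  (forall y, E y -> x <= y) /\ (forall z, (forall y, E y -> z <= y) -> z <= x).

(* psi(A), A the (2g-3)-subgroup generated by ws 0, ..., ws (2g-4) *)
Definition A_image (g : nat) (ws : nat -> word) (rho : rep) (M : Mat2) : Prop :=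
  exists u : word, Forall (fun l => (fst l < 2 * g - 3)%nat) u /\ M = eval rho (subst ws u).

Definition TrSet (g : nat) (rho : rep) (t : R) : Prop :=
  exists w, wf_word g w /\ (t = mtr (eval rho w) \/ t = - mtr (eval rho w)).
Definition trace_growth_gt (T : R -> Prop) (alpha : R) : Prop :=
  exists c, c > 0 /\ exists N : nat, forall n : nat, (N <= n)%nat -> (1 <= n)%nat ->
    exists l : list R, NoDup l /\
      Forall (fun t => T t /\ - INR n <= t <= INR n) l /\
      c * Rpower (INR n) alpha <= INR (length l).

(* Main.v *)
(* Let [Y] be the first generator outside [A]. For distinct [a], [a'] in [A], the locus [tr (a Y) = +- tr (a' Y)] in Teichmueller
   space is algebraic. It has empty interior: one can replace [Y] by [c Y], for [c] in the centralizer of a suitable [m], and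
   change the last two generators so that the relator and [A] are preserved; this turns [tr (a Y)] into [tr (a c Y)], and the
   admissible [m] together with [1] span enough to recover [a] up to sign. Away from these countably many loci, the traces
   [tr (a Y)] are at least as numerous as the [a] of bounded norm, and these are counted as follows. For [s < delta] the Poincare
   series of [A] diverges, so some shell [F] of [A] is large. Any two elements of [F] can be joined by a connector among
   [1, p, q, p q], with [p], [q] the first two generators, so that norms multiply up to a constant; hence products of [m] elements
   of [F] take at least [(|F| / B)^m] values, with [B] independent of the shell, and their norms at a nearby point are controlled
   by those of the finitely many factors.

   The deformed representations stay in Teichmueller space because nearby representations of the surface group are discrete and
   faithful. This follows from a local-to-global principle once [rho] is known to be cocompact, and it is: if the orbit of a point
   stayed far from some point of a horocycle, the cup product of two classes of degree one would be a coboundary, while it does not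
   vanish on the relator. Expressing the deformation in the original generators requires the standard generating set to define
   an automorphism; the surface group is Hopfian, by Hilbert's basis theorem applied to its representation variety. *)
From Stdlib Require Import ZArith Lra Lia Psatz Relations Classical SetoidList FunctionalExtensionality.
From Coquelicot Require Import Coquelicot.
From Stdlib Require Cantor.
From mathcomp Require ssreflect ssrfun ssrbool eqtype ssrnat seq ssralg poly Rstruct.
From Stdlib Require Import Reals List.
Require Import Defs.
Import ListNotations.
Open Scope R_scope.

(** The exponent [2 * delta] arises because [exp (hdist_o M)] is comparable to the square of the
    norm of [M]: divergence of the series at [s] forces roughly [n ^ (2 * s)] elements of norm at
    most [n], along a sequence of shells. A single large shell of exponent below [2 * s] is enough,
    because its products propagate the count to all scales.

    The neighborhood must be fixed before [rho'] is known, and nothing is known about the critical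
    exponent at [rho']. Counting and estimating are therefore separated: products are told apart at
    [rho], as group elements, and only upper bounds on norms are taken at [rho']. Outside the loci,
    distinct group elements have distinct traces at [rho'], so the count carries over. Every
    constant costs a bounded factor per factor of the product, and a shell far enough out pays for
    it within [eps].

    Discreteness and faithfulness alone do not survive deformation in general, free groups being the
    standard counterexample. Cocompactness has to come from what separates surface groups from free
    groups, the nonzero cohomology in degree two, and it enters the proof through integration of
    differential forms. *)

Ltac mat_destr := repeat match goal with M : Mat2 |- _ => destruct M end.
Ltac mat := intros; mat_destr; unfold mmul, madj, mid, mneg, mdet, mtr in *; cbn in *; try ring; f_equal; ring.

(** * Algebra and norm of 2x2 matrices *)

Lemma mmul_assoc A B C : mmul A (mmul B C) = mmul (mmul A B) C. Proof. mat. Qed.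
Lemma mmul_id_l A : mmul mid A = A. Proof. mat. Qed.
Lemma mmul_id_r A : mmul A mid = A. Proof. mat. Qed.
Lemma mdet_mmul A B : mdet (mmul A B) = mdet A * mdet B. Proof. mat. Qed.
Lemma mdet_madj A : mdet (madj A) = mdet A. Proof. mat. Qed.
Lemma mdet_mneg A : mdet (mneg A) = mdet A. Proof. mat. Qed.
Lemma mdet_mid : mdet mid = 1. Proof. unfold mdet; cbn; ring. Qed.
Lemma madj_mmul A B : madj (mmul A B) = mmul (madj B) (madj A). Proof. mat. Qed.
Lemma madj_madj A : madj (madj A) = A. Proof. mat. Qed.
Lemma madj_mid : madj mid = mid. Proof. mat. Qed.
Lemma madj_mneg A : madj (mneg A) = mneg (madj A). Proof. mat. Qed.
Lemma mneg_mneg A : mneg (mneg A) = A. Proof. mat. Qed.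
Lemma mmul_mneg_l A B : mmul (mneg A) B = mneg (mmul A B). Proof. mat. Qed.
Lemma mmul_mneg_r A B : mmul A (mneg B) = mneg (mmul A B). Proof. mat. Qed.
Lemma mtr_mneg A : mtr (mneg A) = - mtr A. Proof. mat. Qed.
Lemma mtr_mmul_comm A B : mtr (mmul A B) = mtr (mmul B A). Proof. mat. Qed.
Lemma mmul_madj_r A : mdet A = 1 -> mmul A (madj A) = mid.
Proof.
  destruct A as [a b c d]; unfold mdet, mmul, madj, mid; cbn; intros H.
  f_equal; try ring; rewrite <- H; ring.
Qed.
Lemma mmul_madj_l A : mdet A = 1 -> mmul (madj A) A = mid.
Proof.
  destruct A as [a b c d]; unfold mdet, mmul, madj, mid; cbn; intros H.
  f_equal; try ring; rewrite <- H; ring.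
Qed.
Lemma mmul_madj_cancel_l A B : mdet A = 1 -> mmul (madj A) (mmul A B) = B.
Proof. intros H; rewrite mmul_assoc, mmul_madj_l, mmul_id_l; auto. Qed.
Lemma mmul_madj_cancel_l' A B : mdet A = 1 -> mmul A (mmul (madj A) B) = B.
Proof. intros H; rewrite mmul_assoc, mmul_madj_r, mmul_id_l; auto. Qed.
Lemma mmul_madj_cancel_r A B : mdet A = 1 -> mmul (mmul B A) (madj A) = B.
Proof. intros H; rewrite <- mmul_assoc, mmul_madj_r, mmul_id_r; auto. Qed.
Lemma mmul_madj_cancel_r' A B : mdet A = 1 -> mmul (mmul B (madj A)) A = B.
Proof. intros H; rewrite <- mmul_assoc, mmul_madj_l, mmul_id_r; auto. Qed.

Lemma pm_eq_refl A : pm_eq A A. Proof. now left. Qed.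
Lemma pm_eq_sym A B : pm_eq A B -> pm_eq B A.
Proof. intros [->| ->]; [now left|right; now rewrite mneg_mneg]. Qed.
Lemma pm_eq_trans A B C : pm_eq A B -> pm_eq B C -> pm_eq A C.
Proof.
  intros [->| ->] [->| ->]; rewrite ?mneg_mneg; [now left|now right|now right|now left].
Qed.
Lemma pm_eq_mmul A A' B B' : pm_eq A A' -> pm_eq B B' -> pm_eq (mmul A B) (mmul A' B').
Proof.
  intros [->| ->] [->| ->]; rewrite ?mmul_mneg_l, ?mmul_mneg_r, ?mneg_mneg;
    [now left|now right|now right|now left].
Qed.
Lemma pm_eq_madj A B : pm_eq A B -> pm_eq (madj A) (madj B).
Proof. intros [->| ->]; rewrite ?madj_mneg; [now left|now right]. Qed.
Lemma pm_eq_madj_mmul A B : mdet A = 1 -> pm_eq (mmul (madj A) B) mid -> pm_eq A B.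
Proof.
  intros HA H. apply pm_eq_sym.
  rewrite <- (mmul_madj_cancel_l' A B HA).
  pose proof (pm_eq_mmul _ _ _ _ (pm_eq_refl A) H) as K. now rewrite mmul_id_r in K.
Qed.

(** For determinant one, twice the logarithm of this norm is the displacement of [i] up to a bounded
    error. Thus [mnorm (mmul (madj P) Q)] measures the distance from [P i] to [Q i], and metric
    inequalities become multiplicative ones. *)
Definition mnorm (M : Mat2) : R :=
  Rmax (Rmax (Rabs (m11 M)) (Rabs (m12 M))) (Rmax (Rabs (m21 M)) (Rabs (m22 M))).

Lemma mnorm_entries M :
  Rabs (m11 M) <= mnorm M /\ Rabs (m12 M) <= mnorm M /\
  Rabs (m21 M) <= mnorm M /\ Rabs (m22 M) <= mnorm M.
Proof.
  unfold mnorm.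
  pose proof (Rmax_l (Rmax (Rabs (m11 M)) (Rabs (m12 M))) (Rmax (Rabs (m21 M)) (Rabs (m22 M)))).
  pose proof (Rmax_r (Rmax (Rabs (m11 M)) (Rabs (m12 M))) (Rmax (Rabs (m21 M)) (Rabs (m22 M)))).
  pose proof (Rmax_l (Rabs (m11 M)) (Rabs (m12 M))).
  pose proof (Rmax_r (Rabs (m11 M)) (Rabs (m12 M))).
  pose proof (Rmax_l (Rabs (m21 M)) (Rabs (m22 M))).
  pose proof (Rmax_r (Rabs (m21 M)) (Rabs (m22 M))).
  repeat split; lra.
Qed.
Lemma mnorm_lub M K :
  Rabs (m11 M) <= K -> Rabs (m12 M) <= K -> Rabs (m21 M) <= K -> Rabs (m22 M) <= K ->
  mnorm M <= K.
Proof. intros; unfold mnorm; repeat apply Rmax_lub; assumption. Qed.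
Lemma mnorm_attained M :
  mnorm M = Rabs (m11 M) \/ mnorm M = Rabs (m12 M) \/
  mnorm M = Rabs (m21 M) \/ mnorm M = Rabs (m22 M).
Proof.
  unfold mnorm, Rmax; repeat (destruct Rle_dec); auto.
Qed.
Lemma mnorm_nonneg M : 0 <= mnorm M.
Proof. destruct (mnorm_entries M) as [H _]. pose proof (Rabs_pos (m11 M)). lra. Qed.
Lemma mnorm_mneg M : mnorm (mneg M) = mnorm M.
Proof. unfold mnorm, mneg; cbn; now rewrite !Rabs_Ropp. Qed.
Lemma mnorm_pm A B : pm_eq A B -> mnorm A = mnorm B.
Proof. intros [->| ->]; [reflexivity|apply mnorm_mneg]. Qed.
Lemma mnorm_madj M : mnorm (madj M) = mnorm M.
Proof.
  unfold mnorm, madj; cbn. rewrite !Rabs_Ropp.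
  unfold Rmax; repeat (destruct Rle_dec); lra.
Qed.
Lemma Rabs_mul_le a b A B : Rabs a <= A -> Rabs b <= B -> Rabs (a * b) <= A * B.
Proof. intros; rewrite Rabs_mult; apply Rmult_le_compat; auto using Rabs_pos. Qed.
Lemma mnorm_mmul A B : mnorm (mmul A B) <= 2 * (mnorm A * mnorm B).
Proof.
  destruct (mnorm_entries A) as (a1 & a2 & a3 & a4).
  destruct (mnorm_entries B) as (b1 & b2 & b3 & b4).
  apply mnorm_lub; cbn;
    (eapply Rle_trans; [apply Rabs_triang|]);
    (replace (2 * (mnorm A * mnorm B)) with (mnorm A * mnorm B + mnorm A * mnorm B) by ring);
    apply Rplus_le_compat; apply Rabs_mul_le; assumption.
Qed.
Lemma mnorm_det M : mdet M = 1 -> 1 <= 2 * (mnorm M * mnorm M).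
Proof.
  unfold mdet; intros H. destruct (mnorm_entries M) as (a1 & a2 & a3 & a4).
  pose proof (Rabs_mul_le _ _ _ _ a1 a4). pose proof (Rabs_mul_le _ _ _ _ a2 a3).
  pose proof (Rle_abs (m11 M * m22 M)). pose proof (Rle_abs (- (m12 M * m21 M))) as H3.
  rewrite Rabs_Ropp in H3. lra.
Qed.
Lemma mnorm_det_half M : mdet M = 1 -> / 2 < mnorm M.
Proof.
  intros H; pose proof (mnorm_det M H). pose proof (mnorm_nonneg M).
  apply Rnot_le_lt; intro. nra.
Qed.
Lemma mnorm_mid : mnorm mid = 1.
Proof. unfold mnorm, mid; cbn. rewrite Rabs_R0, Rabs_R1. unfold Rmax; repeat destruct Rle_dec; lra. Qed.
Lemma mtr_mnorm M : Rabs (mtr M) <= 2 * mnorm M.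
Proof.
  destruct (mnorm_entries M) as (a1 & _ & _ & a4). unfold mtr.
  eapply Rle_trans; [apply Rabs_triang|lra].
Qed.

(* Every entry of [madj P * Q] is, up to sign, a determinant of a column of [P] and a column of [Q], so this is the
   Plücker relation for four vectors of the plane; it plays the role of the four-point inequality of the hyperbolic plane. *)
Lemma four_point P Q S T :
  mnorm (mmul (madj P) Q) * mnorm (mmul (madj S) T) <=
  mnorm (mmul (madj P) S) * mnorm (mmul (madj Q) T)
  + mnorm (mmul (madj P) T) * mnorm (mmul (madj Q) S).
Proof.
  destruct (mnorm_entries (mmul (madj P) S)) as (a1 & a2 & a3 & a4).
  destruct (mnorm_entries (mmul (madj Q) T)) as (b1 & b2 & b3 & b4).
  destruct (mnorm_entries (mmul (madj P) T)) as (c1 & c2 & c3 & c4).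
  destruct (mnorm_entries (mmul (madj Q) S)) as (d1 & d2 & d3 & d4).
  (* For each choice of maximal entries on the left, one relation between minors gives their
     product; the four alternatives are the signs with which entries represent minors. *)
  assert (key : forall x y u v u' v', x * y = u * v + u' * v' \/ x * y = - (u * v + u' * v')
     \/ x * y = u * v - u' * v' \/ x * y = - (u * v - u' * v') ->
    Rabs u <= mnorm (mmul (madj P) S) -> Rabs v <= mnorm (mmul (madj Q) T) ->
    Rabs u' <= mnorm (mmul (madj P) T) -> Rabs v' <= mnorm (mmul (madj Q) S) ->
    Rabs x * Rabs y <= mnorm (mmul (madj P) S) * mnorm (mmul (madj Q) T)
  + mnorm (mmul (madj P) T) * mnorm (mmul (madj Q) S)).
  { intros x y u v u' v' E h1 h2 h3 h4. rewrite <- Rabs_mult.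
    pose proof (Rabs_mul_le _ _ _ _ h1 h2). pose proof (Rabs_mul_le _ _ _ _ h3 h4).
    pose proof (Rabs_triang (u * v) (u' * v')). pose proof (Rabs_triang (u * v) (- (u' * v'))).
    rewrite Rabs_Ropp in *. unfold Rminus in E.
    destruct E as [E|[E|[E|E]]]; rewrite E, ?Rabs_Ropp; lra. }
  destruct (mnorm_attained (mmul (madj P) Q)) as [E|[E|[E|E]]]; rewrite E;
  destruct (mnorm_attained (mmul (madj S) T)) as [F|[F|[F|F]]]; rewrite F; clear E F.
  all: mat_destr; unfold mmul, madj in *; cbn in *.
  all: first
   [ eapply key; [|exact a1|exact b1|exact c1|exact d1]; (left; ring) || (right; left; ring) || (right; right; left; ring) || (right; right; right; ring)
   | idtac ].
  all: let t := ((left; ring) || (right; left; ring) || (right; right; left; ring) || (right; right; right; ring)) in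
   match type of key with _ =>
   first
    [ eapply key; [|exact a1|exact b2|exact c2|exact d1]; t
    | eapply key; [|exact a1|exact b3|exact c1|exact d3]; t
    | eapply key; [|exact a1|exact b4|exact c2|exact d3]; t
    | eapply key; [|exact a2|exact b1|exact c1|exact d2]; t
    | eapply key; [|exact a2|exact b2|exact c2|exact d2]; t
    | eapply key; [|exact a2|exact b3|exact c1|exact d4]; t
    | eapply key; [|exact a2|exact b4|exact c2|exact d4]; t
    | eapply key; [|exact a3|exact b1|exact c3|exact d1]; t
    | eapply key; [|exact a3|exact b2|exact c4|exact d1]; t
    | eapply key; [|exact a3|exact b3|exact c3|exact d3]; t
    | eapply key; [|exact a3|exact b4|exact c4|exact d3]; t
    | eapply key; [|exact a4|exact b1|exact c3|exact d2]; t
    | eapply key; [|exact a4|exact b2|exact c4|exact d2]; t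
    | eapply key; [|exact a4|exact b3|exact c3|exact d4]; t
    | eapply key; [|exact a4|exact b4|exact c4|exact d4]; t ]
   end.
Qed.

Lemma mnorm_madj_mmul_triang A B C : mdet B = 1 ->
  mnorm (mmul (madj A) C) <= 2 * (mnorm (mmul (madj A) B) * mnorm (mmul (madj B) C)).
Proof.
  intros H. rewrite <- (mmul_madj_cancel_l' B C H) at 1. rewrite mmul_assoc. apply mnorm_mmul.
Qed.

(** * Words and representations *)

Definition SLrep (rho : rep) := forall i, mdet (rho i) = 1.

Section Words.
Variable rho : rep.

Lemma eval_app u v : eval rho (u ++ v) = mmul (eval rho u) (eval rho v).
Proof. induction u as [|l u IH]; cbn; [now rewrite mmul_id_l|now rewrite IH, mmul_assoc]. Qed.
Lemma eval_linv l : eval_letter rho (linv l) = madj (eval_letter rho l).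
Proof. destruct l as [i [|]]; unfold eval_letter, linv; cbn; [now rewrite madj_madj|reflexivity]. Qed.
Lemma eval_winv w : eval rho (winv w) = madj (eval rho w).
Proof.
  induction w as [|l w IH]; [symmetry; apply madj_mid|].
  unfold winv in *; cbn. rewrite eval_app, IH, madj_mmul. cbn.
  now rewrite mmul_id_r, eval_linv.
Qed.
Lemma eval_subst ws u : eval rho (subst ws u) = eval (fun i => eval rho (ws i)) u.
Proof.
  induction u as [|[i b] u IH]; [reflexivity|].
  unfold subst in *; cbn. rewrite eval_app, IH. destruct b; cbn; now rewrite ?eval_winv.
Qed.
Hypothesis Hsl : SLrep rho.
Lemma mdet_eval_letter l : mdet (eval_letter rho l) = 1.
Proof. destruct l as [i [|]]; unfold eval_letter; cbn; rewrite ?mdet_madj; apply Hsl. Qed.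
Lemma mdet_eval w : mdet (eval rho w) = 1.
Proof.
  induction w as [|l w IH]; cbn; [apply mdet_mid|].
  now rewrite mdet_mmul, mdet_eval_letter, IH, Rmult_1_l.
Qed.
Lemma geq_pm g u v : pm_eq (eval rho (relator g)) mid -> geq g u v ->
  pm_eq (eval rho u) (eval rho v).
Proof.
  intros Hr H. induction H as [u v H|u|u v H IH|u v w H1 IH1 H2 IH2].
  - destruct H as [u v l|u v]; rewrite !eval_app.
    + apply pm_eq_mmul; [apply pm_eq_refl|]. cbn. rewrite eval_linv, mmul_assoc, mmul_madj_r, mmul_id_l.
      apply pm_eq_refl. apply mdet_eval_letter.
    + apply pm_eq_mmul; [apply pm_eq_refl|]. rewrite <- (mmul_id_l (eval rho v)) at 1.
      apply pm_eq_mmul; [now apply pm_eq_sym|apply pm_eq_refl].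
  - apply pm_eq_refl.
  - now apply pm_eq_sym.
  - eapply pm_eq_trans; eassumption.
Qed.
End Words.

Lemma eval_ext rho rho' w : (forall l, In l w -> rho (fst l) = rho' (fst l)) -> eval rho w = eval rho' w.
Proof.
  induction w as [|l w IH]; intros H; cbn; [reflexivity|].
  rewrite IH by (intros; apply H; now right). unfold eval_letter. rewrite H by now left. reflexivity.
Qed.

Section Group.
Variable g : nat.

Lemma wf_app u v : wf_word g u -> wf_word g v -> wf_word g (u ++ v).
Proof. intros; apply Forall_app; auto. Qed.
Lemma wf_app_inv u v : wf_word g (u ++ v) -> wf_word g u /\ wf_word g v.
Proof. intros; now apply Forall_app. Qed.
Lemma wf_nil : wf_word g []. Proof. constructor. Qed.
Lemma wf_winv w : wf_word g w -> wf_word g (winv w).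
Proof.
  intros H; unfold winv. apply Forall_rev, Forall_map. eapply Forall_impl; [|exact H].
  now intros [i b].
Qed.
Lemma wf_subst ws u : (forall i, (i < 2 * g)%nat -> wf_word g (ws i)) -> wf_word g u ->
  wf_word g (subst ws u).
Proof.
  intros H Hu; induction Hu as [|[i b] u Hi Hu IH]; [constructor|].
  unfold subst; cbn. apply wf_app; [|exact IH]. cbn in Hi. destruct b; auto using wf_winv.
Qed.
Lemma wf_relator : wf_word g (relator g).
Proof.
  apply Forall_forall. intros l Hl. unfold relator in Hl. apply in_flat_map in Hl.
  destruct Hl as (i & Hi & Hl). apply in_seq in Hi. cbn in Hl.
  destruct Hl as [<-|[<-|[<-|[<-|[]]]]]; cbn; lia.
Qed.

Lemma geq_refl u : geq g u u. Proof. apply rst_refl. Qed.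
Lemma geq_sym u v : geq g u v -> geq g v u. Proof. apply rst_sym. Qed.
Lemma geq_trans u v w : geq g u v -> geq g v w -> geq g u w. Proof. apply rst_trans. Qed.
Lemma geq_ctx a b u v : geq g u v -> geq g (a ++ u ++ b) (a ++ v ++ b).
Proof.
  intros H; induction H as [u v H|u|u v H IH|u v w H1 IH1 H2 IH2].
  - destruct H as [u v l|u v]; rewrite <- !app_assoc, !(app_assoc a u); apply rst_step.
    + replace ((l :: linv l :: v) ++ b) with (l :: linv l :: (v ++ b)) by reflexivity. constructor.
    + replace ((relator g ++ v) ++ b) with (relator g ++ (v ++ b)) by apply app_assoc. constructor.
  - apply geq_refl.
  - now apply geq_sym.
  - eapply geq_trans; eassumption.
Qed.
Lemma geq_app u u' v v' : geq g u u' -> geq g v v' -> geq g (u ++ v) (u' ++ v').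
Proof.
  intros H1 H2. eapply geq_trans; [apply (geq_ctx [] v _ _ H1)|].
  pose proof (geq_ctx u' [] _ _ H2) as H. now rewrite !app_nil_r in H.
Qed.
Lemma geq_winv_r w : geq g (w ++ winv w) [].
Proof.
  induction w as [|l w IH]; [apply geq_refl|]. unfold winv in *; cbn.
  eapply geq_trans; [pose proof (geq_ctx [l] [linv l] _ _ IH) as H; cbn in H; rewrite <- app_assoc in H; exact H|].
  apply geq_sym, rst_step. exact (step_cancel g [] [] l).
Qed.
Lemma winv_winv w : winv (winv w) = w.
Proof.
  unfold winv. rewrite map_rev, rev_involutive, map_map.
  rewrite <- (map_id w) at 2. apply map_ext. intros [i b]; unfold linv; cbn. now rewrite Bool.negb_involutive.
Qed.
Lemma winv_app u v : winv (u ++ v) = winv v ++ winv u.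
Proof. unfold winv. now rewrite map_app, rev_app_distr. Qed.
Lemma geq_winv_l w : geq g (winv w ++ w) [].
Proof. rewrite <- (winv_winv w) at 2. apply geq_winv_r. Qed.
Lemma geq_of_trivial u v : geq g (u ++ winv v) [] -> geq g u v.
Proof.
  intros H. pose proof (geq_app _ _ _ _ H (geq_refl v)) as H1. rewrite <- app_assoc in H1.
  apply geq_sym. eapply geq_trans; [apply geq_sym, H1|].
  rewrite <- (app_nil_r u) at 2. apply geq_app; [apply geq_refl|apply geq_winv_l].
Qed.
Lemma trivial_of_geq u v : geq g u v -> geq g (u ++ winv v) [].
Proof.
  intros H. eapply geq_trans; [|apply (geq_winv_r v)]. apply geq_app; [exact H|apply geq_refl].
Qed.
Lemma geq_winv u v : geq g u v -> geq g (winv u) (winv v).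
Proof.
  intros H. apply geq_of_trivial. rewrite winv_winv.
  eapply geq_trans; [apply geq_app; [apply geq_refl|apply geq_sym, H]|]. apply geq_winv_l.
Qed.

Lemma subst_app ws u v : subst ws (u ++ v) = subst ws u ++ subst ws v.
Proof. apply flat_map_app. Qed.
Lemma subst_winv ws u : subst ws (winv u) = winv (subst ws u).
Proof.
  induction u as [|[i b] u IH]; [reflexivity|].
  change ((i, b) :: u) with ([(i, b)] ++ u). rewrite winv_app, !subst_app, winv_app, IH. f_equal.
  unfold winv, subst; cbn. rewrite !app_nil_r. destruct b; cbn; [|reflexivity].
  symmetry; apply winv_winv.
Qed.
Lemma geq_subst ws u v : trivial g (subst ws (relator g)) -> geq g u v -> geq g (subst ws u) (subst ws v).
Proof.
  intros Hr H; induction H as [u v H|u|u v H IH|u v w H1 IH1 H2 IH2].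
  - destruct H as [u v l|u v].
    + replace (u ++ l :: linv l :: v) with (u ++ ([l] ++ winv [l]) ++ v) by reflexivity.
      rewrite !subst_app, subst_winv. apply geq_app; [apply geq_refl|].
      pose proof (geq_app _ _ _ _ (geq_winv_r (subst ws [l])) (geq_refl (subst ws v))) as H.
      cbn in H. now apply geq_sym.
    + rewrite !subst_app. apply geq_app; [apply geq_refl|].
      pose proof (geq_app _ _ _ _ Hr (geq_refl (subst ws v))) as H. cbn in H. now apply geq_sym.
  - apply geq_refl.
  - now apply geq_sym.
  - eapply geq_trans; eassumption.
Qed.
Lemma geq_subst_ext ws ws' u : (forall l, In l u -> geq g (ws (fst l)) (ws' (fst l))) ->
  geq g (subst ws u) (subst ws' u).
Proof.
  induction u as [|[i b] u IH]; intros H; [apply geq_refl|].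
  unfold subst in *; cbn. apply geq_app; [|apply IH; intros; apply H; now right].
  specialize (H (i, b) (or_introl eq_refl)); cbn in H. destruct b; auto using geq_winv.
Qed.
Lemma subst_subst ws us u : subst ws (subst us u) = subst (fun i => subst ws (us i)) u.
Proof.
  induction u as [|[i b] u IH]; [reflexivity|].
  change (subst us ((i, b) :: u)) with ((if b then winv (us i) else us i) ++ subst us u).
  rewrite subst_app, IH. unfold subst at 3; cbn. f_equal. destruct b; [apply subst_winv|reflexivity].
Qed.
Lemma subst_id u : subst (fun i => [(i, false)]) u = u.
Proof.
  induction u as [|[i b] u IH]; [reflexivity|].
  change (subst (fun i => [(i, false)]) ((i, b) :: u))
    with ((if b then [(i, true)] else [(i, false)]) ++ subst (fun i => [(i, false)]) u).
  rewrite IH. now destruct b.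
Qed.
End Group.

(* [SLrep] also constrains the letters outside the alphabet, on which [is_DF] says nothing. *)
Definition DFrep (g : nat) (rho : rep) : Prop := SLrep rho /\ is_DF g rho.

Lemma DF_geq g rho u v : DFrep g rho -> wf_word g u -> wf_word g v ->
  pm_eq (eval rho u) (eval rho v) -> geq g u v.
Proof.
  intros (Hsl & _ & _ & _ & Hf) Hu Hv H. apply geq_of_trivial. apply Hf.
  - now apply wf_app, wf_winv.
  - rewrite eval_app, eval_winv. rewrite <- (mmul_madj_r (eval rho v)) by now apply mdet_eval.
    apply pm_eq_mmul; [exact H|apply pm_eq_refl].
Qed.
Lemma DF_pm g rho u v : DFrep g rho -> geq g u v -> pm_eq (eval rho u) (eval rho v).
Proof. intros (Hsl & _ & Hr & _) H. now apply geq_pm with g. Qed.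
Lemma Teich_DFrep g rho : Teich g rho -> DFrep g rho.
Proof.
  intros (HDF & _ & Hm & _). split; [|exact HDF]. intros i.
  destruct (Nat.lt_ge_cases i (2 * g)); [now apply HDF|]. rewrite Hm by assumption. apply mdet_mid.
Qed.

(** * Finite sums over representatives of group elements *)

Definition lsum {T : Type} (F : T -> R) (l : list T) : R :=
  fold_right (fun x acc => F x + acc) 0 l.

Lemma lsum_app {T} (F : T -> R) l l' : lsum F (l ++ l') = lsum F l + lsum F l'.
Proof. induction l; unfold lsum in *; cbn; [ring|]. rewrite IHl. ring. Qed.
Lemma lsum_ext {T} (F G : T -> R) l : (forall x, In x l -> F x = G x) -> lsum F l = lsum G l.
Proof.
  induction l as [|x l IH]; unfold lsum in *; cbn; intros H; [reflexivity|].
  now rewrite IH, H by auto.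
Qed.
Lemma lsum_zero {T} (F : T -> R) l : (forall x, In x l -> F x = 0) -> lsum F l = 0.
Proof.
  induction l as [|x l IH]; unfold lsum in *; cbn; intros H; [reflexivity|].
  rewrite IH, H by auto. ring.
Qed.
Lemma lsum_plus {T} (F G : T -> R) l : lsum (fun x => F x + G x) l = lsum F l + lsum G l.
Proof. induction l; unfold lsum in *; cbn; [ring|]. rewrite IHl. ring. Qed.
Lemma lsum_scal {T} c (F : T -> R) l : lsum (fun x => c * F x) l = c * lsum F l.
Proof. induction l; unfold lsum in *; cbn; [ring|]. rewrite IHl. ring. Qed.
Lemma lsum_map {S T} (f : S -> T) (F : T -> R) l : lsum F (map f l) = lsum (fun x => F (f x)) l.
Proof. induction l; unfold lsum in *; cbn; [reflexivity|]. now rewrite IHl. Qed.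
Lemma lsum_nonneg {T} (F : T -> R) l : (forall x, In x l -> 0 <= F x) -> 0 <= lsum F l.
Proof.
  induction l as [|x l IH]; unfold lsum in *; cbn; intros H; [lra|].
  specialize (IH (fun y Hy => H y (or_intror Hy))). specialize (H x (or_introl eq_refl)). lra.
Qed.
Lemma lsum_ge_term {T} (F : T -> R) l y : (forall x, In x l -> 0 <= F x) -> In y l -> F y <= lsum F l.
Proof.
  induction l as [|x l IH]; intros H Hy; [destruct Hy|destruct Hy as [Hy|H0]].
  - subst x. pose proof (lsum_nonneg F l (fun z Hz => H z (or_intror Hz))). unfold lsum in *; cbn. lra.
  - specialize (IH (fun z Hz => H z (or_intror Hz)) H0). specialize (H x (or_introl eq_refl)). unfold lsum in *; cbn. lra.
Qed.
Lemma lsum_le {T} (F G : T -> R) l : (forall x, In x l -> F x <= G x) -> lsum F l <= lsum G l.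
Proof.
  induction l as [|x l IH]; unfold lsum in *; cbn; intros H; [lra|].
  specialize (IH (fun y Hy => H y (or_intror Hy))). specialize (H x (or_introl eq_refl)). lra.
Qed.

(** Sums over the group are written as sums over lists of words up to equivalence. Two
    repetition-free lists that both meet every class in the support of [F] may differ elsewhere;
    matching the classes one by one shows that the sums agree. *)
Lemma lsum_equiv {T} (E : T -> T -> Prop) (F : T -> R) : Equivalence E -> forall L L',
  NoDupA E L -> NoDupA E L' ->
  (forall x y, In x L -> In y L' -> E x y -> F x = F y) ->
  (forall x, In x L -> F x <> 0 -> exists y, In y L' /\ E x y) ->
  (forall y, In y L' -> F y <> 0 -> exists x, In x L /\ E x y) ->
  lsum F L = lsum F L'.
Proof.
  intros HE L; induction L as [|x L IH]; intros L' HL HL' Hres H1 H2.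
  - symmetry; apply lsum_zero. intros y Hy. destruct (Req_dec (F y) 0); [assumption|].
    destruct (H2 y Hy H) as (? & [] & _).
  - inversion HL as [|? ? HxL HL0]; subst.
    destruct (Req_dec (F x) 0) as [Hx|Hx].
    + cbn. fold (lsum F L). rewrite Hx, Rplus_0_l. apply IH; auto.
      * intros; apply Hres; auto; now right.
      * intros; apply H1; auto; now right.
      * intros y Hy Hy0. destruct (H2 y Hy Hy0) as (z & [<-|Hz] & Hzy); [|now exists z].
        exfalso; apply Hy0. rewrite <- (Hres x y); auto; now left.
    + destruct (H1 x (or_introl eq_refl) Hx) as (y & Hy & Hxy).
      destruct (in_split _ _ Hy) as (l1 & l2 & ->).
      rewrite (lsum_app F l1 (y :: l2)). cbn. fold (lsum F L) (lsum F l2).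
      rewrite (IH (l1 ++ l2)).
      * rewrite lsum_app, (Hres x y); auto; [ring|now left].
      * assumption.
      * eapply NoDupA_split, HL'.
      * intros a b Ha Hb. apply Hres; [now right|]. apply in_app_iff in Hb. apply in_app_iff; cbn; tauto.
      * intros a Ha Ha0. destruct (H1 a (or_intror Ha) Ha0) as (b & Hb & Hab).
        exists b; split; [|exact Hab]. apply in_app_iff in Hb; apply in_app_iff.
        destruct Hb as [Hb|[<-|Hb]]; auto. exfalso. apply HxL. apply InA_alt. exists a; split; [|exact Ha].
        now transitivity y.
      * intros b Hb Hb0.
        assert (Hb' : In b (l1 ++ y :: l2)) by (apply in_app_iff in Hb; apply in_app_iff; cbn; tauto).
        destruct (H2 b Hb' Hb0) as (a & [<-|Ha] & Hab); [|now exists a].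
        exfalso. assert (Hyb : E y b) by (transitivity x; [now symmetry|exact Hab]).
        apply (NoDupA_swap HE) in HL'. inversion HL' as [|? ? Hn _]; subst. apply Hn.
        apply InA_alt. exists b; auto.
Qed.

(** * Finiteness of balls in a discrete group *)

Lemma up_eq_close x y : up x = up y -> Rabs (x - y) < 1.
Proof.
  intros H. destruct (archimed x) as [a b], (archimed y) as [c d]. rewrite H in a, b.
  apply Rabs_def1; lra.
Qed.
Lemma up_range x K : Rabs x <= K -> (- up K <= up x <= up K)%Z.
Proof.
  intros H. destruct (archimed x) as [a b], (archimed K) as [c d].
  assert (Hx : -K <= x <= K) by (now apply Rabs_le_inv in H || (unfold Rabs in H; destruct Rcase_abs in H; lra)).
  split; apply Z.lt_succ_r; apply lt_IZR; unfold Z.succ; rewrite ?plus_IZR, ?opp_IZR; lra.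
Qed.

(** Pigeonhole on a grid of mesh [eps]: matrices whose entries fall in the same cells are close, and
    the box of size [K] meets finitely many cells. The shift by [U] makes the cell numbers
    nonnegative. *)
Lemma box_finite eps K : eps > 0 -> exists N : nat, forall l : list Mat2,
  (forall A, In A l -> mnorm A <= K) -> ForallOrdPairs (fun A B => ~ close eps A B) l ->
  (length l <= N)%nat.
Proof.
  intros Heps.
  set (U := up (K / eps)).
  set (c := fun x : R => Z.to_nat (up (x / eps) + U)).
  set (cell := fun A => (((c (m11 A), c (m12 A)), (c (m21 A), c (m22 A))))).
  set (r := seq 0 (S (Z.to_nat (2 * U)))).
  exists (length (list_prod (list_prod r r) (list_prod r r))). intros l Hl HP.
  rewrite <- (length_map cell l). 
  assert (Hsmall : forall x, Rabs x <= K -> (0 <= up (x / eps) + U <= 2 * U)%Z).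
  { intros x Hx. assert (Rabs (x / eps) <= K / eps).
    { unfold Rdiv. rewrite Rabs_mult, (Rabs_pos_eq (/ eps)) by (left; apply Rinv_0_lt_compat; lra).
      apply Rmult_le_compat_r; [left; apply Rinv_0_lt_compat; lra|exact Hx]. }
    apply up_range in H. fold U in H. lia. }
  assert (Hin : forall x, Rabs x <= K -> In (c x) r).
  { intros x Hx. apply Hsmall in Hx. unfold r, c. apply in_seq. lia. }
  assert (Heq : forall x y, Rabs x <= K -> Rabs y <= K -> c x = c y -> Rabs (x - y) < eps).
  { intros x y Hx Hy E. unfold c in E. apply Hsmall in Hx, Hy. apply Z2Nat.inj in E; try lia.
    assert (E' : up (x / eps) = up (y / eps)) by lia. apply up_eq_close in E'.
    replace (x - y) with ((x / eps - y / eps) * eps) by (field; lra).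
    rewrite Rabs_mult, (Rabs_pos_eq eps) by lra. nra. }
  apply NoDup_incl_length.
  - induction HP as [|A l HA HP IH]; cbn; constructor.
    + intros Hc. apply in_map_iff in Hc. destruct Hc as (B & HB & HBl).
      rewrite Forall_forall in HA. apply (HA B HBl).
      destruct (mnorm_entries A) as (a1 & a2 & a3 & a4). destruct (mnorm_entries B) as (b1 & b2 & b3 & b4).
      pose proof (Hl A (or_introl eq_refl)). pose proof (Hl B (or_intror HBl)).
      unfold cell in HB. injection HB; intros.
      repeat split; apply Heq; try lra; congruence.
    + apply IH. intros; apply Hl; now right.
  - intros x Hx. apply in_map_iff in Hx. destruct Hx as (A & <- & HA).
    destruct (mnorm_entries A) as (a1 & a2 & a3 & a4). pose proof (Hl A HA).
    repeat apply in_prod; apply Hin; lra.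
Qed.

(** The difference of [mmul (madj A) B] and [mid] is [madj A] times [B - A], so each of its entries
    is a sum of two products with a factor at most [K]. *)
Lemma close_madj_mmul eps K A B : 0 < K -> mdet A = 1 -> mnorm A <= K ->
  close (eps / (2 * K)) B A -> close eps (mmul (madj A) B) mid.
Proof.
  intros HK HA HN (h1 & h2 & h3 & h4).
  destruct (mnorm_entries A) as (a1 & a2 & a3 & a4).
  assert (key : forall u v x y t, Rabs u <= K -> Rabs v <= K -> Rabs x < eps / (2 * K) -> Rabs y < eps / (2 * K) ->
    t = u * x + v * y -> Rabs t < eps).
  { intros u v x y t Hu Hv Hx Hy ->. eapply Rle_lt_trans; [apply Rabs_triang|].
    rewrite !Rabs_mult. pose proof (Rabs_pos u). pose proof (Rabs_pos v).
    pose proof (Rabs_pos x). pose proof (Rabs_pos y).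
    assert (Rabs u * Rabs x <= K * Rabs x) by nra. assert (Rabs v * Rabs y <= K * Rabs y) by nra.
    assert (K * Rabs x < K * (eps / (2 * K))) by nra. assert (K * Rabs y < K * (eps / (2 * K))) by nra.
    replace eps with (K * (eps / (2 * K)) + K * (eps / (2 * K))) by (field; lra). lra. }
  assert (Hdet : m11 A * m22 A - m12 A * m21 A = 1) by exact HA.
  repeat split; cbn.
  - apply key with (m22 A) (- m12 A) (m11 B - m11 A) (m21 B - m21 A); rewrite ?Rabs_Ropp; try lra; rewrite <- Hdet; ring.
  - apply key with (m22 A) (- m12 A) (m12 B - m12 A) (m22 B - m22 A); rewrite ?Rabs_Ropp; try lra; ring.
  - apply key with (- m21 A) (m11 A) (m11 B - m11 A) (m21 B - m21 A); rewrite ?Rabs_Ropp; try lra; ring.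
  - apply key with (- m21 A) (m11 A) (m12 B - m12 A) (m22 B - m22 A); rewrite ?Rabs_Ropp; try lra; rewrite <- Hdet; ring.
Qed.

#[global] Instance geq_Equivalence g : Equivalence (geq g).
Proof. split; [exact (geq_refl g)|exact (geq_sym g)|exact (geq_trans g)]. Qed.

Section Balls.
Variables (g : nat) (rho : rep).
Hypothesis HDF : DFrep g rho.

(** Discreteness speaks only of elements near the identity. Two elements of the ball in a common
    small box have a quotient near the identity, so they coincide; hence inequivalent words of
    bounded norm are separated in a bounded box. *)
Lemma DF_ball_bound K : exists N : nat, forall l : list word,
  Forall (wf_word g) l -> (forall w, In w l -> mnorm (eval rho w) <= K) ->
  NoDupA (geq g) l -> (length l <= N)%nat.
Proof.
  pose proof HDF as (Hsl & _ & Hr & (eps & Heps & Hd) & Hf).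
  set (K' := Rmax K 1). assert (HK' : 0 < K') by (unfold K'; pose proof (Rmax_r K 1); lra).
  assert (Heps' : eps / (2 * K') > 0) by (apply Rdiv_lt_0_compat; lra).
  destruct (box_finite (eps / (2 * K')) K Heps') as (N & HN). exists N. intros l Hwf Hl Hnd.
  rewrite <- (length_map (eval rho) l). apply HN.
  - intros A HA. apply in_map_iff in HA. destruct HA as (w & <- & Hw). auto.
  - induction Hnd as [|w l Hw Hnd IH]; cbn; constructor.
    + apply Forall_forall. intros B HB Hc. apply in_map_iff in HB. destruct HB as (v & <- & Hv).
      apply Hw, InA_alt. exists v; split; [|exact Hv].
      inversion Hwf as [|? ? Hww Hwl]; subst. rewrite Forall_forall in Hwl.
      symmetry. apply DF_geq with rho; auto. apply pm_eq_madj_mmul; [now apply mdet_eval|].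
      rewrite <- eval_winv, <- eval_app. apply Hd; [apply wf_app; auto; apply wf_winv; auto|].
      left. rewrite eval_app, eval_winv. apply close_madj_mmul with K'; auto using mdet_eval.
      unfold K'; pose proof (Rmax_l K 1); pose proof (Hl v (or_intror Hv)); lra.
    + inversion Hwf; subst. apply IH; auto. intros; apply Hl; now right.
Qed.

(** The index sets of all sums over the group below: representatives without repetition that include
    the ball of radius [K] and possibly further elements. *)
Definition ball_list (K : R) (L : list word) : Prop :=
  Forall (wf_word g) L /\ NoDupA (geq g) L /\
  forall w, wf_word g w -> mnorm (eval rho w) <= K -> exists v, In v L /\ geq g w v.

(** A repetition-free list inside the ball is extended as long as some element is missing. The bound
    [N] of [DF_ball_bound] stops this, with [n] counting the room that remains. *)
Lemma ball_list_exists K : exists L, ball_list K L.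
Proof.
  destruct (DF_ball_bound K) as (N & HN).
  assert (main : forall n l, Forall (wf_word g) l -> (forall w, In w l -> mnorm (eval rho w) <= K) ->
    NoDupA (geq g) l -> (N <= length l + n)%nat -> exists L, ball_list K L).
  { induction n as [|n IH]; intros l H1 H2 H3 H4;
    destruct (classic (forall w, wf_word g w -> mnorm (eval rho w) <= K -> exists v, In v l /\ geq g w v)) as [H|H].
    - exists l; split; auto.
    - exfalso. apply not_all_ex_not in H. destruct H as (w & H). apply imply_to_and in H. destruct H as (Hw & H).
      apply imply_to_and in H. destruct H as (HwK & H).
      assert (Hlen : (length (w :: l) <= N)%nat); [|cbn in Hlen; lia].
      apply HN; [now constructor|intros ? [<-|]; auto|]. constructor; [|assumption].
      intros Hin. apply InA_alt in Hin. apply H. destruct Hin as (v & ? & ?). now exists v.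
    - exists l; split; auto.
    - apply not_all_ex_not in H. destruct H as (w & H). apply imply_to_and in H. destruct H as (Hw & H).
      apply imply_to_and in H. destruct H as (HwK & H).
      apply (IH (w :: l)); [now constructor|intros ? [<-|]; auto| |cbn; lia]. constructor; [|assumption].
      intros Hin. apply InA_alt in Hin. apply H. destruct Hin as (v & ? & ?). now exists v. }
  apply (main N []); [constructor|intros ? []|constructor|lia].
Qed.

(** Change of variable by a bijection [f] of the group, applied to left and right translations and
    to inversion. The support of [F] and its preimage under [f] must both lie in the ball, since a
    fixed list [L] is not stable under [f]. *)
Lemma lsum_reindex K L (F : word -> R) (f : word -> word) :
  ball_list K L ->
  (forall u v, wf_word g u -> wf_word g v -> geq g u v -> F u = F v) ->
  (forall u, wf_word g u -> wf_word g (f u)) ->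
  (forall u v, wf_word g u -> wf_word g v -> geq g (f u) (f v) -> geq g u v) ->
  (forall u, wf_word g u -> F u <> 0 -> mnorm (eval rho u) <= K) ->
  (forall u, wf_word g u -> F u <> 0 -> exists x, wf_word g x /\ mnorm (eval rho x) <= K /\ geq g (f x) u) ->
  (forall u v, wf_word g u -> wf_word g v -> geq g u v -> geq g (f u) (f v)) ->
  lsum (fun u => F (f u)) L = lsum F L.
Proof.
  intros (Hwf & Hnd & Hc) HF Hfw Hfi Hs Hsf Hfg. rewrite <- lsum_map.
  rewrite Forall_forall in Hwf.
  apply lsum_equiv with (geq g); auto.
  - typeclasses eauto.
  - clear Hc. induction Hnd as [|w l Hw Hnd IH]; cbn; constructor.
    + intros Hin. apply InA_alt in Hin. destruct Hin as (y & Hy & Hyl). apply in_map_iff in Hyl.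
      destruct Hyl as (v & <- & Hv). apply Hw, InA_alt. exists v; split; [|exact Hv].
      apply Hfi; auto; apply Hwf; cbn; auto.
    + apply IH. intros; apply Hwf; now right.
  - intros x y Hx Hy. apply in_map_iff in Hx. destruct Hx as (v & <- & Hv). apply HF; auto.
  - intros x Hx Hx0. apply in_map_iff in Hx. destruct Hx as (v & <- & Hv).
    apply Hc; auto.
  - intros y Hy Hy0. destruct (Hsf y (Hwf _ Hy) Hy0) as (x & Hx & HxK & Hxy).
    destruct (Hc x Hx HxK) as (v & Hv & Hxv). exists (f v); split; [now apply in_map|].
    transitivity (f x); [|exact Hxy]. apply Hfg; auto. now symmetry.
Qed.
End Balls.

(** * Calculus in two real variables *)

Definition cont2 (u : R -> R -> R) := forall x y, continuity_2d_pt u x y.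
Definition C1 (u ux uy : R -> R -> R) :=
  (forall x y, differentiable_pt_lim u x y (ux x y) (uy x y)) /\ cont2 ux /\ cont2 uy.
Definition ex_C1 u := exists ux uy, C1 u ux uy.
Definition C2 (u ux uy : R -> R -> R) := C1 u ux uy /\ ex_C1 ux /\ ex_C1 uy.
Definition ex_C2 u := exists ux uy, C2 u ux uy.

Lemma C1_cont u ux uy : C1 u ux uy -> cont2 u.
Proof. intros (H & _ & _) x y. apply differentiable_continuity_pt. exists (ux x y), (uy x y). apply H. Qed.
Lemma ex_C1_cont u : ex_C1 u -> cont2 u.
Proof. intros (ux & uy & H). eapply C1_cont, H. Qed.
Lemma cont2_const c : cont2 (fun _ _ => c). Proof. intros x y; apply continuity_2d_pt_const. Qed.
Lemma cont2_fst : cont2 (fun x _ => x). Proof. intros x y; apply continuity_2d_pt_id1. Qed.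
Lemma cont2_snd : cont2 (fun _ y => y). Proof. intros x y; apply continuity_2d_pt_id2. Qed.
Lemma cont2_plus u v : cont2 u -> cont2 v -> cont2 (fun x y => u x y + v x y).
Proof. intros H1 H2 x y; now apply continuity_2d_pt_plus. Qed.
Lemma cont2_minus u v : cont2 u -> cont2 v -> cont2 (fun x y => u x y - v x y).
Proof. intros H1 H2 x y; now apply continuity_2d_pt_minus. Qed.
Lemma cont2_mult u v : cont2 u -> cont2 v -> cont2 (fun x y => u x y * v x y).
Proof. intros H1 H2 x y; now apply continuity_2d_pt_mult. Qed.
Lemma cont2_comp g u : (forall x y, continuous g (u x y)) -> cont2 u -> cont2 (fun x y => g (u x y)).
Proof.
  intros Hg Hu x y. apply continuity_1d_2d_pt_comp; [|apply Hu]. apply continuity_pt_filterlim, Hg.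
Qed.
Lemma cont2_comp2 f u v : cont2 f -> cont2 u -> cont2 v -> cont2 (fun x y => f (u x y) (v x y)).
Proof.
  intros Hf Hu Hv x y eps. destruct (Hf (u x y) (v x y) eps) as [d Hd].
  destruct (Hu x y d) as [d1 H1], (Hv x y d) as [d2 H2].
  exists (mkposreal _ (Rmin_stable_in_posreal d1 d2)); cbn; intros a b Ha Hb.
  apply Hd; [apply H1|apply H2]; eapply Rlt_le_trans; eauto; apply Rmin_l || apply Rmin_r.
Qed.
Lemma cont2_cont1 u y x : cont2 u -> continuous (fun x => u x y) x.
Proof.
  intros H. apply continuity_pt_filterlim. intros eps Heps.
  destruct (H x y (mkposreal eps Heps)) as [d Hd]. exists d; split; [apply cond_pos|].
  intros z (_ & Hz). apply Hd; [exact Hz|]. rewrite Rminus_diag, Rabs_R0. apply cond_pos.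
Qed.
Lemma cont2_cont2 u x y : cont2 u -> continuous (fun y => u x y) y.
Proof.
  intros H. apply continuity_pt_filterlim. intros eps Heps.
  destruct (H x y (mkposreal eps Heps)) as [d Hd]. exists d; split; [apply cond_pos|].
  intros z (_ & Hz). apply Hd; [|exact Hz]. rewrite Rminus_diag, Rabs_R0. apply cond_pos.
Qed.
Lemma cont2_curve u (c1 c2 : R -> R) t : cont2 u -> continuous c1 t -> continuous c2 t ->
  continuous (fun t => u (c1 t) (c2 t)) t.
Proof.
  intros H H1 H2. apply continuity_pt_filterlim. intros eps Heps.
  destruct (H (c1 t) (c2 t) (mkposreal eps Heps)) as [d Hd].
  apply continuity_pt_filterlim in H1, H2.
  destruct (H1 d (cond_pos d)) as (a1 & Ha1 & K1). destruct (H2 d (cond_pos d)) as (a2 & Ha2 & K2).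
  exists (Rmin a1 a2); split; [now apply Rmin_glb_lt|]. intros z (Hz0 & Hz). apply Hd.
  - apply K1; split; [exact Hz0|]. eapply Rlt_le_trans; [exact Hz|apply Rmin_l].
  - apply K2; split; [exact Hz0|]. eapply Rlt_le_trans; [exact Hz|apply Rmin_r].
Qed.
Lemma cont2_locally_lt u x0 y0 K : cont2 u -> u x0 y0 < K -> locally_2d (fun x y => u x y < K) x0 y0.
Proof.
  intros H Hlt. assert (Hp : 0 < K - u x0 y0) by lra.
  destruct (H x0 y0 (mkposreal _ Hp)) as [d Hd]. exists d; intros x y Hx Hy.
  specialize (Hd x y Hx Hy); cbn in Hd. apply Rabs_def2 in Hd. lra.
Qed.

Lemma C1_is_derive_x u ux uy x y : C1 u ux uy -> is_derive (fun x => u x y) x (ux x y).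
Proof.
  intros (H & _). apply is_derive_Reals. specialize (H x y).
  pose proof (derivable_pt_lim_comp_2d u (fun t => t) (fun _ => y) x _ _ 1 0 H
    (derivable_pt_lim_id x) (derivable_pt_lim_const y x)) as K.
  rewrite Rmult_1_r, Rmult_0_r, Rplus_0_r in K. exact K.
Qed.
Lemma C1_is_derive_y u ux uy x y : C1 u ux uy -> is_derive (fun y => u x y) y (uy x y).
Proof.
  intros (H & _). apply is_derive_Reals. specialize (H x y).
  pose proof (derivable_pt_lim_comp_2d u (fun _ => x) (fun t => t) y _ _ 0 1 H
    (derivable_pt_lim_const x y) (derivable_pt_lim_id y)) as K.
  rewrite Rmult_1_r, Rmult_0_r, Rplus_0_l in K. exact K.
Qed.
Lemma C1_unique u ux uy vx vy x y : C1 u ux uy -> C1 u vx vy -> ux x y = vx x y /\ uy x y = vy x y.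
Proof.
  intros H H'. split.
  - pose proof (C1_is_derive_x _ _ _ x y H) as K. pose proof (C1_is_derive_x _ _ _ x y H') as K'.
    apply is_derive_unique in K, K'. congruence.
  - pose proof (C1_is_derive_y _ _ _ x y H) as K. pose proof (C1_is_derive_y _ _ _ x y H') as K'.
    apply is_derive_unique in K, K'. congruence.
Qed.

Lemma C1_const c : C1 (fun _ _ => c) (fun _ _ => 0) (fun _ _ => 0).
Proof.
  split; [|split; apply cont2_const]. intros x y.
  apply (differentiable_pt_lim_proj1_0 (fun _ => c)), derivable_pt_lim_const.
Qed.
Lemma C1_fst : C1 (fun x _ => x) (fun _ _ => 1) (fun _ _ => 0).
Proof.
  split; [|split; apply cont2_const]. intros x y.
  apply (differentiable_pt_lim_proj1_0 (fun x => x)), derivable_pt_lim_id.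
Qed.
Lemma C1_snd : C1 (fun _ y => y) (fun _ _ => 0) (fun _ _ => 1).
Proof.
  split; [|split; apply cont2_const]. intros x y eps. exists (mkposreal 1 Rlt_0_1). intros u v _ _.
  replace (v - y - (0 * (u - x) + 1 * (v - y))) with 0 by ring. rewrite Rabs_R0.
  apply Rmult_le_pos; [left; apply cond_pos|]. eapply Rle_trans; [apply Rabs_pos|apply Rmax_l].
Qed.
Lemma differentiable_pt_lim_Rplus x y : differentiable_pt_lim Rplus x y 1 1.
Proof.
  intros eps. exists (mkposreal 1 Rlt_0_1). intros u v _ _.
  replace (u + v - (x + y) - (1 * (u - x) + 1 * (v - y))) with 0 by ring. rewrite Rabs_R0.
  apply Rmult_le_pos; [left; apply cond_pos|]. eapply Rle_trans; [apply Rabs_pos|apply Rmax_l].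
Qed.
Lemma differentiable_pt_lim_Rmult x y : differentiable_pt_lim Rmult x y y x.
Proof.
  intros eps. exists eps. intros u v Hu _.
  replace (u * v - x * y - (y * (u - x) + x * (v - y))) with ((u - x) * (v - y)) by ring.
  rewrite Rabs_mult. apply Rmult_le_compat; try apply Rabs_pos; [now left|apply Rmax_r].
Qed.
Lemma C1_plus u ux uy v vx vy : C1 u ux uy -> C1 v vx vy ->
  C1 (fun x y => u x y + v x y) (fun x y => ux x y + vx x y) (fun x y => uy x y + vy x y).
Proof.
  intros (H1 & H2 & H3) (K1 & K2 & K3). split; [|split; now apply cont2_plus]. intros x y.
  pose proof (differentiable_pt_lim_comp Rplus u v x y _ _ _ _ _ _
    (differentiable_pt_lim_Rplus (u x y) (v x y)) (H1 x y) (K1 x y)) as H.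
  now rewrite !Rmult_1_l in H.
Qed.
Lemma C1_mult u ux uy v vx vy : C1 u ux uy -> C1 v vx vy ->
  C1 (fun x y => u x y * v x y) (fun x y => v x y * ux x y + u x y * vx x y)
     (fun x y => v x y * uy x y + u x y * vy x y).
Proof.
  intros HH KK. pose proof (C1_cont _ _ _ HH). pose proof (C1_cont _ _ _ KK).
  destruct HH as (H1 & H2 & H3), KK as (K1 & K2 & K3).
  split; [|split; apply cont2_plus; now apply cont2_mult]. intros x y.
  exact (differentiable_pt_lim_comp Rmult u v x y _ _ _ _ _ _
    (differentiable_pt_lim_Rmult (u x y) (v x y)) (H1 x y) (K1 x y)).
Qed.
Lemma C1_comp g g' u ux uy : (forall x y, is_derive g (u x y) (g' (u x y))) ->
  (forall x y, continuous g' (u x y)) -> C1 u ux uy ->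
  C1 (fun x y => g (u x y)) (fun x y => g' (u x y) * ux x y) (fun x y => g' (u x y) * uy x y).
Proof.
  intros Hg Hg' HH. pose proof (C1_cont _ _ _ HH) as Hu. destruct HH as (H1 & H2 & H3).
  split; [|split; apply cont2_mult; auto; now apply cont2_comp]. intros x y.
  pose proof (differentiable_pt_lim_comp (fun a _ => g a) u u x y _ _ _ _ _ _
   (differentiable_pt_lim_proj1_0 g (u x y) (u x y) _ (proj1 (is_derive_Reals _ _ _) (Hg x y)))
   (H1 x y) (H1 x y)) as H.
  now rewrite !Rmult_0_l, !Rplus_0_r in H.
Qed.
Lemma C1_comp2 f fx fy u ux uy v vx vy : C1 f fx fy -> C1 u ux uy -> C1 v vx vy ->
  C1 (fun x y => f (u x y) (v x y))
     (fun x y => fx (u x y) (v x y) * ux x y + fy (u x y) (v x y) * vx x y)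
     (fun x y => fx (u x y) (v x y) * uy x y + fy (u x y) (v x y) * vy x y).
Proof.
  intros HF HU HV. pose proof (C1_cont _ _ _ HU) as Hu. pose proof (C1_cont _ _ _ HV) as Hv.
  destruct HF as (F1 & F2 & F3), HU as (U1 & U2 & U3), HV as (V1 & V2 & V3).
  split; [intros x y; now apply differentiable_pt_lim_comp|].
  split; apply cont2_plus; apply cont2_mult; auto; apply (cont2_comp2 _ u v); auto.
Qed.
Lemma C1_ext u ux uy v vx vy : C1 u ux uy -> (forall x y, u x y = v x y) ->
  (forall x y, ux x y = vx x y) -> (forall x y, uy x y = vy x y) -> C1 v vx vy.
Proof.
  intros H E E1 E2. replace v with u by (extensionality x; extensionality y; auto).
  replace vx with ux by (extensionality x; extensionality y; auto).
  now replace vy with uy by (extensionality x; extensionality y; auto).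
Qed.

Lemma ex_C1_const c : ex_C1 (fun _ _ => c). Proof. eexists _, _; apply C1_const. Qed.
Lemma ex_C1_plus u v : ex_C1 u -> ex_C1 v -> ex_C1 (fun x y => u x y + v x y).
Proof. intros (? & ? & H) (? & ? & K). eexists _, _; apply (C1_plus _ _ _ _ _ _ H K). Qed.
Lemma ex_C1_mult u v : ex_C1 u -> ex_C1 v -> ex_C1 (fun x y => u x y * v x y).
Proof. intros (? & ? & H) (? & ? & K). eexists _, _; apply (C1_mult _ _ _ _ _ _ H K). Qed.
Lemma ex_C1_minus u v : ex_C1 u -> ex_C1 v -> ex_C1 (fun x y => u x y - v x y).
Proof.
  intros H K. pose proof (ex_C1_plus _ _ H (ex_C1_mult _ _ (ex_C1_const (-1)) K)) as (a & b & L).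
  exists a, b. eapply C1_ext; [exact L| | |]; intros; cbn; ring.
Qed.

Lemma C2_ex_C1 u ux uy : C2 u ux uy -> ex_C1 u. Proof. intros (H & _); now exists ux, uy. Qed.
Lemma ex_C2_ex_C1 u : ex_C2 u -> ex_C1 u. Proof. intros (a & b & H); now apply C2_ex_C1 in H. Qed.
Lemma ex_C2_cont u : ex_C2 u -> cont2 u. Proof. intros H; now apply ex_C1_cont, ex_C2_ex_C1. Qed.
Lemma ex_C2_const c : ex_C2 (fun _ _ => c).
Proof. eexists _, _; split; [apply C1_const|split; apply ex_C1_const]. Qed.
Lemma ex_C2_fst : ex_C2 (fun x _ => x).
Proof. eexists _, _; split; [apply C1_fst|split; apply ex_C1_const]. Qed.
Lemma ex_C2_snd : ex_C2 (fun _ y => y).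
Proof. eexists _, _; split; [apply C1_snd|split; apply ex_C1_const]. Qed.
Lemma ex_C2_plus u v : ex_C2 u -> ex_C2 v -> ex_C2 (fun x y => u x y + v x y).
Proof.
  intros (? & ? & H & Hx & Hy) (? & ? & K & Kx & Ky). eexists _, _; split; [apply (C1_plus _ _ _ _ _ _ H K)|].
  split; now apply ex_C1_plus.
Qed.
Lemma ex_C2_mult u v : ex_C2 u -> ex_C2 v -> ex_C2 (fun x y => u x y * v x y).
Proof.
  intros HH KK. pose proof (ex_C2_ex_C1 _ HH). pose proof (ex_C2_ex_C1 _ KK).
  destruct HH as (? & ? & H1 & Hx & Hy), KK as (? & ? & K & Kx & Ky).
  eexists _, _; split; [apply (C1_mult _ _ _ _ _ _ H1 K)|].
  split; apply ex_C1_plus; now apply ex_C1_mult.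
Qed.
Lemma ex_C2_comp g g' g'' u : (forall x y, is_derive g (u x y) (g' (u x y))) ->
  (forall x y, is_derive g' (u x y) (g'' (u x y))) -> (forall x y, continuous g'' (u x y)) ->
  ex_C2 u -> ex_C2 (fun x y => g (u x y)).
Proof.
  intros Hg Hg' Hc (ux & uy & H & Hx & Hy).
  assert (Hc' : forall x y, continuous g' (u x y)).
  { intros; apply (ex_derive_continuous (K := R_AbsRing) (V := R_NormedModule)). eexists; apply Hg'. }
  eexists _, _; split; [apply (C1_comp g g' _ _ _ Hg Hc' H)|].
  assert (ex_C1 (fun x y => g' (u x y))) by (eexists _, _; apply (C1_comp g' g'' _ _ _ Hg' Hc H)).
  split; now apply ex_C1_mult.
Qed.
Lemma ex_C2_lsum {T} (F : T -> R -> R -> R) l : (forall a, ex_C2 (F a)) ->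
  ex_C2 (fun x y => lsum (fun a => F a x y) l).
Proof.
  intros H; induction l as [|a l IH]; [exact (ex_C2_const 0)|].
  exact (ex_C2_plus _ _ (H a) IH).
Qed.
Lemma ex_C2_inv u : (forall x y, u x y <> 0) -> ex_C2 u -> ex_C2 (fun x y => / u x y).
Proof.
  intros H0 H. apply (ex_C2_comp Rinv (fun t => - / (t * t)) (fun t => 2 / (t * t * t))); auto.
  - intros x y. auto_derive; [apply H0|]. field; apply H0.
  - intros x y. auto_derive; [apply Rmult_integral_contrapositive; auto|]. field; apply H0.
  - intros x y. apply (ex_derive_continuous (K := R_AbsRing) (V := R_NormedModule)). auto_derive.
    repeat apply Rmult_integral_contrapositive_currified; auto.
Qed.

Lemma C2_mixed u ux uy uxx uxy uyx uyy x y : C1 u ux uy -> C1 ux uxx uxy -> C1 uy uyx uyy ->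
  uxy x y = uyx x y.
Proof.
  intros H Hx Hy.
  assert (E1 : forall x y, Derive (fun t => u t y) x = ux x y) by (intros; eapply is_derive_unique, C1_is_derive_x, H).
  assert (E2 : forall x y, Derive (fun t => u x t) y = uy x y) by (intros; eapply is_derive_unique, C1_is_derive_y, H).
  assert (E3 : forall x y, Derive (fun z => Derive (fun t => u t z) x) y = uxy x y).
  { intros. rewrite (Derive_ext _ (fun z => ux x0 z)) by (intros; apply E1). eapply is_derive_unique, C1_is_derive_y, Hx. }
  assert (E4 : forall x y, Derive (fun z => Derive (fun t => u z t) y) x = uyx x y).
  { intros. rewrite (Derive_ext _ (fun z => uy z y0)) by (intros; apply E2). eapply is_derive_unique, C1_is_derive_x, Hy. }
  rewrite <- E3, <- E4. symmetry. apply Schwarz.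
  - exists (mkposreal 1 Rlt_0_1). intros a b _ _. repeat split.
    + eexists; eapply C1_is_derive_x, H.
    + eexists; eapply C1_is_derive_y, H.
    + apply ex_derive_ext with (fun z => uy z b); [intros; now rewrite E2|]. eexists; eapply C1_is_derive_x, Hy.
    + apply ex_derive_ext with (fun z => ux a z); [intros; now rewrite E1|]. eexists; eapply C1_is_derive_y, Hx.
  - eapply continuity_2d_pt_ext; [intros; symmetry; apply E4|]. apply Hy.
  - eapply continuity_2d_pt_ext; [intros; symmetry; apply E3|]. apply Hx.
Qed.

Lemma differentiable_from_partials f fx l x y :
  locally_2d (fun x y => is_derive (fun t => f t y) x (fx x y)) x y ->
  is_derive (fun t => f x t) y l -> continuity_2d_pt fx x y ->
  differentiable_pt_lim f x y (fx x y) l.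
Proof.
  intros H1 H2 H3. apply filterdiff_differentiable_pt_lim.
  apply is_derive_filterdiff; auto.
  - now apply locally_2d_locally in H1.
  - apply continuity_2d_pt_filterlim in H3. exact H3.
Qed.

Lemma abs_RInt_bound f a b M : ex_RInt f a b ->
  (forall t, Rmin a b <= t <= Rmax a b -> Rabs (f t) <= M) -> Rabs (RInt f a b) <= Rabs (b - a) * M.
Proof.
  intros He Hb. destruct (Rle_dec a b) as [Hab|Hab].
  - rewrite (Rabs_pos_eq (b - a)) by lra. apply abs_RInt_le_const; auto.
    intros; apply Hb. rewrite Rmin_left, Rmax_right; lra.
  - rewrite <- opp_RInt_swap by now apply ex_RInt_swap. unfold opp; cbn. rewrite Rabs_Ropp.
    rewrite (Rabs_left1 (b - a)) by lra. replace (- (b - a)) with (a - b) by ring.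
    apply abs_RInt_le_const; [lra|now apply ex_RInt_swap|].
    intros; apply Hb. rewrite Rmin_right, Rmax_left; lra.
Qed.
Lemma cont2_ex_RInt w y a b : cont2 w -> ex_RInt (fun u => w u y) a b.
Proof. intros H. apply (ex_RInt_continuous (V := R_CompleteNormedModule)). intros; now apply cont2_cont1. Qed.

Lemma cont2_RInt w a : cont2 w -> cont2 (fun x y => RInt (fun u => w u y) a x).
Proof.
  intros H x0 y0 eps.
  set (al := Rmin a (x0 - 1)). set (be := Rmax a (x0 + 1)).
  assert (Hal : al <= a /\ al <= x0 - 1) by (split; [apply Rmin_l|apply Rmin_r]).
  assert (Hbe : a <= be /\ x0 + 1 <= be) by (split; [apply Rmax_l|apply Rmax_r]).
  assert (Hpos : 0 < eps / (2 * (be - al))) by (apply Rdiv_lt_0_compat; [apply cond_pos|lra]).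
  destruct (uniform_continuity_2d_1d w al be y0 (fun x _ => H x y0) (mkposreal _ Hpos)) as [d Hd]; cbn in Hd.
  assert (Hc : continuous (fun x => RInt (fun u => w u y0) a x) x0).
  { apply (ex_derive_continuous (K := R_AbsRing) (V := R_NormedModule)). exists (w x0 y0).
    apply (is_derive_RInt (V := R_NormedModule) (fun u => w u y0) _ a).
    - apply filter_forall. intros z. apply (RInt_correct (V := R_CompleteNormedModule)), cont2_ex_RInt, H.
    - now apply cont2_cont1. }
  apply continuity_pt_filterlim in Hc. destruct (Hc (eps / 2)) as (d1 & Hd1 & Hc1);
    [apply Rdiv_lt_0_compat; [apply cond_pos|lra]|].
  assert (Hdd : 0 < Rmin (Rmin d d1) 1) by (repeat apply Rmin_glb_lt; auto; [apply cond_pos|lra]).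
  exists (mkposreal _ Hdd). intros x y Hx Hy. cbn [pos] in Hx, Hy.
  assert (Hx' : Rabs (x - x0) < d1 /\ Rabs (x - x0) < 1 /\ Rabs (y - y0) < d).
  { pose proof (Rmin_l (Rmin d d1) 1). pose proof (Rmin_r (Rmin d d1) 1).
    pose proof (Rmin_l d d1). pose proof (Rmin_r d d1). repeat split; lra. }
  destruct Hx' as (Hx1 & Hx2 & Hy1). apply Rabs_def2 in Hx2.
  assert (E : RInt (fun u => w u y) a x - RInt (fun u => w u y0) a x0 =
     RInt (fun u => w u y - w u y0) a x +
     (RInt (fun u => w u y0) a x - RInt (fun u => w u y0) a x0)).
  { pose proof (RInt_minus (V := R_CompleteNormedModule) (fun u => w u y) (fun u => w u y0) a x
      (cont2_ex_RInt _ _ _ _ H) (cont2_ex_RInt _ _ _ _ H)) as K. change (RInt (fun u => w u y - w u y0) a x =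
      RInt (fun u => w u y) a x - RInt (fun u => w u y0) a x) in K. rewrite K. ring. }
  rewrite E. eapply Rle_lt_trans; [apply Rabs_triang|].
  replace (pos eps) with (eps / 2 + eps / 2) by field. apply Rplus_le_lt_compat.
  - eapply Rle_trans; [apply (abs_RInt_bound _ a x (eps / (2 * (be - al))))|].
    + apply (cont2_ex_RInt (fun u v => w u v - w u y0) y).
      apply cont2_minus; [exact H|]. exact (cont2_comp2 _ _ _ H cont2_fst (cont2_const y0)).
    + intros t Ht. left.
      assert (al <= t <= be).
      { unfold Rmin, Rmax in Ht; destruct Rle_dec in Ht; lra. }
      apply Rabs_def2 in Hy1. pose proof (cond_pos d).
      apply Hd; try lra. rewrite Rminus_diag, Rabs_R0. apply cond_pos.
    + assert (Rabs (x - a) <= be - al) by (apply Rabs_le; lra).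
      replace (eps / 2) with ((be - al) * (eps / (2 * (be - al)))) by (field; lra).
      apply Rmult_le_compat_r; [lra|assumption].
  - destruct (Req_dec x x0) as [->|Hne]; [rewrite Rminus_diag, Rabs_R0; pose proof (cond_pos eps); lra|].
    apply Hc1. split; [split; [exact I|now apply not_eq_sym]|exact Hx1].
Qed.

Lemma C1_RInt w wy a : cont2 w -> cont2 wy -> (forall x y, is_derive (fun y => w x y) y (wy x y)) ->
  C1 (fun x y => RInt (fun u => w u y) a x) w (fun x y => RInt (fun u => wy u y) a x).
Proof.
  intros Hw Hwy Hd. split; [|split; [assumption|now apply cont2_RInt]]. intros x y.
  assert (E : forall x y, Derive (fun z => w x z) y = wy x y) by (intros; apply is_derive_unique, Hd).
  apply differentiable_from_partials; [| |apply Hw].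
  - exists (mkposreal 1 Rlt_0_1). intros x' y' _ _.
    apply (is_derive_RInt (V := R_NormedModule) (fun u => w u y') _ a).
    + apply filter_forall. intros z. apply (RInt_correct (V := R_CompleteNormedModule)), cont2_ex_RInt, Hw.
    + now apply cont2_cont1.
  - pose proof (is_derive_RInt_param (fun y u => w u y) a x y) as K.
    rewrite (RInt_ext _ (fun u => wy u y)) in K by (intros; apply E). apply K.
    + apply filter_forall. intros z t _. eexists; apply Hd.
    + intros t _. eapply continuity_2d_pt_ext; [intros u v; symmetry; apply E|].
      exact (cont2_comp2 _ _ _ Hwy cont2_snd cont2_fst y t).
    + apply filter_forall. intros z. now apply cont2_ex_RInt.
Qed.

(* A closed form on a rectangle has a potential. *)
Lemma closed_form_potential A Ax Ay B Bx By l : C1 A Ax Ay -> C1 B Bx By -> 0 < l ->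
  (forall x y, Rabs x <= l -> Rabs y <= l -> Ay x y = Bx x y) ->
  exists F, forall x y, Rabs x < l -> Rabs y < l -> differentiable_pt_lim F x y (A x y) (B x y).
Proof.
  intros HA HB Hl Hcl.
  pose proof (C1_cont _ _ _ HA) as cA. pose proof (C1_cont _ _ _ HB) as cB.
  assert (HB' : C1 (fun y x => B x y) (fun y x => By x y) (fun y x => Bx x y)).
  { pose proof (C1_comp2 _ _ _ _ _ _ _ _ _ HB C1_snd C1_fst) as K.
    eapply C1_ext; [exact K| | |]; intros; cbn; ring. }
  pose proof (C1_RInt (fun y x => B x y) (fun y x => Bx x y) 0 (C1_cont _ _ _ HB') (proj2 (proj2 HB'))
    (fun y x => C1_is_derive_y _ _ _ y x HB')) as HG.
  (* The form is integrated along the horizontal axis and then vertically. Closedness turns the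
     [x]-derivative of the vertical integral into [A x y - A x 0]. *)
  exists (fun x y => RInt (fun u => A u 0) 0 x + RInt (fun v => B x v) 0 y).
  intros x y Hx Hy.
  apply differentiable_from_partials; [| |apply cA].
  - assert (Hpos : 0 < Rmin (l - Rabs x) (l - Rabs y)) by (apply Rmin_glb_lt; lra).
    exists (mkposreal _ Hpos); cbn. intros x' y' Hx' Hy'.
    assert (Hx2 : Rabs x' <= l).
    { pose proof (Rmin_l (l - Rabs x) (l - Rabs y)). replace x' with (x' - x + x) by ring.
      eapply Rle_trans; [apply Rabs_triang|]. lra. }
    assert (Hy2 : Rabs y' <= l).
    { pose proof (Rmin_r (l - Rabs x) (l - Rabs y)). replace y' with (y' - y + y) by ring.
      eapply Rle_trans; [apply Rabs_triang|]. lra. }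
    replace (A x' y') with (plus (A x' 0) (RInt (fun v => Bx x' v) 0 y')).
    + apply (is_derive_plus (V := R_NormedModule)).
      * apply (is_derive_RInt (V := R_NormedModule) (fun u => A u 0) _ 0).
        -- apply filter_forall. intros z. apply (RInt_correct (V := R_CompleteNormedModule)), cont2_ex_RInt, cA.
        -- now apply cont2_cont1.
      * exact (C1_is_derive_y _ _ _ y' x' HG).
    + rewrite (RInt_ext (fun v => Bx x' v) (fun v => Ay x' v)).
      * pose proof (is_RInt_unique (V := R_CompleteNormedModule) _ _ _ _
          (is_RInt_derive (V := R_CompleteNormedModule) (fun v => A x' v) (fun v => Ay x' v) 0 y'
          (fun z _ => C1_is_derive_y _ _ _ x' z HA) (fun z _ => cont2_cont2 _ x' z (proj2 (proj2 HA))))) as K.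
        change (RInt (fun v => Ay x' v) 0 y' = A x' y' - A x' 0) in K.
        change (A x' 0 + RInt (fun v => Ay x' v) 0 y' = A x' y'). rewrite K. ring.
      * intros v Hv. symmetry. apply Hcl; [exact Hx2|].
        unfold Rmin, Rmax in Hv. apply Rabs_le_between in Hy2. apply Rabs_le.
        destruct Rle_dec in Hv; lra.
  - replace (B x y) with (plus 0 (B x y)) by (unfold plus; cbn; ring).
    apply (is_derive_plus (V := R_NormedModule)); [apply (is_derive_const (V := R_NormedModule))|].
    exact (C1_is_derive_x _ _ _ y x HG).
Qed.

(** * A cut-off of class C2 *)

Definition ppart (t : R) := Rmax 0 t.
Lemma ppart_nonneg t : 0 <= ppart t. Proof. apply Rmax_l. Qed.
Lemma ppart_neg t : t <= 0 -> ppart t = 0. Proof. intros; unfold ppart; now apply Rmax_left. Qed.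
Lemma ppart_pos t : 0 <= t -> ppart t = t. Proof. intros; unfold ppart; now apply Rmax_right. Qed.
Lemma continuous_ppart t : continuous ppart t.
Proof.
  apply continuity_pt_filterlim. intros eps Heps. exists eps; split; [exact Heps|].
  intros z (_ & Hz). cbn in *. unfold Rdist in *. eapply Rle_lt_trans; [|exact Hz].
  unfold ppart, Rmax. apply Rabs_le. unfold Rabs. repeat destruct Rle_dec; destruct Rcase_abs; lra.
Qed.
Lemma is_derive_ppart2 t : is_derive (fun t => ppart t ^ 2) t (2 * ppart t).
Proof.
  apply is_derive_Reals. intros eps Heps. exists (mkposreal eps Heps); cbn. intros h Hh Hlt.
  assert (E : Rabs (ppart (t + h) * (ppart (t + h) * 1) - ppart t * (ppart t * 1) - 2 * ppart t * h) <= Rabs h * Rabs h).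
  { unfold ppart, Rmax. repeat destruct Rle_dec; apply Rabs_le; unfold Rabs; destruct Rcase_abs; split; nra. }
  replace ((ppart (t + h) * (ppart (t + h) * 1) - ppart t * (ppart t * 1)) / h - 2 * ppart t)
    with ((ppart (t + h) * (ppart (t + h) * 1) - ppart t * (ppart t * 1) - 2 * ppart t * h) / h) by (field; auto).
  unfold Rdiv. rewrite Rabs_mult, Rabs_inv.
  assert (0 < Rabs h) by now apply Rabs_pos_lt.
  eapply Rle_lt_trans; [apply Rmult_le_compat_r; [left; now apply Rinv_0_lt_compat|exact E]|].
  rewrite Rmult_assoc, Rinv_r, Rmult_1_r; lra.
Qed.
Lemma ppart_mul t : t * ppart t = ppart t ^ 2.
Proof. unfold ppart, Rmax; destruct Rle_dec; ring. Qed.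
(** The cube makes the positive part twice continuously differentiable. This is the smoothness
    required below, where forms are built from first derivatives and then differentiated once
    more. *)
Definition bump t := ppart t ^ 3.
Lemma is_derive_bump t : is_derive bump t (3 * ppart t ^ 2).
Proof.
  apply is_derive_ext with (fun t => t * ppart t ^ 2).
  { intros s. unfold bump. replace (s * ppart s ^ 2) with (s * ppart s * ppart s) by ring. rewrite ppart_mul. cbn; ring. }
  apply is_derive_Reals.
  replace (3 * ppart t ^ 2) with (1 * ppart t ^ 2 + t * (2 * ppart t)).
  - exact (derivable_pt_lim_mult id (fun t => ppart t ^ 2) t 1 (2 * ppart t) (derivable_pt_lim_id t)
      (proj1 (is_derive_Reals _ _ _) (is_derive_ppart2 t))).
  - replace (t * (2 * ppart t)) with (2 * (t * ppart t)) by ring. rewrite ppart_mul. ring.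
Qed.
Lemma is_derive_bump' t : is_derive (fun t => 3 * ppart t ^ 2) t (6 * ppart t).
Proof.
  apply is_derive_Reals. replace (6 * ppart t) with (3 * (2 * ppart t)) by ring.
  exact (derivable_pt_lim_scal (fun t => ppart t ^ 2) 3 t _ (proj1 (is_derive_Reals _ _ _) (is_derive_ppart2 t))).
Qed.
Lemma bump_nonneg t : 0 <= bump t. Proof. apply pow_le, ppart_nonneg. Qed.
Lemma bump_neg t : t <= 0 -> bump t = 0. Proof. intros; unfold bump; rewrite ppart_neg; auto; ring. Qed.
Lemma bump_ge1 t : 1 <= t -> 1 <= bump t.
Proof. intros; unfold bump; rewrite ppart_pos by lra. nra. Qed.
Lemma ex_C2_bump u : ex_C2 u -> ex_C2 (fun x y => bump (u x y)).
Proof.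
  apply (ex_C2_comp bump (fun t => 3 * ppart t ^ 2) (fun t => 6 * ppart t)); intros.
  - apply is_derive_bump.
  - apply is_derive_bump'.
  - apply (continuous_scal_r (V := R_NormedModule)), continuous_ppart.
Qed.
(** Makes division by a nonnegative sum safe everywhere while leaving the sum unchanged where it is
    at least one, which is where the quotients are evaluated exactly. *)
Definition flo t := t + bump (1 - t).
Lemma flo_pos t : 0 <= t -> 0 < flo t.
Proof.
  intros H; unfold flo. destruct (Req_dec t 0) as [->|]; [|pose proof (bump_nonneg (1 - t)); lra].
  pose proof (bump_ge1 (1 - 0)). lra.
Qed.
Lemma flo_ge1 t : 1 <= t -> flo t = t.
Proof. intros; unfold flo; rewrite bump_neg; lra. Qed.
Lemma ex_C2_inv_flo u : (forall x y, 0 <= u x y) -> ex_C2 u -> ex_C2 (fun x y => / flo (u x y)).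
Proof.
  intros H0 H. apply ex_C2_inv; [intros; pose proof (flo_pos _ (H0 x y)); lra|].
  unfold flo. apply ex_C2_plus; [exact H|]. apply ex_C2_bump.
  destruct (ex_C2_plus _ _ (ex_C2_const 1) (ex_C2_mult _ _ (ex_C2_const (-1)) H)) as (a & b & K & Ka & Kb).
  exists a, b. split; [|now split]. eapply C1_ext; [exact K| | |]; intros; cbn; ring.
Qed.

(** * The hyperbolic plane *)

(* Coordinates [(x, s)] for the point [x + i e^s] of the upper half-plane; [gz x s] maps [i] to it. *)
Definition gz (x s : R) : Mat2 := mkMat2 (exp (s / 2)) (x * exp (- s / 2)) 0 (exp (- s / 2)).
Definition fro (M : Mat2) : R := m11 M * m11 M + m12 M * m12 M + m21 M * m21 M + m22 M * m22 M.
(* [nd M z = 2 cosh d(M i, z)] *)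
Definition nd (M : Mat2) (x s : R) : R := fro (mmul (madj M) (gz x s)).

Lemma exp_half s : exp (s / 2) * exp (s / 2) = exp s.
Proof. rewrite <- exp_plus. f_equal; field. Qed.
Lemma exp_half' s : exp (- s / 2) * exp (- s / 2) = / exp s.
Proof. rewrite <- exp_plus, <- exp_Ropp. f_equal; field. Qed.
Lemma exp_half_inv s : exp (s / 2) * exp (- s / 2) = 1.
Proof. rewrite <- exp_plus, <- exp_0. f_equal; field. Qed.
Lemma exp_nz s : exp s <> 0. Proof. pose proof (exp_pos s); lra. Qed.

Lemma mdet_gz x s : mdet (gz x s) = 1.
Proof. unfold mdet, gz; cbn. rewrite exp_half_inv. ring. Qed.

Lemma nd_formula M x s : nd M x s =
  ((m21 M * m21 M + m22 M * m22 M) * (x * x + exp s * exp s)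
   - 2 * (m11 M * m21 M + m12 M * m22 M) * x + (m11 M * m11 M + m12 M * m12 M)) * / exp s.
Proof.
  unfold nd, fro, mmul, madj, gz; cbn.
  set (p := exp (s / 2)). set (r := exp (- s / 2)).
  assert (Hp : p * p = exp s) by apply exp_half. assert (Hr : r * r = / exp s) by apply exp_half'.
  assert (Hpr : p * r = 1) by apply exp_half_inv.
  replace (exp s * exp s) with (p * p * (p * p)) by (rewrite Hp; ring). rewrite <- Hr.
  assert (Hppr : p * p * (p * p) * (r * r) = p * p).
  { replace (p * p * (p * p) * (r * r)) with (p * p * (p * r) * (p * r)) by ring. rewrite Hpr; ring. }
  transitivity ((m21 M * m21 M + m22 M * m22 M) * (x * x) * (r * r)
     + (m21 M * m21 M + m22 M * m22 M) * (p * p * (p * p) * (r * r))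
     - 2 * (m11 M * m21 M + m12 M * m22 M) * x * (r * r) + (m11 M * m11 M + m12 M * m12 M) * (r * r)); [|ring].
  rewrite Hppr.
  transitivity ((m21 M * m21 M + m22 M * m22 M) * (x * x) * (r * r) + (m21 M * m21 M + m22 M * m22 M) * (p * p)
     - 2 * (m11 M * m21 M * x * (r * r) + m12 M * m22 M * x * (r * r) )
     + (m11 M * m11 M + m12 M * m12 M) * (r * r)); [|ring]. ring_simplify.
  ring [Hpr].
Qed.
Lemma nd_mid x s : nd mid x s = (x * x + exp s * exp s + 1) * / exp s.
Proof. rewrite nd_formula; cbn. ring. Qed.

Lemma fro_nonneg M : 0 <= fro M. Proof. unfold fro; nra. Qed.
Lemma fro_mmul A B : fro (mmul A B) <= fro A * fro B.
Proof.
  destruct A as [a b c d], B as [e f h k]; unfold fro, mmul; cbn.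
  pose proof (Rle_0_sqr (a * k - b * f)). pose proof (Rle_0_sqr (a * h - b * e)).
  pose proof (Rle_0_sqr (c * k - d * f)). pose proof (Rle_0_sqr (c * h - d * e)).
  unfold Rsqr in *. lra.
Qed.
Lemma fro_madj M : fro (madj M) = fro M. Proof. unfold fro, madj; cbn; ring. Qed.
Lemma fro_mneg M : fro (mneg M) = fro M. Proof. unfold fro, mneg; cbn; ring. Qed.
Lemma fro_ge2 M : mdet M = 1 -> 2 <= fro M.
Proof.
  unfold mdet, fro. intros H.
  pose proof (Rle_0_sqr (m11 M - m22 M)). pose proof (Rle_0_sqr (m12 M + m21 M)). unfold Rsqr in *. lra.
Qed.
Lemma mnorm_sq_fro M : mnorm M * mnorm M <= fro M.
Proof.
  unfold fro. pose proof (Rle_0_sqr (m11 M)). pose proof (Rle_0_sqr (m12 M)).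
  pose proof (Rle_0_sqr (m21 M)). pose proof (Rle_0_sqr (m22 M)). unfold Rsqr in *.
  destruct (mnorm_attained M) as [E|[E|[E|E]]]; rewrite E, <- Rabs_mult, Rabs_pos_eq by lra; lra.
Qed.
Lemma mnorm_le_fro M : mdet M = 1 -> mnorm M <= fro M.
Proof.
  intros H. pose proof (fro_ge2 M H). pose proof (mnorm_sq_fro M). pose proof (mnorm_nonneg M).
  destruct (Rle_dec (mnorm M) 1); nra.
Qed.

(** Multiplicative triangle inequality for the distance from [i] to [M i] through the point
    [(x, s)]; [fro] is submultiplicative. *)
Lemma fro_le_nd M x s : fro M <= nd M x s * nd mid x s.
Proof.
  unfold nd. replace (madj mid) with mid by now rewrite madj_mid. rewrite mmul_id_l.
  rewrite <- (fro_madj M). rewrite <- (mmul_id_r (madj M)) at 1.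
  rewrite <- (mmul_madj_r (gz x s)) by apply mdet_gz. rewrite mmul_assoc.
  eapply Rle_trans; [apply fro_mmul|]. rewrite fro_madj. lra.
Qed.
Lemma nd_le_fro M x s : nd M x s <= fro M * nd mid x s.
Proof.
  unfold nd. rewrite madj_mid, mmul_id_l. eapply Rle_trans; [apply fro_mmul|]. rewrite fro_madj. lra.
Qed.
Lemma nd_pm M M' x s : pm_eq M M' -> nd M x s = nd M' x s.
Proof. intros [->| ->]; [reflexivity|]. unfold nd. now rewrite madj_mneg, mmul_mneg_l, fro_mneg. Qed.
Lemma nd_ge2 M x s : mdet M = 1 -> 2 <= nd M x s.
Proof. intros H; unfold nd. apply fro_ge2. now rewrite mdet_mmul, mdet_madj, H, mdet_gz, Rmult_1_l. Qed.
Lemma nd_mid_region x s K : nd mid x s <= K -> Rabs x <= K /\ Rabs s <= K.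
Proof.
  rewrite nd_mid. intros H. pose proof (exp_pos s) as Hy.
  assert (Hi : 0 < / exp s) by now apply Rinv_0_lt_compat.
  assert (E1 : exp s * / exp s = 1) by (apply Rinv_r; lra).
  assert (E : (x * x + exp s * exp s + 1) * / exp s = x * x * / exp s + exp s + / exp s).
  { replace ((x * x + exp s * exp s + 1) * / exp s)
      with (x * x * / exp s + exp s * (exp s * / exp s) + / exp s) by ring. rewrite E1; ring. }
  rewrite E in H.
  assert (0 <= x * x * / exp s) by (apply Rmult_le_pos; [nra|lra]).
  assert (x * x <= K * K).
  { replace (x * x) with (x * x * / exp s * exp s) by (rewrite Rmult_assoc, (Rmult_comm (/ exp s)), E1; ring).
    assert (exp s <= K) by lra. assert (x * x * / exp s <= K) by lra. apply Rmult_le_compat; lra. }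
  split.
  - apply Rabs_le. split; nra.
  - pose proof (exp_ineq1_le s). pose proof (exp_ineq1_le (- s)) as H3. rewrite exp_Ropp in H3.
    apply Rabs_le; split; lra.
Qed.
Definition rect_bound K := (K * K + exp (2 * K) + 1) * exp K.
Lemma nd_mid_rect x s K : Rabs x <= K -> Rabs s <= K -> nd mid x s <= rect_bound K.
Proof.
  intros Hx Hs. rewrite nd_mid. unfold rect_bound.
  assert (Hs' : - K <= s <= K) by now apply Rabs_le_between.
  pose proof (Rabs_mul_le _ _ _ _ Hx Hx). rewrite Rabs_pos_eq in H by apply Rle_0_sqr.
  rewrite <- exp_plus, <- exp_Ropp.
  assert (exp (s + s) <= exp (2 * K)).
  { destruct (Req_dec (s + s) (2 * K)) as [->|]; [lra|left; apply exp_increasing; lra]. }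
  assert (exp (- s) <= exp K).
  { destruct (Req_dec (- s) K) as [->|]; [lra|left; apply exp_increasing; lra]. }
  apply Rmult_le_compat; try lra; [|left; apply exp_pos]. pose proof (exp_pos (s + s)). nra.
Qed.
Lemma rect_bound_ge2 K : 0 <= K -> 2 <= rect_bound K.
Proof.
  intros H. eapply Rle_trans; [apply (nd_ge2 mid 0 0), mdet_mid|]. apply nd_mid_rect; rewrite Rabs_R0; assumption.
Qed.
(** Triangle inequality from [M i] to [(c, 0)] through [(x, s)]. Horizontal translations are
    isometries, so the second distance is measured from [i] after a shift by [c]. *)
Lemma nd_horo M x s c : nd M c 0 <= nd M x s * nd mid (x - c) s.
Proof.
  assert (E : nd mid (x - c) s = fro (mmul (madj (gz x s)) (gz c 0))).
  { rewrite <- fro_madj, madj_mmul, madj_madj. unfold nd. rewrite madj_mid, mmul_id_l. f_equal.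
    unfold gz, mmul, madj; cbn. replace (0 / 2) with 0 by field. replace (-0 / 2) with 0 by field. rewrite exp_0. f_equal; ring. }
  rewrite E. unfold nd. eapply Rle_trans; [|apply fro_mmul]. right. f_equal.
  rewrite <- mmul_assoc, mmul_madj_cancel_l'; [reflexivity|apply mdet_gz].
Qed.
(** At fixed height, [nd M] is a quadratic polynomial in [x] with positive leading coefficient. Its
    vertex [xs] is the same at every height, which is what makes a single [center] usable later. *)
Lemma nd_convex M x x' s : mdet M = 1 ->
  let xs := (m11 M * m21 M + m12 M * m22 M) / (m21 M * m21 M + m22 M * m22 M) in
  Rmin xs x <= x' <= Rmax xs x -> nd M x' s <= nd M x s.
Proof.
  intros H xs Hx'. rewrite !nd_formula.
  assert (Hp : 0 < m21 M * m21 M + m22 M * m22 M).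
  { unfold mdet in H. destruct (Req_dec (m21 M) 0) as [E|]; [|nra].
    destruct (Req_dec (m22 M) 0) as [E'|]; [|nra]. rewrite E, E' in H. lra. }
  apply Rmult_le_compat_r; [left; apply Rinv_0_lt_compat, exp_pos|].
  assert (E : m11 M * m21 M + m12 M * m22 M = (m21 M * m21 M + m22 M * m22 M) * xs) by (unfold xs; field; lra).
  rewrite E. set (A := m21 M * m21 M + m22 M * m22 M) in *.
  assert ((x' - xs) * (x' - xs) <= (x - xs) * (x - xs)).
  { unfold Rmin, Rmax in Hx'. destruct Rle_dec in Hx'; nra. }
  assert (A * ((x' - xs) * (x' - xs)) <= A * ((x - xs) * (x - xs))) by (apply Rmult_le_compat_l; lra).
  nra.
Qed.

(* [M] moves [x + i e^s] to [actx M x s + i e^(acts M x s)]; [jac] is [|c z + d|^2]. *)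
Definition jac (M : Mat2) (x s : R) : R :=
  (m21 M * x + m22 M) * (m21 M * x + m22 M) + m21 M * m21 M * (exp s * exp s).
Definition actx (M : Mat2) (x s : R) : R :=
  (m11 M * m21 M * (x * x + exp s * exp s) + (m11 M * m22 M + m12 M * m21 M) * x + m12 M * m22 M) * / jac M x s.
Definition acts (M : Mat2) (x s : R) : R := s - ln (jac M x s).

Lemma jac_pos M x s : mdet M = 1 -> 0 < jac M x s.
Proof.
  unfold mdet, jac; intros H. pose proof (exp_pos s).
  assert (0 < exp s * exp s) by nra.
  destruct (Req_dec (m21 M) 0) as [E|E].
  - rewrite E in *. assert (m22 M <> 0) by (intros E'; rewrite E' in H; lra). nra.
  - assert (0 < m21 M * m21 M) by now apply Rsqr_pos_lt.
    pose proof (Rle_0_sqr (m21 M * x + m22 M)). unfold Rsqr in *.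
    assert (0 < m21 M * m21 M * (exp s * exp s)) by now apply Rmult_lt_0_compat. lra.
Qed.
Lemma exp_acts M x s : mdet M = 1 -> exp (acts M x s) = exp s * / jac M x s.
Proof.
  intros H. unfold acts, Rminus. rewrite exp_plus, exp_Ropp, exp_ln by now apply jac_pos. reflexivity.
Qed.
Lemma jac_mmul M M' x s : mdet M = 1 -> mdet M' = 1 ->
  jac (mmul M M') x s = jac M (actx M' x s) (acts M' x s) * jac M' x s.
Proof.
  intros H H'. unfold jac at 2. rewrite exp_acts by assumption. unfold actx.
  pose proof (jac_pos M' x s H') as Hp.
  assert (Hd : m11 M' * m22 M' - m12 M' * m21 M' = 1) by exact H'.
  set (J := jac M' x s) in *. unfold jac in J.
  set (y := exp s) in *. destruct M as [a b c d], M' as [e f h k]; cbn in *.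
  unfold jac; cbn. fold y.
  assert (key : (c * (e * h * (x * x + y * y) + (e * k + f * h) * x + f * k) + d * J) *
    (c * (e * h * (x * x + y * y) + (e * k + f * h) * x + f * k) + d * J) + c * c * (y * y)
    = ((((c * e + d * h) * x + (c * f + d * k)) * ((c * e + d * h) * x + (c * f + d * k))
       + (c * e + d * h) * (c * e + d * h) * (y * y)) * J)).
  { replace (c * c * (y * y)) with (c * c * (y * y) * ((e * k - f * h) * (e * k - f * h))) by (rewrite Hd; ring).
    unfold J. ring. }
  apply (Rmult_eq_reg_r J); [|lra]. rewrite <- key. field. lra.
Qed.
Lemma acts_mmul M M' x s : mdet M = 1 -> mdet M' = 1 ->
  acts (mmul M M') x s = acts M (actx M' x s) (acts M' x s).
Proof.
  intros H H'. unfold acts at 1 2. rewrite jac_mmul by assumption.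
  rewrite ln_mult by (now apply jac_pos). unfold acts. ring.
Qed.
Lemma actx_mmul M M' x s : mdet M = 1 -> mdet M' = 1 ->
  actx (mmul M M') x s = actx M (actx M' x s) (acts M' x s).
Proof.
  intros H H'. unfold actx at 1 2. rewrite jac_mmul, exp_acts by assumption.
  pose proof (jac_pos M' x s H') as Hp. pose proof (jac_pos M (actx M' x s) (acts M' x s) H) as Hq.
  set (Q := jac M _ _) in *. clearbody Q. unfold actx.
  assert (Hd : m11 M' * m22 M' - m12 M' * m21 M' = 1) by exact H'.
  set (J := jac M' x s) in *. unfold jac in J.
  set (y := exp s) in *. destruct M as [a b c d], M' as [e f h k]; cbn in *. clear H H'.
  set (n := e * h * (x * x + y * y) + (e * k + f * h) * x + f * k).
  assert (key : (a * c * (n * n + y * y) + (a * d + b * c) * n * J + b * d * J * J)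
    = ((a * e + b * h) * (c * e + d * h) * (x * x + y * y)
       + ((a * e + b * h) * (c * f + d * k) + (a * f + b * k) * (c * e + d * h)) * x
       + (a * f + b * k) * (c * f + d * k)) * J).
  { replace (y * y) with (y * y * ((e * k - f * h) * (e * k - f * h))) at 1 by (rewrite Hd; ring).
    unfold J, n. ring. }
  transitivity (((a * e + b * h) * (c * e + d * h) * (x * x + y * y)
       + ((a * e + b * h) * (c * f + d * k) + (a * f + b * k) * (c * e + d * h)) * x
       + (a * f + b * k) * (c * f + d * k)) * J * / (Q * J * J)); [field; lra|].
  rewrite <- key. field. lra.
Qed.
Lemma jac_pm M M' x s : pm_eq M M' -> jac M x s = jac M' x s.
Proof. intros [->| ->]; [reflexivity|]. unfold jac, mneg; cbn. ring. Qed.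
Lemma acts_pm M M' x s : pm_eq M M' -> acts M x s = acts M' x s.
Proof. intros H. unfold acts. now rewrite (jac_pm _ _ _ _ H). Qed.
Lemma actx_pm M M' x s : pm_eq M M' -> actx M x s = actx M' x s.
Proof.
  intros H. unfold actx. rewrite (jac_pm _ _ _ _ H). destruct H as [->| ->]; [reflexivity|].
  unfold mneg; cbn. f_equal; ring.
Qed.
Lemma act_mid x s : actx mid x s = x /\ acts mid x s = s.
Proof.
  assert (E : jac mid x s = 1) by (unfold jac; cbn; ring).
  unfold actx, acts. rewrite E, ln_1, Rinv_1. cbn. split; ring.
Qed.
Lemma nd_act M W x s : mdet M = 1 -> nd (mmul M W) (actx M x s) (acts M x s) = nd W x s.
Proof.
  intros H. rewrite !nd_formula. rewrite exp_acts by assumption. unfold actx.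
  pose proof (jac_pos M x s H) as Hp. pose proof (exp_pos s) as Hy.
  assert (Hd : m11 M * m22 M - m12 M * m21 M = 1) by exact H.
  set (J := jac M x s) in *. unfold jac in J.
  set (y := exp s) in *. destruct M as [a b c d], W as [e f h k]; cbn in *. clear H.
  set (n := a * c * (x * x + y * y) + (a * d + b * c) * x + b * d).
  assert (key : (((c * e + d * h) * (c * e + d * h) + (c * f + d * k) * (c * f + d * k)) * (n * n + y * y)
     - 2 * ((a * e + b * h) * (c * e + d * h) + (a * f + b * k) * (c * f + d * k)) * n * J
     + ((a * e + b * h) * (a * e + b * h) + (a * f + b * k) * (a * f + b * k)) * J * J) =
     ((h * h + k * k) * (x * x + y * y) - 2 * (e * h + f * k) * x + (e * e + f * f)) * J).
  { replace (((h * h + k * k) * (x * x + y * y) - 2 * (e * h + f * k) * x + (e * e + f * f)))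
     with (((h * h + k * k) * (x * x + y * y) - 2 * (e * h + f * k) * x + (e * e + f * f)) * ((a * d - b * c) * (a * d - b * c))) by (rewrite Hd; ring).
    replace (y * y) with (y * y * ((a * d - b * c) * (a * d - b * c))) at 1 by (rewrite Hd; ring).
    unfold J, n. ring. }
  transitivity ((((c * e + d * h) * (c * e + d * h) + (c * f + d * k) * (c * f + d * k)) * (n * n + y * y)
     - 2 * ((a * e + b * h) * (c * e + d * h) + (a * f + b * k) * (c * f + d * k)) * n * J
     + ((a * e + b * h) * (a * e + b * h) + (a * f + b * k) * (a * f + b * k)) * J * J) * / (J * y)); [field; lra|].
  rewrite key. field. lra.
Qed.
Lemma nd_act_mid M x s : mdet M = 1 -> nd mid (actx M x s) (acts M x s) = nd (madj M) x s.
Proof.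
  intros H. rewrite <- (nd_act M (madj M) x s H), mmul_madj_r by assumption. reflexivity.
Qed.

Lemma ex_C2_exp u : ex_C2 u -> ex_C2 (fun x y => exp (u x y)).
Proof.
  apply (ex_C2_comp exp exp exp); intros; try apply is_derive_exp.
  apply (ex_derive_continuous (K := R_AbsRing) (V := R_NormedModule)). eexists; apply is_derive_exp.
Qed.
Lemma ex_C2_ext u v : (forall x y, u x y = v x y) -> ex_C2 u -> ex_C2 v.
Proof.
  intros E (a & b & H & Ha & Hb). exists a, b. split; [|now split].
  eapply C1_ext; [exact H| | |]; auto.
Qed.
Lemma ex_C2_scal c u : ex_C2 u -> ex_C2 (fun x y => c * u x y).
Proof. intros; apply ex_C2_mult; [apply ex_C2_const|assumption]. Qed.
Lemma ex_C2_jac M : ex_C2 (jac M).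
Proof.
  unfold jac. apply ex_C2_plus.
  - apply ex_C2_mult; apply ex_C2_plus; try apply ex_C2_const; apply ex_C2_scal, ex_C2_fst.
  - apply ex_C2_scal. apply ex_C2_mult; apply ex_C2_exp, ex_C2_snd.
Qed.
Lemma ex_C2_nd M : ex_C2 (nd M).
Proof.
  eapply ex_C2_ext; [intros; symmetry; apply nd_formula|].
  apply ex_C2_mult; [|apply ex_C2_inv; [intros; apply exp_nz|apply ex_C2_exp, ex_C2_snd]].
  apply ex_C2_plus; [|apply ex_C2_const].
  apply ex_C2_ext with (fun x y => (m21 M * m21 M + m22 M * m22 M) * (x * x + exp y * exp y)
    + (- (2 * (m11 M * m21 M + m12 M * m22 M))) * x); [intros; ring|].
  apply ex_C2_plus; apply ex_C2_scal; [|apply ex_C2_fst].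
  apply ex_C2_plus; apply ex_C2_mult; try apply ex_C2_fst; apply ex_C2_exp, ex_C2_snd.
Qed.
Lemma ex_C2_actx M : mdet M = 1 -> ex_C2 (actx M).
Proof.
  intros H. unfold actx. apply ex_C2_mult.
  - apply ex_C2_plus; [|apply ex_C2_const]. apply ex_C2_plus; apply ex_C2_scal; [|apply ex_C2_fst].
    apply ex_C2_plus; apply ex_C2_mult; try apply ex_C2_fst; apply ex_C2_exp, ex_C2_snd.
  - apply ex_C2_inv; [|apply ex_C2_jac]. intros. pose proof (jac_pos M x y H); lra.
Qed.
Lemma ex_C2_acts M : mdet M = 1 -> ex_C2 (acts M).
Proof.
  intros H. unfold acts.
  apply ex_C2_ext with (fun x s => s + (-1) * ln (jac M x s)); [intros; ring|].
  apply ex_C2_plus; [apply ex_C2_snd|]. apply ex_C2_scal.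
  apply (ex_C2_comp ln Rinv (fun t => - / (t * t))); [| | |apply ex_C2_jac]; intros x y;
    pose proof (jac_pos M x y H).
  - now apply is_derive_ln.
  - auto_derive; [lra|]. field; lra.
  - apply (ex_derive_continuous (K := R_AbsRing) (V := R_NormedModule)). auto_derive. nra.
Qed.

(* The action preserves the area form [e^-s dx ds]. *)
Lemma act_jacobian M ax as_ bx bs x s : mdet M = 1 -> C1 (actx M) ax as_ -> C1 (acts M) bx bs ->
  ax x s * bs x s - as_ x s * bx x s = exp (acts M x s - s).
Proof.
  intros H HX HS. pose proof (jac_pos M x s H) as Hp.
  assert (E1 : ax x s = ((m21 M * x + m22 M) * (m21 M * x + m22 M) - m21 M * m21 M * (exp s * exp s)) / (jac M x s * jac M x s)).
  { pose proof (C1_is_derive_x _ _ _ x s HX) as K. apply is_derive_unique in K. rewrite <- K.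
    apply is_derive_unique. unfold actx, jac. auto_derive; [apply Rgt_not_eq, (jac_pos M x s H)|].
    assert (Hd : m11 M * m22 M - m12 M * m21 M = 1) by exact H.
    unfold jac in *. set (y := exp s) in *. destruct M as [a b c d]; cbn in *.
    transitivity ((a * d - b * c) * ((c * x + d) * (c * x + d) - c * c * (y * y)) /
      (((c * x + d) * (c * x + d) + c * c * (y * y)) * ((c * x + d) * (c * x + d) + c * c * (y * y)))).
    { field. lra. } rewrite Hd. field. lra. }
  assert (E2 : as_ x s = 2 * m21 M * (m21 M * x + m22 M) * (exp s * exp s) / (jac M x s * jac M x s)).
  { pose proof (C1_is_derive_y _ _ _ x s HX) as K. apply is_derive_unique in K. rewrite <- K.
    apply is_derive_unique. unfold actx, jac. auto_derive; [apply Rgt_not_eq, (jac_pos M x s H)|].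
    assert (Hd : m11 M * m22 M - m12 M * m21 M = 1) by exact H.
    unfold jac in *. set (y := exp s) in *. destruct M as [a b c d]; cbn in *.
    transitivity ((a * d - b * c) * (2 * c * (c * x + d) * (y * y)) /
      (((c * x + d) * (c * x + d) + c * c * (y * y)) * ((c * x + d) * (c * x + d) + c * c * (y * y)))).
    { field. lra. } rewrite Hd. field. lra. }
  assert (E3 : bx x s = - (2 * m21 M * (m21 M * x + m22 M)) / jac M x s).
  { pose proof (C1_is_derive_x _ _ _ x s HS) as K. apply is_derive_unique in K. rewrite <- K.
    apply is_derive_unique. unfold acts, jac in *. auto_derive; [exact Hp|]. field. lra. }
  assert (E4 : bs x s = ((m21 M * x + m22 M) * (m21 M * x + m22 M) - m21 M * m21 M * (exp s * exp s)) / jac M x s).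
  { pose proof (C1_is_derive_y _ _ _ x s HS) as K. apply is_derive_unique in K. rewrite <- K.
    apply is_derive_unique. unfold acts, jac in *. auto_derive; [exact Hp|]. field. lra. }
  rewrite E1, E2, E3, E4. replace (acts M x s - s) with (acts M x s + - s) by ring.
  rewrite exp_plus, exp_Ropp, exp_acts by assumption.
  pose proof (exp_pos s). unfold jac in *. set (y := exp s) in *. field. split; lra.
Qed.

(** * Partial derivatives and integrals of finite sums *)

Definition Dx (u : R -> R -> R) x s := Derive (fun x => u x s) x.
Definition Ds (u : R -> R -> R) x s := Derive (fun s => u x s) s.
Lemma C1_Derive u ux us : C1 u ux us -> C1 u (Dx u) (Ds u).
Proof.
  intros H. eapply C1_ext; [exact H|reflexivity| |]; intros x y; symmetry; apply is_derive_unique.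
  - eapply C1_is_derive_x, H.
  - eapply C1_is_derive_y, H.
Qed.
Lemma ex_C1_Derive u : ex_C1 u -> C1 u (Dx u) (Ds u).
Proof. intros (a & b & H). eapply C1_Derive, H. Qed.
Lemma ex_C2_Derive u : ex_C2 u -> C1 u (Dx u) (Ds u) /\ ex_C1 (Dx u) /\ ex_C1 (Ds u).
Proof.
  intros (a & b & H & (a1 & a2 & Ha) & (b1 & b2 & Hb)). pose proof (C1_Derive _ _ _ H) as K.
  split; [exact K|]. split.
  - exists a1, a2. eapply C1_ext; [exact Ha| |reflexivity|reflexivity]. intros x y. exact (proj1 (C1_unique _ _ _ _ _ x y H K)).
  - exists b1, b2. eapply C1_ext; [exact Hb| |reflexivity|reflexivity]. intros x y. exact (proj2 (C1_unique _ _ _ _ _ x y H K)).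
Qed.
Lemma C1_Dx u ux us x y : C1 u ux us -> Dx u x y = ux x y.
Proof. intros H. eapply is_derive_unique, C1_is_derive_x, H. Qed.
Lemma C1_Ds u ux us x y : C1 u ux us -> Ds u x y = us x y.
Proof. intros H. eapply is_derive_unique, C1_is_derive_y, H. Qed.
Lemma Dx_ext_loc u v x y : locally_2d (fun x y => u x y = v x y) x y -> Dx u x y = Dx v x y.
Proof. intros H. apply Derive_ext_loc. exact (locally_2d_1d_const_y _ x y H). Qed.
Lemma Ds_ext_loc u v x y : locally_2d (fun x y => u x y = v x y) x y -> Ds u x y = Ds v x y.
Proof. intros H. apply Derive_ext_loc. exact (locally_2d_1d_const_x _ x y H). Qed.

Lemma is_derive_lsum {T} (F : T -> R -> R) (F' : T -> R) l t :
  (forall a, is_derive (F a) t (F' a)) -> is_derive (fun t => lsum (fun a => F a t) l) t (lsum F' l).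
Proof.
  intros H; induction l as [|a l IH].
  - apply (is_derive_const (V := R_NormedModule) 0).
  - apply (is_derive_plus (V := R_NormedModule) (F a) (fun t => lsum (fun a => F a t) l)); auto.
Qed.
Lemma RInt_plus_R f h a b : ex_RInt f a b -> ex_RInt h a b ->
  RInt (fun t => f t + h t) a b = RInt f a b + RInt h a b.
Proof. intros H K. exact (RInt_plus (V := R_CompleteNormedModule) f h a b H K). Qed.
Lemma RInt_scal_R k f a b : ex_RInt f a b -> RInt (fun t => k * f t) a b = k * RInt f a b.
Proof. intros H. exact (RInt_scal (V := R_CompleteNormedModule) f a b k H). Qed.
Lemma ex_RInt_lsum {T} (F : T -> R -> R) l a b : (forall x, ex_RInt (F x) a b) ->
  ex_RInt (fun t => lsum (fun x => F x t) l) a b.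
Proof.
  intros H; induction l as [|x l IH]; [exact (ex_RInt_const (V := R_NormedModule) a b 0)|].
  exact (ex_RInt_plus (V := R_NormedModule) _ _ a b (H x) IH).
Qed.
Lemma RInt_lsum {T} (F : T -> R -> R) l a b : (forall x, ex_RInt (F x) a b) ->
  RInt (fun t => lsum (fun x => F x t) l) a b = lsum (fun x => RInt (F x) a b) l.
Proof.
  intros H; induction l as [|x l IH].
  - transitivity (scal (b - a) 0); [exact (RInt_const (V := R_CompleteNormedModule) a b 0)|].
    unfold scal; cbn; unfold mult; cbn. unfold lsum; cbn. ring.
  - change (RInt (fun t => F x t + lsum (fun x => F x t) l) a b = RInt (F x) a b + lsum (fun x => RInt (F x) a b) l).
    rewrite RInt_plus_R, IH; auto. now apply ex_RInt_lsum.
Qed.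

(** * Exponent sums and the cup product on the relator *)

Definition expo (k : nat) (w : word) : R :=
  lsum (fun l : letter => if Nat.eqb (fst l) k then (if snd l then -1 else 1) else 0) w.
Lemma expo_app k u v : expo k (u ++ v) = expo k u + expo k v.
Proof. apply lsum_app. Qed.
Lemma expo_comm k i : expo k (comm_word i) = 0.
Proof. unfold expo, comm_word, lsum; cbn [fold_right fst snd]. destruct (2 * i =? k)%nat, (2 * i + 1 =? k)%nat; ring. Qed.
Lemma expo_relator k g : expo k (relator g) = 0.
Proof.
  unfold relator. induction (seq 0 g) as [|i l IH]; [reflexivity|]. cbn [flat_map].
  rewrite expo_app, IH, expo_comm. ring.
Qed.
Lemma expo_geq k g u v : geq g u v -> expo k u = expo k v.
Proof.
  intros H; induction H as [u v H|u|u v H IH|u v w H1 IH1 H2 IH2]; try congruence.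
  destruct H as [u v l|u v]; rewrite !expo_app.
  - change (l :: linv l :: v) with ([l] ++ [linv l] ++ v). rewrite !expo_app.
    assert (E : expo k [l] + expo k [linv l] = 0); [|lra].
    destruct l as [i b]. unfold expo, lsum, linv; cbn. destruct (i =? k)%nat, b; cbn; ring.
  - rewrite expo_relator. ring.
Qed.

Lemma relator_length g : length (relator g) = (4 * g)%nat.
Proof.
  unfold relator. rewrite <- (length_seq g 0) at 2. generalize (seq 0 g).
  induction l as [|i l IH]; [reflexivity|]. cbn [flat_map]. rewrite length_app, IH. cbn. lia.
Qed.

(* The cup product of the classes [expo 0] and [expo 1] does not vanish on the relator, so the product [expo 0 * expo 1]
   is not a coboundary. *)
Lemma cup_product_not_coboundary g (G : word -> R) (J : nat -> R) : (1 <= g)%nat ->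
  (forall u v i, relator g = u ++ (i, false) :: v -> G (u ++ [(i, false)]) - G u = J i + expo 0 u * expo 1 [(i, false)]) ->
  (forall u v i, relator g = u ++ (i, true) :: v ->
     G u - G (u ++ [(i, true)]) = J i + expo 0 (u ++ [(i, true)]) * expo 1 [(i, false)]) ->
  G (relator g) = G [] -> False.
Proof.
  intros Hg H1 H2 H.
  (* In a commutator every generator is traversed once in each direction, so the terms [J] cancel,
     as do those that contain [expo 0 u]. What remains is the determinant of the exponents of the
     two generators; it is 1 for the first commutator and 0 for the others. *)
  assert (step : forall u k v, relator g = u ++ comm_word k ++ v ->
    G (u ++ comm_word k) - G u = expo 0 [(2 * k, false)]%nat * expo 1 [(2 * k + 1, false)]%nat
      - expo 0 [(2 * k + 1, false)]%nat * expo 1 [(2 * k, false)]%nat).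
  { intros u k v E. unfold comm_word in E. cbn [app] in E.
    set (i := (2 * k)%nat) in *. set (j := (2 * k + 1)%nat) in *.
    pose proof (H1 _ _ _ E) as E1.
    assert (E' : relator g = (u ++ [(i, false)]) ++ (j, false) :: (i, true) :: (j, true) :: v) by now rewrite <- app_assoc.
    pose proof (H1 _ _ _ E') as E2.
    assert (E'' : relator g = ((u ++ [(i, false)]) ++ [(j, false)]) ++ (i, true) :: (j, true) :: v) by now rewrite <- !app_assoc.
    pose proof (H2 _ _ _ E'') as E3.
    assert (E3' : relator g = (((u ++ [(i, false)]) ++ [(j, false)]) ++ [(i, true)]) ++ (j, true) :: v) by now rewrite <- !app_assoc.
    pose proof (H2 _ _ _ E3') as E4.
    change (comm_word k) with [(i, false); (j, false); (i, true); (j, true)].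
    replace (u ++ [(i, false); (j, false); (i, true); (j, true)]) with
      ((((u ++ [(i, false)]) ++ [(j, false)]) ++ [(i, true)]) ++ [(j, true)]) by now rewrite <- !app_assoc.
    assert (tel : forall a b c d e : R, e - a = b - a + (c - b) - (c - d) - (d - e)) by (intros; ring).
    assert (T : forall k i, expo k [(i, true)] = - expo k [(i, false)]).
    { intros k' i'. unfold expo, lsum; cbn. destruct (i' =? k')%nat; ring. }
    match type of E1 with ?a = _ => match type of E2 with ?b = _ => match type of E3 with ?c = _ =>
      match type of E4 with ?d = _ => transitivity (a + b - c - d) end end end end; [apply tel|].
    rewrite E1, E2, E3, E4, !expo_app, !T. change (i + 1)%nat with j. ring. }
  assert (main : forall m, (m <= g)%nat -> G (flat_map comm_word (seq 0 m)) = G [] + (if Nat.eqb m 0 then 0 else 1)).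
    { induction m as [|m IH]; intros Hm; [cbn; ring|].
      rewrite seq_S, flat_map_app; cbn [flat_map Nat.add]. rewrite app_nil_r.
      pose proof (step (flat_map comm_word (seq 0 m)) m (flat_map comm_word (seq (S m) (g - S m)))) as S1.
      unfold relator in S1. 
      assert (E : seq 0 g = seq 0 m ++ [m] ++ seq (S m) (g - S m)).
      { replace g with (m + (1 + (g - S m)))%nat at 1 by lia. rewrite seq_app. reflexivity. }
      rewrite E, !flat_map_app in S1. cbn [flat_map] in S1. rewrite app_nil_r in S1. specialize (S1 eq_refl).
      rewrite IH in S1 by lia.
      assert (G (flat_map comm_word (seq 0 m) ++ comm_word m) =
        G [] + (if (m =? 0)%nat then 0 else 1) + (expo 0 [(2 * m, false)]%nat * expo 1 [(2 * m + 1, false)]%nat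
      - expo 0 [(2 * m + 1, false)]%nat * expo 1 [(2 * m, false)]%nat)) as -> by lra.
      unfold expo, lsum; cbn [fold_right fst snd]. destruct m as [|m]; [cbn; ring|].
      replace (2 * S m =? 0)%nat with false by (symmetry; apply Nat.eqb_neq; lia).
      replace (2 * S m =? 1)%nat with false by (symmetry; apply Nat.eqb_neq; lia).
      replace (2 * S m + 1 =? 0)%nat with false by (symmetry; apply Nat.eqb_neq; lia).
      cbn [Nat.eqb]. ring. }
  specialize (main g (Nat.le_refl g)). fold (relator g) in main. rewrite H in main.
  destruct g as [|g']; [lia|]. cbn in main. lra.
Qed.

Lemma fro_eval_le g rho B w : 1 <= B -> (forall i, (i < 2 * g)%nat -> fro (rho i) <= B) -> wf_word g w ->
  fro (eval rho w) <= 2 * B ^ length w.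
Proof.
  intros HB H Hw; induction Hw as [|[i b] w Hi Hw IH]; cbn [eval length pow].
  - unfold fro, mid; cbn; lra.
  - eapply Rle_trans; [apply fro_mmul|].
    assert (Hl : fro (eval_letter rho (i, b)) <= B).
    { unfold eval_letter; cbn. destruct b; rewrite ?fro_madj; apply H, Hi. }
    assert (key : forall b p : R, b * (2 * p) = 2 * (b * p)) by (intros; ring).
    eapply Rle_trans; [apply (Rmult_le_compat _ _ _ _ (fro_nonneg _) (fro_nonneg _) Hl IH)|].
    right; apply key.
Qed.

(** [TA dx + TB ds] is the pull-back of [q ds] by [M]. Its exterior derivative is the pull-back of
    [qx dx ds], and the Jacobian comes from [act_jacobian]. *)
Lemma pull_curl q qx qs M x s : C1 q qx qs -> mdet M = 1 ->
  let TA := fun x s => q (actx M x s) (acts M x s) * Dx (acts M) x s in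
  let TB := fun x s => q (actx M x s) (acts M x s) * Ds (acts M) x s in
  ex_C1 TA /\ ex_C1 TB /\
  Dx TB x s - Ds TA x s = qx (actx M x s) (acts M x s) * exp (acts M x s - s).
Proof.
  intros Hq HM TA TB.
  destruct (ex_C2_Derive _ (ex_C2_actx M HM)) as (X & _ & _).
  destruct (ex_C2_Derive _ (ex_C2_acts M HM)) as (S & Sx & Ss).
  apply ex_C1_Derive in Sx, Ss.
  pose proof (C1_comp2 _ _ _ _ _ _ _ _ _ Hq X S) as Q.
  pose proof (C1_mult _ _ _ _ _ _ Q Sx) as HTA. pose proof (C1_mult _ _ _ _ _ _ Q Ss) as HTB.
  split; [eexists _, _; exact HTA|]. split; [eexists _, _; exact HTB|].
  unfold TA, TB. rewrite (C1_Dx _ _ _ x s HTB), (C1_Ds _ _ _ x s HTA).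
  rewrite (C2_mixed _ _ _ _ _ _ _ x s S Sx Ss), <- (act_jacobian M _ _ _ _ x s HM X S). ring.
Qed.

(** * Every point of a horocycle is near the orbit *)

Section Cocompact.
Variables (g : nat) (rho : rep) (B c : R) (L : list word).
Hypothesis Hg : (1 <= g)%nat.
Hypothesis HDF : DFrep g rho.
Hypothesis HB1 : 1 <= B.
Hypothesis HB : forall i, (i < 2 * g)%nat -> fro (rho i) <= B.

(* Nested radii about [i]: [rE] contains the edges from [i] to [rho i], [rP] the path of the prefixes of the relator, [rl] is
   the half-side of a rectangle containing it, [r1] is the radius of the support of [chi]. *)
Definition rE := rect_bound B.
Definition rP := 2 * B ^ (4 * g) * rE.
Definition rl := rP + 1.
Definition r1 := rect_bound rl + 1.
(** Radius of the bumps in [ff]: the denominators are then at least one wherever [nd mid] is at most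
    [r1 + 1]. The two summands of [rK] below bound the group elements that contribute to the
    translates of [ff] and [chi], and to the translates of [q1] along an edge followed by a prefix
    of the relator. *)
Definition r0 := r1 + 2.
Definition rK := r0 * (r1 + 1) + rect_bound (r1 + Rabs c) * rE * (2 * B ^ (4 * g)).

(** The assumption to be refuted. By [nd_horo] the threshold excludes any point that is within [rP]
    of an orbit point and within [r1] of [(c, 0)]. *)
Hypothesis Hfar : forall w, wf_word g w -> rP * r1 < nd (eval rho w) c 0.
Hypothesis HL : ball_list g rho rK L.

Notation ev := (eval rho).

Lemma Hsl : SLrep rho. Proof. apply HDF. Qed.
Lemma det_ev w : mdet (ev w) = 1. Proof. apply mdet_eval, Hsl. Qed.
Lemma rE_ge2 : 2 <= rE. Proof. apply rect_bound_ge2; lra. Qed.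
Lemma powB_ge1 n : 1 <= B ^ n. Proof. now apply pow_R1_Rle. Qed.
Lemma rP_ge : rE <= rP /\ 2 <= rP.
Proof.
  pose proof rE_ge2. pose proof (powB_ge1 (4 * g)). unfold rP. split; nra.
Qed.
Lemma r1_ge : rP + 2 <= r1.
Proof.
  unfold r1, rl, rect_bound. pose proof rP_ge as [_ H].
  pose proof (exp_ineq1_le (rP + 1)). pose proof (exp_pos (2 * (rP + 1))). nra.
Qed.

(* [ff (expo k)] is a smooth function which increases by [expo k gam] under [gam], so that [df /\ dh] is invariant; [chi] is a
   partition of unity, so [df /\ dh] is the sum of the translates of [chi df /\ dh = ww dx ds], whose primitive is [qq ds]. *)
Definition Sm (rr : R) (al : word -> R) (x s : R) : R :=
  lsum (fun u => al u * bump (rr - nd (ev u) x s)) L.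
Definition ff (al : word -> R) (x s : R) : R := Sm r0 al x s * / flo (Sm r0 (fun _ => 1) x s).
Definition chi (x s : R) : R := bump (r1 - nd mid x s) * / flo (Sm r1 (fun _ => 1) x s).

Lemma Sm_nonneg rr x s : 0 <= Sm rr (fun _ => 1) x s.
Proof. apply lsum_nonneg. intros. rewrite Rmult_1_l. apply bump_nonneg. Qed.
Lemma ex_C2_bump_nd rr M : ex_C2 (fun x s => bump (rr - nd M x s)).
Proof.
  apply ex_C2_bump. apply ex_C2_ext with (fun x s => rr + (-1) * nd M x s); [intros; ring|].
  apply ex_C2_plus; [apply ex_C2_const|]. apply ex_C2_scal, ex_C2_nd.
Qed.
Lemma ex_C2_Sm rr al : ex_C2 (Sm rr al).
Proof. apply ex_C2_lsum. intros u. apply ex_C2_scal, ex_C2_bump_nd. Qed.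
Lemma ex_C2_ff al : ex_C2 (ff al).
Proof. apply ex_C2_mult; [apply ex_C2_Sm|]. apply ex_C2_inv_flo; [apply Sm_nonneg|apply ex_C2_Sm]. Qed.
Lemma ex_C2_chi : ex_C2 chi.
Proof. apply ex_C2_mult; [apply ex_C2_bump_nd|]. apply ex_C2_inv_flo; [apply Sm_nonneg|apply ex_C2_Sm]. Qed.

Lemma bump_nz t : bump t <> 0 -> 0 < t.
Proof. intros H. apply Rnot_le_lt. intro. apply H, bump_neg. lra. Qed.
Lemma mnorm_le_of_nd w x s K1 K2 : nd (ev w) x s <= K1 -> nd mid x s <= K2 -> mnorm (ev w) <= K1 * K2.
Proof.
  intros H1 H2. eapply Rle_trans; [apply mnorm_le_fro, det_ev|]. eapply Rle_trans; [apply (fro_le_nd _ x s)|].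
  apply Rmult_le_compat; auto; unfold nd; apply fro_nonneg.
Qed.
Lemma rK_ge : r0 * (r1 + 1) <= rK.
Proof.
  unfold rK. pose proof rE_ge2. pose proof (powB_ge1 (4 * g)). pose proof r1_ge. pose proof rP_ge.
  pose proof (Rabs_pos c). assert (2 <= rect_bound (r1 + Rabs c)) by (apply rect_bound_ge2; lra).
  assert (0 <= rect_bound (r1 + Rabs c) * rE * (2 * B ^ (4 * g))); [|lra].
  apply Rmult_le_pos; [apply Rmult_le_pos|]; lra.
Qed.
Lemma nd_geq u v x s : geq g u v -> nd (ev u) x s = nd (ev v) x s.
Proof. intros H. apply nd_pm. now apply DF_pm with g. Qed.

(** Left translation by [gam] permutes the terms because [nd (gam u)] at the moved point equals
    [nd u] at the original one. The bounds on both points keep every nonzero term in the ball listed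
    by [L]. *)
Lemma Sm_act rr al gam x s : rr <= r0 ->
  (forall u v, wf_word g u -> wf_word g v -> geq g u v -> al u = al v) -> wf_word g gam ->
  nd mid x s <= r1 + 1 -> nd mid (actx (ev gam) x s) (acts (ev gam) x s) <= r1 + 1 ->
  Sm rr al (actx (ev gam) x s) (acts (ev gam) x s) = Sm rr (fun u => al (gam ++ u)) x s.
Proof.
  intros Hrr Hal Hgam H1 H2. symmetry.
  set (x' := actx (ev gam) x s) in *. set (s' := acts (ev gam) x s) in *.
  set (F := fun u => al u * bump (rr - nd (ev u) x' s')).
  assert (E : forall u, nd (ev (gam ++ u)) x' s' = nd (ev u) x s).
  { intros u. rewrite eval_app. apply nd_act, det_ev. }
  assert (Hnz : forall u, F u <> 0 -> nd (ev u) x' s' <= r0).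
  { intros u Hu. unfold F in Hu. assert (bump (rr - nd (ev u) x' s') <> 0) by (intros E0; apply Hu; rewrite E0; ring).
    apply bump_nz in H. lra. }
  transitivity (lsum (fun u => F (gam ++ u)) L).
  { apply lsum_ext. intros u _. unfold F. now rewrite E. }
  unfold Sm. pose proof rK_ge as HK.
  assert (Hsm : forall v z t, nd (ev v) z t <= r0 -> nd mid z t <= r1 + 1 -> mnorm (ev v) <= rK).
  { intros v z t h1 h2. eapply Rle_trans; [eapply mnorm_le_of_nd; eassumption|exact HK]. }
  apply (lsum_reindex g rho rK L F (fun u => gam ++ u)); auto.
  - intros u v Hu Hv Huv. unfold F. rewrite (Hal u v), (nd_geq u v); auto.
  - intros u Hu. now apply wf_app.
  - intros u v Hu Hv Huv. pose proof (geq_app g _ _ _ _ (geq_refl g (winv gam)) Huv) as K.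
    rewrite !app_assoc in K. eapply geq_trans; [apply geq_sym|eapply geq_trans; [exact K|]].
    + exact (geq_app g _ _ _ _ (geq_winv_l g gam) (geq_refl g u)).
    + exact (geq_app g _ _ _ _ (geq_winv_l g gam) (geq_refl g v)).
  - intros u Hu Hu0. apply Hnz in Hu0. now apply Hsm with x' s'.
  - intros u Hu Hu0. apply Hnz in Hu0. exists (winv gam ++ u). repeat split.
    + apply wf_app; auto using wf_winv.
    + apply Hsm with x s; [|exact H1]. rewrite <- E, app_assoc.
      rewrite (nd_geq _ u); [exact Hu0|]. exact (geq_app g _ _ _ _ (geq_winv_r g gam) (geq_refl g u)).
    + rewrite app_assoc. exact (geq_app g _ _ _ _ (geq_winv_r g gam) (geq_refl g u)).
  - intros u v Hu Hv Huv. apply geq_app; [apply geq_refl|exact Huv].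
Qed.

(** The term of the neutral element alone is at least one, and the other terms are nonnegative. *)
Lemma Sm_one_ge1 rr x s : rr <= r0 -> nd mid x s <= rr - 1 -> 1 <= Sm rr (fun _ => 1) x s.
Proof.
  intros Hrr H. destruct HL as (Hwf & _ & Hc).
  destruct (Hc [] (wf_nil g)) as (v & Hv & Hgv).
  { cbn. rewrite mnorm_mid. pose proof r1_ge. pose proof rP_ge.
    eapply Rle_trans; [|exact rK_ge]. rewrite <- (Rmult_1_l 1). unfold r0. apply Rmult_le_compat; lra. }
  assert (Hge : 1 * bump (rr - nd (ev v) x s) <= Sm rr (fun _ => 1) x s).
  { apply (lsum_ge_term (fun u => 1 * bump (rr - nd (ev u) x s)) L v); [|exact Hv].
    intros. rewrite Rmult_1_l. apply bump_nonneg. }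
  rewrite <- (nd_geq [] v x s Hgv) in Hge. cbn [eval] in Hge.
  pose proof (bump_ge1 (rr - nd mid x s)). lra.
Qed.

Lemma ff_act k gam x s : wf_word g gam ->
  nd mid x s <= r1 + 1 -> nd mid (actx (ev gam) x s) (acts (ev gam) x s) <= r1 + 1 ->
  ff (expo k) (actx (ev gam) x s) (acts (ev gam) x s) = expo k gam + ff (expo k) x s.
Proof.
  intros Hgam H1 H2. unfold ff. assert (Hr : r0 <= r0) by lra.
  rewrite !Sm_act; auto; [|intros; now apply expo_geq with g].
  assert (Hge : 1 <= Sm r0 (fun _ => 1) x s) by (apply Sm_one_ge1; [lra|unfold r0; lra]).
  rewrite flo_ge1 by exact Hge.
  assert (E : Sm r0 (fun u => expo k (gam ++ u)) x s = expo k gam * Sm r0 (fun _ => 1) x s + Sm r0 (expo k) x s).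
  { unfold Sm. rewrite <- lsum_scal, <- lsum_plus. apply lsum_ext. intros u _. rewrite expo_app. ring. }
  rewrite E. field. lra.
Qed.

Lemma ff_grad k gam x s : wf_word g gam ->
  nd mid x s < r1 + 1 -> nd mid (actx (ev gam) x s) (acts (ev gam) x s) < r1 + 1 ->
  let x' := actx (ev gam) x s in let s' := acts (ev gam) x s in let f := ff (expo k) in
  Dx f x s = Dx f x' s' * Dx (actx (ev gam)) x s + Ds f x' s' * Dx (acts (ev gam)) x s /\
  Ds f x s = Dx f x' s' * Ds (actx (ev gam)) x s + Ds f x' s' * Ds (acts (ev gam)) x s.
Proof.
  intros Hgam H1 H2 x' s' f.
  destruct (ex_C2_Derive _ (ex_C2_ff (expo k))) as (Hf & _).
  pose proof (ex_C1_Derive _ (ex_C2_ex_C1 _ (ex_C2_actx _ (det_ev gam)))) as HX.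
  pose proof (ex_C1_Derive _ (ex_C2_ex_C1 _ (ex_C2_acts _ (det_ev gam)))) as HS.
  pose proof (C1_comp2 _ _ _ _ _ _ _ _ _ Hf HX HS) as Hc.
  assert (Hloc : locally_2d (fun x s => ff (expo k) x s =
     - expo k gam + ff (expo k) (actx (ev gam) x s) (acts (ev gam) x s)) x s).
  { assert (L1 : locally_2d (fun x s => nd mid x s < r1 + 1) x s)
      by (apply cont2_locally_lt; [apply ex_C2_cont, ex_C2_nd|exact H1]).
    assert (L2 : locally_2d (fun x s => nd mid (actx (ev gam) x s) (acts (ev gam) x s) < r1 + 1) x s).
    { apply (cont2_locally_lt (fun x s => nd mid (actx (ev gam) x s) (acts (ev gam) x s))); [|exact H2].
      apply cont2_comp2; apply ex_C2_cont; [apply ex_C2_nd|apply ex_C2_actx, det_ev|apply ex_C2_acts, det_ev]. }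
    destruct L1 as [d1 L1], L2 as [d2 L2].
    exists (mkposreal _ (Rmin_stable_in_posreal d1 d2)). cbn. intros u v Hu Hv.
    rewrite ff_act; auto; [ring| |]; left; [apply L1|apply L2]; eapply Rlt_le_trans; eauto;
      apply Rmin_l || apply Rmin_r. }
  pose proof (C1_plus _ _ _ _ _ _ (C1_const (- expo k gam)) Hc) as Hc'.
  unfold x', s', f. split.
  - rewrite (Dx_ext_loc _ _ _ _ Hloc), (C1_Dx _ _ _ x s Hc'). ring.
  - rewrite (Ds_ext_loc _ _ _ _ Hloc), (C1_Ds _ _ _ x s Hc'). ring.
Qed.

Notation f := (ff (expo 0)).
Notation h := (ff (expo 1)).
Definition dens x s := Dx f x s * Ds h x s - Ds f x s * Dx h x s.
Definition ww x s := chi x s * dens x s.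
Definition qq x s : R := RInt (fun u => ww u s) (- r1) x.

Lemma ex_C1_ww : ex_C1 ww.
Proof.
  destruct (ex_C2_Derive _ (ex_C2_ff (expo 0))) as (_ & F1 & F2).
  destruct (ex_C2_Derive _ (ex_C2_ff (expo 1))) as (_ & H1 & H2).
  apply ex_C1_mult; [apply ex_C2_ex_C1, ex_C2_chi|]. apply ex_C1_minus; now apply ex_C1_mult.
Qed.
Lemma C1_qq : C1 qq ww (Ds qq).
Proof.
  pose proof (ex_C1_Derive _ ex_C1_ww) as H.
  pose proof (C1_RInt ww (Ds ww) (- r1) (C1_cont _ _ _ H) (proj2 (proj2 H)) (fun x y => C1_is_derive_y _ _ _ x y H)) as K.
  eapply C1_ext; [exact K|reflexivity|reflexivity|]. intros x y. symmetry. exact (C1_Ds _ _ _ x y K).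
Qed.
Lemma ww_support x s : r1 <= nd mid x s -> ww x s = 0.
Proof. intros H. unfold ww, chi. rewrite bump_neg by lra. ring. Qed.
Lemma ww_support' x s : r1 < Rabs x \/ r1 < Rabs s -> ww x s = 0.
Proof.
  intros H. apply ww_support. apply Rnot_lt_le. intros H0.
  assert (H1 : nd mid x s <= r1) by lra. apply nd_mid_region in H1. destruct H, H1; lra.
Qed.

Lemma ww_act gam x s : wf_word g gam -> nd mid x s < r1 ->
  ww (actx (ev gam) x s) (acts (ev gam) x s) * exp (acts (ev gam) x s - s) =
  chi (actx (ev gam) x s) (acts (ev gam) x s) * dens x s.
Proof.
  intros Hgam H. set (x' := actx (ev gam) x s). set (s' := acts (ev gam) x s).
  (* Equivariance of the gradients is available only while both points are near [i]; where the moved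
     point is far, the cut-off kills both sides. *)
  destruct (Rle_dec r1 (nd mid x' s')) as [H'|H'].
  - rewrite ww_support by exact H'. unfold chi. rewrite bump_neg by lra. ring.
  - assert (H2 : nd mid x' s' < r1 + 1) by lra.
    destruct (ff_grad 0 gam x s Hgam) as (E1 & E2); [lra|exact H2|].
    destruct (ff_grad 1 gam x s Hgam) as (E3 & E4); [lra|exact H2|].
    fold x' s' in E1, E2, E3, E4. unfold ww, dens. rewrite E1, E2, E3, E4.
    pose proof (ex_C1_Derive _ (ex_C2_ex_C1 _ (ex_C2_actx _ (det_ev gam)))) as HX.
    pose proof (ex_C1_Derive _ (ex_C2_ex_C1 _ (ex_C2_acts _ (det_ev gam)))) as HS.
    pose proof (act_jacobian _ _ _ _ _ x s (det_ev gam) HX HS) as EJ. fold s' in EJ. rewrite <- EJ. ring.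
Qed.

(** The denominators of all terms agree by [Sm_act]. The numerator at the point moved by [gam] is
    the bump centered at the inverse of [gam], so reindexing by inversion recovers the
    denominator. *)
Lemma chi_sum x s : nd mid x s <= r1 - 1 ->
  lsum (fun gam => chi (actx (ev gam) x s) (acts (ev gam) x s)) L = 1.
Proof.
  intros H. assert (Hr10 : r1 <= r0) by (unfold r0; lra).
  pose proof (Sm_one_ge1 r1 x s Hr10 H) as Hge.
  set (F := fun u => 1 * bump (r1 - nd (ev u) x s)).
  transitivity (lsum (fun gam => / Sm r1 (fun _ => 1) x s * F (winv gam)) L).
  { destruct HL as (Hwf & _). rewrite Forall_forall in Hwf. apply lsum_ext. intros gam Hgam. unfold chi, F.
    rewrite eval_winv, <- nd_act_mid by apply det_ev.
    set (x' := actx (ev gam) x s). set (s' := acts (ev gam) x s).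
    destruct (Rle_dec r1 (nd mid x' s')) as [H'|H']; [rewrite bump_neg by lra; ring|].
    unfold x', s'. rewrite Sm_act; auto; [|lra|fold x' s'; lra]. rewrite flo_ge1 by exact Hge. ring. }
  rewrite lsum_scal.
  rewrite (lsum_reindex g rho rK L F winv); auto.
  - unfold F. fold (Sm r1 (fun _ => 1) x s). field. lra.
  - intros u v _ _ Huv. unfold F. now rewrite (nd_geq u v).
  - intros; now apply wf_winv.
  - intros u v _ _ Huv. apply geq_winv in Huv. now rewrite !winv_winv in Huv.
  - intros u Hu Hu0. unfold F in Hu0.
    assert (Hb : bump (r1 - nd (ev u) x s) <> 0) by (intros E0; apply Hu0; rewrite E0; ring). apply bump_nz in Hb.
    eapply Rle_trans; [apply (mnorm_le_of_nd u x s r0 (r1 + 1)); lra|apply rK_ge].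
  - intros u Hu Hu0. unfold F in Hu0.
    assert (Hb : bump (r1 - nd (ev u) x s) <> 0) by (intros E0; apply Hu0; rewrite E0; ring). apply bump_nz in Hb.
    exists (winv u). repeat split.
    + now apply wf_winv.
    + rewrite eval_winv, mnorm_madj.
      eapply Rle_trans; [apply (mnorm_le_of_nd u x s r0 (r1 + 1)); lra|apply rK_ge].
    + rewrite winv_winv. apply geq_refl.
  - intros; now apply geq_winv.
Qed.

Definition TA q gam x s := q (actx (ev gam) x s) (acts (ev gam) x s) * Dx (acts (ev gam)) x s.
Definition TB q gam x s := q (actx (ev gam) x s) (acts (ev gam) x s) * Ds (acts (ev gam)) x s.
(** [thA dx + thB ds] is [f dh] minus the translates of [qq ds]. The derivative of [f dh] is
    [dens dx ds], that of each translate is [dens] times a translate of [chi], and by [chi_sum]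
    these add up to [dens]; so the form is closed on the rectangle of half-side [rl]. *)
Definition thA x s := f x s * Dx h x s - lsum (fun gam => TA qq gam x s) L.
Definition thB x s := f x s * Ds h x s - lsum (fun gam => TB qq gam x s) L.

Lemma ex_C1_lsum {T} (F : T -> R -> R -> R) l : (forall a, ex_C1 (F a)) ->
  ex_C1 (fun x y => lsum (fun a => F a x y) l).
Proof.
  intros H; induction l as [|a l IH]; [exact (ex_C1_const 0)|]. exact (ex_C1_plus _ _ (H a) IH).
Qed.
Lemma Dx_lsum {T} (F : T -> R -> R -> R) l x s : (forall a, ex_C1 (F a)) ->
  Dx (fun x y => lsum (fun a => F a x y) l) x s = lsum (fun a => Dx (F a) x s) l.
Proof.
  intros H. apply is_derive_unique. apply (is_derive_lsum (fun a x => F a x s) (fun a => Dx (F a) x s)).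
  intros a. apply (C1_is_derive_x _ _ _ x s (ex_C1_Derive _ (H a))).
Qed.
Lemma Ds_lsum {T} (F : T -> R -> R -> R) l x s : (forall a, ex_C1 (F a)) ->
  Ds (fun x y => lsum (fun a => F a x y) l) x s = lsum (fun a => Ds (F a) x s) l.
Proof.
  intros H. apply is_derive_unique. apply (is_derive_lsum (fun a s => F a x s) (fun a => Ds (F a) x s)).
  intros a. apply (C1_is_derive_y _ _ _ x s (ex_C1_Derive _ (H a))).
Qed.
Lemma Dx_minus u v x s : ex_C1 u -> ex_C1 v -> Dx (fun x s => u x s - v x s) x s = Dx u x s - Dx v x s.
Proof.
  intros Hu Hv. apply Derive_minus; eexists; eapply C1_is_derive_x, ex_C1_Derive; assumption.
Qed.
Lemma Ds_minus u v x s : ex_C1 u -> ex_C1 v -> Ds (fun x s => u x s - v x s) x s = Ds u x s - Ds v x s.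
Proof.
  intros Hu Hv. unfold Ds. apply (Derive_minus (fun s => u x s) (fun s => v x s));
  eexists; eapply C1_is_derive_y, ex_C1_Derive; assumption.
Qed.

Lemma potential_exists : exists F, forall x s, Rabs x < rl -> Rabs s < rl ->
  differentiable_pt_lim F x s (thA x s) (thB x s).
Proof.
  destruct (ex_C2_Derive _ (ex_C2_ff (expo 0))) as (F0 & F1 & F2).
  destruct (ex_C2_Derive _ (ex_C2_ff (expo 1))) as (H0 & H1 & H2).
  apply ex_C1_Derive in H1, H2.
  pose proof (C1_mult _ _ _ _ _ _ F0 H1) as PA. pose proof (C1_mult _ _ _ _ _ _ F0 H2) as PB.
  assert (EA : forall gam, ex_C1 (TA qq gam)) by (intros gam; apply (pull_curl _ _ _ _ 0 0 C1_qq (det_ev gam))).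
  assert (EB : forall gam, ex_C1 (TB qq gam)) by (intros gam; apply (pull_curl _ _ _ _ 0 0 C1_qq (det_ev gam))).
  assert (PA' : ex_C1 (fun x s => f x s * Dx h x s)) by (eexists _, _; exact PA).
  assert (PB' : ex_C1 (fun x s => f x s * Ds h x s)) by (eexists _, _; exact PB).
  assert (QA := ex_C1_lsum _ L EA). assert (QB := ex_C1_lsum _ L EB).
  assert (HA : ex_C1 thA) by (apply ex_C1_minus; assumption).
  assert (HBB : ex_C1 thB) by (apply ex_C1_minus; assumption).
  apply closed_form_potential with (Dx thA) (Ds thA) (Dx thB) (Ds thB); auto using ex_C1_Derive.
  - unfold rl. pose proof rP_ge. lra.
  - intros x s Hx Hs.
    assert (Hnd : nd mid x s <= r1 - 1) by (unfold r1; pose proof (nd_mid_rect x s rl Hx Hs); lra).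
    unfold thA, thB. rewrite (Ds_minus _ _ x s PA' QA), (Dx_minus _ _ x s PB' QB).
    rewrite (C1_Ds _ _ _ x s PA), (C1_Dx _ _ _ x s PB).
    rewrite (Ds_lsum _ L x s EA), (Dx_lsum _ L x s EB).
    assert (E : lsum (fun gam => Dx (TB qq gam) x s) L =
       lsum (fun gam => Ds (TA qq gam) x s) L + dens x s).
    { transitivity (lsum (fun gam => Ds (TA qq gam) x s + dens x s * chi (actx (ev gam) x s) (acts (ev gam) x s)) L).
      - destruct HL as (Hwf & _). rewrite Forall_forall in Hwf. apply lsum_ext. intros gam Hgam.
        destruct (pull_curl _ _ _ (ev gam) x s C1_qq (det_ev gam)) as (_ & _ & E).
        rewrite ww_act in E; auto; [|lra]. change (Dx (TB qq gam) x s - Ds (TA qq gam) x s = 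
          chi (actx (ev gam) x s) (acts (ev gam) x s) * dens x s) in E. lra.
      - rewrite lsum_plus, lsum_scal, chi_sum by exact Hnd. ring. }
    rewrite E, (C2_mixed _ _ _ _ _ _ _ x s H0 H1 H2). unfold dens. ring.
Qed.

(** Edges are straight segments in the coordinates [(x, s)] from the base point to its image under
    [rho i]. The path of the prefixes of the relator is made of their translates. *)
Definition edge_x i := actx (rho i) 0 0.
Definition edge_s i := acts (rho i) 0 0.

Lemma base_nd M : mdet M = 1 -> nd mid (actx M 0 0) (acts M 0 0) = fro M.
Proof.
  intros H. rewrite nd_act_mid by exact H. unfold nd. rewrite madj_madj.
  replace (gz 0 0) with mid; [now rewrite mmul_id_r|].
  unfold gz, mid. replace (0 / 2) with 0 by field. replace (- 0 / 2) with 0 by field. rewrite exp_0. f_equal; ring.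
Qed.
Lemma edge_bound i : (i < 2 * g)%nat -> Rabs (edge_x i) <= B /\ Rabs (edge_s i) <= B.
Proof.
  intros Hi. apply nd_mid_region. unfold edge_x, edge_s. rewrite base_nd by apply Hsl. now apply HB.
Qed.
Lemma edge_nd i t : (i < 2 * g)%nat -> 0 <= t <= 1 -> nd mid (t * edge_x i) (t * edge_s i) <= rE.
Proof.
  intros Hi Ht. destruct (edge_bound i Hi) as (H1 & H2).
  apply nd_mid_rect; rewrite Rabs_mult, (Rabs_pos_eq t) by lra;
    [pose proof (Rabs_pos (edge_x i))|pose proof (Rabs_pos (edge_s i))]; nra.
Qed.
Lemma fro_prefix u : wf_word g u -> (length u <= 4 * g)%nat -> fro (ev u) <= 2 * B ^ (4 * g).
Proof.
  intros Hu Hl. eapply Rle_trans; [apply (fro_eval_le g rho B u HB1 HB Hu)|].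
  apply Rmult_le_compat_l; [lra|]. now apply Rle_pow.
Qed.
Lemma path_nd u i t : wf_word g u -> (length u <= 4 * g)%nat -> (i < 2 * g)%nat -> 0 <= t <= 1 ->
  nd mid (actx (ev u) (t * edge_x i) (t * edge_s i)) (acts (ev u) (t * edge_x i) (t * edge_s i)) <= rP.
Proof.
  intros Hu Hl Hi Ht. rewrite nd_act_mid by apply det_ev.
  eapply Rle_trans; [apply nd_le_fro|]. rewrite fro_madj. unfold rP.
  apply Rmult_le_compat; [apply fro_nonneg|unfold nd; apply fro_nonneg|now apply fro_prefix|now apply edge_nd].
Qed.

Definition dS M i t := edge_x i * Dx (acts M) (t * edge_x i) (t * edge_s i) + edge_s i * Ds (acts M) (t * edge_x i) (t * edge_s i).
Definition dX M i t := edge_x i * Dx (actx M) (t * edge_x i) (t * edge_s i) + edge_s i * Ds (actx M) (t * edge_x i) (t * edge_s i).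
Definition dh i t := edge_x i * Dx h (t * edge_x i) (t * edge_s i) + edge_s i * Ds h (t * edge_x i) (t * edge_s i).

Lemma is_derive_edge u ux us i t : C1 u ux us ->
  is_derive (fun t => u (t * edge_x i) (t * edge_s i)) t (edge_x i * ux (t * edge_x i) (t * edge_s i) + edge_s i * us (t * edge_x i) (t * edge_s i)).
Proof.
  intros (H & _). apply is_derive_Reals.
  assert (D : forall k, derivable_pt_lim (fun t => t * k) t k).
  { intros k. apply is_derive_Reals. auto_derive; [exact I|ring]. }
  pose proof (derivable_pt_lim_comp_2d u (fun t => t * edge_x i) (fun t => t * edge_s i) t _ _ _ _ (H _ _) (D _) (D _)) as K.
  replace (edge_x i * ux (t * edge_x i) (t * edge_s i) + edge_s i * us (t * edge_x i) (t * edge_s i)) with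
   (ux (t * edge_x i) (t * edge_s i) * edge_x i + us (t * edge_x i) (t * edge_s i) * edge_s i) by ring. exact K.
Qed.
Lemma continuous_edge u i t : cont2 u -> continuous (fun t => u (t * edge_x i) (t * edge_s i)) t.
Proof.
  intros H. apply (cont2_curve u (fun t => t * edge_x i) (fun t => t * edge_s i)); auto;
  apply (ex_derive_continuous (K := R_AbsRing) (V := R_NormedModule)); auto_derive; exact I.
Qed.
Lemma C1_act M : mdet M = 1 -> C1 (acts M) (Dx (acts M)) (Ds (acts M)) /\ C1 (actx M) (Dx (actx M)) (Ds (actx M)).
Proof.
  intros H; split; apply ex_C1_Derive, ex_C2_ex_C1; [now apply ex_C2_acts|now apply ex_C2_actx].
Qed.
Lemma continuous_dS M i t : mdet M = 1 -> continuous (dS M i) t.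
Proof.
  intros H. destruct (C1_act M H) as ((_ & H1 & H2) & _).
  apply (continuous_edge (fun x s => edge_x i * Dx (acts M) x s + edge_s i * Ds (acts M) x s) i t).
  apply cont2_plus; apply cont2_mult; auto using cont2_const.
Qed.

(** The integral of [q ds] along the image under [M] of the edge [i]. *)
Definition Psi q M i : R := RInt (fun t => q (actx M (t * edge_x i) (t * edge_s i)) (acts M (t * edge_x i) (t * edge_s i)) * dS M i t) 0 1.

Lemma Psi_integrable q M i : cont2 q -> mdet M = 1 ->
  ex_RInt (fun t => q (actx M (t * edge_x i) (t * edge_s i)) (acts M (t * edge_x i) (t * edge_s i)) * dS M i t) 0 1.
Proof.
  intros Hq HM. apply (ex_RInt_continuous (V := R_CompleteNormedModule)). intros t _.
  apply (continuous_mult (K := R_AbsRing) (fun t => q (actx M (t * edge_x i) (t * edge_s i)) (acts M (t * edge_x i) (t * edge_s i))) (dS M i)).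
  - destruct (C1_act M HM) as (H1 & H2).
    apply (continuous_edge (fun x s => q (actx M x s) (acts M x s)) i t).
    apply cont2_comp2; [exact Hq|eapply C1_cont, H2|eapply C1_cont, H1].
  - now apply continuous_dS.
Qed.

Section Potential.
Variable F : R -> R -> R.
Hypothesis HF : forall x s, Rabs x < rl -> Rabs s < rl -> differentiable_pt_lim F x s (thA x s) (thB x s).

Definition Fo w := F (actx (ev w) 0 0) (acts (ev w) 0 0).
Definition Jo i : R := RInt (fun t => f (t * edge_x i) (t * edge_s i) * dh i t) 0 1.

Lemma act_edge_end u i :
  actx (ev (u ++ [(i, false)])) 0 0 = actx (ev u) (edge_x i) (edge_s i) /\
  acts (ev (u ++ [(i, false)])) 0 0 = acts (ev u) (edge_x i) (edge_s i).
Proof.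
  rewrite eval_app. cbn [eval]. rewrite mmul_id_r. unfold eval_letter; cbn [snd fst].
  unfold edge_x, edge_s. split; [apply actx_mmul|apply acts_mmul]; auto using det_ev; apply Hsl.
Qed.

Lemma dh_int i : (i < 2 * g)%nat -> RInt (dh i) 0 1 = expo 1 [(i, false)].
Proof.
  intros Hi. pose proof (ex_C1_Derive _ (ex_C2_ex_C1 _ (ex_C2_ff (expo 1)))) as H.
  pose proof (is_RInt_unique (V := R_CompleteNormedModule) _ _ _ _
    (is_RInt_derive (V := R_CompleteNormedModule) (fun t => h (t * edge_x i) (t * edge_s i)) (dh i) 0 1
     (fun t _ => is_derive_edge _ _ _ i t H)
     (fun t _ => continuous_edge (fun x s => edge_x i * Dx h x s + edge_s i * Ds h x s) i t
       (cont2_plus _ _ (cont2_mult _ _ (cont2_const _) (proj1 (proj2 H))) (cont2_mult _ _ (cont2_const _) (proj2 (proj2 H))))))) as K.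
  change (RInt (dh i) 0 1 = h (1 * edge_x i) (1 * edge_s i) - h (0 * edge_x i) (0 * edge_s i)) in K.
  rewrite K, !Rmult_1_l, !Rmult_0_l.
  assert (Hw : wf_word g [(i, false)]) by (constructor; [exact Hi|constructor]).
  pose proof (ff_act 1 [(i, false)] 0 0 Hw) as E.
  destruct (act_edge_end [] i) as (E1 & E2). cbn [app] in E1, E2. rewrite E1, E2 in E.
  destruct (act_mid (edge_x i) (edge_s i)) as (E3 & E4). cbn [eval] in E. rewrite E3, E4 in E.
  pose proof rP_ge. pose proof r1_ge. pose proof rE_ge2.
  rewrite E; [match goal with |- @eq _ ?a ?b => change (@eq R a b) end; ring| |].
  - pose proof (edge_nd i 0 Hi) as K0. rewrite !Rmult_0_l in K0. lra.
  - pose proof (edge_nd i 1 Hi) as K0. rewrite !Rmult_1_l in K0. lra.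
Qed.

Lemma grad_acts_mmul M M' x s : mdet M = 1 -> mdet M' = 1 ->
  Dx (acts (mmul M M')) x s = Dx (acts M) (actx M' x s) (acts M' x s) * Dx (actx M') x s
    + Ds (acts M) (actx M' x s) (acts M' x s) * Dx (acts M') x s /\
  Ds (acts (mmul M M')) x s = Dx (acts M) (actx M' x s) (acts M' x s) * Ds (actx M') x s
    + Ds (acts M) (actx M' x s) (acts M' x s) * Ds (acts M') x s.
Proof.
  intros H H'. destruct (C1_act M H) as (S & _). destruct (C1_act M' H') as (S' & X').
  pose proof (C1_comp2 _ _ _ _ _ _ _ _ _ S X' S') as K.
  pose proof (C1_ext _ _ _ (acts (mmul M M')) _ _ K (fun x y => eq_sym (acts_mmul M M' x y H H'))
    (fun _ _ => eq_refl) (fun _ _ => eq_refl)) as E.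
  split; [exact (C1_Dx _ _ _ x s E)|exact (C1_Ds _ _ _ x s E)].
Qed.

(** The closed form is integrated along the translate by [u] of the edge [i]. There [f] has
    increased by the constant [expo 0 u] while [dh] is invariant, which produces the cup product;
    the translates of [qq ds] are only permuted, up to the ones lost at infinity, and are treated
    separately. *)
Lemma Fo_step u i : wf_word g u -> (length u <= 4 * g)%nat -> (i < 2 * g)%nat ->
  Fo (u ++ [(i, false)]) - Fo u =
  Jo i + expo 0 u * expo 1 [(i, false)] - lsum (fun gam => Psi qq (ev (gam ++ u)) i) L.
Proof.
  intros Hu Hl Hi.
  set (G := fun t => f (t * edge_x i) (t * edge_s i) * dh i t + expo 0 u * dh i t
     + (-1) * lsum (fun gam => qq (actx (ev (gam ++ u)) (t * edge_x i) (t * edge_s i)) (acts (ev (gam ++ u)) (t * edge_x i) (t * edge_s i))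
           * dS (ev (gam ++ u)) i t) L).
  destruct (C1_act (ev u) (det_ev u)) as (S & X).
  pose proof rP_ge as HP. pose proof r1_ge as H1.
  assert (cq : cont2 qq) by (eapply C1_cont, C1_qq).
  pose proof (ex_C1_Derive _ (ex_C2_ex_C1 _ (ex_C2_ff (expo 0)))) as Hf1.
  pose proof (ex_C1_Derive _ (ex_C2_ex_C1 _ (ex_C2_ff (expo 1)))) as Hh1.
  assert (cdh : forall t, continuous (dh i) t).
  { intros t. apply (continuous_edge (fun x s => edge_x i * Dx h x s + edge_s i * Ds h x s) i t).
    apply cont2_plus; apply cont2_mult; try apply cont2_const; apply Hh1. }
  assert (I1 : ex_RInt (fun t => f (t * edge_x i) (t * edge_s i) * dh i t) 0 1).
  { apply (ex_RInt_continuous (V := R_CompleteNormedModule)). intros t _.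
    apply (continuous_mult (K := R_AbsRing) (fun t => f (t * edge_x i) (t * edge_s i)) (dh i)); [|apply cdh].
    apply continuous_edge. eapply C1_cont, Hf1. }
  assert (I2 : ex_RInt (dh i) 0 1) by (apply (ex_RInt_continuous (V := R_CompleteNormedModule)); intros; apply cdh).
  assert (I2' : ex_RInt (fun t => expo 0 u * dh i t) 0 1) by (apply (ex_RInt_scal (V := R_NormedModule) (dh i)); exact I2).
  assert (I3 : forall gam, ex_RInt (fun t => qq (actx (ev (gam ++ u)) (t * edge_x i) (t * edge_s i)) (acts (ev (gam ++ u)) (t * edge_x i) (t * edge_s i))
           * dS (ev (gam ++ u)) i t) 0 1) by (intros gam; apply Psi_integrable; auto using det_ev).
  pose proof (ex_RInt_lsum _ L 0 1 I3) as I4.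
  assert (I4' : ex_RInt (fun t => (-1) * lsum (fun gam => qq (actx (ev (gam ++ u)) (t * edge_x i) (t * edge_s i)) (acts (ev (gam ++ u)) (t * edge_x i) (t * edge_s i))
           * dS (ev (gam ++ u)) i t) L) 0 1) by exact (ex_RInt_scal (V := R_NormedModule) _ 0 1 (-1) I4).
  assert (EG : RInt G 0 1 = Jo i + expo 0 u * expo 1 [(i, false)] - lsum (fun gam => Psi qq (ev (gam ++ u)) i) L).
  { unfold G. rewrite RInt_plus_R; [|exact (ex_RInt_plus (V := R_NormedModule) _ _ 0 1 I1 I2')|exact I4'].
    rewrite RInt_plus_R by assumption. rewrite (RInt_scal_R (expo 0 u)) by assumption. rewrite (RInt_scal_R (-1)) by assumption.
    rewrite RInt_lsum by assumption. rewrite dh_int by assumption. unfold Jo, Psi.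
    match goal with |- @eq _ ?a ?b => change (@eq R a b) end. ring. }
  rewrite <- EG. symmetry.
  pose proof (is_RInt_derive (V := R_CompleteNormedModule)
    (fun t => F (actx (ev u) (t * edge_x i) (t * edge_s i)) (acts (ev u) (t * edge_x i) (t * edge_s i))) G 0 1) as K.
  destruct (act_edge_end u i) as (E1 & E2).
  transitivity (F (actx (ev u) (1 * edge_x i) (1 * edge_s i)) (acts (ev u) (1 * edge_x i) (1 * edge_s i))
    - F (actx (ev u) (0 * edge_x i) (0 * edge_s i)) (acts (ev u) (0 * edge_x i) (0 * edge_s i)));
    [|rewrite !Rmult_1_l, !Rmult_0_l; unfold Fo; apply (f_equal2 Rminus); [|reflexivity];
      symmetry; apply f_equal2; [exact E1|exact E2]].
  apply (is_RInt_unique (V := R_CompleteNormedModule)), K; clear K.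
  - rewrite Rmin_left, Rmax_right by lra. intros t Ht.
    set (x := t * edge_x i). set (s := t * edge_s i).
    set (x' := actx (ev u) x s). set (s' := acts (ev u) x s).
    assert (Hnd : nd mid x s <= rE) by now apply edge_nd.
    assert (Hnd' : nd mid x' s' <= rP) by now apply path_nd.
    destruct (nd_mid_region _ _ _ Hnd') as (Hx' & Hs').
    assert (HFd : differentiable_pt_lim F x' s' (thA x' s') (thB x' s')) by (apply HF; unfold rl; lra).
    pose proof (derivable_pt_lim_comp_2d F (fun t => actx (ev u) (t * edge_x i) (t * edge_s i))
      (fun t => acts (ev u) (t * edge_x i) (t * edge_s i)) t _ _ _ _ HFd
      (proj1 (is_derive_Reals _ _ _) (is_derive_edge _ _ _ i t X))
      (proj1 (is_derive_Reals _ _ _) (is_derive_edge _ _ _ i t S))) as K.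
    apply is_derive_Reals. eapply eq_ind; [exact K|]. clear K.
    destruct (ff_grad 1 u x s Hu) as (G1 & G2); [lra|fold x' s'; lra|]. fold x' s' in G1, G2.
    pose proof (ff_act 0 u x s Hu) as G3. fold x' s' in G3.
    unfold thA, thB, G. fold x s.
    assert (EL : lsum (fun gam => qq (actx (ev (gam ++ u)) x s) (acts (ev (gam ++ u)) x s) * dS (ev (gam ++ u)) i t) L
      = dX (ev u) i t * lsum (fun gam => TA qq gam x' s') L + dS (ev u) i t * lsum (fun gam => TB qq gam x' s') L).
    { rewrite <- !lsum_scal, <- lsum_plus. apply lsum_ext. intros gam _. rewrite eval_app.
      rewrite actx_mmul, acts_mmul by apply det_ev. fold x' s'. unfold TA, TB, dS, dX. fold x s.
      destruct (grad_acts_mmul (ev gam) (ev u) x s (det_ev gam) (det_ev u)) as (A1 & A2).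
      rewrite A1, A2. fold x' s'. ring. }
    rewrite EL. rewrite G3 by lra. unfold dh, dX, dS. fold x s. rewrite G1, G2. ring.
  - intros t _. unfold G. apply (continuous_plus (V := R_NormedModule)
      (fun t => f (t * edge_x i) (t * edge_s i) * dh i t + expo 0 u * dh i t)).
    + apply (continuous_plus (V := R_NormedModule) (fun t => f (t * edge_x i) (t * edge_s i) * dh i t)).
      * apply (continuous_mult (K := R_AbsRing) (fun t => f (t * edge_x i) (t * edge_s i)) (dh i)); [|apply cdh].
        apply continuous_edge. eapply C1_cont, Hf1.
      * apply (continuous_scal_r (V := R_NormedModule)), cdh.
    + apply (continuous_scal_r (V := R_NormedModule)).
      clear - cq HDF. induction L as [|gam l IH]; [exact (continuous_const (V := R_NormedModule) 0 t)|].
      apply (continuous_plus (V := R_NormedModule) (fun t =>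
        qq (actx (ev (gam ++ u)) (t * edge_x i) (t * edge_s i)) (acts (ev (gam ++ u)) (t * edge_x i) (t * edge_s i))
           * dS (ev (gam ++ u)) i t)); [|exact IH].
      apply (continuous_mult (K := R_AbsRing) (fun t => qq (actx (ev (gam ++ u)) (t * edge_x i) (t * edge_s i)) (acts (ev (gam ++ u)) (t * edge_x i) (t * edge_s i))) (dS (ev (gam ++ u)) i)).
      * destruct (C1_act (ev (gam ++ u)) (det_ev _)) as (H1 & H2).
        apply (continuous_edge (fun x s => qq (actx (ev (gam ++ u)) x s) (acts (ev (gam ++ u)) x s)) i t).
        apply cont2_comp2; [exact cq|eapply C1_cont, H2|eapply C1_cont, H1].
      * apply continuous_dS, det_ev.
Qed.

(* As [(c, 0)] is far from the orbit, near the path of the prefixes every translate of [qc ds] is exact, whereas [q1] has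
   compact support and its contributions to edges exchanged by the group cancel. *)
Definition q1 x s := qq x s - qq (x - c) s.
Definition qc x s := qq (x - c) s.

Lemma cont2_qc : cont2 qc.
Proof.
  apply (cont2_comp2 qq (fun x _ => x - c) (fun _ s => s)); [eapply C1_cont, C1_qq| |apply cont2_snd].
  apply cont2_minus; [apply cont2_fst|apply cont2_const].
Qed.
Lemma cont2_q1 : cont2 q1.
Proof. apply cont2_minus; [eapply C1_cont, C1_qq|apply cont2_qc]. Qed.
Lemma cont2_ww : cont2 ww. Proof. apply ex_C1_cont, ex_C1_ww. Qed.

Lemma qq_diff a b s : (forall u, Rmin a b < u < Rmax a b -> ww u s = 0) -> qq a s = qq b s.
Proof.
  intros H. unfold qq.
  pose proof (RInt_Chasles (V := R_CompleteNormedModule) (fun u => ww u s) (- r1) a b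
    (cont2_ex_RInt _ _ _ _ cont2_ww) (cont2_ex_RInt _ _ _ _ cont2_ww)) as K.
  change (RInt (fun u => ww u s) (- r1) a + RInt (fun u => ww u s) a b = RInt (fun u => ww u s) (- r1) b) in K.
  rewrite <- K. rewrite (RInt_ext (fun u => ww u s) (fun _ => 0) a b) by (intros; now apply H).
  pose proof (RInt_const (V := R_CompleteNormedModule) a b 0) as K0.
  change (RInt (fun _ : R => 0) a b = (b - a) * 0) in K0.
  rewrite K0, Rmult_0_r, Rplus_0_r. reflexivity.
Qed.
(** Far out in [x], the interval between [x - c] and [x] misses the support of [ww]; so the total
    mass of [ww] on a horizontal line, which makes [qq] fail to have compact support, cancels. *)
Lemma q1_support x s : r1 + Rabs c < Rabs x \/ r1 < Rabs s -> q1 x s = 0.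
Proof.
  intros H. unfold q1. rewrite (qq_diff x (x - c) s); [ring|].
  intros u Hu. apply ww_support'. destruct H as [H|H]; [left|now right].
  revert H Hu. unfold Rmin, Rmax, Rabs. repeat destruct Rcase_abs; repeat destruct Rle_dec; lra.
Qed.

Lemma Psi_zero q M i : cont2 q ->
  (forall t, 0 <= t <= 1 -> q (actx M (t * edge_x i) (t * edge_s i)) (acts M (t * edge_x i) (t * edge_s i)) = 0) -> Psi q M i = 0.
Proof.
  intros Hq H. unfold Psi.
  rewrite (RInt_ext _ (fun _ => 0)).
  - pose proof (RInt_const (V := R_CompleteNormedModule) 0 1 0) as K0.
    change (RInt (fun _ : R => 0) 0 1 = (1 - 0) * 0) in K0.
    rewrite K0. apply Rmult_0_r.
  - rewrite Rmin_left, Rmax_right by lra. intros t Ht. rewrite H by lra.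
    apply Rmult_0_l.
Qed.
Lemma Psi_pm q M M' i : pm_eq M M' -> Psi q M i = Psi q M' i.
Proof.
  intros H. unfold Psi. apply RInt_ext. intros t _. unfold dS, Dx, Ds.
  rewrite (actx_pm M M' _ _ H), (acts_pm M M' _ _ H).
  rewrite (Derive_ext (fun x => acts M x (t * edge_s i)) (fun x => acts M' x (t * edge_s i))) by (intros; now apply acts_pm).
  rewrite (Derive_ext (fun s => acts M (t * edge_x i) s) (fun s => acts M' (t * edge_x i) s)) by (intros; now apply acts_pm).
  reflexivity.
Qed.

(** By compact support the list [L] captures the whole sum over the group, which right translation
    by [u] does not change. The contribution of [q1] thus depends on the generator [i] only. *)
Lemma Psi_q1_shift u i : wf_word g u -> (length u <= 4 * g)%nat -> (i < 2 * g)%nat ->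
  lsum (fun gam => Psi q1 (ev (gam ++ u)) i) L = lsum (fun gam => Psi q1 (ev gam) i) L.
Proof.
  intros Hu Hlu Hi. set (Fn := fun w => Psi q1 (ev w) i).
  set (K0 := rect_bound (r1 + Rabs c) * rE).
  pose proof rE_ge2 as HE. pose proof r1_ge as H1. pose proof rP_ge as HP. pose proof (Rabs_pos c) as Hc.
  pose proof (powB_ge1 (4 * g)) as HBp.
  assert (HR : 2 <= rect_bound (r1 + Rabs c)) by (apply rect_bound_ge2; lra).
  assert (HK0 : 0 <= K0) by (unfold K0; apply Rmult_le_pos; lra).
  assert (Hr : 0 <= r0 * (r1 + 1)) by (unfold r0; apply Rmult_le_pos; lra).
  assert (HK : K0 * (2 * B ^ (4 * g)) <= rK) by (unfold rK, K0; lra).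
  assert (HK' : K0 <= rK) by (eapply Rle_trans; [|exact HK]; rewrite <- (Rmult_1_r K0) at 1; apply Rmult_le_compat_l; lra).
  assert (Hs : forall w, Fn w <> 0 -> fro (ev w) <= K0).
  { intros w Hw. apply Rnot_lt_le. intros Hlt. apply Hw. unfold Fn. refine (Psi_zero q1 (ev w) i cont2_q1 _).
    intros t Ht. apply q1_support.
    set (x' := actx _ _ _). set (s' := acts _ _ _).
    destruct (Rlt_dec (r1 + Rabs c) (Rabs x')) as [|Hx]; [now left|].
    destruct (Rlt_dec r1 (Rabs s')) as [|Hs']; [now right|]. exfalso.
    assert (Hnd : nd mid x' s' <= rect_bound (r1 + Rabs c)) by (apply nd_mid_rect; lra).
    unfold x', s' in Hnd. rewrite nd_act_mid in Hnd by apply det_ev.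
    pose proof (fro_le_nd (madj (ev w)) (t * edge_x i) (t * edge_s i)) as Hf. rewrite fro_madj in Hf.
    assert (nd (madj (ev w)) (t * edge_x i) (t * edge_s i) * nd mid (t * edge_x i) (t * edge_s i) <= K0); [|lra].
    unfold K0. apply Rmult_le_compat; [unfold nd; apply fro_nonneg|unfold nd; apply fro_nonneg|exact Hnd|now apply edge_nd]. }
  apply (lsum_reindex g rho rK L Fn (fun w => w ++ u)); auto.
  - intros w v _ _ H. exact (Psi_pm q1 (ev w) (ev v) i (DF_pm g rho w v HDF H)).
  - intros w Hw. now apply wf_app.
  - intros w v _ _ H. pose proof (geq_app g _ _ _ _ H (geq_refl g (winv u))) as K. rewrite <- !app_assoc in K.
    assert (T : forall z, geq g (z ++ u ++ winv u) z).
    { intros z. rewrite <- (app_nil_r z) at 2. apply geq_app; [apply geq_refl|apply geq_winv_r]. }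
    eapply geq_trans; [apply geq_sym, T|]. eapply geq_trans; [exact K|apply T].
  - intros w Hw Hw0. apply Hs in Hw0. eapply Rle_trans; [apply mnorm_le_fro, det_ev|]. lra.
  - intros w Hw Hw0. apply Hs in Hw0. exists (w ++ winv u). repeat split.
    + apply wf_app; auto using wf_winv.
    + eapply Rle_trans; [apply mnorm_le_fro, det_ev|]. rewrite eval_app, eval_winv.
      eapply Rle_trans; [apply fro_mmul|]. rewrite fro_madj. eapply Rle_trans; [|exact HK].
      apply Rmult_le_compat; auto using fro_nonneg. now apply fro_prefix.
    + rewrite <- app_assoc. pose proof (geq_app g _ _ _ _ (geq_refl g w) (geq_winv_l g u)) as T.
      rewrite app_nil_r in T. exact T.
  - intros w v _ _ H. apply geq_app; [exact H|apply geq_refl].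
Qed.

(** The vertex in [nd_convex]: the abscissa nearest to the orbit point of [gam], at every height. *)
Definition center gam := (m11 (ev gam) * m21 (ev gam) + m12 (ev gam) * m22 (ev gam)) /
  (m21 (ev gam) * m21 (ev gam) + m22 (ev gam) * m22 (ev gam)).
Definition Kc gam s : R := RInt (fun s => qc (center gam) s) 0 s.

(** All points between [x] and the center are within [rP] of the orbit point of [gam], hence by
    [Hfar] farther than [r1] from [(c, 0)], where the shifted density vanishes. So [qc] depends on
    the height alone there, and [qc ds] has the primitive [Kc gam]. *)
Lemma qc_center gam x s : wf_word g gam -> nd (ev gam) x s <= rP -> qc x s = qc (center gam) s.
Proof.
  intros Hgam H. unfold qc. symmetry. apply qq_diff. intros u Hu. apply ww_support. apply Rnot_lt_le. intros Hlt.
  assert (Hu' : Rmin (center gam) x <= u + c <= Rmax (center gam) x).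
  { revert Hu. unfold Rmin, Rmax. repeat destruct Rle_dec; lra. }
  pose proof (nd_convex (ev gam) x (u + c) s (det_ev gam) Hu') as Hcv.
  pose proof (nd_horo (ev gam) (u + c) s c) as Hh. replace (u + c - c) with u in Hh by ring.
  specialize (Hfar gam Hgam). pose proof (fro_nonneg (mmul (madj (ev gam)) (gz (u + c) s))).
  assert (nd (ev gam) (u + c) s * nd mid u s <= rP * r1); [|lra].
  apply Rmult_le_compat; [unfold nd; apply fro_nonneg|unfold nd; apply fro_nonneg|lra|lra].
Qed.

Lemma is_derive_Kc gam s : is_derive (Kc gam) s (qc (center gam) s).
Proof.
  unfold Kc. apply (is_derive_RInt (V := R_NormedModule) (fun s => qc (center gam) s) _ 0).
  - apply filter_forall. intros z. apply (RInt_correct (V := R_CompleteNormedModule)).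
    apply (ex_RInt_continuous (V := R_CompleteNormedModule)). intros t _. apply cont2_cont2, cont2_qc.
  - apply cont2_cont2, cont2_qc.
Qed.

Lemma Psi_qc_exact gam u i : wf_word g gam -> wf_word g u -> (length u <= 4 * g)%nat -> (i < 2 * g)%nat ->
  Psi qc (ev (gam ++ u)) i =
  Kc gam (acts (ev (gam ++ u)) (edge_x i) (edge_s i)) - Kc gam (acts (ev (gam ++ u)) 0 0).
Proof.
  intros Hgam Hu Hl Hi. set (M := ev (gam ++ u)). assert (HM : mdet M = 1) by apply det_ev.
  destruct (C1_act M HM) as (S & X).
  assert (cS : forall t, continuous (fun t => acts M (t * edge_x i) (t * edge_s i)) t)
    by (intros t; apply continuous_edge; eapply C1_cont, S).
  pose proof (is_RInt_derive (V := R_CompleteNormedModule)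
    (fun t => Kc gam (acts M (t * edge_x i) (t * edge_s i)))
    (fun t => dS M i t * qc (center gam) (acts M (t * edge_x i) (t * edge_s i))) 0 1) as K.
  unfold Psi.
  transitivity (RInt (fun t => dS M i t * qc (center gam) (acts M (t * edge_x i) (t * edge_s i))) 0 1).
  - apply RInt_ext. rewrite Rmin_left, Rmax_right by lra. intros t Ht.
    rewrite (qc_center gam); [match goal with |- @eq _ ?a ?b => change (@eq R a b) end; ring|exact Hgam|].
    unfold M. rewrite eval_app, actx_mmul, acts_mmul by apply det_ev.
    rewrite <- (mmul_id_r (ev gam)) at 1. rewrite nd_act by apply det_ev. apply path_nd; auto; lra.
  - transitivity (Kc gam (acts M (1 * edge_x i) (1 * edge_s i)) - Kc gam (acts M (0 * edge_x i) (0 * edge_s i)));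
      [|now rewrite !Rmult_1_l, !Rmult_0_l].
    apply (is_RInt_unique (V := R_CompleteNormedModule)), K.
    + intros t _. apply (is_derive_comp (V := R_NormedModule) (Kc gam) (fun t => acts M (t * edge_x i) (t * edge_s i))).
      * apply is_derive_Kc.
      * exact (is_derive_edge _ _ _ i t S).
    + intros t _. apply (continuous_mult (K := R_AbsRing) (dS M i)); [now apply continuous_dS|].
      apply (continuous_comp (fun t => acts M (t * edge_x i) (t * edge_s i)) (qc (center gam))); [apply cS|].
      apply cont2_cont2, cont2_qc.
Qed.

Lemma Psi_split M i : mdet M = 1 -> Psi qq M i = Psi q1 M i + Psi qc M i.
Proof.
  intros HM. unfold Psi. rewrite <- RInt_plus_R by (apply Psi_integrable; auto using cont2_q1, cont2_qc).
  apply RInt_ext. intros t _. unfold q1, qc. match goal with |- @eq _ ?a ?b => change (@eq R a b) end. ring.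
Qed.

(** The sum absorbs the exact part [qc], and [Jo'] absorbs the compactly supported part [q1]. The
    increments of [Go] then have precisely the form that [cup_product_not_coboundary] forbids. *)
Definition Go w := Fo w + lsum (fun gam => Kc gam (acts (ev (gam ++ w)) 0 0)) L.
Definition Jo' i := Jo i - lsum (fun gam => Psi q1 (ev gam) i) L.

Lemma Go_step u i : wf_word g u -> (length u <= 4 * g)%nat -> (i < 2 * g)%nat ->
  Go (u ++ [(i, false)]) - Go u = Jo' i + expo 0 u * expo 1 [(i, false)].
Proof.
  intros Hu Hl Hi.
  assert (E : lsum (fun gam => Psi qq (ev (gam ++ u)) i) L =
    lsum (fun gam => Psi q1 (ev gam) i) L +
    (lsum (fun gam => Kc gam (acts (ev (gam ++ u ++ [(i, false)])) 0 0)) L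
     + (-1) * lsum (fun gam => Kc gam (acts (ev (gam ++ u)) 0 0)) L)).
  { rewrite <- (Psi_q1_shift u i) by assumption. rewrite <- lsum_scal, <- !lsum_plus.
    destruct HL as (Hwf & _). rewrite Forall_forall in Hwf. apply lsum_ext. intros gam Hgam.
    rewrite Psi_split by apply det_ev. rewrite Psi_qc_exact by auto.
    destruct (act_edge_end (gam ++ u) i) as (_ & E2).
    assert (E3 : acts (ev (gam ++ u ++ [(i, false)])) 0 0 = acts (ev (gam ++ u)) (edge_x i) (edge_s i)).
    { rewrite app_assoc. exact E2. }
    rewrite E3. ring. }
  pose proof (Fo_step u i Hu Hl Hi) as E1. rewrite E in E1. unfold Go, Jo'. lra.
Qed.

Lemma Go_pm u v : pm_eq (ev u) (ev v) -> Go u = Go v.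
Proof.
  intros H. unfold Go, Fo. rewrite (actx_pm _ _ _ _ H), (acts_pm _ _ _ _ H). f_equal.
  apply lsum_ext. intros gam _. f_equal. apply acts_pm. rewrite !eval_app.
  apply pm_eq_mmul; [apply pm_eq_refl|exact H].
Qed.

Lemma no_potential : False.
Proof.
  apply (cup_product_not_coboundary g Go Jo'); auto.
  - intros u v i E. pose proof (wf_relator g) as Hw. pose proof (relator_length g) as Hlen. rewrite E in Hw, Hlen.
    rewrite length_app in Hlen. apply wf_app_inv in Hw. destruct Hw as (Hu & Hv). inversion Hv; subst.
    apply Go_step; auto. unfold word, letter in *. lia.
  - intros u v i E. pose proof (wf_relator g) as Hw. pose proof (relator_length g) as Hlen. rewrite E in Hw, Hlen.
    rewrite length_app in Hlen. cbn in Hlen. apply wf_app_inv in Hw. destruct Hw as (Hu & Hv). inversion Hv; subst.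
    (* An inverse letter is a positive step taken backwards, starting from the longer prefix. *)
    assert (E2 : Go u = Go ((u ++ [(i, true)]) ++ [(i, false)])).
    { apply Go_pm. left. rewrite <- app_assoc. rewrite eval_app. cbn [eval]. change (ev ([(i, true)] ++ [(i, false)])) with
       (mmul (madj (rho i)) (mmul (rho i) mid)). rewrite mmul_id_r, mmul_madj_l by apply Hsl. now rewrite mmul_id_r. }
    rewrite E2 at 1. apply Go_step; auto.
    + apply wf_app; [exact Hu|]. constructor; [assumption|constructor].
    + rewrite length_app. cbn. unfold word, letter in *. lia.
  - apply Go_pm. apply HDF.
Qed.
End Potential.

Lemma far_absurd : False.
Proof. destruct potential_exists as (F & HF). exact (no_potential F HF). Qed.
End Cocompact.

(** The constant depends only on [g] and the bound on the generators. This uniformity allows the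
    result to be applied to all conjugates of a representation by rotations. *)
Lemma orbit_meets_horocycle g B : (1 <= g)%nat -> 1 <= B -> exists K, forall rho, DFrep g rho ->
  (forall i, (i < 2 * g)%nat -> fro (rho i) <= B) -> forall c, exists w, wf_word g w /\ nd (eval rho w) c 0 <= K.
Proof.
  intros Hg HB1. exists (rP g B * r1 g B). intros rho HDF HB c.
  apply NNPP. intros Hno.
  assert (Hfar : forall w, wf_word g w -> rP g B * r1 g B < nd (eval rho w) c 0).
  { intros w Hw. apply Rnot_le_lt. intros H. apply Hno. now exists w. }
  destruct (ball_list_exists g rho HDF (rK g B c)) as (L & HL).
  exact (far_absurd g rho B c L Hg HDF HB1 HB Hfar HL).
Qed.

(** * Conjugation and cocompactness *)

Definition mdiff (A B : Mat2) : Mat2 := mkMat2 (m11 A - m11 B) (m12 A - m12 B) (m21 A - m21 B) (m22 A - m22 B).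
Lemma close_mdiff e A B : close e A B <-> mnorm (mdiff A B) < e.
Proof.
  split.
  - intros (h1 & h2 & h3 & h4). destruct (mnorm_attained (mdiff A B)) as [E|[E|[E|E]]]; rewrite E; assumption.
  - intros H. destruct (mnorm_entries (mdiff A B)) as (h1 & h2 & h3 & h4). cbn in *. repeat split; lra.
Qed.
Lemma mdiff_mmul_l A B C : mmul A (mdiff B C) = mdiff (mmul A B) (mmul A C).
Proof. unfold mdiff; mat. Qed.
Lemma mdiff_mmul_r A B C : mmul (mdiff B C) A = mdiff (mmul B A) (mmul C A).
Proof. unfold mdiff; mat. Qed.
Lemma mdiff_mneg A B : mdiff (mneg A) (mneg B) = mneg (mdiff A B).
Proof. unfold mdiff, mneg; mat. Qed.

Definition conj_rep (k : Mat2) (rho : rep) : rep := fun i => mmul (mmul k (rho i)) (madj k).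

Section Conj.
Variable k : Mat2.
Hypothesis Hk : mdet k = 1.

Lemma eval_conj rho w : eval (conj_rep k rho) w = mmul (mmul k (eval rho w)) (madj k).
Proof.
  induction w as [|[i b] w IH]; cbn [eval].
  - now rewrite mmul_id_r, mmul_madj_r.
  - rewrite IH. assert (E : eval_letter (conj_rep k rho) (i, b) = mmul (mmul k (eval_letter rho (i, b))) (madj k)).
    { unfold eval_letter, conj_rep; cbn [fst snd]. destruct b; [|reflexivity].
      now rewrite !madj_mmul, madj_madj, mmul_assoc. }
    rewrite E, <- !mmul_assoc. do 2 f_equal. rewrite !mmul_assoc, mmul_madj_l, mmul_id_l by assumption. reflexivity.
Qed.
Lemma conj_inv A B : mmul (mmul k A) (madj k) = B -> A = mmul (mmul (madj k) B) k.
Proof.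
  intros <-. rewrite !mmul_assoc, mmul_madj_l, mmul_id_l by assumption.
  now rewrite <- mmul_assoc, mmul_madj_l, mmul_id_r.
Qed.
Lemma conj_pm_mid A : pm_eq (mmul (mmul k A) (madj k)) mid <-> pm_eq A mid.
Proof.
  split; intros [H|H].
  - left. apply conj_inv in H. now rewrite mmul_id_r, mmul_madj_l in H.
  - right. apply conj_inv in H. now rewrite mmul_mneg_r, mmul_id_r, mmul_mneg_l, mmul_madj_l in H.
  - left. now rewrite H, mmul_id_r, mmul_madj_r.
  - right. now rewrite H, mmul_mneg_r, mmul_id_r, mmul_mneg_l, mmul_madj_r.
Qed.
Lemma conj_close e A J : (J = mid \/ J = mneg mid) ->
  close (e / (4 * (mnorm k * mnorm k))) (mmul (mmul k A) (madj k)) J -> close e A J.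
Proof.
  intros HJ H. apply close_mdiff. apply close_mdiff in H.
  assert (EJ : mmul (mmul k J) (madj k) = J).
  { destruct HJ as [-> | ->]; rewrite ?mmul_mneg_r, ?mmul_id_r, ?mmul_mneg_l, mmul_madj_r by assumption; reflexivity. }
  rewrite <- EJ, <- mdiff_mmul_r, <- mdiff_mmul_l in H.
  pose proof (mnorm_det_half k Hk) as Hn. set (D := mdiff A J) in *.
  assert (E : D = mmul (mmul (madj k) (mmul (mmul k D) (madj k))) k) by now apply conj_inv.
  rewrite E. eapply Rle_lt_trans; [apply mnorm_mmul|].
  pose proof (mnorm_mmul (madj k) (mmul (mmul k D) (madj k))) as H2. rewrite mnorm_madj in H2.
  set (y := mnorm (mmul (mmul k D) (madj k))) in *.
  assert (4 * (mnorm k * mnorm k) * y < e).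
  { apply Rmult_lt_reg_r with (/ (4 * (mnorm k * mnorm k))); [apply Rinv_0_lt_compat; nra|].
    replace (4 * (mnorm k * mnorm k) * y * / (4 * (mnorm k * mnorm k))) with y by (field; lra). exact H. }
  assert (mnorm (mmul (madj k) (mmul (mmul k D) (madj k))) * mnorm k <= 2 * (mnorm k * y) * mnorm k)
    by (apply Rmult_le_compat_r; lra).
  lra.
Qed.
Lemma DFrep_conj g rho : DFrep g rho -> DFrep g (conj_rep k rho).
Proof.
  intros (Hsl & Hd & Hr & (eps & Heps & Hc) & Hf).
  assert (HS : SLrep (conj_rep k rho)).
  { intros i. unfold conj_rep. now rewrite !mdet_mmul, mdet_madj, Hk, Hsl, !Rmult_1_l. }
  pose proof (mnorm_det_half k Hk) as Hn.
  split; [exact HS|]. repeat split.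
  - intros i _. apply HS.
  - rewrite eval_conj. now apply conj_pm_mid.
  - exists (eps / (4 * (mnorm k * mnorm k))). split; [apply Rdiv_lt_0_compat; nra|].
    intros w Hw Hcl. rewrite eval_conj in *. apply conj_pm_mid. apply Hc; [exact Hw|].
    destruct Hcl as [Hcl|Hcl]; [left|right]; apply conj_close in Hcl; auto.
  - intros w Hw Hp. rewrite eval_conj in Hp. apply (conj_pm_mid (eval rho w)) in Hp. now apply Hf.
Qed.
End Conj.

Definition cocompact (g : nat) (rho : rep) (D : R) : Prop :=
  forall M, mdet M = 1 -> exists w, wf_word g w /\ mnorm (mmul (madj (eval rho w)) M) <= D.

(* [fro k = 2] says that [k] is a rotation about [i]. *)
Lemma rotate_to_horocycle M : mdet M = 1 -> exists k c N, mdet k = 1 /\ fro k = 2 /\ fro N = 2 /\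
  mmul k M = mmul (gz c 0) N.
Proof.
  intros H.
  set (A := m21 M * m21 M + m22 M * m22 M). set (C := m11 M * m11 M + m12 M * m12 M).
  set (B := m11 M * m21 M + m12 M * m22 M).
  assert (HAC : A * C - B * B = 1).
  { transitivity (mdet M * mdet M); [unfold A, B, C, mdet; ring|rewrite H; ring]. }
  assert (HA : 0 <= A) by (unfold A; nra). assert (HC : 0 <= C) by (unfold C; nra).
  assert (Hdisc : 0 <= A + C - 2).
  { apply Rnot_lt_le. intros Hlt. pose proof (Rle_0_sqr (A - C)). pose proof (Rle_0_sqr B). unfold Rsqr in *. nra. }
  (* The squared norm of the bottom row of [mmul k M] is the quadratic form
     [A p^2 - 2 B p q + C q^2], and the point has height one when this equals [p^2 + q^2]. The form
     has determinant one, so the discriminant of the difference is [A + C - 2], which is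
     nonnegative. *)
  assert (Hpq : exists p q, 0 < p * p + q * q /\ (A - 1) * (p * p) - 2 * B * (p * q) + (C - 1) * (q * q) = 0).
  { destruct (Req_dec A 1) as [E|E].
    - exists 1, 0. rewrite E. split; [lra|ring].
    - set (d := sqrt (A + C - 2)). assert (Hd : d * d = A + C - 2) by now apply sqrt_sqrt.
      exists (B + d), (A - 1). split.
      + assert (0 < (A - 1) * (A - 1)) by (apply Rsqr_pos_lt; lra). pose proof (Rle_0_sqr (B + d)). unfold Rsqr in *. lra.
      + transitivity ((A - 1) * (d * d - B * B + (C - 1) * (A - 1))); [ring|]. rewrite Hd.
        transitivity ((A - 1) * (A * C - B * B - 1)); [ring|]. rewrite HAC. ring. }
  destruct Hpq as (p0 & q0 & Hpos & Hroot).
  set (n := sqrt (p0 * p0 + q0 * q0)). assert (Hn : n * n = p0 * p0 + q0 * q0) by (apply sqrt_sqrt; lra).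
  assert (Hn0 : 0 < n) by now apply sqrt_lt_R0.
  set (p := p0 / n). set (q := q0 / n).
  assert (E1 : p * p + q * q = 1).
  { transitivity ((p0 * p0 + q0 * q0) / (n * n)); [unfold p, q; field; lra|]. rewrite Hn. field. lra. }
  assert (E2 : A * (p * p) - 2 * B * (p * q) + C * (q * q) = 1).
  { transitivity (((A - 1) * (p0 * p0) - 2 * B * (p0 * q0) + (C - 1) * (q0 * q0)) / (n * n) + (p * p + q * q)).
    - unfold p, q. field. lra.
    - rewrite Hroot, E1. field. lra. }
  clearbody p q. clear Hroot Hn n Hn0 Hpos p0 q0.
  set (k := mkMat2 p q (- q) p). set (W := mmul k M).
  set (c := m11 W * m21 W + m12 W * m22 W).
  assert (Hk : mdet k = 1) by (unfold mdet, k; cbn; lra).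
  assert (HW : mdet W = 1) by (unfold W; rewrite mdet_mmul, Hk, H; ring).
  assert (HW2 : m21 W * m21 W + m22 W * m22 W = 1).
  { rewrite <- E2. unfold W, k, mmul, A, B, C; cbn. ring. }
  exists k, c, (mmul (madj (gz c 0)) W).
  repeat split; auto.
  - unfold fro, k; cbn. lra.
  - assert (EN : mmul (madj (gz c 0)) W = mkMat2 (m11 W - c * m21 W) (m12 W - c * m22 W) (m21 W) (m22 W)).
    { unfold gz. replace (0 / 2) with 0 by field. replace (- 0 / 2) with 0 by field. rewrite exp_0.
      unfold mmul, madj; cbn [m11 m12 m21 m22]. f_equal; ring. }
    rewrite EN. unfold fro; cbn [m11 m12 m21 m22].
    assert ((m11 W * m11 W + m12 W * m12 W) - c * c = 1).
    { transitivity (mdet W * mdet W); [|rewrite HW; ring].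
      transitivity ((m11 W * m11 W + m12 W * m12 W) * (m21 W * m21 W + m22 W * m22 W) - c * c); [rewrite HW2; ring|].
      unfold c, mdet; ring. }
    assert (Ec : m11 W * m21 W + m12 W * m22 W = c) by reflexivity.
    transitivity ((m11 W * m11 W + m12 W * m12 W) - 2 * c * (m11 W * m21 W + m12 W * m22 W)
      + c * c * (m21 W * m21 W + m22 W * m22 W) + (m21 W * m21 W + m22 W * m22 W)); [ring|].
    rewrite Ec, HW2. lra.
  - symmetry. apply mmul_madj_cancel_l', mdet_gz.
Qed.

(** A rotation about [i] brings any given point to the horocycle of height one, where
    [orbit_meets_horocycle] applies to the conjugated representation. *)
Theorem DF_cocompact g rho : (1 <= g)%nat -> DFrep g rho -> exists D, 1 <= D /\ cocompact g rho D.
Proof.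
  intros Hg HDF.
  assert (HB : exists B, 1 <= B /\ forall i, (i < 2 * g)%nat -> fro (rho i) <= B).
  { generalize (2 * g)%nat. induction n as [|n (B & HB1 & HB)].
    - exists 1. split; [lra|intros; lia].
    - exists (B + fro (rho n)). pose proof (fro_nonneg (rho n)). split; [lra|]. intros i Hi.
      destruct (Nat.eq_dec i n) as [->|]; [lra|]. assert (fro (rho i) <= B) by (apply HB; lia). lra. }
  destruct HB as (B & HB1 & HB).
  (* Conjugation by a rotation multiplies [fro] by at most 2 on each side. *)
  destruct (orbit_meets_horocycle g (2 * B * 2) Hg) as (K & HK); [lra|].
  exists (Rmax 1 (2 * (K * 2) * 2)). split; [apply Rmax_l|].
  intros M HM. destruct (rotate_to_horocycle M HM) as (k & c & N & Hk & Hfk & HfN & E).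
  destruct (HK (conj_rep k rho)) with (c := c) as (w & Hw & Hnd).
  - now apply DFrep_conj.
  - intros i Hi. unfold conj_rep. eapply Rle_trans; [apply fro_mmul|]. rewrite fro_madj, Hfk.
    apply Rmult_le_compat_r; [lra|]. eapply Rle_trans; [apply fro_mmul|]. rewrite Hfk.
    apply Rmult_le_compat_l; [lra|]. now apply HB.
  - exists w. split; [exact Hw|]. eapply Rle_trans; [|apply Rmax_r].
    pose proof HDF as (Hsl & _).
    assert (HdM : mdet (mmul (madj (eval rho w)) M) = 1)
      by (rewrite mdet_mmul, mdet_madj, HM, mdet_eval by assumption; ring).
    eapply Rle_trans; [apply mnorm_le_fro, HdM|].
    assert (E2 : mmul (madj (eval rho w)) M = mmul (mmul (madj k) (mmul (madj (eval (conj_rep k rho) w)) (gz c 0))) N).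
    { rewrite eval_conj by assumption. rewrite <- !mmul_assoc, <- E.
      rewrite !madj_mmul, madj_madj. rewrite <- !mmul_assoc.
      rewrite !mmul_madj_cancel_l by assumption. reflexivity. }
    rewrite E2. eapply Rle_trans; [apply fro_mmul|]. rewrite HfN.
    apply Rmult_le_compat_r; [lra|]. eapply Rle_trans; [apply fro_mmul|]. rewrite fro_madj, Hfk.
    unfold nd in Hnd. pose proof (fro_nonneg (mmul (madj (eval (conj_rep k rho) w)) (gz c 0))). lra.
Qed.

(** * Local-to-global principle *)

Definition mprod (l : list Mat2) : Mat2 := fold_right mmul mid l.
(** A local quasi-geodesic: consecutive steps are long and do not backtrack, in the sense that norms
    multiply up to the factor [kap]. *)
Fixpoint chain (kap Lam : R) (l : list Mat2) : Prop :=
  match l with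
  | x :: (y :: _) as l' => Lam <= mnorm x /\ kap * (mnorm x * mnorm y) <= mnorm (mmul x y) /\ chain kap Lam l'
  | _ => True
  end.


(** [four_point] at [mid], [x y], [x] and the full product bounds the norm of the latter below by
    [kap a r - a r' / b], where [a], [b] are the norms of [x], [y], and [r], [r'] those of the
    products from [y] on and after [y]. By induction and [2 <= kap * Lam] the loss is at most half
    of the main term. *)
Lemma chain_step kap Lam l : 0 < kap -> 0 < Lam -> 2 <= kap * Lam -> forall x, chain kap Lam (x :: l) -> l <> [] ->
  (forall z, In z (x :: l) -> mdet z = 1) -> kap / 2 * (mnorm x * mnorm (mprod l)) <= mnorm (mprod (x :: l)).
Proof.
  intros Hk HL HkL. induction l as [|y l IH]; intros x Hc Hne Hdet; [easy|].
  destruct Hc as (Hx & Hxy & Hc). destruct l as [|z l].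
  - cbn [mprod fold_right]. rewrite mmul_id_r. pose proof (mnorm_nonneg x). pose proof (mnorm_nonneg y).
    assert (0 <= mnorm x * mnorm y) by nra. nra.
  - assert (IH' : kap / 2 * (mnorm y * mnorm (mprod (z :: l))) <= mnorm (mprod (y :: z :: l))).
    { apply IH; [exact Hc|easy|]. intros a Ha; apply Hdet; now right. }
    clear IH. destruct Hc as (Hy & _).
    set (R' := mprod (z :: l)) in *. assert (ER : mprod (y :: z :: l) = mmul y R') by reflexivity.
    rewrite ER in *. change (mprod (x :: y :: z :: l)) with (mmul x (mmul y R')).
    assert (dx : mdet x = 1) by (apply Hdet; cbn; auto). assert (dy : mdet y = 1) by (apply Hdet; cbn; auto).
    pose proof (four_point mid (mmul x y) x (mmul x (mmul y R'))) as F.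
    rewrite madj_mid, !mmul_id_l in F. rewrite (mmul_madj_cancel_l x) in F by exact dx.
    replace (mmul x (mmul y R')) with (mmul (mmul x y) R') in F at 1 by now rewrite mmul_assoc.
    rewrite mmul_madj_cancel_l in F by (rewrite mdet_mmul, dx, dy; ring).
    rewrite madj_mmul, <- mmul_assoc, mmul_madj_l, mmul_id_r, mnorm_madj in F by exact dx.
    pose proof (mnorm_nonneg x) as px. pose proof (mnorm_nonneg (mmul y R')) as pr. pose proof (mnorm_nonneg R') as pr'.
    assert (py : 0 < mnorm y) by lra.
    set (a := mnorm x) in *. set (b := mnorm y) in *. set (r := mnorm (mmul y R')) in *. set (r' := mnorm R') in *.
    set (m := mnorm (mmul x (mmul y R'))) in *. set (xy := mnorm (mmul x y)) in *.
    assert (H1 : kap * (a * b) * r <= xy * r) by (apply Rmult_le_compat_r; lra).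
    assert (Hkb : 2 <= kap * b) by (apply Rle_trans with (kap * Lam); [lra|apply Rmult_le_compat_l; lra]).
    assert (H2 : r' <= kap * b / 2 * r).
    { assert (b * r' * kap <= 2 * r) by lra. 
      assert (r' <= r). { assert (2 * r' <= kap * b * r') by (apply Rmult_le_compat_r; lra). nra. }
      assert (1 * r <= kap * b / 2 * r) by (apply Rmult_le_compat_r; lra). lra. }
    assert (H3 : a * r' <= a * (kap * b / 2 * r)) by (apply Rmult_le_compat_l; lra).
    apply Rmult_le_reg_r with b; [exact py|].
    nra.
Qed.

Lemma chain_growth kap Lam l t : 0 < kap -> 0 < Lam -> 2 <= kap * Lam -> chain kap Lam (l ++ [t]) ->
  (forall z, In z (l ++ [t]) -> mdet z = 1) ->
  (kap * Lam / 2) ^ length l * mnorm t <= mnorm (mprod (l ++ [t])).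
Proof.
  intros Hk HL HkL. induction l as [|x l IH]; intros Hc Hdet.
  - cbn. rewrite mmul_id_r. lra.
  - assert (Hne : l ++ [t] <> []) by (destruct l; discriminate).
    pose proof (chain_step kap Lam (l ++ [t]) Hk HL HkL x Hc Hne Hdet) as H1.
    change ((x :: l) ++ [t]) with (x :: (l ++ [t])).
    assert (Hx : Lam <= mnorm x).
    { cbn in Hc. destruct (l ++ [t]); [easy|]. apply Hc. }
    assert (Hc' : chain kap Lam (l ++ [t])).
    { cbn in Hc. destruct (l ++ [t]); [easy|]. apply Hc. }
    specialize (IH Hc' (fun z Hz => Hdet z (or_intror Hz))).
    pose proof (mnorm_nonneg t). pose proof (mnorm_nonneg (mprod (l ++ [t]))).
    eapply Rle_trans; [|exact H1]. cbn [length pow].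
    apply Rle_trans with (kap * Lam / 2 * mnorm (mprod (l ++ [t]))).
    + rewrite Rmult_assoc. apply Rmult_le_compat_l; lra.
    + assert (Lam * mnorm (mprod (l ++ [t])) <= mnorm x * mnorm (mprod (l ++ [t]))) by (apply Rmult_le_compat_r; lra).
      nra.
Qed.

(** * Stability of cocompact representations *)

(** [P i] lies, up to a bounded error, on the geodesic from [i] to [M i], at the distance that
    corresponds to norm [lam]. *)
Lemma radial_step M lam : mdet M = 1 -> 1 <= lam <= mnorm M ->
  exists P, mdet P = 1 /\ lam / 2 <= mnorm P <= lam /\ mnorm (mmul (madj P) M) <= 2 * mnorm M / lam.
Proof.
  intros HM (Hl & HlM).
  destruct (mnorm_entries M) as (h1 & h2 & h3 & h4).
  (* [(a, b)] is the column of [M] with the largest entry and [(u, v)] its direction. The other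
     column has component of size [/ n] across this direction because the determinant is 1 or -1. *)
  assert (key : forall a b x y, a * y - b * x = 1 \/ a * y - b * x = -1 -> Rabs a <= mnorm M -> Rabs b <= mnorm M ->
     Rabs x <= mnorm M -> Rabs y <= mnorm M -> mnorm M = Rabs a \/ mnorm M = Rabs b ->
     exists u v n, u * u + v * v = 1 /\ Rabs (u * a + v * b) <= 2 * mnorm M /\ Rabs (u * x + v * y) <= 2 * mnorm M /\
       0 < n /\ mnorm M <= n /\ - v * a + u * b = 0 /\ Rabs (- v * x + u * y) = / n).
  { intros a b x y Hdet Ha Hb Hx Hy Hmax.
    set (n := sqrt (a * a + b * b)).
    assert (Hab : mnorm M * mnorm M <= a * a + b * b).
    { destruct Hmax as [E|E]; rewrite E, <- Rabs_mult, Rabs_pos_eq; nra. }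
    assert (Hn : n * n = a * a + b * b) by (apply sqrt_sqrt; nra).
    assert (Hn0 : 0 < n) by (apply sqrt_lt_R0; nra).
    assert (HMn : mnorm M <= n) by (apply Rnot_lt_le; intro; nra).
    exists (a / n), (b / n), n.
    assert (E1 : a / n * (a / n) + b / n * (b / n) = 1).
    { transitivity ((a * a + b * b) / (n * n)); [field; lra|]. rewrite Hn; field. nra. }
    assert (Hu : Rabs (a / n) <= 1) by (apply Rabs_le; split; nra).
    assert (Hv : Rabs (b / n) <= 1) by (apply Rabs_le; split; nra).
    assert (bd : forall u v p q, Rabs u <= 1 -> Rabs v <= 1 -> Rabs p <= mnorm M -> Rabs q <= mnorm M ->
      Rabs (u * p + v * q) <= 2 * mnorm M).
    { intros u v p q ? ? Hp Hq. eapply Rle_trans; [apply Rabs_triang|].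
      pose proof (Rabs_mul_le u p 1 _ H Hp). pose proof (Rabs_mul_le v q 1 _ H0 Hq). lra. }
    repeat split; auto.
    - field; lra.
    - replace (- (b / n) * x + a / n * y) with ((a * y - b * x) * / n) by (field; lra).
      rewrite Rabs_mult, (Rabs_pos_eq (/ n)) by (left; now apply Rinv_0_lt_compat).
      destruct Hdet as [Hd|Hd]; rewrite Hd; [rewrite Rabs_R1; ring|].
      replace (-1) with (- (1)) by ring. rewrite Rabs_Ropp, Rabs_R1. ring. }
  assert (fin : forall u v n, u * u + v * v = 1 -> 0 < n -> mnorm M <= n ->
    Rabs (u * m11 M + v * m21 M) <= 2 * mnorm M -> Rabs (u * m12 M + v * m22 M) <= 2 * mnorm M ->
    Rabs (- v * m11 M + u * m21 M) <= / n -> Rabs (- v * m12 M + u * m22 M) <= / n ->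
    exists P, mdet P = 1 /\ lam / 2 <= mnorm P <= lam /\ mnorm (mmul (madj P) M) <= 2 * mnorm M / lam).
  { intros u v n E1 Hn HMn g1 g2 g3 g4.
    (* The rotation to the direction [(u, v)] followed on the right by the diagonal matrix with
       entries [lam] and [/ lam]. *)
    exists (mkMat2 (lam * u) (- v / lam) (lam * v) (u / lam)).
    assert (Hil : / lam <= 1) by (rewrite <- Rinv_1; apply Rinv_le_contravar; lra).
    assert (Hil0 : 0 < / lam) by (apply Rinv_0_lt_compat; lra).
    assert (Hu : Rabs u <= 1) by (apply Rabs_le; split; nra).
    assert (Hv : Rabs v <= 1) by (apply Rabs_le; split; nra).
    split; [unfold mdet; cbn; rewrite <- E1; field; lra|]. split; [split|].
    - destruct (mnorm_entries (mkMat2 (lam * u) (- v / lam) (lam * v) (u / lam))) as (k1 & _ & k3 & _). cbn in k1, k3.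
      rewrite Rabs_mult, (Rabs_pos_eq lam) in k1, k3 by lra.
      apply Rnot_lt_le. intros Hlt.
      assert (Rabs u < / 2) by nra. assert (Rabs v < / 2) by nra.
      assert (u * u = Rabs u * Rabs u) by (rewrite <- Rabs_mult; symmetry; apply Rabs_pos_eq; nra).
      assert (v * v = Rabs v * Rabs v) by (rewrite <- Rabs_mult; symmetry; apply Rabs_pos_eq; nra).
      pose proof (Rabs_pos u). pose proof (Rabs_pos v). nra.
    - apply mnorm_lub; cbn; unfold Rdiv; rewrite Rabs_mult, ?Rabs_Ropp; try rewrite (Rabs_pos_eq lam) by lra;
        try rewrite (Rabs_pos_eq (/ lam)) by lra; pose proof (Rabs_pos u); pose proof (Rabs_pos v); nra.
    - assert (B1 : forall z, Rabs z <= 2 * mnorm M -> Rabs (z / lam) <= 2 * mnorm M / lam).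
      { intros z Hz. unfold Rdiv. rewrite Rabs_mult, (Rabs_pos_eq (/ lam)) by lra. apply Rmult_le_compat_r; lra. }
      assert (B2 : forall z, Rabs z <= / n -> Rabs (lam * z) <= 2 * mnorm M / lam).
      { intros z Hz. rewrite Rabs_mult, (Rabs_pos_eq lam) by lra.
        apply Rle_trans with 1.
        - apply Rle_trans with (lam * / n); [apply Rmult_le_compat_l; lra|].
          apply Rmult_le_reg_r with n; [lra|]. rewrite Rmult_assoc, Rinv_l by lra. lra.
        - apply Rmult_le_reg_r with lam; [lra|]. unfold Rdiv. rewrite Rmult_assoc, Rinv_l by lra. lra. }
      apply mnorm_lub; cbn.
      + replace (u / lam * m11 M + - (- v / lam) * m21 M) with ((u * m11 M + v * m21 M) / lam) by (field; lra). auto.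
      + replace (u / lam * m12 M + - (- v / lam) * m22 M) with ((u * m12 M + v * m22 M) / lam) by (field; lra). auto.
      + replace (- (lam * v) * m11 M + lam * u * m21 M) with (lam * (- v * m11 M + u * m21 M)) by ring. auto.
      + replace (- (lam * v) * m12 M + lam * u * m22 M) with (lam * (- v * m12 M + u * m22 M)) by ring. auto. }
  assert (HM' : m11 M * m22 M - m12 M * m21 M = 1) by exact HM.
  assert (Hcol : (mnorm M = Rabs (m11 M) \/ mnorm M = Rabs (m21 M)) \/ (mnorm M = Rabs (m12 M) \/ mnorm M = Rabs (m22 M)))
    by (destruct (mnorm_attained M) as [E|[E|[E|E]]]; auto).
  assert (Hinv : forall n, 0 < n -> 0 < / n) by (intros; now apply Rinv_0_lt_compat).
  destruct Hcol as [Hc|Hc].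
  - destruct (key (m11 M) (m21 M) (m12 M) (m22 M)) as (u & v & n & E1 & b1 & b2 & Hn & HMn & E2 & E3); auto; [left; lra|].
    apply (fin u v n); auto; [rewrite E2, Rabs_R0; left; auto|lra].
  - destruct (key (m12 M) (m22 M) (m11 M) (m21 M)) as (u & v & n & E1 & b1 & b2 & Hn & HMn & E2 & E3); auto; [right; lra|].
    apply (fin u v n); auto; [lra|rewrite E2, Rabs_R0; left; auto].
Qed.

Section Stability.
Variables (g : nat) (rho : rep) (D lam : R).
Hypothesis HDF : DFrep g rho.
Hypothesis HD : 1 <= D.
Hypothesis Hco : cocompact g rho D.
Hypothesis Hlam : 16 * D <= lam.

(** [cst] bounds the loss when one piece is split off a word; [kap0] is the resulting loss for two
    consecutive pieces, and [Lam0] the least norm of a piece. *)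
Definition cst := 8 * (D * D).
Definition kap0 := / (2 * (cst * cst)).
Definition Lam0 := lam / (4 * D).

Lemma sl : SLrep rho. Proof. apply HDF. Qed.

(** The point of [radial_step] is replaced by an orbit point within [D]. The inequality
    [16 * D <= lam] makes the norm of the remainder drop by a factor 4, so peeling terminates. *)
Lemma peel w : wf_word g w -> lam <= mnorm (eval rho w) -> exists s, wf_word g s /\
  Lam0 <= mnorm (eval rho s) <= 2 * lam * D /\
  mnorm (eval rho (winv s ++ w)) <= mnorm (eval rho w) / 4 /\
  mnorm (eval rho s) * mnorm (eval rho (winv s ++ w)) <= cst * mnorm (eval rho w).
Proof.
  intros Hw Hl. set (M := eval rho w) in *. assert (HM : mdet M = 1) by apply mdet_eval, sl.
  destruct (radial_step M lam HM) as (P & HP & (P1 & P2) & P3); [lra|].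
  destruct (Hco P HP) as (s & Hs & HsD).
  assert (Hds : mdet (eval rho s) = 1) by apply mdet_eval, sl.
  exists s. rewrite eval_app, eval_winv. fold M. set (S := eval rho s) in *.
  pose proof (mnorm_madj_mmul_triang mid P S HP) as T1.
  rewrite madj_mid, !mmul_id_l in T1.
  assert (ES : mnorm (mmul (madj P) S) = mnorm (mmul (madj S) P)).
  { rewrite <- mnorm_madj, madj_mmul, madj_madj. reflexivity. }
  rewrite ES in T1.
  pose proof (mnorm_madj_mmul_triang mid S P Hds) as T2. rewrite madj_mid, !mmul_id_l in T2.
  pose proof (mnorm_madj_mmul_triang S P M HP) as T3.
  pose proof (mnorm_nonneg P). pose proof (mnorm_nonneg S). pose proof (mnorm_nonneg M).
  pose proof (mnorm_nonneg (mmul (madj S) P)). pose proof (mnorm_nonneg (mmul (madj P) M)).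
  set (d := mnorm (mmul (madj S) P)) in *. set (pm := mnorm (mmul (madj P) M)) in *.
  assert (Hil : 0 < / lam) by (apply Rinv_0_lt_compat; lra).
  assert (A1 : mnorm S <= 2 * lam * D).
  { assert (mnorm P * d <= lam * D) by (apply Rmult_le_compat; lra). lra. }
  assert (A2 : mnorm (mmul (madj S) M) <= 4 * D * mnorm M / lam).
  { assert (d * pm <= D * (2 * mnorm M / lam)) by (apply Rmult_le_compat; lra). unfold Rdiv in *. lra. }
  assert (A3 : 0 <= mnorm (mmul (madj S) M)) by apply mnorm_nonneg.
  repeat split; auto.
  - unfold Lam0. apply Rmult_le_reg_r with (4 * D); [lra|]. unfold Rdiv. rewrite Rmult_assoc, Rinv_l by lra.
    assert (mnorm S * d <= mnorm S * D) by (apply Rmult_le_compat_l; lra). lra.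
  - eapply Rle_trans; [exact A2|]. apply Rmult_le_reg_r with lam; [lra|].
    replace (4 * D * mnorm M / lam * lam) with (4 * D * mnorm M) by (field; lra).
    assert (mnorm M * (16 * D) <= mnorm M * lam) by (apply Rmult_le_compat_l; lra). lra.
  - apply Rle_trans with (2 * lam * D * (4 * D * mnorm M / lam)).
    + apply Rmult_le_compat; lra.
    + unfold cst. right. field. lra.
Qed.

(** The last clause is the induction invariant: the first piece lies along the way to [w]. It is
    what links the newly peeled piece to the next one in the chain. *)
Lemma decompose n : forall w, wf_word g w -> mnorm (eval rho w) <= lam * 4 ^ n ->
  exists ss t, Forall (wf_word g) (ss ++ [t]) /\ geq g w (concat (ss ++ [t])) /\
    (forall s, In s (ss ++ [t]) -> mnorm (eval rho s) <= 2 * lam * D) /\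
    chain kap0 Lam0 (map (eval rho) (ss ++ [t])) /\
    exists h, hd_error (ss ++ [t]) = Some h /\
      mnorm (eval rho h) * mnorm (eval rho (winv h ++ w)) <= cst * mnorm (eval rho w).
Proof.
  assert (Hcst : 1 <= cst) by (unfold cst; nra).
  assert (base : forall w, wf_word g w -> mnorm (eval rho w) <= lam ->
    exists ss t, Forall (wf_word g) (ss ++ [t]) /\ geq g w (concat (ss ++ [t])) /\
    (forall s, In s (ss ++ [t]) -> mnorm (eval rho s) <= 2 * lam * D) /\
    chain kap0 Lam0 (map (eval rho) (ss ++ [t])) /\
    exists h, hd_error (ss ++ [t]) = Some h /\
      mnorm (eval rho h) * mnorm (eval rho (winv h ++ w)) <= cst * mnorm (eval rho w)).
  { intros w Hw Hn. exists [], w. cbn [app concat]. rewrite app_nil_r. repeat split; auto.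
    - apply geq_refl.
    - intros s [<-|[]]. nra.
    - exists w. split; [reflexivity|]. rewrite eval_app, eval_winv, mmul_madj_l by apply mdet_eval, sl.
      rewrite mnorm_mid. pose proof (mnorm_nonneg (eval rho w)). nra. }
  induction n as [|n IH]; intros w Hw Hn.
  - apply base; auto. cbn in Hn. lra.
  - destruct (Rle_dec lam (mnorm (eval rho w))) as [Hl|Hl]; [|apply base; auto; lra].
    destruct (peel w Hw Hl) as (s & Hs & (s1 & s2) & s3 & s4).
    assert (Hw1 : wf_word g (winv s ++ w)) by (apply wf_app; auto using wf_winv).
    destruct (IH (winv s ++ w) Hw1) as (ss & t & W & E & N & C & h & Hh & HhC).
    { cbn [pow] in Hn. lra. }
    exists (s :: ss), t. cbn [app].
    split; [now constructor|]. split; [|split; [|split]].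
    + cbn [concat]. eapply geq_trans; [|apply geq_app; [apply geq_refl|exact E]].
      rewrite app_assoc. apply geq_sym. exact (geq_app g _ _ _ _ (geq_winv_r g s) (geq_refl g w)).
    + intros z [<-|Hz]; [lra|auto].
    + cbn [map]. destruct (ss ++ [t]) as [|h' rest]; [easy|]. cbn in Hh. injection Hh as ->.
      split; [exact s1|]. split; [|exact C].
      set (M1 := eval rho (winv s ++ w)) in *. set (M := eval rho w) in *.
      set (S := eval rho s) in *. set (H := eval rho h) in *.
      assert (dS : mdet S = 1) by apply mdet_eval, sl. assert (dH : mdet H = 1) by apply mdet_eval, sl.
      assert (dM1 : mdet M1 = 1) by apply mdet_eval, sl. assert (dM : mdet M = 1) by apply mdet_eval, sl.
      assert (EM : M = mmul S M1).
      { unfold M1. rewrite eval_app, eval_winv. symmetry. now apply mmul_madj_cancel_l'. }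
      rewrite eval_app, eval_winv in HhC. fold H M1 in HhC.
      (* The piece [S] satisfies [|S| |M1| <= cst |M|] and the next one satisfies
         [|H| |H^-1 M1| <= cst |M1|]. Inserting this triangle inequality between them gives
         [|S| |H| <= 2 cst^2 |S H|]. *)
      assert (T : mnorm M <= 2 * (mnorm (mmul S H) * mnorm (mmul (madj H) M1))).
      { rewrite EM. rewrite <- (mmul_madj_cancel_l' H M1 dH) at 1. rewrite mmul_assoc. apply mnorm_mmul. }
      pose proof (mnorm_det_half M1 dM1). pose proof (mnorm_det_half S dS). pose proof (mnorm_det_half H dH).
      pose proof (mnorm_nonneg (mmul (madj H) M1)) as pz. pose proof (mnorm_nonneg (mmul S H)) as py.
      set (y := mnorm (mmul S H)) in *. set (z := mnorm (mmul (madj H) M1)) in *.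
      set (a := mnorm S) in *. set (b := mnorm H) in *. set (m1 := mnorm M1) in *. set (m := mnorm M) in *.
      unfold kap0. apply Rmult_le_reg_l with (2 * (cst * cst) * m1); [apply Rmult_lt_0_compat; nra|].
      replace (2 * (cst * cst) * m1 * (/ (2 * (cst * cst)) * (a * b))) with (a * m1 * b) by (field; lra).
      apply Rle_trans with (cst * m * b); [apply Rmult_le_compat_r; lra|].
      apply Rle_trans with (cst * (2 * (y * z)) * b); [apply Rmult_le_compat_r; [lra|apply Rmult_le_compat_l; lra]|].
      replace (cst * (2 * (y * z)) * b) with (2 * cst * y * (b * z)) by ring.
      replace (2 * (cst * cst) * m1 * y) with (2 * cst * y * (cst * m1)) by ring.
      apply Rmult_le_compat_l; [|exact HhC]. apply Rmult_le_pos; lra.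
    + exists s. split; [reflexivity|exact s4].
Qed.
End Stability.

Lemma mnorm_mdiff_sym A B : mnorm (mdiff A B) = mnorm (mdiff B A).
Proof. rewrite <- mnorm_mneg. f_equal. unfold mdiff, mneg; cbn. f_equal; ring. Qed.
Lemma mnorm_mdiff_triang A B C : mnorm (mdiff A C) <= mnorm (mdiff A B) + mnorm (mdiff B C).
Proof.
  destruct (mnorm_entries (mdiff A B)) as (a1 & a2 & a3 & a4).
  destruct (mnorm_entries (mdiff B C)) as (b1 & b2 & b3 & b4). cbn in *.
  assert (T : forall x y z, Rabs (x - z) <= Rabs (x - y) + Rabs (y - z)).
  { intros x y z. replace (x - z) with ((x - y) + (y - z)) by ring. apply Rabs_triang. }
  apply mnorm_lub; cbn.
  - pose proof (T (m11 A) (m11 B) (m11 C)). lra.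
  - pose proof (T (m12 A) (m12 B) (m12 C)). lra.
  - pose proof (T (m21 A) (m21 B) (m21 C)). lra.
  - pose proof (T (m22 A) (m22 B) (m22 C)). lra.
Qed.
Lemma mnorm_le_mdiff A B : mnorm A <= mnorm B + mnorm (mdiff A B).
Proof.
  assert (E : forall M, mnorm M = mnorm (mdiff M (mkMat2 0 0 0 0))).
  { intros [a b c d]. unfold mdiff; cbn. now rewrite !Rminus_0_r. }
  rewrite (E A), (E B). pose proof (mnorm_mdiff_triang A B (mkMat2 0 0 0 0)). lra.
Qed.
Lemma mnorm_mdiff_mmul A A' B B' :
  mnorm (mdiff (mmul A' B') (mmul A B)) <= 2 * (mnorm (mdiff A' A) * (mnorm B + mnorm (mdiff B' B)) + mnorm A * mnorm (mdiff B' B)).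
Proof.
  eapply Rle_trans; [apply (mnorm_mdiff_triang _ (mmul A B'))|].
  rewrite <- mdiff_mmul_r, <- mdiff_mmul_l.
  pose proof (mnorm_mmul (mdiff A' A) B'). pose proof (mnorm_mmul A (mdiff B' B)).
  pose proof (mnorm_le_mdiff B' B). pose proof (mnorm_nonneg (mdiff A' A)).
  assert (mnorm (mdiff A' A) * mnorm B' <= mnorm (mdiff A' A) * (mnorm B + mnorm (mdiff B' B))) by (apply Rmult_le_compat_l; lra).
  lra.
Qed.
Lemma near_weaken g r r' rho rho' : r <= r' -> near g r rho rho' -> near g r' rho rho'.
Proof. intros H Hn i Hi. destruct (Hn i Hi) as (h1 & h2 & h3 & h4). repeat split; lra. Qed.

Lemma eval_continuous g rho w : wf_word g w -> forall e, e > 0 -> exists r, r > 0 /\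
  forall rho', near g r rho rho' -> mnorm (mdiff (eval rho' w) (eval rho w)) < e.
Proof.
  intros Hw; induction Hw as [|[i b] w Hi Hw IH]; intros e He.
  - exists 1. split; [lra|]. intros rho' _. cbn. unfold mdiff, mid, mnorm; cbn.
    rewrite !Rminus_diag, Rabs_R0. unfold Rmax; repeat destruct Rle_dec; lra.
  - cbn in Hi. set (A := eval_letter rho (i, b)). set (W := eval rho w).
    pose proof (mnorm_nonneg A) as pA. pose proof (mnorm_nonneg W) as pW.
    set (e1 := e / (4 * (mnorm A + 1))). set (e2 := e / (4 * (mnorm W + e1))).
    assert (He1 : e1 > 0) by (apply Rdiv_lt_0_compat; lra).
    assert (He2 : e2 > 0) by (apply Rdiv_lt_0_compat; lra).
    destruct (IH e1 He1) as (r & Hr & HC). exists (Rmin r e2). split; [now apply Rmin_glb_lt|].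
    intros rho' Hn. pose proof (near_weaken _ _ _ _ _ (Rmin_l r e2) Hn) as Hn1. specialize (HC rho' Hn1).
    assert (HA : mnorm (mdiff (eval_letter rho' (i, b)) A) < e2).
    { pose proof (near_weaken _ _ _ _ _ (Rmin_r r e2) Hn i Hi) as Hc. apply close_mdiff in Hc.
      rewrite mnorm_mdiff_sym in Hc. unfold A, eval_letter; cbn [fst snd]. destruct b; [|exact Hc].
      replace (mdiff (madj (rho' i)) (madj (rho i))) with (madj (mdiff (rho' i) (rho i))) by (unfold mdiff, madj; cbn; f_equal; ring).
      now rewrite mnorm_madj. }
    change (mnorm (mdiff (mmul (eval_letter rho' (i, b)) (eval rho' w)) (mmul A W)) < e).
    eapply Rle_lt_trans; [apply mnorm_mdiff_mmul|]. fold W in HC.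
    pose proof (mnorm_nonneg (mdiff (eval_letter rho' (i, b)) A)) as p1.
    pose proof (mnorm_nonneg (mdiff (eval rho' w) W)) as p2.
    set (x := mnorm (mdiff (eval_letter rho' (i, b)) A)) in *. set (y := mnorm (mdiff (eval rho' w) W)) in *.
    assert (x * (mnorm W + y) <= e2 * (mnorm W + e1)) by (apply Rmult_le_compat; lra).
    assert (mnorm A * y <= mnorm A * e1) by (apply Rmult_le_compat_l; lra).
    assert (e2 * (mnorm W + e1) = e / 4) by (unfold e2; field; lra).
    assert (mnorm A * e1 < e / 4).
    { replace (e / 4) with ((mnorm A + 1) * e1) by (unfold e1; field; lra). lra. }
    lra.
Qed.
Lemma eval_continuous_list g rho l : Forall (wf_word g) l -> forall e, e > 0 -> exists r, r > 0 /\
  forall rho', near g r rho rho' -> forall w, In w l -> mnorm (mdiff (eval rho' w) (eval rho w)) < e.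
Proof.
  intros Hl e He; induction Hl as [|w l Hw Hl (r & Hr & IH)].
  - exists 1. split; [lra|]. intros ? _ ? [].
  - destruct (eval_continuous g rho w Hw e He) as (r' & Hr' & Hc). exists (Rmin r r').
    split; [now apply Rmin_glb_lt|]. intros rho' Hn z [<-|Hz].
    + apply Hc. eapply near_weaken; [apply Rmin_r|exact Hn].
    + apply IH; auto. eapply near_weaken; [apply Rmin_l|exact Hn].
Qed.

Lemma eval_concat rho l : eval rho (concat l) = mprod (map (eval rho) l).
Proof. induction l as [|w l IH]; [reflexivity|]. cbn [concat map]. rewrite eval_app, IH. reflexivity. Qed.

Lemma chain_perturb rho rho' kap Lam K e l : 0 < kap -> 1 <= K -> 1 <= Lam -> 0 < e -> e <= / 2 ->
  e * (1 + kap * (K + 1)) <= kap / 8 ->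
  (forall s, In s l -> / 2 < mnorm (eval rho s) <= K) ->
  (forall s, In s l -> mnorm (mdiff (eval rho' s) (eval rho s)) < e) ->
  (forall s t, In s l -> In t l -> mnorm (mdiff (eval rho' (s ++ t)) (eval rho (s ++ t))) < e) ->
  chain kap Lam (map (eval rho) l) -> chain (kap / 2) (Lam / 2) (map (eval rho') l).
Proof.
  intros Hk HK HL He He2 Hek Hb H1 H2. induction l as [|s l IH]; intros Hc; [exact I|].
  destruct l as [|t l]; [exact I|]. cbn [map] in *. destruct Hc as (Hs & Hst & Hc).
  assert (Is : In s (s :: t :: l)) by (cbn; auto). assert (It : In t (s :: t :: l)) by (cbn; auto).
  pose proof (H1 s Is). pose proof (H1 t It). pose proof (H2 s t Is It) as H12.
  pose proof (Hb s Is). pose proof (Hb t It).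
  pose proof (mnorm_le_mdiff (eval rho' s) (eval rho s)). pose proof (mnorm_le_mdiff (eval rho' t) (eval rho t)).
  pose proof (mnorm_le_mdiff (eval rho s) (eval rho' s)) as Hs'. rewrite mnorm_mdiff_sym in Hs'.
  pose proof (mnorm_le_mdiff (eval rho (s ++ t)) (eval rho' (s ++ t))) as Hst'. rewrite mnorm_mdiff_sym in Hst'.
  rewrite !eval_app in *.
  pose proof (mnorm_nonneg (eval rho' s)). pose proof (mnorm_nonneg (eval rho' t)).
  set (a := mnorm (eval rho s)) in *. set (b := mnorm (eval rho t)) in *.
  set (a' := mnorm (eval rho' s)) in *. set (b' := mnorm (eval rho' t)) in *.
  set (c := mnorm (mmul (eval rho s) (eval rho t))) in *. set (c' := mnorm (mmul (eval rho' s) (eval rho' t))) in *.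
  split; [change (Lam / 2 <= a'); lra|]. split.
  - change (kap / 2 * (a' * b') <= c').
    assert (a' * b' <= (a + e) * (b + e)) by (apply Rmult_le_compat; lra).
    assert (e * (a + b + e) <= e * (2 * (K + 1))) by (apply Rmult_le_compat_l; lra).
    assert (/ 2 * / 2 <= a * b) by (apply Rmult_le_compat; lra).
    assert (kap / 2 * (a' * b') <= kap / 2 * (a * b + e * (2 * (K + 1)))) by (apply Rmult_le_compat_l; lra).
    assert (kap / 2 * (/ 2 * / 2) <= kap / 2 * (a * b)) by (apply Rmult_le_compat_l; lra).
    lra.
  - apply IH; auto.
    + intros; apply Hb; now right.
    + intros; apply H1; now right.
    + intros; apply H2; now right.
Qed.

(** All pieces of all decompositions lie in one ball, so finitely many matrices have to be
    controlled. Near [rho] every chain remains a chain with halved constants, whatever its length; a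
    word that [rho'] sends near plus or minus the identity is then a single piece, which [rho] also
    sends near it. *)
Theorem DF_stable g rho : (1 <= g)%nat -> DFrep g rho -> exists r, r > 0 /\
  forall rho', SLrep rho' -> pm_eq (eval rho' (relator g)) mid -> near g r rho rho' -> DFrep g rho'.
Proof.
  intros Hg HDF. destruct (DF_cocompact g rho Hg HDF) as (D & HD & Hco).
  set (C := cst D). assert (HC : 1 <= C) by (unfold C, cst; nra).
  set (kap := kap0 D).
  assert (Hkap : 0 < kap) by (unfold kap, kap0; fold C; apply Rinv_0_lt_compat; nra).
  (* This gives [64 <= kap * Lam]. With both constants halved, the growth rate per piece is still at
     least 8, so a product of two or more pieces has norm at least 4, too far from the identity. *)
  set (lam := 16 * D + 64 * (4 * D) * / kap).
  assert (Hik : 0 < / kap) by now apply Rinv_0_lt_compat.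
  assert (Hlam : 16 * D <= lam).
  { unfold lam. assert (0 <= 64 * (4 * D) * / kap) by (apply Rmult_le_pos; lra). lra. }
  set (Lam := Lam0 D lam).
  assert (HLam : 64 * / kap <= Lam /\ 1 <= Lam).
  { assert (E : Lam = 4 + 64 * / kap) by (unfold Lam, Lam0, lam; field; split; lra). rewrite E. lra. }
  destruct HLam as (HLk & HL1).
  assert (HkL : 64 <= kap * Lam).
  { apply Rmult_le_reg_l with (/ kap); [exact Hik|]. rewrite <- Rmult_assoc, Rinv_l by lra. lra. }
  set (K := 2 * lam * D). assert (HK : 1 <= K) by (unfold K; nra).
  destruct (ball_list_exists g rho HDF K) as (L & HLwf & _ & HLc).
  pose proof HDF as (Hsl & Hdet & Hrel & (eps & Heps & Hdis) & Hfai).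
  set (e := Rmin (Rmin (/ 2) (eps / 2)) (kap / 8 / (1 + kap * (K + 1)))).
  assert (Hden : 0 < 1 + kap * (K + 1)) by nra.
  assert (He : 0 < e).
  { unfold e. repeat apply Rmin_glb_lt; try lra. apply Rdiv_lt_0_compat; lra. }
  assert (He2 : e <= / 2) by (eapply Rle_trans; [apply Rmin_l|apply Rmin_l]).
  assert (Hee : e <= eps / 2) by (eapply Rle_trans; [apply Rmin_l|apply Rmin_r]).
  assert (Hek : e * (1 + kap * (K + 1)) <= kap / 8).
  { apply Rle_trans with (kap / 8 / (1 + kap * (K + 1)) * (1 + kap * (K + 1))).
    - apply Rmult_le_compat_r; [lra|apply Rmin_r].
    - right. field. lra. }
  (* The chain condition involves products of two consecutive pieces, so these are controlled as
     well. *)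
  set (L2 := L ++ flat_map (fun s => map (fun t => s ++ t) L) L).
  assert (HL2 : Forall (wf_word g) L2).
  { rewrite Forall_forall in HLwf. apply Forall_forall. intros w Hw. apply in_app_iff in Hw.
    destruct Hw as [Hw|Hw]; [auto|]. apply in_flat_map in Hw. destruct Hw as (s & Hs & Hw).
    apply in_map_iff in Hw. destruct Hw as (t & <- & Ht). apply wf_app; auto. }
  destruct (eval_continuous_list g rho L2 HL2 e He) as (r & Hr & Hcont).
  exists r. split; [exact Hr|]. intros rho' Hsl' Hrel' Hn.
  assert (H1 : forall s, In s L -> mnorm (mdiff (eval rho' s) (eval rho s)) < e).
  { intros s Hs. apply (Hcont rho' Hn). apply in_app_iff; now left. }
  assert (H2 : forall s t, In s L -> In t L -> mnorm (mdiff (eval rho' (s ++ t)) (eval rho (s ++ t))) < e).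
  { intros s t Hs Ht. apply (Hcont rho' Hn). apply in_app_iff; right. apply in_flat_map. exists s; split; [exact Hs|].
    now apply in_map. }
  assert (main : forall w, wf_word g w -> (close (Rmin 1 (eps / 2)) (eval rho' w) mid \/
      close (Rmin 1 (eps / 2)) (eval rho' w) (mneg mid)) -> geq g w []).
  { intros w Hw Hcl.
    assert (Hpow : exists n, mnorm (eval rho w) <= lam * 4 ^ n).
    { destruct (Pow_x_infinity 4) with (b := mnorm (eval rho w)) as (n & Hn4); [rewrite Rabs_pos_eq; lra|].
      exists n. specialize (Hn4 n (Nat.le_refl n)). rewrite Rabs_pos_eq in Hn4 by (apply pow_le; lra).
      assert (1 * 4 ^ n <= lam * 4 ^ n) by (apply Rmult_le_compat_r; [apply pow_le; lra|nra]). lra. }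
    destruct Hpow as (n & Hpow).
    destruct (decompose g rho D lam HDF HD Hco Hlam n w Hw Hpow) as (ss & t & Wf & E & N & Ch & _).
    (* The pieces are arbitrary words; only their representatives in [L] are known to move
       little. *)
    assert (Hrep : exists vs v, Forall2 (geq g) (ss ++ [t]) (vs ++ [v]) /\ (forall z, In z (vs ++ [v]) -> In z L)
        /\ length vs = length ss).
    { assert (HR : forall s, In s (ss ++ [t]) -> exists v, In v L /\ geq g s v).
      { intros s Hs. rewrite Forall_forall in Wf. apply HLc; [auto|]. apply N; auto. }
      clear - HR. induction ss as [|s ss IH].
      - destruct (HR t) as (v & Hv & Hg); [cbn; auto|]. exists [], v. cbn. repeat split; auto. now intros z [<-|[]].
      - destruct IH as (vs & v & F2 & HI & Hlen); [intros; apply HR; now right|].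
        destruct (HR s) as (v0 & Hv0 & Hg0); [now left|].
        exists (v0 :: vs), v. cbn. repeat split; auto. intros z [<-|Hz]; auto. }
    destruct Hrep as (vs & v & F2 & HvL & Hlen).
    assert (Evs : geq g (concat (ss ++ [t])) (concat (vs ++ [v]))).
    { clear - F2. induction F2 as [|a b l l' Hab F IH]; cbn; [apply geq_refl|now apply geq_app]. }
    assert (Hnorm : Forall2 (fun A B => mnorm A = mnorm B) (map (eval rho) (ss ++ [t])) (map (eval rho) (vs ++ [v]))).
    { clear - F2 HDF. induction F2 as [|a b l l' Hab F IH]; cbn; constructor; auto. apply mnorm_pm. now apply DF_pm with g. }
    assert (Chv : chain kap Lam (map (eval rho) (vs ++ [v]))).
    { clear - F2 Ch HDF. change (chain kap Lam (map (eval rho) (ss ++ [t]))) in Ch.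
      induction F2 as [|a b l l' Hab F IH]; [exact I|]. inversion F as [|c d m m' Hcd F']; subst; [exact I|].
      cbn [map] in *. destruct Ch as (c1 & c2 & c3).
      rewrite (mnorm_pm _ _ (DF_pm _ _ _ _ HDF Hab)) in c1, c2. rewrite (mnorm_pm _ _ (DF_pm _ _ _ _ HDF Hcd)) in c2.
      rewrite (mnorm_pm _ _ (pm_eq_mmul _ _ _ _ (DF_pm _ _ _ _ HDF Hab) (DF_pm _ _ _ _ HDF Hcd))) in c2.
      split; [exact c1|]. split; [exact c2|]. apply IH. exact c3. }
    assert (Hb : forall s, In s (vs ++ [v]) -> / 2 < mnorm (eval rho s) <= K).
    { intros s Hs. split; [apply mnorm_det_half, mdet_eval, Hsl|].
      apply in_split in Hs. destruct Hs as (l1 & l2 & Es). rewrite Es in F2.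
      apply Forall2_app_inv_r in F2. destruct F2 as (m1 & m2 & _ & F & Em).
      inversion F as [|x y p q Hxy _]; subst. rewrite <- (mnorm_pm _ _ (DF_pm _ _ _ _ HDF Hxy)). apply N.
      rewrite Em. apply in_app_iff; cbn; auto. }
    pose proof (chain_perturb rho rho' kap Lam K e (vs ++ [v]) Hkap HK HL1 He He2 Hek Hb
      (fun s Hs => H1 s (HvL s Hs)) (fun s t Hs Ht => H2 s t (HvL s Hs) (HvL t Ht)) Chv) as Ch'.
    assert (Ew : geq g w (concat (vs ++ [v]))) by (eapply geq_trans; eassumption).
    assert (Epm : pm_eq (eval rho' w) (mprod (map (eval rho') (vs ++ [v])))).
    { rewrite <- eval_concat. now apply geq_pm with g. }
    destruct vs as [|v0 vs].
    - cbn [app concat] in Ew. rewrite app_nil_r in Ew.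
      assert (Hv : In v L) by (apply HvL; cbn; auto).
      assert (Hvwf : wf_word g v) by (rewrite Forall_forall in HLwf; auto).
      eapply geq_trans; [exact Ew|]. apply Hfai; [exact Hvwf|]. apply Hdis; [exact Hvwf|].
      cbn [app map mprod fold_right] in Epm. rewrite mmul_id_r in Epm.
      specialize (H1 v Hv). rewrite mnorm_mdiff_sym in H1.
      assert (key : forall J, close (Rmin 1 (eps / 2)) (eval rho' v) J -> close eps (eval rho v) J).
      { intros J HJ. apply close_mdiff. apply close_mdiff in HJ.
        eapply Rle_lt_trans; [apply (mnorm_mdiff_triang _ (eval rho' v))|].
        pose proof (Rmin_r 1 (eps / 2)). lra. }
      destruct Epm as [Ep|Ep]; rewrite Ep in Hcl.
      + destruct Hcl as [Hcl|Hcl]; [left|right]; auto.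
      + destruct Hcl as [Hcl|Hcl]; [right|left]; apply key; apply close_mdiff; apply close_mdiff in Hcl;
          rewrite <- mnorm_mneg, <- mdiff_mneg, ?mneg_mneg in Hcl; exact Hcl.
    - exfalso.
      rewrite map_app in Ch', Epm. cbn [map] in Ch', Epm.
      pose proof (chain_growth (kap / 2) (Lam / 2) (eval rho' v0 :: map (eval rho') vs) (eval rho' v)) as G.
      assert (G' : (kap / 2 * (Lam / 2) / 2) ^ length (eval rho' v0 :: map (eval rho') vs) * mnorm (eval rho' v) <=
          mnorm (mprod ((eval rho' v0 :: map (eval rho') vs) ++ [eval rho' v]))).
      { apply G; try lra; [exact Ch'|]. intros z Hz.
        apply in_app_iff in Hz. destruct Hz as [[<-|Hz]|[<-|[]]]; try now apply mdet_eval.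
        apply in_map_iff in Hz. destruct Hz as (s & <- & _). now apply mdet_eval. }
      rewrite <- (mnorm_pm _ _ Epm) in G'.
      assert (Hbig : 8 <= kap / 2 * (Lam / 2) / 2) by lra.
      set (q := kap / 2 * (Lam / 2) / 2) in *. cbn [length pow] in G'.
      pose proof (pow_R1_Rle q (length (map (eval rho') vs))) as Hp. specialize (Hp ltac:(lra)).
      pose proof (mnorm_det_half _ (mdet_eval rho' Hsl' v)) as Hv.
      assert (Hsmall : mnorm (eval rho' w) < 2).
      { pose proof (Rmin_l 1 (eps / 2)).
        destruct Hcl as [Hcl|Hcl]; apply close_mdiff in Hcl;
        [pose proof (mnorm_le_mdiff (eval rho' w) mid) as Hm|pose proof (mnorm_le_mdiff (eval rho' w) (mneg mid)) as Hm];
        rewrite ?mnorm_mneg, mnorm_mid in Hm; lra. }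
      set (p := q ^ length (map (eval rho') vs)) in *.
      assert (8 * 1 <= q * p) by (apply Rmult_le_compat; lra).
      assert (8 * / 2 <= q * p * mnorm (eval rho' v)) by (apply Rmult_le_compat; lra). lra. }
  assert (Htr : forall w, geq g w [] -> pm_eq (eval rho' w) mid) by (intros w E; exact (geq_pm rho' Hsl' g w [] Hrel' E)).
  assert (Hmin : Rmin 1 (eps / 2) > 0) by (apply Rmin_glb_lt; lra).
  split; [exact Hsl'|]. split; [intros; apply Hsl'|]. split; [exact Hrel'|]. split.
  - exists (Rmin 1 (eps / 2)). split; [exact Hmin|]. intros w Hw Hcl. apply Htr. now apply main.
  - intros w Hw Hp. apply main; [exact Hw|].
    assert (Z : forall M, close (Rmin 1 (eps / 2)) M M).
    { intros M. repeat split; rewrite Rminus_diag, Rabs_R0; exact Hmin. }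
    destruct Hp as [-> | ->]; [left|right]; apply Z.
Qed.

(** * Hilbert's basis theorem and stabilization of zero sets *)

Module HilbertBasis.
Import ssreflect ssrfun ssrbool eqtype ssrnat seq ssralg poly Rstruct.
Import GRing.Theory.
Local Open Scope ring_scope.

Definition ideal (A : comNzRingType) (J : A -> Prop) :=
  J 0 /\ (forall a b, J a -> J b -> J (a + b)) /\ (forall r a, J a -> J (r * a)).
Definition noetherian (A : comNzRingType) := forall I : nat -> A -> Prop,
  (forall n, ideal A (I n)) -> (forall n a, I n a -> I n.+1 a) -> exists N, forall n a, I n a -> I N a.

Lemma noetherian_R : noetherian (Rdefinitions.R : comNzRingType).
Proof.
move=> I HI Hinc.
case: (classic (exists n a, I n a /\ a <> 0)) => [[n [a [Ha Ha0]]]|Hn].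
  exists n => m b _. have [_ [_ HM]] := HI n.
  have -> : b = (b / a) * a by rewrite divfK //; apply/eqP.
  exact: HM.
exists O => n a Ha. case: (classic (a = 0)) => [->|Ha0]; first by case: (HI O).
by case: Hn; exists n, a.
Qed.

Lemma chain_mono (A : Type) (I : nat -> A -> Prop) : (forall n a, I n a -> I n.+1 a) ->
  forall m n a, (m <= n)%N -> I m a -> I n a.
Proof.
move=> H m n a /subnK <-. elim: (n - m)%N => [|k IH] //= Ha. rewrite addSn. apply: H. exact: IH.
Qed.

(** [J n d] is the ideal of coefficients of degree [d] of the elements of [I n] of degree at most
    [d]; it increases in both indices. A single [N] at which all these ideals have stabilized lets
    leading terms be cancelled within [I N]. *)
Lemma noetherian_poly (A : comNzRingType) : noetherian A -> noetherian {poly A}.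
Proof.
move=> HA I HI Hinc.
have mono := chain_mono _ _ Hinc.
pose J n d (a : A) := exists p, [/\ I n p, (size p <= d.+1)%N & p`_d = a].
have HJ n d : ideal A (J n d).
  have [H0 [HD HM]] := HI n. split; [|split].
  - by exists 0; split; rewrite ?size_poly0 ?coef0.
  - move=> a b [p [Hp sp <-]] [q [Hq sq <-]]. exists (p + q); split; [exact: HD| |by rewrite coefD].
    apply: leq_trans (size_polyD _ _) _. by rewrite geq_max sp sq.
  - move=> r a [p [Hp sp <-]]. exists (r%:P * p); split; [exact: HM| |by rewrite coefCM].
    by rewrite mul_polyC; apply: leq_trans (size_scale_leq _ _) sp.
have Jn n d a : J n d a -> J n.+1 d a by move=> [p [Hp sp e]]; exists p; split=> //; exact: Hinc.
have Jd n d a : J n d a -> J n d.+1 a.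
  move=> [p [Hp sp e]]; exists ('X * p); have [_ [_ HM]] := HI n; split; [exact: HM| |].
    rewrite mulrC; apply: leq_trans (size_polyMleq _ _) _. by rewrite size_polyX addn2 /= ltnS.
  by rewrite coefXM.
(* The diagonal sequence settles all degrees from [k0] on at once; only the finitely many smaller
   degrees need separate stabilization. *)
have [k0 Hk0] : exists N, forall n a, J n n a -> J N N a.
  by apply: (HA (fun n => J n n)) => // n a Ha; apply: Jd; apply: Jn.
have [N HN1 HN2] : exists2 N, (k0 <= N)%N & forall d, (d < k0)%N -> forall n a, J n d a -> J N d a.
  have Hd d : exists N, forall n a, J n d a -> J N d a.
    by apply: (HA (fun n => J n d)) => [n|n a]; [exact: HJ|exact: Jn].
  have Jmono d := chain_mono _ (fun n => J n d) (fun n => Jn n d).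
  have [N HN] : exists N, forall d, (d < k0)%N -> forall n a, J n d a -> J N d a.
    elim: k0 {Hk0} => [|k [N HN]]; first by exists O.
    have [M HM] := Hd k. exists (maxn N M) => d. rewrite ltnS leq_eqVlt => /orP [/eqP -> |Hdk] n a Ha.
      exact: (Jmono _ _ _ _ (leq_maxr N M) (HM n a Ha)).
    exact: (Jmono _ _ _ _ (leq_maxl N M) (HN d Hdk n a Ha)).
  exists (maxn k0 N) => [|d Hdk n a Ha]; first exact: leq_maxl.
  exact: (Jmono _ _ _ _ (leq_maxr k0 N) (HN d Hdk n a Ha)).
exists N.
(* Induction on the size: an element of [I N] with the same coefficient in top degree is
   subtracted. *)
have main s : forall n (p : {poly A}), (size p <= s)%N -> I n p -> I N p.
  elim: s => [|s IH] n p sp Hp.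
    have -> : p = 0 by apply/eqP; rewrite -size_poly_eq0 -leqn0. by case: (HI N).
  have [q [Hq sq eq]] : exists q : {poly A}, [/\ I N q, (size q <= s.+1)%N & q`_s = p`_s].
    have Hps : J n s p`_s by exists p.
    case: (ltnP s k0) => Hs.
      exact: HN2 Hs n _ Hps.
    have Hm : J (maxn n s) (maxn n s) p`_s.
      apply: (chain_mono _ (fun d => J (maxn n s) d) (fun d => Jd (maxn n s) d) s _ _ (leq_maxr n s)).
      exact: (chain_mono _ (fun m => J m s) (fun m => Jn m s) n _ _ (leq_maxl n s)).
    have [q [Hq sq e]] := Hk0 _ _ Hm.
    exists ('X^(s - k0) * q); have [_ [_ HM]] := HI N; split.
    - apply: HM. exact: (mono _ _ _ HN1 Hq).
    - rewrite mulrC; apply: leq_trans (size_polyMleq _ _) _. rewrite size_polyXn addnS /=.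
      by apply: leq_trans (leq_add sq (leqnn _)) _; rewrite addSn subnKC.
    - by rewrite coefXnM ltnNge leq_subr /= subKn.
  have [H0 [HD HM]] := HI N.
  have -> : p = (p - q) + q by rewrite subrK.
  apply: HD => //. apply: (IH (maxn n N)).
    apply/leq_sizeP => j; rewrite leq_eqVlt => /orP [/eqP <- |Hj]; first by rewrite coefB eq subrr.
    by rewrite coefB !nth_default ?subrr //; [exact: leq_trans sq Hj|exact: leq_trans sp Hj].
  have [_ [HD' HM']] := HI (maxn n N). apply: HD'; first exact: (mono _ _ _ (leq_maxl n N) Hp).
  rewrite -mulN1r. apply: HM'. exact: (mono _ _ _ (leq_maxr n N) Hq).
by move=> n p; exact: main.
Qed.

(** The polynomial ring in [m] variables as an iterated [{poly A}], with its evaluations. The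
    variables beyond [m] are zero, in accordance with the points to which it is applied. *)
Lemma tower m : exists A : comNzRingType, noetherian A /\
  exists (X : nat -> A) (c : {rmorphism Rdefinitions.R -> A}) (ev : (nat -> Rdefinitions.R) -> {rmorphism A -> Rdefinitions.R}),
  forall x, [/\ forall a, ev x (c a) = a, forall n, (n < m)%N -> ev x (X n) = x n & forall n, (m <= n)%N -> X n = 0].
Proof.
elim: m => [|m [A [HA [X [c [ev H]]]]]].
  exists (Rdefinitions.R : comNzRingType); split; first exact: noetherian_R.
  exists (fun _ => 0), (idfun : {rmorphism Rdefinitions.R -> Rdefinitions.R}).
  exists (fun _ => (idfun : {rmorphism Rdefinitions.R -> Rdefinitions.R})) => x; split=> //.
exists {poly A}; split; first exact: noetherian_poly.
exists (fun n => if n == m then 'X else (X n)%:P), (polyC \o c), (fun x => horner_eval (x m) \o map_poly (ev x)) => x.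
have [H1 H2 H3] := H x. split.
- by move=> a; rewrite /= /horner_eval map_polyC hornerC; exact: H1.
- move=> n; rewrite ltnS leq_eqVlt => /orP [/eqP ->|Hn]; first by rewrite eqxx /= /horner_eval map_polyX hornerX.
  by rewrite (ltn_eqF Hn) /= /horner_eval map_polyC hornerC; exact: H2.
- by move=> n Hn; rewrite (gtn_eqF Hn) H3 ?(ltnW Hn) // polyC0.
Qed.

Fixpoint interp (A : comNzRingType) (X : nat -> A) (c : Rdefinitions.R -> A) (p : Defs.poly) : A :=
  match p with
  | PVar n => X n
  | PConst r => c r
  | PAdd p q => interp A X c p + interp A X c q
  | PMul p q => interp A X c p * interp A X c q
  end.

Theorem zero_sets_stabilize (m : nat) (E : nat -> Defs.poly -> Prop) :
  (forall n p, E n p -> E n.+1 p) -> exists N, forall x : nat -> Rdefinitions.R, (forall n, (m <= n)%coq_nat -> x n = 0) ->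
  (forall p, E N p -> peval x p = 0) -> forall p, E N.+1 p -> peval x p = 0.
Proof.
move=> HE. have [A [HA [X [c [ev H]]]]] := tower m.
(* The ideal generated by the equations [E n], as the intersection of all ideals that contain
   them. *)
pose I n (a : A) := forall J, ideal A J -> (forall p, E n p -> J (interp A X c p)) -> J a.
have [|n a Ha J HJ Hp|N HN] := HA I.
- move=> n; split; [|split].
  + by move=> J [].
  + by move=> a b Ha Hb J HJ Hp; have [_ [HD _]] := HJ; apply: HD; [exact: Ha|exact: Hb].
  + by move=> r a Ha J HJ Hp; have [_ [_ HM]] := HJ; apply: HM; exact: Ha.
- by apply: Ha => // p Hp'; apply: Hp; exact: HE.
exists N => x Hx HZ p Hp. have [H1 H2 H3] := H x.
have HV q : ev x (interp A X c q) = peval x q.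
  elim: q => [n|r|q1 IH1 q2 IH2|q1 IH1 q2 IH2] /=.
  - case: (ltnP n m) => Hn; first exact: H2. by rewrite H3 // rmorph0 Hx //; apply/leP.
  - exact: H1.
  - by rewrite rmorphD IH1 IH2.
  - by rewrite rmorphM IH1 IH2.
rewrite -HV. have HI : I N.+1 (interp A X c p) by move=> J _; apply.
(* The ideal of polynomials that vanish at [x] contains the equations of stage [N], hence the ideal
   they generate. *)
apply: (HN _ _ HI (fun a => ev x a = 0)); last by move=> q Hq; rewrite HV; exact: HZ.
split; first exact: rmorph0. split=> [a b Ha Hb|r a Ha]; first by rewrite rmorphD Ha Hb addr0.
by rewrite rmorphM Ha mulr0.
Qed.
End HilbertBasis.

Lemma zero_sets_stabilize (m : nat) (E : nat -> poly -> Prop) :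
  (forall n p, E n p -> E (S n) p) -> exists N, forall x : nat -> R, (forall n, (m <= n)%nat -> x n = 0) ->
  (forall p, E N p -> peval x p = 0) -> forall p, E (S N) p -> peval x p = 0.
Proof. exact (HilbertBasis.zero_sets_stabilize m E). Qed.

(** * Word maps as polynomial maps *)

Definition pmat := (poly * poly * poly * poly)%type.
Definition pm_eval (x : nat -> R) (P : pmat) : Mat2 :=
  let '(a, b, c, d) := P in mkMat2 (peval x a) (peval x b) (peval x c) (peval x d).
Definition pm_mul (P Q : pmat) : pmat :=
  let '(a, b, c, d) := P in let '(e, f, h, k) := Q in
  (PAdd (PMul a e) (PMul b h), PAdd (PMul a f) (PMul b k), PAdd (PMul c e) (PMul d h), PAdd (PMul c f) (PMul d k)).
Definition pneg (p : poly) := PMul (PConst (-1)) p.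
Definition pm_letter (l : letter) : pmat :=
  let i := fst l in
  if snd l then (PVar (4 * i + 3), pneg (PVar (4 * i + 1)), pneg (PVar (4 * i + 2)), PVar (4 * i))
  else (PVar (4 * i), PVar (4 * i + 1), PVar (4 * i + 2), PVar (4 * i + 3)).
Definition pm_word (w : word) : pmat :=
  fold_right (fun l P => pm_mul (pm_letter l) P) (PConst 1, PConst 0, PConst 0, PConst 1) w.

Lemma coord_entry g rho i k : (i < 2 * g)%nat -> (k < 4)%nat -> coord g rho (4 * i + k) = entry k (rho i).
Proof.
  intros Hi Hk. unfold coord.
  replace (4 * i + k <? 8 * g)%nat with true by (symmetry; apply Nat.ltb_lt; lia).
  replace ((4 * i + k) mod 4)%nat with k by (rewrite Nat.add_comm, Nat.mul_comm, Nat.Div0.mod_add, Nat.mod_small; auto).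
  replace ((4 * i + k) / 4)%nat with i; [reflexivity|].
  rewrite Nat.add_comm, Nat.mul_comm, Nat.div_add, Nat.div_small by lia. reflexivity.
Qed.
Lemma pm_mul_eval x P Q : pm_eval x (pm_mul P Q) = mmul (pm_eval x P) (pm_eval x Q).
Proof. destruct P as [[[a b] c] d], Q as [[[e f] h] k]; reflexivity. Qed.
Lemma pm_word_eval g rho w : wf_word g w -> pm_eval (coord g rho) (pm_word w) = eval rho w.
Proof.
  intros Hw; induction Hw as [|[i b] w Hi Hw IH]; [reflexivity|].
  cbn [pm_word fold_right]. fold (pm_word w). rewrite pm_mul_eval, IH. cbn [eval]. f_equal. cbn [fst] in Hi.
  pose proof (coord_entry g rho i 0 Hi) as E0. pose proof (coord_entry g rho i 1 Hi) as E1.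
  pose proof (coord_entry g rho i 2 Hi) as E2. pose proof (coord_entry g rho i 3 Hi) as E3.
  rewrite Nat.add_0_r in E0.
  unfold pm_letter, eval_letter; cbn [fst snd]. destruct b; unfold pm_eval, pneg; cbn [peval];
    rewrite E0, E1, E2, E3 by lia; cbn [entry].
  - unfold madj. f_equal; ring.
  - destruct (rho i); reflexivity.
Qed.

(** For determinant one, the matrix is plus or minus the identity exactly when it is scalar, so
    triviality in the projective group is given by equations without a choice of sign. *)
Definition scalar_eqs (w : word) : list poly :=
  let '(a, b, c, d) := pm_word w in [b; c; PAdd a (pneg d)].
Lemma scalar_pm M : mdet M = 1 -> m12 M = 0 -> m21 M = 0 -> m11 M = m22 M -> pm_eq M mid.
Proof.
  destruct M as [a b c d]; unfold mdet; cbn; intros H -> -> ->.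
  assert (E : (d - 1) * (d + 1) = 0) by lra. apply Rmult_integral in E.
  destruct E; [left|right]; unfold mid, mneg; cbn; f_equal; lra.
Qed.
Lemma scalar_eqs_spec g rho w : SLrep rho -> wf_word g w ->
  ((forall p, In p (scalar_eqs w) -> peval (coord g rho) p = 0) <-> pm_eq (eval rho w) mid).
Proof.
  intros Hsl Hw. pose proof (pm_word_eval g rho w Hw) as E. unfold scalar_eqs.
  pose proof (mdet_eval rho Hsl w) as Hd. rewrite <- E in *.
  destruct (pm_word w) as [[[a b] c] d]. unfold pm_eval in *. split.
  - intros H. apply scalar_pm; cbn; auto.
    + apply H; cbn; auto.
    + apply H; cbn; auto.
    + pose proof (H (PAdd a (pneg d))) as H3. cbn in H3. specialize (H3 ltac:(auto)). lra.
  - intros [H|H] p Hp; unfold mid, mneg in H; cbn in H; injection H; intros;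
      destruct Hp as [<-|[<-|[<-|[]]]]; cbn; lra.
Qed.

(** * The surface group is Hopfian *)

Lemma finite_choice {T} (P : nat -> T -> Prop) (d : T) n : (forall j, (j < n)%nat -> exists u, P j u) ->
  exists f : nat -> T, forall j, (j < n)%nat -> P j (f j).
Proof.
  induction n as [|n IH]; intros H; [exists (fun _ => d); intros; lia|].
  destruct IH as (f & Hf); [intros; apply H; lia|]. destruct (H n) as (u & Hu); [lia|].
  exists (fun j => if Nat.eqb j n then u else f j). intros j Hj.
  destruct (Nat.eqb_spec j n) as [->|Hne]; [exact Hu|]. apply Hf. lia.
Qed.

Section Hopf.
Variables (g : nat) (ws : nat -> word).
Hypothesis Hws : standard_gen_set g ws.

Lemma gen_preimages : exists us : nat -> word, forall j, (j < 2 * g)%nat -> wf_word g (us j) /\ geq g [(j, false)] (subst ws (us j)).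
Proof.
  apply (finite_choice (fun j u => wf_word g u /\ geq g [(j, false)] (subst ws u)) ([] : word)). apply Hws.
Qed.

Lemma wf_letters w l : wf_word g w -> In l w -> (fst l < 2 * g)%nat.
Proof. intros H Hl. unfold wf_word in H. rewrite Forall_forall in H. now apply H. Qed.

Lemma subst_preimage us v : (forall j, (j < 2 * g)%nat -> wf_word g (us j) /\ geq g [(j, false)] (subst ws (us j))) ->
  wf_word g v -> geq g (subst ws (subst us v)) v.
Proof.
  intros Hus Hv. rewrite subst_subst. rewrite <- (subst_id v) at 2. apply geq_subst_ext.
  intros l Hl. apply geq_sym, Hus. now apply wf_letters with v.
Qed.

Fixpoint wsN (n : nat) (i : nat) : word :=
  match n with O => [(i, false)] | S n => subst ws (wsN n i) end.
Lemma subst_wsN n w : subst (wsN (S n)) w = subst ws (subst (wsN n) w).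
Proof. symmetry. apply subst_subst. Qed.
Lemma wsN_surj n v : wf_word g v -> exists w, wf_word g w /\ geq g (subst (wsN n) w) v.
Proof.
  revert v; induction n as [|n IH]; intros v Hv.
  - exists v. split; [exact Hv|]. change (geq g (subst (fun i : nat => [(i, false)]) v) v). rewrite subst_id. apply geq_refl.
  - destruct gen_preimages as (us & Hus).
    destruct (IH (subst us v)) as (w & Hw & E); [apply wf_subst; [intros; now apply Hus|exact Hv]|].
    exists w. split; [exact Hw|]. rewrite subst_wsN.
    eapply geq_trans; [apply geq_subst; [apply Hws|exact E]|]. now apply subst_preimage.
Qed.

(* The representations [rho o phi^n] kill exactly [ker phi^n]; by Noetherianity the varieties of representations
   killing [ker phi^n] stabilize, so the kernels do. *)
Theorem hopfian rho w0 : DFrep g rho -> wf_word g w0 -> geq g (subst ws w0) [] -> geq g w0 [].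
Proof.
  intros HDF Hw0 Hker. pose proof HDF as (Hsl & _).
  set (E := fun n p => exists w, wf_word g w /\ geq g (subst (wsN n) w) [] /\ In p (scalar_eqs w)).
  destruct (zero_sets_stabilize (8 * g) E) as (N & HN).
  { intros n p (w & Hw & Hk & Hp). exists w. repeat split; auto. rewrite subst_wsN.
    eapply geq_trans; [apply geq_subst; [apply Hws|exact Hk]|]. apply geq_refl. }
  set (sig := fun i => eval rho (wsN N i)).
  assert (Hsig : SLrep sig) by (intros i; now apply mdet_eval).
  assert (Hev : forall w, eval sig w = eval rho (subst (wsN N) w)) by (intros w; symmetry; apply eval_subst).
  assert (Hx : forall n, (8 * g <= n)%nat -> coord g sig n = 0).
  { intros n Hn. unfold coord. now replace (n <? 8 * g)%nat with false by (symmetry; apply Nat.ltb_ge; lia). }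
  assert (H1 : forall p, E N p -> peval (coord g sig) p = 0).
  { intros p (w & Hw & Hk & Hp). apply (proj2 (scalar_eqs_spec g sig w Hsig Hw)); [|exact Hp].
    rewrite Hev. exact (DF_pm g rho _ [] HDF Hk). }
  specialize (HN _ Hx H1).
  (* [w0] is the image of some [w] under the [N]-th iterate, and [w] is killed by the next one. The
     representation [sig] satisfies the equations of stage [N], hence those of stage [N + 1], so it
     kills [w]; this says that [rho] kills [w0]. *)
  destruct (wsN_surj N w0 Hw0) as (w & Hw & Hww0).
  assert (Hwk : geq g (subst (wsN (S N)) w) []).
  { rewrite subst_wsN. eapply geq_trans; [apply geq_subst; [apply Hws|exact Hww0]|exact Hker]. }
  assert (Hpm : pm_eq (eval sig w) mid).
  { apply (scalar_eqs_spec g sig w Hsig Hw). intros p Hp. apply HN. now exists w. }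
  rewrite Hev in Hpm. apply DF_geq with rho; auto using wf_nil.
  eapply pm_eq_trans; [|exact Hpm]. apply pm_eq_sym. now apply DF_pm with g.
Qed.

Lemma preimage_subst rho us v : DFrep g rho ->
  (forall j, (j < 2 * g)%nat -> wf_word g (us j) /\ geq g [(j, false)] (subst ws (us j))) ->
  wf_word g v -> geq g (subst us (subst ws v)) v.
Proof.
  intros HDF Hus Hv. apply geq_of_trivial.
  assert (W1 : wf_word g (subst us (subst ws v))).
  { apply wf_subst; [intros; now apply Hus|]. apply wf_subst; [apply Hws|exact Hv]. }
  apply (hopfian rho); auto using wf_app, wf_winv.
  rewrite subst_app, subst_winv. apply trivial_of_geq.
  apply subst_preimage; [exact Hus|]. apply wf_subst; [apply Hws|exact Hv].
Qed.
Lemma relator_preimage rho us : DFrep g rho ->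
  (forall j, (j < 2 * g)%nat -> wf_word g (us j) /\ geq g [(j, false)] (subst ws (us j))) ->
  geq g (subst us (relator g)) [].
Proof.
  intros HDF Hus. apply (hopfian rho); auto.
  - apply wf_subst; [intros; now apply Hus|apply wf_relator].
  - eapply geq_trans; [apply subst_preimage; [exact Hus|apply wf_relator]|].
    apply geq_sym, rst_step. pose proof (step_rel g [] []) as K. cbn in K. now rewrite app_nil_r in K.
Qed.
End Hopf.

(** * Absence of parabolic elements *)

Lemma unipotent_conj C e : mdet C = 1 -> mtr C = 2 -> 0 < e -> exists k, mdet k = 1 /\
  close e (mmul (mmul k C) (madj k)) mid.
Proof.
  destruct C as [a b c d]; unfold mdet, mtr; cbn. intros Hd Ht He.
  assert (Ed : d = 2 - a) by lra. subst d.
  assert (Hsq : (a - 1) * (a - 1) + b * c = 0) by lra.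
  assert (small : forall x, exists t, 0 < t /\ Rabs (t * x) < e).
  { intros x. pose proof (Rabs_pos x). exists (e / (Rabs x + 1)).
    assert (Ht0 : 0 < e / (Rabs x + 1)) by (apply Rdiv_lt_0_compat; lra). split; [exact Ht0|].
    rewrite Rabs_mult, (Rabs_pos_eq (e / _)) by lra.
    replace e with (e / (Rabs x + 1) * (Rabs x + 1)) at 2 by (field; lra). apply Rmult_lt_compat_l; lra. }
  destruct (Req_dec c 0) as [Hc|Hc].
  - subst c. assert (a = 1) by (assert ((a - 1) * (a - 1) = 0) by lra; apply Rmult_integral in H; lra). subst a.
    destruct (small b) as (t & Ht0 & Htb). set (s := sqrt t). assert (Hs : s * s = t) by (apply sqrt_sqrt; lra).
    assert (Hs0 : 0 < s) by now apply sqrt_lt_R0.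
    exists (mkMat2 s 0 0 (/ s)). split; [unfold mdet; cbn; field; lra|].
    apply close_mdiff. unfold mdiff, mmul, madj, mid; cbn.
    assert (E : mkMat2 ((s * 1 + 0 * 0) * / s + (s * b + 0 * (2 - 1)) * - 0 - 1)
        ((s * 1 + 0 * 0) * - 0 + (s * b + 0 * (2 - 1)) * s - 0) ((0 * 1 + / s * 0) * / s + (0 * b + / s * (2 - 1)) * - 0 - 0)
        ((0 * 1 + / s * 0) * - 0 + (0 * b + / s * (2 - 1)) * s - 1) = mkMat2 0 (t * b) 0 0).
    { rewrite <- Hs. f_equal; field; lra. }
    rewrite E. unfold mnorm; cbn. rewrite !Rabs_R0. repeat apply Rmax_lub_lt; lra.
  - destruct (small c) as (t & Ht0 & Htc). set (s := sqrt t). assert (Hs : s * s = t) by (apply sqrt_sqrt; lra).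
    assert (Hs0 : 0 < s) by now apply sqrt_lt_R0.
    exists (mkMat2 (/ s) (- (a - 1) / (c * s)) 0 s). split; [unfold mdet; cbn; field; lra|].
    apply close_mdiff. unfold mdiff, mmul, madj, mid; cbn.
    match goal with |- mnorm ?M < _ => assert (E : M = mkMat2 0 0 (t * c) 0) end.
    { assert (Eb : b = - ((a - 1) * (a - 1)) / c) by (apply (Rmult_eq_reg_r c); [|exact Hc]; field_simplify; lra).
      rewrite Eb, <- Hs. f_equal; field; lra. }
    rewrite E. unfold mnorm; cbn. rewrite !Rabs_R0. repeat apply Rmax_lub_lt; lra.
Qed.

(** A matrix of trace 2 has conjugates arbitrarily near the identity. By cocompactness the
    conjugating matrix is an orbit element up to a factor of norm at most [D], so a conjugate of [w]
    inside the group is near the identity, and discreteness makes it trivial. *)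
Lemma no_parabolic g rho D w : DFrep g rho -> 1 <= D -> cocompact g rho D -> wf_word g w ->
  mtr (eval rho w) = 2 -> geq g w [].
Proof.
  intros HDF HD Hco Hw Ht. pose proof HDF as (Hsl & _ & _ & (eps & Heps & Hdis) & _).
  assert (He : 0 < eps / (4 * (D * D))) by (apply Rdiv_lt_0_compat; nra).
  destruct (unipotent_conj (eval rho w) _ (mdet_eval rho Hsl w) Ht He) as (k & Hk & Hcl).
  destruct (Hco (madj k)) as (v & Hv & HvD); [now rewrite mdet_madj|].
  set (b := mmul (madj (eval rho v)) (madj k)) in *.
  assert (Hdv : mdet (eval rho v) = 1) by now apply mdet_eval.
  assert (Hb : mdet b = 1) by (unfold b; rewrite mdet_mmul, !mdet_madj, Hdv, Hk; ring).
  set (u := winv v ++ w ++ v).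
  assert (Hu : wf_word g u) by (unfold u; auto using wf_app, wf_winv).
  assert (E : mmul (mmul (madj b) (eval rho u)) (madj (madj b)) = mmul (mmul k (eval rho w)) (madj k)).
  { unfold b, u. rewrite !eval_app, eval_winv, !madj_madj, madj_mmul, !madj_madj.
    rewrite <- !mmul_assoc. f_equal. rewrite !mmul_assoc. rewrite mmul_madj_r, mmul_id_l by exact Hdv.
    rewrite <- !mmul_assoc. f_equal. now rewrite mmul_madj_cancel_l'. }
  assert (Htr : pm_eq (eval rho u) mid).
  { apply Hdis; [exact Hu|]. left. apply (conj_close (madj b)); [now rewrite mdet_madj|now left|].
    rewrite E, mnorm_madj. pose proof (mnorm_det_half b Hb).
    apply close_mdiff. apply close_mdiff in Hcl. eapply Rlt_le_trans; [exact Hcl|].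
    unfold Rdiv. apply Rmult_le_compat_l; [lra|]. apply Rinv_le_contravar; nra. }
  assert (Hgu : geq g u []) by (apply DF_geq with rho; auto using wf_nil).
  unfold u in Hgu.
  pose proof (geq_ctx g v (winv v) _ _ Hgu) as K. rewrite <- !app_assoc in K.
  assert (K2 : geq g (v ++ winv v ++ w ++ v ++ winv v) w).
  { rewrite app_assoc. rewrite <- (app_nil_r w) at 2.
    exact (geq_app g _ _ _ _ (geq_winv_r g v) (geq_app g _ _ _ _ (geq_refl g w) (geq_winv_r g v))). }
  eapply geq_trans; [apply geq_sym, K2|]. eapply geq_trans; [exact K|]. apply geq_winv_r.
Qed.

(** * The trace form and the basis 1, P, Q, PQ *)

Definition mcomm (P Q : Mat2) : Mat2 := mmul P (mmul Q (mmul (madj P) (madj Q))).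
Definition det3 (a1 a2 a3 b1 b2 b3 c1 c2 c3 : R) :=
  a1 * (b2 * c3 - b3 * c2) - a2 * (b1 * c3 - b3 * c1) + a3 * (b1 * c2 - b2 * c1).

Section TraceForm.
Variables P Q : Mat2.
Definition trace_coords (Z : Mat2) : R :=
  Rabs (mtr Z) + Rabs (mtr (mmul Z P)) + Rabs (mtr (mmul Z Q)) + Rabs (mtr (mmul Z (mmul P Q))).
Definition trace_lin (F : Mat2 -> R) : Prop := exists c1 c2 c3 c4, forall Z,
  F Z = c1 * mtr Z + c2 * mtr (mmul Z P) + c3 * mtr (mmul Z Q) + c4 * mtr (mmul Z (mmul P Q)).
Lemma trace_lin_comb F G k k' : trace_lin F -> trace_lin G -> trace_lin (fun Z => k * F Z + k' * G Z).
Proof.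
  intros (c1 & c2 & c3 & c4 & H) (e1 & e2 & e3 & e4 & H').
  exists (k * c1 + k' * e1), (k * c2 + k' * e2), (k * c3 + k' * e3), (k * c4 + k' * e4). intros Z. rewrite H, H'. ring.
Qed.
Lemma trace_lin_ext F G : (forall Z, G Z = F Z) -> trace_lin F -> trace_lin G.
Proof. intros E (c1 & c2 & c3 & c4 & H). exists c1, c2, c3, c4. intros Z. now rewrite E, H. Qed.
Lemma trace_lin_bound F : trace_lin F -> exists C, 0 <= C /\ forall Z, Rabs (F Z) <= C * trace_coords Z.
Proof.
  intros (c1 & c2 & c3 & c4 & H). exists (Rabs c1 + Rabs c2 + Rabs c3 + Rabs c4).
  pose proof (Rabs_pos c1) as p1. pose proof (Rabs_pos c2) as p2. pose proof (Rabs_pos c3) as p3. pose proof (Rabs_pos c4) as p4.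
  split; [lra|]. intros Z. rewrite H. unfold trace_coords.
  set (x1 := mtr Z). set (x2 := mtr (mmul Z P)). set (x3 := mtr (mmul Z Q)). set (x4 := mtr (mmul Z (mmul P Q))).
  pose proof (Rabs_pos x1). pose proof (Rabs_pos x2). pose proof (Rabs_pos x3). pose proof (Rabs_pos x4).
  pose proof (Rabs_triang (c1 * x1 + c2 * x2 + c3 * x3) (c4 * x4)). pose proof (Rabs_triang (c1 * x1 + c2 * x2) (c3 * x3)).
  pose proof (Rabs_triang (c1 * x1) (c2 * x2)). rewrite !Rabs_mult in *.
  set (S := Rabs x1 + Rabs x2 + Rabs x3 + Rabs x4) in *.
  assert (Rabs c1 * Rabs x1 <= Rabs c1 * S) by (apply Rmult_le_compat_l; unfold S; lra).
  assert (Rabs c2 * Rabs x2 <= Rabs c2 * S) by (apply Rmult_le_compat_l; unfold S; lra).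
  assert (Rabs c3 * Rabs x3 <= Rabs c3 * S) by (apply Rmult_le_compat_l; unfold S; lra).
  assert (Rabs c4 * Rabs x4 <= Rabs c4 * S) by (apply Rmult_le_compat_l; unfold S; lra).
  lra.
Qed.

(* The Gram-type determinant of [1, P, Q, PQ] is [tr [P, Q] - 2]. *)
Lemma trace_form_coercive : mdet P = 1 -> mdet Q = 1 -> mtr (mcomm P Q) <> 2 ->
  exists C, 0 < C /\ forall Z, mnorm Z <= C * trace_coords Z.
Proof.
  intros HP HQ Hne.
  assert (B1 : trace_lin mtr) by (exists 1, 0, 0, 0; intros; ring).
  assert (B2 : trace_lin (fun Z => mtr (mmul Z P))) by (exists 0, 1, 0, 0; intros; ring).
  assert (B3 : trace_lin (fun Z => mtr (mmul Z Q))) by (exists 0, 0, 1, 0; intros; ring).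
  assert (B4 : trace_lin (fun Z => mtr (mmul Z (mmul P Q)))) by (exists 0, 0, 0, 1; intros; ring).
  assert (L : trace_lin m11 /\ trace_lin m12 /\ trace_lin m21 /\ trace_lin m22).
  { destruct P as [a b c d], Q as [e f h k]. unfold mcomm, mdet, mtr, mmul, madj in *; cbn in *.
    set (p1 := a * e + b * h) in *. set (p2 := c * e + d * h) in *.
    set (p3 := a * f + b * k) in *. set (p4 := c * f + d * k) in *.
    set (Del := det3 c b d h f k p2 p3 p4 - det3 a c b e h f p1 p2 p3).
    assert (HD : Del <> 0).
    (* The trace of the commutator is 2 plus [Del]. The matrix entries of [Z] are then recovered
       from the four traces by Cramer's rule with denominator [Del]. *)
    { intros H0. apply Hne.
      transitivity (2 * ((a * d - b * c) * (e * k - f * h)) + Del); [|rewrite HP, HQ, H0; ring].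
      unfold Del, det3, p1, p2, p3, p4. ring. }
    assert (L1 : trace_lin m11).
    { pose proof (trace_lin_comb _ _ (/ Del) (/ Del)
        (trace_lin_comb _ _ (det3 c b d h f k p2 p3 p4) (- (h * p3 - f * p2)) B1 B2)
        (trace_lin_comb _ _ (c * p3 - b * p2) (- (c * f - b * h)) B3 B4)) as K.
      eapply trace_lin_ext; [|exact K]. cbn beta. intros Z. fold p1 p2 p3 p4.
      apply (Rmult_eq_reg_l Del); [|exact HD]. rewrite Rmult_plus_distr_l, <- !Rmult_assoc, Rinv_r by exact HD.
      unfold Del, det3. ring. }
    assert (L4 : trace_lin m22).
    { eapply trace_lin_ext; [|exact (trace_lin_comb _ _ 1 (-1) B1 L1)]. intros Z; cbn. ring. }
    pose proof (trace_lin_comb _ _ 1 (-1) B2 (trace_lin_comb _ _ a d L1 L4)) as R2.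
    pose proof (trace_lin_comb _ _ 1 (-1) B3 (trace_lin_comb _ _ e k L1 L4)) as R3.
    pose proof (trace_lin_comb _ _ 1 (-1) B4 (trace_lin_comb _ _ p1 p4 L1 L4)) as R4.
    repeat split; auto.
    - pose proof (trace_lin_comb _ _ (/ Del) (/ Del)
        (trace_lin_comb _ _ (b * p4 - d * p3 + (a * p3 - b * p1)) (- (f * p4 - k * p3 + (e * p3 - f * p1))) R3 R2)
        (trace_lin_comb _ _ (- (b * k - d * f + (a * f - b * e))) 0 R4 R4)) as K.
      eapply trace_lin_ext; [|exact (trace_lin_comb _ _ (-1) 0 K K)]. cbn beta. intros Z. fold p1 p2 p3 p4.
      apply (Rmult_eq_reg_l Del); [|exact HD].
      match goal with |- _ = Del * (-1 * (/ Del * ?u + / Del * ?v) + 0 * _) => transitivity (- (u + v)); [|field; exact HD] end.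
      unfold Del, det3; ring.
    - pose proof (trace_lin_comb _ _ (/ Del) (/ Del)
        (trace_lin_comb _ _ (c * p4 - d * p2 + (a * p2 - c * p1)) (- (h * p4 - k * p2 + (e * p2 - h * p1))) R3 R2)
        (trace_lin_comb _ _ (- (c * k - d * h + (a * h - c * e))) 0 R4 R4)) as K.
      eapply trace_lin_ext; [|exact K]. cbn beta. intros Z. fold p1 p2 p3 p4.
      apply (Rmult_eq_reg_l Del); [|exact HD].
      match goal with |- _ = Del * (/ Del * ?u + / Del * ?v) => transitivity (u + v); [|field; exact HD] end.
      unfold Del, det3; ring. }
  destruct L as (L1 & L2 & L3 & L4).
  destruct (trace_lin_bound _ L1) as (C1 & H1 & K1). destruct (trace_lin_bound _ L2) as (C2 & H2 & K2).
  destruct (trace_lin_bound _ L3) as (C3 & H3 & K3). destruct (trace_lin_bound _ L4) as (C4 & H4 & K4).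
  exists (C1 + C2 + C3 + C4 + 1). split; [lra|]. intros Z. specialize (K1 Z). specialize (K2 Z). specialize (K3 Z). specialize (K4 Z).
  assert (HS : 0 <= trace_coords Z).
  { unfold trace_coords. pose proof (Rabs_pos (mtr Z)). pose proof (Rabs_pos (mtr (mmul Z P))).
    pose proof (Rabs_pos (mtr (mmul Z Q))). pose proof (Rabs_pos (mtr (mmul Z (mmul P Q)))). lra. }
  set (S := trace_coords Z) in *.
  assert (0 <= C1 * S) by now apply Rmult_le_pos. assert (0 <= C2 * S) by now apply Rmult_le_pos.
  assert (0 <= C3 * S) by now apply Rmult_le_pos. assert (0 <= C4 * S) by now apply Rmult_le_pos.
  apply mnorm_lub; lra.
Qed.
Lemma trace_form_nondegenerate Z : mdet P = 1 -> mdet Q = 1 -> mtr (mcomm P Q) <> 2 ->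
  mtr Z = 0 -> mtr (mmul Z P) = 0 -> mtr (mmul Z Q) = 0 -> mtr (mmul Z (mmul P Q)) = 0 ->
  Z = mkMat2 0 0 0 0.
Proof.
  intros HP HQ Hne E1 E2 E3 E4. destruct (trace_form_coercive HP HQ Hne) as (C & HC & H). specialize (H Z).
  unfold trace_coords in H. rewrite E1, E2, E3, E4, Rabs_R0 in H.
  destruct (mnorm_entries Z) as (h1 & h2 & h3 & h4).
  assert (K : forall x, Rabs x <= mnorm Z -> x = 0).
  { intros x Hx. destruct (Req_dec x 0) as [|Hx0]; [assumption|]. pose proof (Rabs_pos_lt x Hx0). lra. }
  destruct Z as [z1 z2 z3 z4]; cbn in *. f_equal; now apply K.
Qed.
End TraceForm.

(** A homomorphism to the Heisenberg group detecting commutators. *)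
Section Heisenberg.
Variables (g i i' : nat).
Hypothesis Hi : (i < g)%nat.
Hypothesis Hi' : (i' < g)%nat.
Hypothesis Hne : i <> i'.

(** Handle [i] is sent to the standard pair and handle [i'] to the same pair in reverse order, so
    their commutators have opposite central values, and the relator becomes trivial while the
    commutator of handle [i] does not. *)
Definition hx (j : nat) : R := if Nat.eqb j (2 * i) then 1 else if Nat.eqb j (2 * i' + 1) then 1 else 0.
Definition hy (j : nat) : R := if Nat.eqb j (2 * i + 1) then 1 else if Nat.eqb j (2 * i') then 1 else 0.
Definition hmul (u v : R * R * R) : R * R * R :=
  let '(x, y, z) := u in let '(x', y', z') := v in (x + x', y + y', z + z' + x * y').
Definition hlet (l : letter) : R * R * R :=
  if snd l then (- hx (fst l), - hy (fst l), 0) else (hx (fst l), hy (fst l), 0).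
Definition hval (w : word) : R * R * R := fold_right (fun l v => hmul (hlet l) v) (0, 0, 0) w.

Lemma hmul_assoc u v w : hmul u (hmul v w) = hmul (hmul u v) w.
Proof. destruct u as [[a b] c], v as [[d e] f], w as [[p q] r]. unfold hmul. f_equal; [f_equal|]; ring. Qed.
Lemma hmul_1 u : hmul (0, 0, 0) u = u.
Proof. destruct u as [[a b] c]. unfold hmul. f_equal; [f_equal|]; ring. Qed.
Lemma hval_app u v : hval (u ++ v) = hmul (hval u) (hval v).
Proof.
  induction u as [|l u IH]; [symmetry; apply hmul_1|].
  change (hmul (hlet l) (hval (u ++ v)) = hmul (hmul (hlet l) (hval u)) (hval v)). now rewrite IH, hmul_assoc.
Qed.
(** The inverse of [(x, y, 0)] is [(-x, -y, x * y)]; this is why [hlet] may send an inverse letter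
    to the plain negative. *)
Lemma hxy j : hx j * hy j = 0.
Proof.
  unfold hx, hy. destruct (Nat.eqb_spec j (2 * i)), (Nat.eqb_spec j (2 * i' + 1)), (Nat.eqb_spec j (2 * i + 1)),
    (Nat.eqb_spec j (2 * i')); try lia; ring.
Qed.
Lemma hval_comm k : hval (comm_word k) = (0, 0, (if Nat.eqb k i then 1 else 0) - (if Nat.eqb k i' then 1 else 0)).
Proof.
  transitivity (0, 0, hx (2 * k) * hy (2 * k + 1) - hx (2 * k + 1) * hy (2 * k)).
  - pose proof (hxy (2 * k)) as A. pose proof (hxy (2 * k + 1)) as B.
    unfold hval, comm_word, hlet, hmul; cbn [fold_right fst snd]. f_equal; [f_equal|]; [ring|ring|].
    set (x := hx (2 * k)) in *. set (y := hy (2 * k)) in *. set (x' := hx (2 * k + 1)) in *. set (y' := hy (2 * k + 1)) in *.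
    lra.
  - f_equal. unfold hx, hy. destruct (Nat.eqb_spec k i), (Nat.eqb_spec k i');
    destruct (Nat.eqb_spec (2 * k) (2 * i)), (Nat.eqb_spec (2 * k) (2 * i' + 1)), (Nat.eqb_spec (2 * k + 1) (2 * i + 1)),
     (Nat.eqb_spec (2 * k + 1) (2 * i')), (Nat.eqb_spec (2 * k + 1) (2 * i)), (Nat.eqb_spec (2 * k + 1) (2 * i' + 1)),
     (Nat.eqb_spec (2 * k) (2 * i + 1)), (Nat.eqb_spec (2 * k) (2 * i')); try lia; ring.
Qed.
Lemma hval_relator : hval (relator g) = (0, 0, 0).
Proof.
  assert (H : forall m, hval (flat_map comm_word (seq 0 m)) =
    (0, 0, (if Nat.ltb i m then 1 else 0) - (if Nat.ltb i' m then 1 else 0))).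
  { induction m as [|m IH]; [cbn; f_equal; ring|].
    rewrite seq_S, flat_map_app; cbn [flat_map Nat.add]. rewrite app_nil_r, hval_app, IH, hval_comm. unfold hmul.
    f_equal; [f_equal; ring|].
    destruct (Nat.ltb_spec i m), (Nat.ltb_spec i' m), (Nat.ltb_spec i (S m)), (Nat.ltb_spec i' (S m)),
      (Nat.eqb_spec m i), (Nat.eqb_spec m i'); try lia; ring. }
  unfold relator. rewrite H. destruct (Nat.ltb_spec i g), (Nat.ltb_spec i' g); try lia. f_equal; ring.
Qed.
Lemma hval_geq u v : geq g u v -> hval u = hval v.
Proof.
  intros H; induction H as [u v H|u|u v H IH|u v w H1 IH1 H2 IH2]; try congruence.
  destruct H as [u v l|u v]; rewrite !hval_app.
  - change (l :: linv l :: v) with ([l; linv l] ++ v). rewrite hval_app.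
    assert (E : hval [l; linv l] = (0, 0, 0)); [|now rewrite E, hmul_1].
    pose proof (hxy (fst l)) as A. destruct l as [j b]. unfold hval, hlet, linv, hmul; cbn [fold_right fst snd] in *.
    destruct b; cbn [negb]; f_equal; try (f_equal; ring); set (x := hx j) in *; set (y := hy j) in *; lra.
  - now rewrite hval_relator, hmul_1.
Qed.
Lemma comm_nontrivial : ~ geq g (comm_word i) [].
Proof.
  intros H. apply hval_geq in H. rewrite hval_comm in H. rewrite Nat.eqb_refl in H.
  destruct (Nat.eqb_spec i i'); [contradiction|]. cbn in H. injection H as H. lra.
Qed.
End Heisenberg.

(** * Deformations *)

Definition cont0 (f : R -> R) : Prop := continuity_pt f 0.
Definition evt (P : R -> Prop) : Prop := exists d, d > 0 /\ forall t, Rabs t < d -> P t.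

Lemma evt_and P Q : evt P -> evt Q -> evt (fun t => P t /\ Q t).
Proof.
  intros (d & Hd & H) (d' & Hd' & H'). exists (Rmin d d'). split; [now apply Rmin_glb_lt|].
  intros t Ht. pose proof (Rmin_l d d'). pose proof (Rmin_r d d'). split; [apply H|apply H']; lra.
Qed.
Lemma evt_mono (P Q : R -> Prop) : (forall t, P t -> Q t) -> evt P -> evt Q.
Proof. intros H (d & Hd & K). exists d. split; auto. Qed.
Lemma evt_all {T} (P : T -> R -> Prop) l : (forall x, In x l -> evt (P x)) -> evt (fun t => forall x, In x l -> P x t).
Proof.
  induction l as [|x l IH]; intros H; [exists 1; split; [lra|intros ? _ ? []]|].
  apply evt_mono with (fun t => P x t /\ forall y, In y l -> P y t).
  - intros t (H1 & H2) y [<-|Hy]; auto.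
  - apply evt_and; [apply H; now left|apply IH; intros; apply H; now right].
Qed.

Lemma cont0_const c : cont0 (fun _ => c).
Proof. apply continuity_pt_const. now intros ? ?. Qed.
Lemma cont0_id : cont0 (fun t => t).
Proof. apply derivable_continuous_pt, derivable_pt_id. Qed.
Lemma cont0_plus f g : cont0 f -> cont0 g -> cont0 (fun t => f t + g t).
Proof. exact (continuity_pt_plus f g 0). Qed.
Lemma cont0_minus f g : cont0 f -> cont0 g -> cont0 (fun t => f t - g t).
Proof. exact (continuity_pt_minus f g 0). Qed.
Lemma cont0_mult f g : cont0 f -> cont0 g -> cont0 (fun t => f t * g t).
Proof. exact (continuity_pt_mult f g 0). Qed.
Lemma cont0_opp f : cont0 f -> cont0 (fun t => - f t).
Proof. exact (continuity_pt_opp f 0). Qed.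
Lemma cont0_inv f : cont0 f -> f 0 <> 0 -> cont0 (fun t => / f t).
Proof. exact (continuity_pt_inv f 0). Qed.
Lemma cont0_div f g : cont0 f -> cont0 g -> g 0 <> 0 -> cont0 (fun t => f t / g t).
Proof. intros; apply cont0_mult; auto using cont0_inv. Qed.
Lemma cont0_sqrt f : cont0 f -> 0 <= f 0 -> cont0 (fun t => sqrt (f t)).
Proof. intros H H0. exact (continuity_pt_comp f sqrt 0 H (continuity_pt_sqrt _ H0)). Qed.
Lemma cont0_near f e : cont0 f -> e > 0 -> evt (fun t => Rabs (f t - f 0) < e).
Proof.
  intros H He. destruct (H e He) as (d & Hd & K). exists d; split; [exact Hd|]. intros t Ht.
  destruct (Req_dec 0 t) as [<-|Hne]; [rewrite Rminus_diag, Rabs_R0; exact He|].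
  apply K. split; [split; [exact I|exact Hne]|]. cbn. unfold Rdist. now rewrite Rminus_0_r.
Qed.
Lemma cont0_lt f c : cont0 f -> c < f 0 -> evt (fun t => c < f t).
Proof.
  intros H Hc. apply evt_mono with (fun t => Rabs (f t - f 0) < f 0 - c).
  - intros t Ht. apply Rabs_def2 in Ht. lra.
  - apply cont0_near; [exact H|lra].
Qed.
Create HintDb cont0.
#[local] Hint Resolve cont0_const cont0_id cont0_plus cont0_minus cont0_mult cont0_opp : cont0.

Definition mcont (F : R -> Mat2) : Prop :=
  cont0 (fun t => m11 (F t)) /\ cont0 (fun t => m12 (F t)) /\ cont0 (fun t => m21 (F t)) /\ cont0 (fun t => m22 (F t)).
Lemma mcont_const A : mcont (fun _ => A).
Proof. repeat split; apply cont0_const. Qed.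
Lemma mcont_mmul F G : mcont F -> mcont G -> mcont (fun t => mmul (F t) (G t)).
Proof. intros (? & ? & ? & ?) (? & ? & ? & ?). repeat split; cbn; auto 6 with cont0. Qed.
Lemma mcont_madj F : mcont F -> mcont (fun t => madj (F t)).
Proof. intros (? & ? & ? & ?). repeat split; cbn; auto with cont0. Qed.
Lemma mcont_mneg F : mcont F -> mcont (fun t => mneg (F t)).
Proof. intros (? & ? & ? & ?). repeat split; cbn; auto with cont0. Qed.
Lemma mcont_mtr F : mcont F -> cont0 (fun t => mtr (F t)).
Proof. intros (? & ? & ? & ?). unfold mtr; auto with cont0. Qed.
Lemma mcont_close F e : mcont F -> e > 0 -> evt (fun t => close e (F 0) (F t)).
Proof.
  intros (h1 & h2 & h3 & h4) He.
  pose proof (evt_and _ _ (evt_and _ _ (cont0_near _ e h1 He) (cont0_near _ e h2 He))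
    (evt_and _ _ (cont0_near _ e h3 He) (cont0_near _ e h4 He))) as K.
  eapply evt_mono; [|exact K]. cbn. intros t ((k1 & k2) & k3 & k4).
  repeat split; rewrite Rabs_minus_sym; assumption.
Qed.
Lemma mcont_eval (F : R -> rep) w : (forall i, mcont (fun t => F t i)) -> mcont (fun t => eval (F t) w).
Proof.
  intros H; induction w as [|[i b] w IH]; [exact (mcont_const mid)|].
  cbn [eval]. apply mcont_mmul; [|exact IH]. unfold eval_letter; cbn [fst snd].
  destruct b; [apply mcont_madj|]; apply H.
Qed.

(** * Return to the Fricke normalization *)

Section Normalize.
Variables A B : R -> Mat2.
Hypothesis HA : mcont A.
Hypothesis HB : mcont B.
Hypothesis HA12 : m12 (A 0) = 0.
Hypothesis HA21 : m21 (A 0) = 0.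
Hypothesis HAlt : m22 (A 0) < m11 (A 0).
Hypothesis HB1 : m11 (B 0) + m12 (B 0) = m21 (B 0) + m22 (B 0).
Hypothesis HBlt : m22 (B 0) - m12 (B 0) < m11 (B 0) + m12 (B 0).

(* The root near [0] of [b e^2 + (a - d) e - c], written so as to remain continuous at [b = 0]. *)
Definition slope (a b c d : R) := 2 * c / ((a - d) + sqrt ((a - d) * (a - d) + 4 * (b * c))).
Lemma slope_spec a b c d : 0 < (a - d) + sqrt ((a - d) * (a - d) + 4 * (b * c)) -> 0 <= (a - d) * (a - d) + 4 * (b * c) ->
  let e := slope a b c d in b * (e * e) + (a - d) * e - c = 0.
Proof.
  intros H H0 e. set (S := sqrt ((a - d) * (a - d) + 4 * (b * c))) in *.
  assert (HS : S * S = (a - d) * (a - d) + 4 * (b * c)) by now apply sqrt_sqrt.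
  unfold e, slope. fold S. set (x := a - d) in *.
  transitivity (c * (4 * (b * c) + x * x - S * S) / ((x + S) * (x + S))); [field; lra|].
  replace (4 * (b * c) + x * x - S * S) with 0 by lra. field. lra.
Qed.
Lemma slope_cont (a b c d : R -> R) : cont0 a -> cont0 b -> cont0 c -> cont0 d -> d 0 < a 0 -> c 0 = 0 ->
  cont0 (fun t => slope (a t) (b t) (c t) (d t)) /\ slope (a 0) (b 0) (c 0) (d 0) = 0 /\
  evt (fun t => let e := slope (a t) (b t) (c t) (d t) in b t * (e * e) + (a t - d t) * e - c t = 0).
Proof.
  intros Ha Hb Hc Hd Hlt Hc0.
  assert (Hdisc : cont0 (fun t => (a t - d t) * (a t - d t) + 4 * (b t * c t))) by auto 6 with cont0.
  assert (Hd0 : (a 0 - d 0) * (a 0 - d 0) + 4 * (b 0 * c 0) = (a 0 - d 0) * (a 0 - d 0)) by (rewrite Hc0; ring).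
  assert (Hp : 0 < (a 0 - d 0) * (a 0 - d 0)) by nra.
  assert (Hsq : cont0 (fun t => sqrt ((a t - d t) * (a t - d t) + 4 * (b t * c t)))) by (apply cont0_sqrt; [exact Hdisc|lra]).
  assert (Hden : cont0 (fun t => a t - d t + sqrt ((a t - d t) * (a t - d t) + 4 * (b t * c t)))) by auto with cont0.
  assert (Hden0 : 0 < a 0 - d 0 + sqrt ((a 0 - d 0) * (a 0 - d 0) + 4 * (b 0 * c 0))).
  { pose proof (sqrt_pos ((a 0 - d 0) * (a 0 - d 0) + 4 * (b 0 * c 0))). lra. }
  split; [|split].
  - unfold slope. apply cont0_div; [auto with cont0|exact Hden|lra].
  - unfold slope. rewrite Hc0. unfold Rdiv. ring.
  - pose proof (cont0_lt _ 0 Hden Hden0) as E1.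
    assert (E2 : evt (fun t => 0 < (a t - d t) * (a t - d t) + 4 * (b t * c t))) by (apply cont0_lt; [exact Hdisc|lra]).
    eapply evt_mono; [|exact (evt_and _ _ E1 E2)]. cbn. intros t (k1 & k2). apply slope_spec; lra.
Qed.

(** The eigenvectors of [A 0] and [B 0] in question are simple, so they move continuously, and [k t]
    carries them back to their normalized positions. *)
Lemma normalizer : exists k : R -> Mat2, mcont k /\ k 0 = mid /\ evt (fun t => mdet (k t) = 1 /\
  let A' := mmul (mmul (k t) (A t)) (madj (k t)) in let B' := mmul (mmul (k t) (B t)) (madj (k t)) in
  m12 A' = 0 /\ m21 A' = 0 /\ m11 B' + m12 B' = m21 B' + m22 B').
Proof.
  destruct HA as (a1 & a2 & a3 & a4), HB as (b1 & b2 & b3 & b4).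
  destruct (slope_cont (fun t => m11 (A t)) (fun t => m12 (A t)) (fun t => m21 (A t)) (fun t => m22 (A t)))
    as (ce & e0 & He); auto.
  destruct (slope_cont (fun t => m11 (A t)) (fun t => - m21 (A t)) (fun t => - m12 (A t)) (fun t => m22 (A t)))
    as (ce' & e0' & He'); auto with cont0; [cbn; lra|].
  destruct (slope_cont (fun t => m11 (B t) + m12 (B t)) (fun t => m12 (B t))
     (fun t => m21 (B t) + m22 (B t) - m11 (B t) - m12 (B t)) (fun t => m22 (B t) - m12 (B t)))
    as (cf & f0 & Hf); auto 6 with cont0; [cbn; lra|].
  set (e := fun t => slope (m11 (A t)) (m12 (A t)) (m21 (A t)) (m22 (A t))).
  set (e' := fun t => slope (m11 (A t)) (- m21 (A t)) (- m12 (A t)) (m22 (A t))).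
  set (f := fun t => slope (m11 (B t) + m12 (B t)) (m12 (B t)) (m21 (B t) + m22 (B t) - m11 (B t) - m12 (B t)) (m22 (B t) - m12 (B t))).
  change (cont0 e) in ce. change (e 0 = 0) in e0. change (cont0 e') in ce'. change (e' 0 = 0) in e0'.
  change (cont0 f) in cf. change (f 0 = 0) in f0.
  (* [A t] has eigenvectors [(1, e)] and [(e', 1)], and [B t] has [(1, 1 + f)]. The rows of [k t]
     annihilate [(e', 1)] and [(1, e)] respectively; [be] and [al] weight them so that [(1, 1 + f)]
     goes to a multiple of [(1, 1)], and [r] gives determinant one. *)
  set (q := fun t => 1 - e t * e' t).
  set (al := fun t => (1 - e' t * (1 + f t)) / q t). set (be := fun t => (1 + f t - e t) / q t).
  set (Dl := fun t => al t * be t * q t).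
  assert (cq : cont0 q) by (unfold q; auto with cont0). assert (q0 : q 0 = 1) by (unfold q; rewrite e0, e0'; ring).
  assert (cal : cont0 al) by (unfold al; apply cont0_div; auto with cont0; lra).
  assert (cbe : cont0 be) by (unfold be; apply cont0_div; auto with cont0; lra).
  assert (al0 : al 0 = 1) by (unfold al; rewrite q0, e0', f0; field).
  assert (be0 : be 0 = 1) by (unfold be; rewrite q0, e0, f0; field).
  assert (cD : cont0 Dl) by (unfold Dl; auto with cont0). assert (D0 : Dl 0 = 1) by (unfold Dl; rewrite al0, be0, q0; ring).
  set (r := fun t => / sqrt (Dl t)).
  assert (cs : cont0 (fun t => sqrt (Dl t))) by (apply cont0_sqrt; [exact cD|lra]).
  assert (cr : cont0 r) by (unfold r; apply cont0_inv; [exact cs|rewrite D0, sqrt_1; lra]).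
  assert (r0 : r 0 = 1) by (unfold r; rewrite D0, sqrt_1; field).
  exists (fun t => mkMat2 (r t * be t) (- (r t * (be t * e' t))) (- (r t * (al t * e t))) (r t * al t)).
  split; [|split].
  - repeat split; cbn; auto 6 with cont0.
  - unfold mid. rewrite r0, al0, be0, e0, e0'. f_equal; ring.
  - assert (Eq : evt (fun t => 0 < q t)) by (apply cont0_lt; [exact cq|lra]).
    assert (ED : evt (fun t => 0 < Dl t)) by (apply cont0_lt; [exact cD|lra]).
    eapply evt_mono; [|exact (evt_and _ _ (evt_and _ _ He (evt_and _ _ He' Hf)) (evt_and _ _ Eq ED))].
    cbn beta. intros t ((E1 & E2 & E3) & Hq & HD).
    change (let x := e t in m12 (A t) * (x * x) + (m11 (A t) - m22 (A t)) * x - m21 (A t) = 0) in E1.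
    change (let x := e' t in - m21 (A t) * (x * x) + (m11 (A t) - m22 (A t)) * x - - m12 (A t) = 0) in E2.
    change (let x := f t in m12 (B t) * (x * x) + (m11 (B t) + m12 (B t) - (m22 (B t) - m12 (B t))) * x
      - (m21 (B t) + m22 (B t) - m11 (B t) - m12 (B t)) = 0) in E3.
    cbv zeta in E1, E2, E3.
    assert (Hr : r t * r t * Dl t = 1).
    { unfold r. rewrite <- (sqrt_sqrt (Dl t)) at 3 by lra. field. apply Rgt_not_eq. now apply sqrt_lt_R0. }
    assert (K1 : al t + be t * e' t = 1) by (unfold al, be, q in *; field; lra).
    assert (K2 : al t * e t + be t = 1 + f t) by (unfold al, be, q in *; field; lra).
    unfold Dl, q in Hr.
    set (R := r t) in *. set (x := al t) in *. set (y := be t) in *. set (u := e t) in *. set (v := e' t) in *. set (w := f t) in *.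
    clearbody R x y u v w.
    split; [unfold mdet; cbn; rewrite <- Hr; ring|]. cbv zeta. destruct (A t) as [a b c d], (B t) as [a' b' c' d'].
    unfold mmul, madj; cbn in *. split; [|split].
    + transitivity (R * R * y * y * (b - - (a - d) * v + - c * (v * v))); [ring|].
      replace (b - - (a - d) * v + - c * (v * v)) with 0 by lra. ring.
    + transitivity (- (R * R * x * x * (b * (u * u) + (a - d) * u - c))); [ring|]. rewrite E1; ring.
    + assert (G : c' + d' * (1 + w) = (a' + b' * (1 + w)) * (1 + w)) by lra.
      transitivity (R * R * ((y * (a' * (x + y * v) + b' * (x * u + y)) - y * v * (c' * (x + y * v) + d' * (x * u + y))))); [ring|].
      transitivity (R * R * ((x * (c' * (x + y * v) + d' * (x * u + y)) - x * u * (a' * (x + y * v) + b' * (x * u + y))))); [|ring].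
      rewrite K1, K2. replace (c' * 1 + d' * (1 + w)) with ((a' + b' * (1 + w)) * (1 + w)) by lra.
      transitivity (R * R * (a' + b' * (1 + w)) * (y - y * v * (1 + w))); [ring|].
      transitivity (R * R * (a' + b' * (1 + w)) * (x * (1 + w) - x * u)); [|ring].
      f_equal. rewrite <- K2. replace x with (1 - y * v) by lra. ring.
Qed.
End Normalize.

(** * Twist flows on two handles *)

Definition mscal (k : R) (A : Mat2) : Mat2 := mkMat2 (k * m11 A) (k * m12 A) (k * m21 A) (k * m22 A).
Definition madd (A B : Mat2) : Mat2 := mkMat2 (m11 A + m11 B) (m12 A + m12 B) (m21 A + m21 B) (m22 A + m22 B).

Definition ckap (m : Mat2) (t : R) : R := / sqrt (1 + t * mtr m + t * t).
(* A curve through the identity in the centralizer of [m]; [ckap] normalizes its determinant. *)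
Definition ccurve (m : Mat2) (t : R) : Mat2 := mscal (ckap m t) (madd mid (mscal t m)).

Lemma ccurve_commutes m t : mmul (ccurve m t) m = mmul m (ccurve m t).
Proof. destruct m as [a b c d]. unfold ccurve, mscal, madd, mmul, mid; cbn. f_equal; ring. Qed.
Lemma ccurve_0 m : ccurve m 0 = mid.
Proof.
  unfold ccurve, ckap. replace (1 + 0 * mtr m + 0 * 0) with 1 by ring. rewrite sqrt_1, Rinv_1.
  unfold mscal, madd, mid; cbn. f_equal; ring.
Qed.
Lemma ccurve_cont m : mcont (ccurve m).
Proof.
  assert (H : cont0 (ckap m)).
  { unfold ckap. apply cont0_inv.
    - apply cont0_sqrt; [auto 6 with cont0|]. apply Rlt_le. replace (1 + 0 * mtr m + 0 * 0) with 1 by ring. lra.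
    - replace (1 + 0 * mtr m + 0 * 0) with 1 by ring. rewrite sqrt_1. lra. }
  repeat split; cbn; auto 6 with cont0.
Qed.
Lemma ccurve_evt m : mdet m = 1 -> evt (fun t => mdet (ccurve m t) = 1 /\ ckap m t <> 0).
Proof.
  intros Hm. apply evt_mono with (fun t => 0 < 1 + t * mtr m + t * t).
  - intros t Ht. assert (Hs : 0 < sqrt (1 + t * mtr m + t * t)) by now apply sqrt_lt_R0.
    assert (Hk : ckap m t * ckap m t * (1 + t * mtr m + t * t) = 1).
    { unfold ckap. rewrite <- (sqrt_sqrt (1 + t * mtr m + t * t)) at 3 by lra. field. lra. }
    split; [|unfold ckap; apply Rinv_neq_0_compat; lra].
    rewrite <- Hk. unfold ccurve, mdet, mscal, madd, mid, mtr in *. cbn.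
    destruct m as [a b c d]; cbn in *. set (k := ckap _ _) in *.
    transitivity (k * k * (1 + t * (a + d) + t * t * (a * d - b * c))); [ring|]. rewrite Hm. ring.
  - apply (cont0_lt (fun t => 1 + t * mtr m + t * t)); [auto 6 with cont0|lra].
Qed.

Lemma mcomm_slide_inv A B : mdet A = 1 -> mdet B = 1 -> mcomm (mmul A (madj B)) B = mcomm A B.
Proof.
  intros dA dB. unfold mcomm. rewrite madj_mmul, madj_madj, <- !mmul_assoc. f_equal.
  rewrite (mmul_madj_cancel_l B) by exact dB.
  reflexivity.
Qed.
Lemma mcomm_rotate_inv A B : mdet A = 1 -> mdet B = 1 -> mcomm (madj B) (mmul B (mmul A (madj B))) = mcomm A B.
Proof.
  intros dA dB. unfold mcomm. rewrite !madj_mmul, !madj_madj, <- !mmul_assoc.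
  rewrite (mmul_madj_cancel_l B) by exact dB. f_equal.
  rewrite (mmul_madj_cancel_l B) by exact dB. reflexivity.
Qed.

Section Flows.
Variables X Y P Q : Mat2.
Hypothesis dX : mdet X = 1.
Hypothesis dY : mdet Y = 1.
Hypothesis dP : mdet P = 1.
Hypothesis dQ : mdet Q = 1.
Definition KK := mmul Y (mmul (madj X) (madj Y)).

(* Infinitesimal generators of the twists that fix [X] and move [Y] to [c Y]. *)
Definition twists : list Mat2 :=
  [mmul Y (mmul X (madj Y)); mmul KK P; mmul KK (mmul P Q); mmul KK (mmul P (mmul Q (madj P)))].

Lemma det_KK : mdet KK = 1.
Proof. unfold KK. rewrite !mdet_mmul, !mdet_madj, dX, dY. ring. Qed.
Lemma det_twists m : In m twists -> mdet m = 1.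
Proof.
  intros [<-|[<-|[<-|[<-|[]]]]]; rewrite ?mdet_mmul, ?mdet_madj, ?det_KK, ?dX, ?dY, ?dP, ?dQ; ring.
Qed.

Lemma conj_commute c m : mdet c = 1 -> mmul c m = mmul m c -> mmul c (mmul m (madj c)) = m.
Proof. intros Hc H. rewrite mmul_assoc, H, <- mmul_assoc, mmul_madj_r, mmul_id_r; auto. Qed.

(** In the commutator of [X] and [c Y], the inverse of [mmul Y (mmul X (madj Y))] appears conjugated
    by [c], which fixes it. *)
Lemma twist_A c : mdet c = 1 -> mmul c (mmul Y (mmul X (madj Y))) = mmul (mmul Y (mmul X (madj Y))) c ->
  mcomm X (mmul c Y) = mcomm X Y.
Proof.
  intros Hc H. set (m := mmul Y (mmul X (madj Y))) in *.
  assert (E : mmul c (mmul (madj m) (madj c)) = madj m).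
  { transitivity (madj (mmul c (mmul m (madj c)))); [rewrite !madj_mmul, madj_madj, mmul_assoc; reflexivity|].
    now rewrite conj_commute. }
  unfold mcomm. f_equal. unfold m in E. rewrite !madj_mmul, madj_madj in *. rewrite <- !mmul_assoc in *. exact E.
Qed.
(** [KK P'] is a subword of the product of the two commutators. The substitution amounts to
    conjugating this subword by [c], which commutes with it, and changes nothing else. *)
Lemma twist_B c P' Q' : mdet P' = 1 -> mdet Q' = 1 -> mdet c = 1 -> mmul c (mmul KK P') = mmul (mmul KK P') c ->
  mmul (mcomm X (mmul c Y)) (mcomm (mmul (mmul c P') (madj c)) (mmul Q' (madj c))) = mmul (mcomm X Y) (mcomm P' Q').
Proof.
  intros HP HQ Hc H. pose proof (conj_commute c _ Hc H) as E.
  unfold mcomm, KK in *. rewrite !madj_mmul, !madj_madj. rewrite <- !mmul_assoc in *.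
  f_equal. rewrite (mmul_madj_cancel_l c) by exact Hc.
  rewrite (mmul_madj_cancel_l c) by exact Hc.
  set (W := mmul Q' (mmul (madj P') (madj Q'))).
  transitivity (mmul (mmul c (mmul Y (mmul (madj X) (mmul (madj Y) (mmul P' (madj c)))))) W); [|now rewrite E, <- !mmul_assoc].
  unfold W. rewrite <- !mmul_assoc, ?(mmul_madj_cancel_l c) by exact Hc. reflexivity.
Qed.

Lemma mcomm_slide : mcomm (mmul P Q) Q = mcomm P Q.
Proof.
  unfold mcomm. rewrite madj_mmul, <- !mmul_assoc. do 2 f_equal.
  rewrite (mmul_madj_cancel_l' Q); auto.
Qed.
Lemma mcomm_rotate : mcomm (mmul P (mmul Q (madj P))) (madj P) = mcomm P Q.
Proof.
  unfold mcomm. rewrite !madj_mmul, madj_madj, <- !mmul_assoc. do 2 f_equal.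
  rewrite (mmul_madj_cancel_l P), mmul_madj_l, mmul_id_r by auto. reflexivity.
Qed.

Lemma flow_exists m : In m twists -> exists F G H : R -> Mat2,
  mcont F /\ mcont G /\ mcont H /\ F 0 = Y /\ G 0 = P /\ H 0 = Q /\ (forall t, F t = mmul (ccurve m t) Y) /\
  evt (fun t => ckap m t <> 0 /\ mdet (F t) = 1 /\ mdet (G t) = 1 /\ mdet (H t) = 1 /\
    mmul (mcomm X (F t)) (mcomm (G t) (H t)) = mmul (mcomm X Y) (mcomm P Q)).
Proof.
  intros Hm. pose proof (det_twists m Hm) as dm. pose proof (ccurve_evt m dm) as Ev.
  pose proof (ccurve_cont m) as Cc. pose proof (ccurve_0 m) as C0. pose proof (ccurve_commutes m) as Cm.
  set (c := ccurve m) in *.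
  assert (CF : mcont (fun t => mmul (c t) Y)) by (apply mcont_mmul; [exact Cc|apply mcont_const]).
  assert (F0 : mmul (c 0) Y = Y) by now rewrite C0, mmul_id_l.
  (* The last three twists are instances of [twist_B] for three bases [(P', Q')] of the second
     handle with the same commutator; [rp] and [rq] convert such a basis back to [(P, Q)]. *)
  assert (main : forall P' Q' (rp rq : Mat2 -> Mat2 -> Mat2), m = mmul KK P' -> mdet P' = 1 -> mdet Q' = 1 ->
     mcomm P' Q' = mcomm P Q -> rp P' Q' = P -> rq P' Q' = Q ->
     (forall A B, mdet A = 1 -> mdet B = 1 -> mdet (rp A B) = 1 /\ mdet (rq A B) = 1 /\ mcomm (rp A B) (rq A B) = mcomm A B) ->
     (forall A B, mcont A -> mcont B -> mcont (fun t => rp (A t) (B t)) /\ mcont (fun t => rq (A t) (B t))) ->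
     exists F G H : R -> Mat2,
  mcont F /\ mcont G /\ mcont H /\ F 0 = Y /\ G 0 = P /\ H 0 = Q /\ (forall t, F t = mmul (c t) Y) /\
  evt (fun t => ckap m t <> 0 /\ mdet (F t) = 1 /\ mdet (G t) = 1 /\ mdet (H t) = 1 /\
    mmul (mcomm X (F t)) (mcomm (G t) (H t)) = mmul (mcomm X Y) (mcomm P Q))).
  { intros P' Q' rp rq Em dP' dQ' HC Hrp Hrq Hr Hrc.
    set (A := fun t => mmul (mmul (c t) P') (madj (c t))). set (B := fun t => mmul Q' (madj (c t))).
    assert (CA : mcont A) by (apply mcont_mmul; [apply mcont_mmul; [exact Cc|apply mcont_const]|now apply mcont_madj]).
    assert (CB : mcont B) by (apply mcont_mmul; [apply mcont_const|now apply mcont_madj]).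
    destruct (Hrc A B CA CB) as (CG & CH).
    assert (A0 : A 0 = P') by (unfold A; now rewrite C0, madj_mid, mmul_id_l, mmul_id_r).
    assert (B0 : B 0 = Q') by (unfold B; now rewrite C0, madj_mid, mmul_id_r).
    exists (fun t => mmul (c t) Y), (fun t => rp (A t) (B t)), (fun t => rq (A t) (B t)).
    repeat (split; [first [exact CF|exact CG|exact CH|exact F0|rewrite A0, B0; assumption|reflexivity]|]).
    eapply evt_mono; [|exact Ev]. cbn beta. intros t (dc & Hk).
    assert (dA : mdet (A t) = 1) by (unfold A; rewrite !mdet_mmul, mdet_madj, dc, dP'; ring).
    assert (dB : mdet (B t) = 1) by (unfold B; rewrite mdet_mmul, mdet_madj, dc, dQ'; ring).
    destruct (Hr (A t) (B t) dA dB) as (r1 & r2 & r3).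
    split; [exact Hk|]. split; [rewrite mdet_mmul, dc, dY; ring|]. split; [exact r1|]. split; [exact r2|].
    rewrite r3, <- HC. unfold A, B. apply twist_B; auto. rewrite <- Em. apply Cm. }
  destruct Hm as [<-|[<-|[<-|[<-|[]]]]].
  - exists (fun t => mmul (c t) Y), (fun _ => P), (fun _ => Q).
    repeat (split; [first [exact CF|apply mcont_const|exact F0|reflexivity]|]).
    eapply evt_mono; [|exact Ev]. cbn beta. intros t (dc & Hk).
    repeat split; auto; [rewrite mdet_mmul, dc, dY; ring|]. f_equal. apply twist_A; [exact dc|apply Cm].
  - apply (main P Q (fun A _ => A) (fun _ B => B)); auto.
  - apply (main (mmul P Q) Q (fun A B => mmul A (madj B)) (fun _ B => B)); auto.
    + rewrite mdet_mmul, dP, dQ; ring.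
    + apply mcomm_slide.
    + now apply mmul_madj_cancel_r.
    + intros A B dA dB. split; [rewrite mdet_mmul, mdet_madj, dA, dB; ring|]. split; [exact dB|].
      now apply mcomm_slide_inv.
    + intros A B cA cB. split; [|exact cB]. apply mcont_mmul; [exact cA|now apply mcont_madj].
  - apply (main (mmul P (mmul Q (madj P))) (madj P) (fun _ B => madj B) (fun A B => mmul B (mmul A (madj B)))); auto.
    + rewrite !mdet_mmul, mdet_madj, dP, dQ; ring.
    + now rewrite mdet_madj.
    + apply mcomm_rotate.
    + apply madj_madj.
    + rewrite madj_madj. rewrite <- (mmul_assoc P), mmul_madj_cancel_l by exact dP. now apply mmul_madj_cancel_r'.
    + intros A B dA dB. split; [now rewrite mdet_madj|]. split; [rewrite !mdet_mmul, mdet_madj, dA, dB; ring|].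
      now apply mcomm_rotate_inv.
    + intros A B cA cB. split; [now apply mcont_madj|]. apply mcont_mmul; [exact cB|]. apply mcont_mmul; [exact cA|now apply mcont_madj].
Qed.
End Flows.

(** * From curves of generators to curves in Teichmueller space *)

Lemma eval_pm rho rho' w : (forall l, In l w -> pm_eq (rho (fst l)) (rho' (fst l))) -> pm_eq (eval rho w) (eval rho' w).
Proof.
  induction w as [|[i b] w IH]; intros H; [apply pm_eq_refl|]. cbn [eval]. apply pm_eq_mmul.
  - pose proof (H (i, b) (or_introl eq_refl)) as K. unfold eval_letter. cbn [fst snd] in *. destruct b; [now apply pm_eq_madj|exact K].
  - apply IH. intros; apply H; now right.
Qed.

Definition msign (s : bool) (A : Mat2) : Mat2 := if s then mneg A else A.
Lemma msign_pm s A : pm_eq (msign s A) A.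
Proof. destruct s; [now right|now left]. Qed.

Section Deform.
Variables (g : nat) (ws : nat -> word) (rho : rep).
Hypothesis Hg : (1 <= g)%nat.
Hypothesis Hws : standard_gen_set g ws.
Hypothesis HT : Teich g rho.

(** [sig] prescribes images of the standard generators, whereas [Teich] is stated in the original
    ones. The latter are words [us] in the former; evaluating these, correcting signs and
    conjugating by [normalizer] gives a curve through [rho], and [DF_stable] keeps it in
    Teichmueller space. *)
Lemma deform (sig : R -> rep) :
  (forall i, mcont (fun t => sig t i)) -> (forall i, (i < 2 * g)%nat -> sig 0 i = eval rho (ws i)) ->
  evt (fun t => SLrep (sig t) /\ pm_eq (eval (sig t) (relator g)) mid) ->
  forall r, r > 0 -> evt (fun t => exists rho' k, Teich g rho' /\ near g r rho rho' /\ mdet k = 1 /\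
    forall u, wf_word g u -> pm_eq (eval rho' (subst ws u)) (mmul (mmul k (eval (sig t) u)) (madj k))).
Proof.
  intros Hc H0 Hev r Hr. pose proof (Teich_DFrep g rho HT) as HDF.
  destruct (gen_preimages g ws Hws) as (us & Hus).
  assert (E0 : forall u, wf_word g u -> eval (sig 0) u = eval rho (subst ws u)).
  { intros u Hu. rewrite eval_subst. apply eval_ext. intros l Hl. apply H0. now apply wf_letters with u. }
  (* The lifts agree with [rho] only up to sign at time 0. The signs are fixed there once and for
     all, and continuity keeps the traces positive. *)
  destruct (finite_choice (fun j s => msign s (eval (sig 0) (us j)) = rho j) false (2 * g)) as (sg & Hsg).
  { intros j Hj. destruct (Hus j Hj) as (W & E). rewrite (E0 _ W).
    pose proof (DF_pm g rho _ _ HDF E) as K. cbn in K. unfold eval_letter in K. cbn in K. rewrite mmul_id_r in K.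
    destruct K as [K|K]; [exists false|exists true]; cbn; now rewrite K, ?mneg_mneg. }
  set (rho1 := fun t j => if Nat.ltb j (2 * g) then msign (sg j) (eval (sig t) (us j)) else mid).
  assert (C1 : forall j, mcont (fun t => rho1 t j)).
  { intros j. unfold rho1. destruct (Nat.ltb j (2 * g)); [|apply mcont_const].
    destruct (sg j); cbn; [apply mcont_mneg|]; now apply mcont_eval. }
  destruct HT as (_ & T1 & T2 & T3 & T4 & T5 & T6 & T7).
  assert (Z1 : forall j, rho1 0 j = rho j).
  { intros j. unfold rho1. destruct (Nat.ltb_spec j (2 * g)); [now apply Hsg|]. symmetry; now apply T2. }
  destruct HDF as (Hsl & HD).
  assert (d0 : mdet (rho 0%nat) = 1) by apply Hsl. assert (d1 : mdet (rho 1%nat) = 1) by apply Hsl.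
  assert (tr1 : mtr (rho 1%nat) > 0) by (apply T1; lia).
  destruct (normalizer (fun t => rho1 t 0%nat) (fun t => rho1 t 1%nat)) as (k & Ck & K0 & Ek); cbn beta; rewrite ?Z1; auto.
  { unfold mdet in d0. rewrite T3, T4 in d0. set (a := m11 (rho 0%nat)) in *. set (d := m22 (rho 0%nat)) in *.
    destruct (Rlt_le_dec d a) as [|Hle]; [assumption|]. exfalso.
    assert (a * a <= a * d) by (apply Rmult_le_compat_l; lra). nra. }
  { unfold mdet in d1. unfold mtr in tr1. set (a := m11 (rho 1%nat)) in *. set (b := m12 (rho 1%nat)) in *. set (c := m21 (rho 1%nat)) in *. set (d := m22 (rho 1%nat)) in *.
    (* [a + b] is the eigenvalue on [(1, 1)] and [d - b] the other one. Their product is 1 and their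
       sum is positive, so both are positive and the attracting one is larger. *)
    assert (Hmu : (a + b) * (d - b) = 1) by (replace c with (a + b - d) in d1 by lra; lra).
    assert (Hsq : 1 < (a + b) * (a + b)) by (rewrite <- T6 in T7; cbn in T7; lra).
    assert (Hp : 0 < a + b).
    { destruct (Rlt_le_dec 0 (a + b)) as [|Hle]; [assumption|]. exfalso.
      assert (0 < d - b) by lra. assert ((a + b) * (d - b) <= 0 * (d - b)) by (apply Rmult_le_compat_r; lra). lra. }
    destruct (Rlt_le_dec (d - b) (a + b)) as [|Hle]; [assumption|]. exfalso.
    assert ((a + b) * (a + b) <= (a + b) * (d - b)) by (apply Rmult_le_compat_l; lra). lra. }
  set (rho2 := fun t => conj_rep (k t) (rho1 t)).
  assert (C2 : forall j, mcont (fun t => rho2 t j)).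
  { intros j. unfold rho2, conj_rep. apply mcont_mmul; [apply mcont_mmul; [exact Ck|apply C1]|now apply mcont_madj]. }
  assert (Z2 : forall j, rho2 0 j = rho j).
  { intros j. unfold rho2, conj_rep. now rewrite K0, madj_mid, mmul_id_l, mmul_id_r, Z1. }
  destruct (DF_stable g rho Hg (conj Hsl HD)) as (rs & Hrs & Hstab).
  assert (Enear : forall e, e > 0 -> evt (fun t => near g e rho (rho2 t))).
  { intros e He. apply evt_mono with (fun t => forall j, In j (seq 0 (2 * g)) -> close e (rho2 0 j) (rho2 t j)).
    - intros t Ht j Hj. rewrite <- Z2. apply Ht, in_seq. lia.
    - apply evt_all. intros j _. apply (mcont_close (fun t => rho2 t j)); auto. }
  assert (Etr : evt (fun t => forall j, In j (seq 0 (2 * g)) -> 0 < mtr (rho2 t j))).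
  { apply evt_all. intros j Hj. apply in_seq in Hj. apply (cont0_lt (fun t => mtr (rho2 t j))).
    - apply mcont_mtr, C2.
    - rewrite Z2. apply T1. lia. }
  assert (E5 : evt (fun t => 1 < m11 (rho2 t 0%nat))).
  { apply (cont0_lt (fun t => m11 (rho2 t 0%nat))); [apply C2|rewrite Z2; exact T5]. }
  assert (E7 : evt (fun t => 1 < (m21 (rho2 t 1%nat) + m22 (rho2 t 1%nat)) ^ 2)).
  { destruct (C2 1%nat) as (_ & _ & c3 & c4).
    apply (cont0_lt (fun t => (m21 (rho2 t 1%nat) + m22 (rho2 t 1%nat)) ^ 2)); [|rewrite Z2; exact T7].
    cbn. auto 6 with cont0. }
  eapply evt_mono; [|exact (evt_and _ _ (evt_and _ _ Hev Ek) (evt_and _ _ (evt_and _ _ (Enear _ Hr) (Enear _ Hrs)) (evt_and _ _ Etr (evt_and _ _ E5 E7))))].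
  cbn beta. intros t (((Hslt & Hrel) & dk & N1 & N2 & N3) & (Nr & Ns) & Htr & H5 & H7).
  assert (Hsl1 : SLrep (rho1 t)).
  { intros j. unfold rho1. destruct (Nat.ltb j (2 * g)); [|apply mdet_mid].
    destruct (sg j); cbn; rewrite ?mdet_mneg; now apply mdet_eval. }
  assert (Hev1 : forall w, wf_word g w -> pm_eq (eval (rho1 t) w) (eval (sig t) (subst us w))).
  { intros w Hw. rewrite eval_subst. apply eval_pm. intros l Hl. unfold rho1.
    replace (Nat.ltb (fst l) (2 * g)) with true; [apply msign_pm|]. symmetry; apply Nat.ltb_lt. now apply wf_letters with w. }
  (* The relator in the original generators must become trivial when rewritten in the standard ones.
     This is where the substitution has to be invertible, not only surjective. *)
  assert (Hrel1 : pm_eq (eval (rho1 t) (relator g)) mid).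
  { eapply pm_eq_trans; [apply Hev1, wf_relator|]. change mid with (eval (sig t) []).
    apply (geq_pm (sig t) Hslt g); [exact Hrel|]. apply relator_preimage with ws rho; auto. now split. }
  assert (Hsl2 : SLrep (rho2 t)).
  { intros j. unfold rho2, conj_rep. rewrite !mdet_mmul, mdet_madj, dk, Hsl1. ring. }
  assert (HDF2 : DFrep g (rho2 t)).
  { apply Hstab; auto. unfold rho2. rewrite eval_conj by exact dk. now apply conj_pm_mid. }
  exists (rho2 t), (k t). split; [|split; [exact Nr|split; [exact dk|]]].
  - split; [apply HDF2|]. split; [intros i Hi; apply Htr, in_seq; lia|]. split.
    + intros i Hi. unfold rho2, conj_rep, rho1. replace (Nat.ltb i (2 * g)) with false by (symmetry; apply Nat.ltb_ge; lia).
      rewrite mmul_id_r. now apply mmul_madj_r.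
    + exact (conj N1 (conj N2 (conj H5 (conj N3 H7)))).
  - intros u Hu. unfold rho2. rewrite eval_conj by exact dk.
    apply pm_eq_mmul; [apply pm_eq_mmul; [apply pm_eq_refl|]|apply pm_eq_refl].
    eapply pm_eq_trans; [apply Hev1, wf_subst; [apply Hws|exact Hu]|].
    apply (geq_pm (sig t) Hslt g); [exact Hrel|]. apply preimage_subst with rho; auto. now split.
Qed.
End Deform.

(** * Twist deformations and coincidences of traces *)

Lemma relator_split g : (2 <= g)%nat ->
  relator g = flat_map comm_word (seq 0 (g - 2)) ++ comm_word (g - 2) ++ comm_word (g - 1).
Proof.
  intros Hg. unfold relator. replace (seq 0 g) with (seq 0 (g - 2) ++ [g - 2; g - 1]%nat).
  - rewrite flat_map_app. cbn [flat_map]. now rewrite app_nil_r.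
  - replace g with ((g - 2) + 2)%nat at 4 by lia. rewrite seq_app. cbn. repeat f_equal; lia.
Qed.
Lemma eval_comm_word rho i : eval rho (comm_word i) = mcomm (rho (2 * i)%nat) (rho (2 * i + 1)%nat).
Proof. unfold comm_word, mcomm; cbn [eval eval_letter fst snd]. unfold eval_letter; cbn [fst snd]. now rewrite mmul_id_r. Qed.

Lemma mtr_conj k A : mdet k = 1 -> mtr (mmul (mmul k A) (madj k)) = mtr A.
Proof. intros Hk. rewrite mtr_mmul_comm, mmul_assoc, mmul_madj_l, mmul_id_l; auto. Qed.
Lemma pm_mtr_sq A B : pm_eq A B -> mtr A ^ 2 = mtr B ^ 2.
Proof. intros [-> | ->]; rewrite ?mtr_mneg; ring. Qed.

(** Trace 2 would make the commutator trivial by [no_parabolic]; [hopfian] carries this back to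
    [comm_word i], and [comm_nontrivial] excludes it with the help of the second handle [i']. *)
Lemma gen_comm_trace g ws rho i i' : (1 <= g)%nat -> standard_gen_set g ws -> DFrep g rho -> (i < g)%nat -> (i' < g)%nat -> i <> i' ->
  mtr (mcomm (eval rho (ws (2 * i)%nat)) (eval rho (ws (2 * i + 1)%nat))) <> 2.
Proof.
  intros Hg Hws HDF Hi Hi' Hne H. destruct (DF_cocompact g rho Hg HDF) as (D & HD & Hco).
  assert (Hwf : wf_word g (comm_word i)) by (unfold comm_word; repeat constructor; cbn [fst]; lia).
  apply (comm_nontrivial g i i' Hi Hi' Hne), (hopfian g ws Hws rho); auto.
  apply (no_parabolic g rho D); auto.
  - apply wf_subst; [apply Hws|exact Hwf].
  - rewrite eval_subst, eval_comm_word. exact H.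
Qed.

Section Codim.
Variables (g : nat) (ws : nat -> word).
Hypothesis Hg : (3 <= g)%nat.
Hypothesis Hws : standard_gen_set g ws.
Notation iX := (2 * (g - 2))%nat.
Notation iY := (2 * (g - 2) + 1)%nat.
Notation iP := (2 * (g - 1))%nat.
Notation iQ := (2 * (g - 1) + 1)%nat.
Definition gen (rho : rep) (i : nat) : Mat2 := eval rho (ws i).
Definition Aword (u : word) : Prop := Forall (fun l => (fst l < 2 * g - 3)%nat) u.
(** Squaring removes the sign of the lift, so that equality of two such values is a polynomial
    condition that covers both signs. *)
Definition ttest (rho : rep) (u : word) : R := mtr (eval rho (subst ws (u ++ [(iY, false)]))) ^ 2.
Definition tw (rho : rep) : list Mat2 := twists (gen rho iX) (gen rho iY) (gen rho iP) (gen rho iQ).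

(** The flow moves only the generators from [iY] on, so the words in [A] keep their matrices. Up to
    the factor [ckap], which is the same for all [u], the trace is affine in the time [t]. *)
Lemma twist_deform rho m : Teich g rho -> In m (tw rho) -> forall r, r > 0 ->
  evt (fun t => ckap m t <> 0 /\ exists rho', Teich g rho' /\ near g r rho rho' /\
    forall u, Aword u -> ttest rho' u =
      (ckap m t * (mtr (mmul (eval (gen rho) u) (gen rho iY)) + t * mtr (mmul (eval (gen rho) u) (mmul m (gen rho iY))))) ^ 2).
Proof.
  intros HT Hm r Hr. pose proof (Teich_DFrep g rho HT) as HDF. pose proof HDF as (Hsl & _).
  assert (dg : forall i, mdet (gen rho i) = 1) by (intros; now apply mdet_eval).
  destruct (flow_exists _ _ _ _ (dg iX) (dg iY) (dg iP) (dg iQ) m Hm) as (F & G & H & CF & CG & CH & F0 & G0 & H0 & EF & Ev).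
  set (sig := fun t i => if Nat.eqb i iY then F t else if Nat.eqb i iP then G t else if Nat.eqb i iQ then H t else gen rho i).
  assert (SY : forall t, sig t iY = F t) by (intros; unfold sig; now rewrite Nat.eqb_refl).
  assert (SP : forall t, sig t iP = G t).
  { intros; unfold sig. rewrite Nat.eqb_refl. now replace (Nat.eqb iP iY) with false by (symmetry; apply Nat.eqb_neq; lia). }
  assert (SQ : forall t, sig t iQ = H t).
  { intros; unfold sig. rewrite Nat.eqb_refl. replace (Nat.eqb iQ iY) with false by (symmetry; apply Nat.eqb_neq; lia).
    now replace (Nat.eqb iQ iP) with false by (symmetry; apply Nat.eqb_neq; lia). }
  assert (SO : forall t i, (i <= iX)%nat -> sig t i = gen rho i).
  { intros t i Hi; unfold sig. replace (Nat.eqb i iY) with false by (symmetry; apply Nat.eqb_neq; lia).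
    replace (Nat.eqb i iP) with false by (symmetry; apply Nat.eqb_neq; lia).
    now replace (Nat.eqb i iQ) with false by (symmetry; apply Nat.eqb_neq; lia). }
  pose proof (deform g ws rho ltac:(lia) Hws HT sig) as Dm.
  assert (Hrel0 : pm_eq (eval (gen rho) (relator g)) mid).
  { unfold gen. rewrite <- eval_subst. exact (DF_pm g rho _ [] HDF (proj1 (proj2 Hws))). }
  assert (D1 : forall i, mcont (fun t => sig t i)).
  { intros i. unfold sig. destruct (Nat.eqb i iY); [exact CF|]. destruct (Nat.eqb i iP); [exact CG|].
    destruct (Nat.eqb i iQ); [exact CH|apply mcont_const]. }
  assert (D2 : forall i, (i < 2 * g)%nat -> sig 0 i = eval rho (ws i)).
  { intros i _. unfold sig. destruct (Nat.eqb_spec i iY) as [->|_]; [exact F0|].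
    destruct (Nat.eqb_spec i iP) as [->|_]; [exact G0|]. destruct (Nat.eqb_spec i iQ) as [->|_]; [exact H0|reflexivity]. }
  assert (D3 : evt (fun t => SLrep (sig t) /\ pm_eq (eval (sig t) (relator g)) mid)).
  { eapply evt_mono; [|exact Ev]. cbn beta. intros t (_ & dF & dG & dH & Erel). split.
    - intros i. unfold sig. destruct (Nat.eqb i iY); [exact dF|]. destruct (Nat.eqb i iP); [exact dG|].
      destruct (Nat.eqb i iQ); [exact dH|apply dg].
    - rewrite relator_split in * by lia. rewrite !eval_app, !eval_comm_word in *.
      rewrite SY, SP, SQ, SO by lia. rewrite Erel.
      rewrite (eval_ext (sig t) (gen rho)); [exact Hrel0|].
      intros l Hl. apply SO. apply in_flat_map in Hl. destruct Hl as (j & Hj & Hl). apply in_seq in Hj.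
      unfold comm_word in Hl. destruct Hl as [<-|[<-|[<-|[<-|[]]]]]; cbn [fst]; lia. }
  specialize (Dm D1 D2 D3 r Hr).
  eapply evt_mono; [|exact (evt_and _ _ Ev Dm)]. cbn beta.
  intros t ((Hk & _) & rho' & k & HT' & Hn & dk & Hev). split; [exact Hk|].
  exists rho'. split; [exact HT'|]. split; [exact Hn|]. intros u Hu. unfold ttest.
  assert (Wu : wf_word g (u ++ [(iY, false)])).
  { apply wf_app; [|constructor; [cbn [fst]; lia|constructor]]. eapply Forall_impl; [|exact Hu]. cbn. intros; lia. }
  rewrite (pm_mtr_sq _ _ (Hev _ Wu)), mtr_conj by exact dk. f_equal. rewrite eval_app. cbn [eval]. unfold eval_letter. cbn [fst snd].
  rewrite mmul_id_r, SY, EF. rewrite (eval_ext (sig t) (gen rho)).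
  - set (a := eval (gen rho) u). set (y := gen rho iY). unfold ccurve. generalize (ckap m t). intros z.
    destruct a, y, m. unfold mscal, madd, mid, mmul, mtr; cbn. ring.
  - intros l Hl. apply SO. unfold Aword in Hu. rewrite Forall_forall in Hu. specialize (Hu l Hl). lia.
Qed.

Definition mzero := mkMat2 0 0 0 0.
(** By the Cayley-Hamilton theorem, the traces of [N] and of [N] times the first twist determine
    that of [N KK]. Then [W = N KK] has zero traces against 1, [P], [PQ] and the conjugate of [Q] by
    [P], hence also against [Q], and the trace form is nondegenerate. *)
Lemma twists_span rho N : DFrep g rho -> mtr N = 0 -> (forall m, In m (tw rho) -> mtr (mmul N m) = 0) -> N = mzero.
Proof.
  intros HDF H0 H. pose proof HDF as (Hsl & _).
  assert (dg : forall i, mdet (gen rho i) = 1) by (intros; now apply mdet_eval).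
  pose proof (gen_comm_trace g ws rho (g - 1) (g - 2) ltac:(lia) Hws HDF ltac:(lia) ltac:(lia) ltac:(lia)) as Hc.
  fold (gen rho iP) in Hc. fold (gen rho iQ) in Hc.
  unfold tw in H. set (X := gen rho iX) in *. set (Y := gen rho iY) in *. set (P := gen rho iP) in *. set (Q := gen rho iQ) in *.
  assert (dX : mdet X = 1) by apply dg. assert (dY : mdet Y = 1) by apply dg.
  assert (dP : mdet P = 1) by apply dg. assert (dQ : mdet Q = 1) by apply dg.
  clearbody X Y P Q.
  pose proof (H _ (or_introl eq_refl)) as H1. pose proof (H _ (or_intror (or_introl eq_refl))) as H2.
  pose proof (H _ (or_intror (or_intror (or_introl eq_refl)))) as H3.
  pose proof (H _ (or_intror (or_intror (or_intror (or_introl eq_refl))))) as H4. clear H.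
  set (K := KK X Y) in *. assert (dK : mdet K = 1) by now apply det_KK.
  assert (EK : mtr (mmul N K) = 0).
  { assert (E : mtr (mmul N K) = mdet Y * mtr X * mtr N - mtr (mmul N (mmul Y (mmul X (madj Y))))).
    { unfold K, KK. destruct N, X, Y. unfold mdet, mtr, mmul, madj; cbn. ring. }
    rewrite E, H1, H0. ring. }
  set (W := mmul N K). rewrite (mmul_assoc N K) in H2, H3, H4. fold W in H2, H3, H4. fold W in EK.
  assert (EQ : mtr (mmul W Q) = 0).
  { assert (E : mtr (mmul (mmul (mmul W P) Q) (madj P)) =
       mtr P * mtr (mmul W (mmul P Q)) - mtr (mmul P Q) * mtr (mmul W P) + mdet P * (mtr Q * mtr W - mtr (mmul W Q))).
    { clearbody W. destruct W, P, Q. unfold mdet, mtr, mmul, madj; cbn. ring. }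
    rewrite <- !mmul_assoc in E. rewrite H4, H3, H2, EK, dP in E. lra. }
  assert (EW : W = mzero).
  { apply (trace_form_nondegenerate P Q W); auto. }
  rewrite <- (mmul_madj_cancel_r K N dK). fold W. rewrite EW. unfold mzero, mmul; cbn. f_equal; ring.
Qed.

Lemma quadratic_zero a b c : evt (fun t => a + b * t + c * (t * t) = 0) -> a = 0 /\ b = 0 /\ c = 0.
Proof.
  intros (d & Hd & H).
  assert (H0 : a = 0). { pose proof (H 0) as K. rewrite Rabs_R0 in K. specialize (K Hd). lra. }
  assert (K1 : a + b * (d / 2) + c * (d / 2 * (d / 2)) = 0) by (apply H; rewrite Rabs_right; lra).
  assert (K2 : a + b * (- (d / 2)) + c * (- (d / 2) * - (d / 2)) = 0) by (apply H; rewrite Rabs_Ropp, Rabs_right; lra).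
  split; [exact H0|]. split.
  - assert (E : b * d = 0) by lra. apply Rmult_integral in E. lra.
  - assert (E : c * (d * d) = 0) by lra. apply Rmult_integral in E. destruct E as [|E]; [assumption|]. nra.
Qed.

Lemma twist_compare rho r u u' m : Teich g rho -> r > 0 -> Aword u -> Aword u' ->
  (forall rho', Teich g rho' -> near g r rho rho' -> ttest rho' u = ttest rho' u') -> In m (tw rho) ->
  let al u := mtr (mmul (eval (gen rho) u) (gen rho iY)) in
  let be u := mtr (mmul (eval (gen rho) u) (mmul m (gen rho iY))) in
  al u ^ 2 = al u' ^ 2 /\ al u * be u = al u' * be u' /\ be u ^ 2 = be u' ^ 2.
Proof.
  intros HT Hr Hu Hu' HE Hm al be. pose proof (twist_deform rho m HT Hm r Hr) as Ev.
  destruct (quadratic_zero (al u ^ 2 - al u' ^ 2) (2 * (al u * be u - al u' * be u')) (be u ^ 2 - be u' ^ 2)) as (h1 & h2 & h3).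
  - eapply evt_mono; [|exact Ev]. cbn beta. intros t (Hk & rho' & HT' & Hn & Ht).
    specialize (HE rho' HT' Hn). rewrite (Ht u Hu), (Ht u' Hu') in HE. fold (al u) (al u') (be u) (be u') in HE.
    set (z := ckap m t) in *.
    assert (E : z ^ 2 * (al u ^ 2 - al u' ^ 2 + 2 * (al u * be u - al u' * be u') * t + (be u ^ 2 - be u' ^ 2) * (t * t)) = 0) by lra.
    apply Rmult_integral in E. destruct E as [E|E]; [|exact E]. exfalso. apply (pow_nonzero z 2 Hk E).
  - lra.
Qed.

Lemma ttest_gen rho u : ttest rho u = mtr (mmul (eval (gen rho) u) (gen rho iY)) ^ 2.
Proof. unfold ttest. rewrite eval_subst, eval_app. cbn [eval]. now rewrite mmul_id_r. Qed.

Lemma wf_Aword u : Aword u -> wf_word g (subst ws u).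
Proof. intros Hu. apply wf_subst; [apply Hws|]. eapply Forall_impl; [|exact Hu]. cbn. intros; lia. Qed.

(** With a nonzero trace at [rho], the sign [e] relating the two traces is determined there, and the
    mixed coefficient of the quadratic identity forces the same sign for every twist. Hence
    [Y (a - e a')] is orthogonal to the identity and all twists. *)
Lemma codim_regular rho r u u' : Teich g rho -> r > 0 -> Aword u -> Aword u' -> ttest rho u <> 0 ->
  (forall rho', Teich g rho' -> near g r rho rho' -> ttest rho' u = ttest rho' u') ->
  geq g (subst ws u) (subst ws u').
Proof.
  intros HT Hr Hu Hu' Hne HE. pose proof (Teich_DFrep g rho HT) as HDF. pose proof HDF as (Hsl & _).
  pose proof (fun m Hm => twist_compare rho r u u' m HT Hr Hu Hu' HE Hm) as C. cbv zeta in C.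
  rewrite ttest_gen in Hne.
  assert (dY : mdet (gen rho iY) = 1) by now apply mdet_eval.
  set (Y := gen rho iY) in *. set (a := eval (gen rho) u) in *. set (a' := eval (gen rho) u') in *.
  assert (A0 : mtr (mmul a Y) <> 0) by (intros E; apply Hne; rewrite E; ring).
  assert (Key : forall e, (e = 1 \/ e = -1) -> mtr (mmul a Y) = e * mtr (mmul a' Y) -> mdiff a (mscal e a') = mzero).
  { intros e He Ee. set (N := mdiff a (mscal e a')).
    assert (EN : mmul Y N = mzero).
    { apply (twists_span rho); [exact HDF| |].
      - transitivity (mtr (mmul a Y) - e * mtr (mmul a' Y)); [|lra].
        unfold N. clear. clearbody a a' Y. destruct a, a', Y. unfold mtr, mmul, mdiff, mscal; cbn. ring.
      - intros m Hm. destruct (C m Hm) as (_ & c2 & _). fold Y a a' in c2.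
        assert (Eb : mtr (mmul a (mmul m Y)) = e * mtr (mmul a' (mmul m Y))).
        { rewrite Ee in c2. rewrite Rmult_assoc in c2.
          assert (B0 : mtr (mmul a' Y) <> 0) by (intros E; apply A0; rewrite Ee, E; ring).
          assert (E1 : e * mtr (mmul a (mmul m Y)) = mtr (mmul a' (mmul m Y))).
          { apply (Rmult_eq_reg_l (mtr (mmul a' Y))); [lra|exact B0]. }
          rewrite <- E1. destruct He as [-> | ->]; ring. }
        transitivity (mtr (mmul a (mmul m Y)) - e * mtr (mmul a' (mmul m Y))); [|lra].
        unfold N. clear. clearbody a a' Y. destruct a, a', Y, m. unfold mtr, mmul, mdiff, mscal; cbn. ring. }
    rewrite <- (mmul_madj_cancel_l Y N dY), EN. unfold mmul, mzero; cbn. f_equal; ring. }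
  apply (DF_geq g rho); auto using wf_Aword. rewrite !eval_subst. change (pm_eq a a').
  destruct (C _ (or_introl eq_refl)) as (c1 & _). fold Y a a' in c1.
  assert (Hs : mtr (mmul a Y) = 1 * mtr (mmul a' Y) \/ mtr (mmul a Y) = -1 * mtr (mmul a' Y)).
  { assert (E : (mtr (mmul a Y) - mtr (mmul a' Y)) * (mtr (mmul a Y) + mtr (mmul a' Y)) = 0) by lra.
    apply Rmult_integral in E. lra. }
  destruct Hs as [Hs|Hs]; [left; pose proof (Key 1 (or_introl eq_refl) Hs) as K|right; pose proof (Key (-1) (or_intror eq_refl) Hs) as K];
    clear - K; clearbody a a'; destruct a, a'; unfold mdiff, mscal, mzero, mneg in *; cbn in *; injection K; intros; f_equal; lra.
Qed.

Lemma near_trans r r' rho1 rho2 rho3 : near g r rho1 rho2 -> near g r' rho2 rho3 -> near g (r + r') rho1 rho3.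
Proof.
  intros H H' i Hi. specialize (H i Hi). specialize (H' i Hi). destruct H as (h1 & h2 & h3 & h4), H' as (k1 & k2 & k3 & k4).
  assert (T : forall x y z, Rabs (x - y) < r -> Rabs (y - z) < r' -> Rabs (x - z) < r + r').
  { intros x y z Hx Hy. replace (x - z) with ((x - y) + (y - z)) by ring. pose proof (Rabs_triang (x - y) (y - z)). lra. }
  repeat split; eapply T; eassumption.
Qed.

(** A vanishing trace is removed by moving a little along a twist. Some twist changes it to first
    order, since otherwise [twists_span] would give [mmul Y a = mzero], against the determinant. *)
Theorem trace_coincidence_rigid rho r u u' : Teich g rho -> r > 0 -> Aword u -> Aword u' ->
  (forall rho', Teich g rho' -> near g r rho rho' -> ttest rho' u = ttest rho' u') ->
  geq g (subst ws u) (subst ws u').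
Proof.
  intros HT Hr Hu Hu' HE. destruct (Req_dec (ttest rho u) 0) as [E0|Hne]; [|now apply codim_regular with rho r].
  pose proof (Teich_DFrep g rho HT) as HDF. pose proof HDF as (Hsl & _).
  rewrite ttest_gen in E0.
  assert (dY : mdet (gen rho iY) = 1) by now apply mdet_eval.
  set (a := eval (gen rho) u) in *. set (Y := gen rho iY) in *.
  assert (da : mdet a = 1) by (apply mdet_eval; intros i; now apply mdet_eval).
  assert (A0 : mtr (mmul a Y) = 0).
  { cbn in E0. rewrite Rmult_1_r in E0. apply Rmult_integral in E0. tauto. }
  assert (Hex : exists m, In m (tw rho) /\ mtr (mmul a (mmul m Y)) <> 0).
  { apply NNPP. intros Hno. assert (E : mmul Y a = mzero).
    { apply (twists_span rho); [exact HDF|rewrite mtr_mmul_comm; exact A0|].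
      intros m Hm. apply NNPP. intros Hm0. apply Hno. exists m. split; [exact Hm|].
      now rewrite mmul_assoc, mtr_mmul_comm, mmul_assoc. }
    pose proof (mdet_mmul Y a) as K. rewrite E, dY, da in K. unfold mdet, mzero in K; cbn in K. lra. }
  destruct Hex as (m & Hm & Hb).
  destruct (twist_deform rho m HT Hm (r / 2) ltac:(lra)) as (d & Hd & Ht).
  destruct (Ht (d / 2)) as (Hk & rho1 & HT1 & Hn1 & E1); [rewrite Rabs_right; lra|].
  specialize (E1 u Hu). fold a Y in E1. rewrite A0 in E1.
  apply (codim_regular rho1 (r / 2)); auto; [lra| |].
  - rewrite E1. apply pow_nonzero. apply Rmult_integral_contrapositive_currified; [exact Hk|].
    rewrite Rplus_0_l. apply Rmult_integral_contrapositive_currified; [lra|exact Hb].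
  - intros rho' HT' Hn'. apply HE; [exact HT'|]. replace r with (r / 2 + r / 2) by lra. now apply near_trans with rho1.
Qed.
End Codim.

(** * Counting *)

Lemma classical_split {T} (P : T -> Prop) (l : list T) : exists l1 l2,
  (forall x, In x l1 -> In x l /\ P x) /\ (forall x, In x l2 -> In x l /\ ~ P x) /\
  length l = (length l1 + length l2)%nat /\ (forall F, lsum F l = lsum F l1 + lsum F l2) /\
  (forall E, ForallOrdPairs E l -> ForallOrdPairs E l1 /\ ForallOrdPairs E l2).
Proof.
  induction l as [|x l (l1 & l2 & H1 & H2 & H3 & H4 & H5)].
  - exists [], []. repeat split; try easy; try constructor. intros F; cbn; ring.
  - assert (FOP : forall E l', incl l' l -> ForallOrdPairs E (x :: l) -> ForallOrdPairs E l' -> ForallOrdPairs E (x :: l')).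
    { intros E l' Hi Hx Hl'. inversion Hx as [|? ? Hf]; subst. constructor; [|exact Hl'].
      rewrite Forall_forall in *. auto. }
    destruct (classic (P x)) as [Hx|Hx].
    + exists (x :: l1), l2. split; [intros y [<-|Hy]; cbn; [tauto|specialize (H1 y Hy); tauto]|].
      split; [intros y Hy; specialize (H2 y Hy); cbn; tauto|]. split; [cbn; lia|]. split.
      * intros F. change (F x + lsum F l = F x + lsum F l1 + lsum F l2). rewrite H4. ring.
      * intros E HE. inversion HE as [|? ? Hf HE']; subst. destruct (H5 E HE'). split; [|assumption].
        apply FOP; auto. intros y Hy; now apply H1.
    + exists l1, (x :: l2). split; [intros y Hy; specialize (H1 y Hy); cbn; tauto|].
      split; [intros y [<-|Hy]; cbn; [tauto|specialize (H2 y Hy); tauto]|]. split; [cbn; lia|]. split.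
      * intros F. change (F x + lsum F l = lsum F l1 + (F x + lsum F l2)). rewrite H4. ring.
      * intros E HE. inversion HE as [|? ? Hf HE']; subst. destruct (H5 E HE'). split; [assumption|].
        apply FOP; auto. intros y Hy; now apply H2.
Qed.

Lemma cover_count {T K} (rel : T -> K -> Prop) (E : T -> T -> Prop) (M : nat) (D : list K) : forall l, ForallOrdPairs E l ->
  (forall x, In x l -> exists d, In d D /\ rel x d) ->
  (forall d l', In d D -> ForallOrdPairs E l' -> (forall x, In x l' -> In x l /\ rel x d) -> (length l' <= M)%nat) ->
  (length l <= length D * M)%nat.
Proof.
  induction D as [|d D IH]; intros l HE Hc HM.
  - destruct l as [|x l]; [cbn; lia|]. destruct (Hc x (or_introl eq_refl)) as (d & [] & _).
  - destruct (classical_split (fun x => rel x d) l) as (l1 & l2 & H1 & H2 & H3 & _ & H5).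
    destruct (H5 E HE) as (E1 & E2).
    assert (A1 : (length l1 <= M)%nat) by (apply (HM d); [now left|exact E1|exact H1]).
    assert (A2 : (length l2 <= length D * M)%nat).
    { apply IH; [exact E2| |].
      - intros x Hx. destruct (H2 x Hx) as (Hxl & Hn). destruct (Hc x Hxl) as (d' & [<-|Hd'] & Hr); [contradiction|]. now exists d'.
      - intros d' l' Hd' HE' Hl'. apply (HM d'); [now right|exact HE'|]. intros x Hx. destruct (Hl' x Hx) as (Hx2 & Hr).
        split; [now apply H2|exact Hr]. }
    cbn [length]. lia.
Qed.

Lemma separate {T} (E : T -> T -> Prop) l : (forall x, E x x) ->
  exists D, incl D l /\ ForallOrdPairs (fun x y => ~ E x y) D /\ forall x, In x l -> exists d, In d D /\ E x d.
Proof.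
  intros HE. induction l as [|x l (D & H1 & H2 & H3)].
  - exists []. split; [easy|]. split; [constructor|]. intros ? [].
  - destruct (classic (exists d, In d D /\ E x d)) as [Hx|Hx].
    + exists D. split; [intros y Hy; right; auto|]. split; [exact H2|]. intros y [<-|Hy]; auto.
    + exists (x :: D). split; [intros y [<-|Hy]; [now left|right; auto]|]. split.
      * constructor; [|exact H2]. apply Forall_forall. intros d Hd Hxd. apply Hx. now exists d.
      * intros y [<-|Hy]; [exists x; split; [now left|apply HE]|]. destruct (H3 y Hy) as (d & Hd & K). exists d; split; [now right|exact K].
Qed.

(** * Large shells from divergence of the Poincare series *)

Lemma hterm_le M s x : mdet M = 1 -> 0 < s -> 0 < x -> x <= mnorm M -> exp (- s * hdist_o M) <= Rpower (x * x / 2) (- s).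
Proof.
  intros HM Hs Hx HxM. unfold Rpower. pose proof (mnorm_sq_fro M) as Hf.
  assert (Hl : ln (x * x / 2) <= hdist_o M).
  { unfold hdist_o. set (X := (m11 M ^ 2 + _) / 2) || set (X := (_ + m22 M ^ 2) / 2).
    assert (EX : X = fro M / 2) by (unfold X, fro; cbn [pow]; lra).
    pose proof (sqrt_pos (X * X - 1)).
    assert (x * x <= mnorm M * mnorm M) by (apply Rmult_le_compat; lra).
    apply Rcomplements.ln_le; nra. }
  assert (Hm : - s * hdist_o M <= - s * ln (x * x / 2)) by nra.
  destruct (Rle_lt_or_eq_dec _ _ Hm) as [H|H]; [left; now apply exp_increasing|right; now rewrite H].
Qed.
Lemma hterm_le_1 M s : mdet M = 1 -> 0 < s -> exp (- s * hdist_o M) <= 1.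
Proof.
  intros HM Hs. pose proof (fro_ge2 M HM) as Hf.
  assert (Hl : 0 <= hdist_o M).
  { unfold hdist_o. set (X := (m11 M ^ 2 + _) / 2) || set (X := (_ + m22 M ^ 2) / 2).
    assert (EX : X = fro M / 2) by (unfold X, fro; cbn [pow]; lra).
    pose proof (sqrt_pos (X * X - 1)). rewrite <- ln_1. apply Rcomplements.ln_le; lra. }
  rewrite <- exp_0. assert (Hm : - s * hdist_o M <= 0) by nra.
  destruct (Rle_lt_or_eq_dec _ _ Hm) as [H|H]; [left; now apply exp_increasing|right; now rewrite H].
Qed.

Lemma shell_term al s k : 0 < s -> Rpower (3 ^ k) al * Rpower (3 ^ k * 3 ^ k / 2) (- s) = Rpower 2 s * Rpower 3 (al - 2 * s) ^ k.
Proof.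
  intros Hs. assert (Hk : 0 < 3 ^ k) by (apply pow_lt; lra).
  rewrite <- (Rpower_pow k (Rpower 3 _)) by apply exp_pos. rewrite <- (Rpower_pow k 3) by lra.
  rewrite !Rpower_mult. unfold Rpower.
  assert (E : ln (exp (INR k * ln 3) * exp (INR k * ln 3) / 2) = 2 * (INR k * ln 3) - ln 2).
  { unfold Rdiv. pose proof (exp_pos (INR k * ln 3)). rewrite !ln_mult, ln_Rinv, !ln_exp; try lra.
    - apply Rmult_lt_0_compat; lra. }
  rewrite E, <- !exp_plus. f_equal. ring.
Qed.

Section Shells.
Variables (g : nat) (ws : nat -> word) (rho : rep).
Hypothesis Hg : (3 <= g)%nat.
Hypothesis Hws : standard_gen_set g ws.
Hypothesis HDF : DFrep g rho.
Notation th := (gen ws rho).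
Definition sep (us : list word) : Prop := ForallOrdPairs (fun u v => ~ pm_eq (eval th u) (eval th v)) us.

Lemma mdet_th u : mdet (eval th u) = 1.
Proof. apply mdet_eval. intros i. apply mdet_eval. apply HDF. Qed.
Lemma A_ball_bound K : exists N : nat, forall us, (forall u, In u us -> Aword g u /\ mnorm (eval th u) <= K) -> sep us ->
  (length us <= N)%nat.
Proof.
  destruct (DF_ball_bound g rho HDF K) as (N & HN). exists N. intros us Hu Hs.
  rewrite <- (length_map (subst ws) us). apply HN.
  - apply Forall_forall. intros w Hw. apply in_map_iff in Hw. destruct Hw as (u & <- & Hw). apply wf_Aword; auto. now apply Hu.
  - intros w Hw. apply in_map_iff in Hw. destruct Hw as (u & <- & Hw). rewrite eval_subst. now apply Hu.
  - clear Hu. induction Hs as [|u us Hf Hs IH]; cbn; constructor; [|exact IH].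
    intros Hin. apply InA_alt in Hin. destruct Hin as (w & E & Hw). apply in_map_iff in Hw. destruct Hw as (v & <- & Hv).
    rewrite Forall_forall in Hf. apply (Hf v Hv). apply (DF_pm g rho _ _ HDF) in E. now rewrite !eval_subst in E.
Qed.

(** If every shell from [k0] on obeyed the opposite bound, the series would be dominated, outside a
    finite ball, by a geometric series of ratio [Rpower 3 (al - 2 * s)], as [shell_term] computes,
    and would converge. *)
Lemma big_shell al s C k0 : 0 < s -> al < 2 * s -> 0 < C -> ~ poincare_converges (A_image g ws rho) s ->
  exists k us, (k0 <= k)%nat /\ sep us /\ (forall u, In u us -> Aword g u /\ 3 ^ k <= mnorm (eval th u) < 3 ^ S k) /\
    C * Rpower (3 ^ k) al < INR (length us).
Proof.
  intros Hs Hal HC Hdiv. apply NNPP. intros Hno. apply Hdiv. clear Hdiv.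
  assert (Hsh : forall k us, (k0 <= k)%nat -> sep us ->
     (forall u, In u us -> Aword g u /\ 3 ^ k <= mnorm (eval th u) < 3 ^ S k) -> INR (length us) <= C * Rpower (3 ^ k) al).
  { intros k us Hk Hsep Hu. apply Rnot_lt_le. intros Hlt. apply Hno. now exists k, us. }
  clear Hno. destruct (A_ball_bound (3 ^ k0)) as (N & HN).
  set (r := Rpower 3 (al - 2 * s)).
  assert (Hr0 : 0 < r) by apply exp_pos.
  assert (Hr1 : r < 1).
  { unfold r. rewrite <- (Rpower_O 3) by lra. apply Rpower_lt; lra. }
  set (F := fun u => exp (- s * hdist_o (eval th u))).
  assert (count : forall us c, 0 <= c -> (forall u, In u us -> F u <= c) -> lsum F us <= INR (length us) * c).
  { intros us c Hc0 Hc. eapply Rle_trans; [apply (lsum_le F (fun _ => c)); exact Hc|].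
    right. clear. induction us as [|u us IH]; [cbn; ring|]. cbn [length]. rewrite S_INR. unfold lsum in *; cbn [fold_right]. rewrite IH. ring. }
  set (A := C * Rpower 2 s). assert (HA : 0 < A) by (apply Rmult_lt_0_compat; [exact HC|apply exp_pos]).
  assert (main : forall n us, sep us -> (forall u, In u us -> Aword g u /\ mnorm (eval th u) < 3 ^ (k0 + n)) ->
    lsum F us <= INR N + A * ((1 - r ^ (k0 + n)) / (1 - r))).
  { induction n as [|n IH]; intros us Hsep Hu.
    - assert (lsum F us <= INR (length us) * 1) by (apply count; [lra|]; intros u Hu'; apply hterm_le_1; [apply mdet_th|exact Hs]).
      assert (INR (length us) <= INR N).
      { apply le_INR, HN; [|exact Hsep]. intros u Hu'. destruct (Hu u Hu') as (h1 & h2). rewrite Nat.add_0_r in h2. split; [exact h1|lra]. }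
      assert (0 <= (1 - r ^ (k0 + 0)) / (1 - r)).
      { apply Rmult_le_pos; [|left; apply Rinv_0_lt_compat; lra].
        assert (r ^ (k0 + 0) <= 1) by (rewrite <- (pow1 (k0 + 0)); apply pow_incr; lra). lra. }
      assert (0 <= A * ((1 - r ^ (k0 + 0)) / (1 - r))) by (apply Rmult_le_pos; lra). lra.
    - destruct (classical_split (fun u => mnorm (eval th u) < 3 ^ (k0 + n)) us) as (l1 & l2 & H1 & H2 & _ & H4 & H5).
      destruct (H5 _ Hsep) as (S1 & S2). rewrite H4.
      assert (B1 : lsum F l1 <= INR N + A * ((1 - r ^ (k0 + n)) / (1 - r))).
      { apply IH; [exact S1|]. intros u Hu'. destruct (H1 u Hu') as (h1 & h2). split; [now apply Hu|exact h2]. }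
      assert (B2 : lsum F l2 <= A * r ^ (k0 + n)).
      { set (k := (k0 + n)%nat) in *.
        assert (P3 : 0 < 3 ^ k) by (apply pow_lt; lra).
        apply Rle_trans with (INR (length l2) * Rpower (3 ^ k * 3 ^ k / 2) (- s)).
        - apply count; [left; apply exp_pos|]. intros u Hu'. destruct (H2 u Hu') as (h1 & h2).
          apply hterm_le; [apply mdet_th|exact Hs|exact P3|lra].
        - apply Rle_trans with (C * Rpower (3 ^ k) al * Rpower (3 ^ k * 3 ^ k / 2) (- s)).
          + apply Rmult_le_compat_r; [left; apply exp_pos|]. apply Hsh; [unfold k; lia|exact S2|].
            intros u Hu'. destruct (H2 u Hu') as (h1 & h2). destruct (Hu u h1) as (h3 & h4).
            split; [exact h3|]. split; [lra|]. unfold k. now rewrite <- Nat.add_succ_r.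
          + rewrite Rmult_assoc, shell_term by exact Hs. fold r. unfold A. lra. }
      replace (k0 + S n)%nat with (S (k0 + n)) by lia. cbn [pow].
      replace ((1 - r * r ^ (k0 + n)) / (1 - r)) with ((1 - r ^ (k0 + n)) / (1 - r) + r ^ (k0 + n)) by (field; lra). lra. }
  exists (INR N + A * (/ (1 - r))). intros l Hl Hnd.
  assert (Hch : exists us, l = map (fun u => eval rho (subst ws u)) us /\ forall u, In u us -> Aword g u).
  { clear Hnd. induction Hl as [|M l (u & Hu & ->) _ (us & -> & Hus)]; [exists []; split; [reflexivity|intros ? []]|].
    exists (u :: us). split; [reflexivity|]. intros v [<-|Hv]; auto. }
  destruct Hch as (us & -> & Hus). clear Hl.
  change (lsum (fun M => exp (- s * hdist_o M)) (map (fun u => eval rho (subst ws u)) us) <= INR N + A * / (1 - r)).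
  rewrite lsum_map. rewrite (lsum_ext _ F) by (intros u _; unfold F; now rewrite eval_subst).
  assert (Hsep : sep us).
  { clear - Hnd. induction us as [|u us IH]; [constructor|]. inversion Hnd as [|? ? Hf Hnd']; subst. constructor; [|now apply IH].
    rewrite Forall_forall in *. intros v Hv E. apply (Hf (eval rho (subst ws v))); [now apply (in_map (fun u => eval rho (subst ws u)))|].
    now rewrite !eval_subst. }
  assert (Hn : exists n, forall u, In u us -> mnorm (eval th u) < 3 ^ (k0 + n)).
  { clear. induction us as [|u us (n & IH)]; [exists O; intros ? []|].
    destruct (Pow_x_infinity 3 ltac:(rewrite Rabs_right; lra) (mnorm (eval th u) + 1)) as (m & Hm).
    exists (n + m)%nat. intros v [<-|Hv].
    - specialize (Hm (k0 + (n + m))%nat ltac:(lia)). rewrite Rabs_right in Hm by (apply Rle_ge, pow_le; lra). lra.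
    - eapply Rlt_le_trans; [apply IH, Hv|]. apply Rle_pow; [lra|lia]. }
  destruct Hn as (n & Hn). eapply Rle_trans; [apply (main n us Hsep); intros u Hu; split; auto|].
  apply Rplus_le_compat_l, Rmult_le_compat_l; [lra|]. unfold Rdiv. rewrite <- (Rmult_1_l (/ (1 - r))) at 2.
  apply Rmult_le_compat_r; [left; apply Rinv_0_lt_compat; lra|]. assert (0 < r ^ (k0 + n)) by now apply pow_lt. lra.
Qed.
End Shells.

(** * Products of elements of a shell *)

Lemma pm_eq_cancel_l A X Y : mdet A = 1 -> pm_eq (mmul A X) (mmul A Y) -> pm_eq X Y.
Proof.
  intros dA H. rewrite <- (mmul_madj_cancel_l A X dA), <- (mmul_madj_cancel_l A Y dA).
  apply pm_eq_mmul; [apply pm_eq_refl|exact H].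
Qed.

Fixpoint seqs (F : list word) (m : nat) : list (list word) :=
  match m with O => [[]] | S m => map (fun p => fst p :: snd p) (list_prod F (seqs F m)) end.
Lemma seqs_length F m : length (seqs F m) = (length F ^ m)%nat.
Proof. induction m as [|m IH]; [reflexivity|]. cbn [seqs Nat.pow]. now rewrite length_map, length_prod, IH. Qed.
Lemma seqs_in F m s : In s (seqs F m) -> length s = m /\ incl s F.
Proof.
  revert s; induction m as [|m IH]; intros s; cbn [seqs].
  - intros [<-|[]]. split; [reflexivity|intros ? []].
  - intros Hs. apply in_map_iff in Hs. destruct Hs as ((f & s') & <- & Hs). apply in_prod_iff in Hs. destruct Hs as (Hf & Hs').
    destruct (IH s' Hs') as (E & Hi). cbn [fst snd]. split; [cbn; now rewrite E|]. now apply incl_cons.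
Qed.
Lemma NoDup_seqs F m : NoDup F -> NoDup (seqs F m).
Proof.
  intros HF. induction m as [|m IH]; [repeat constructor; easy|]. cbn [seqs]. revert IH. generalize (seqs F m). intros L IH.
  induction HF as [|f F Hf HF IHF]; [constructor|]. cbn [list_prod]. rewrite map_app, map_map. cbn [fst snd].
  apply NoDup_app.
  - apply NoDup_map_NoDup_ForallPairs; [|exact IH]. intros a b _ _ E. now injection E.
  - exact IHF.
  - intros s Hs Hs'. apply in_map_iff in Hs, Hs'. destruct Hs as (t & <- & _). destruct Hs' as ((f' & t') & E & Hp).
    apply in_prod_iff in Hp. cbn in E. injection E as -> ->. tauto.
Qed.

Section Products.
Variables (Fs Hs : list word) (h : word -> word -> word).

(* Consecutive factors [f], [f'] are joined by the connector [h f f']. *)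
Fixpoint cw (s : list word) : word :=
  match s with [] => [] | f :: s' => match s' with [] => f | f' :: _ => f ++ h f f' ++ cw s' end end.

Lemma cw_bound th K H s : 1 <= K -> 1 <= H -> (forall f, In f Fs -> mnorm (eval th f) <= K) ->
  (forall f f', In f Fs -> In f' Fs -> mnorm (eval th (h f f')) <= H) -> incl s Fs ->
  mnorm (eval th (cw s)) <= (4 * K * H) ^ length s.
Proof.
  intros HK HH HF Hh. induction s as [|f s IH]; intros Hi; [cbn; rewrite mnorm_mid; lra|].
  assert (Hf : In f Fs) by (apply Hi; now left). pose proof (HF f Hf) as Kf. pose proof (mnorm_nonneg (eval th f)).
  specialize (IH (fun x Hx => Hi x (or_intror Hx))).
  assert (P4 : 1 <= 4 * K * H) by nra.
  destruct s as [|f' s].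
  - cbn [cw length pow]. nra.
  - assert (Hf' : In f' Fs) by (apply Hi; right; now left). pose proof (Hh f f' Hf Hf') as Kh. pose proof (mnorm_nonneg (eval th (h f f'))).
    change (cw (f :: f' :: s)) with (f ++ h f f' ++ cw (f' :: s)). rewrite !eval_app.
    change (length (f :: f' :: s)) with (S (length (f' :: s))). set (n := length (f' :: s)) in *. cbn [pow].
    set (W := eval th (cw (f' :: s))) in *. pose proof (mnorm_nonneg W).
    eapply Rle_trans; [apply mnorm_mmul|].
    assert (A1 : mnorm (mmul (eval th (h f f')) W) <= 2 * (H * (4 * K * H) ^ n)).
    { eapply Rle_trans; [apply mnorm_mmul|]. apply Rmult_le_compat_l; [lra|]. apply Rmult_le_compat; lra. }
    pose proof (mnorm_nonneg (mmul (eval th (h f f')) W)).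
    apply Rle_trans with (2 * (K * (2 * (H * (4 * K * H) ^ n)))); [|right; ring].
    apply Rmult_le_compat_l; [lra|]. apply Rmult_le_compat; lra.
Qed.

Variables (th : rep) (H kap Lam : R) (B : nat).
(** A connector costs a factor [2 * H] whenever it is attached to or removed from a matrix. This
    happens once for [Lamc] and three times for [kapc]. *)
Definition kapc := kap / (8 * (H * H * H)).
Definition Lamc := Lam / (2 * H).
Definition trackc := 8 * (H * H) / kapc.
Hypothesis Hsl : SLrep th.
Hypothesis HH : 1 <= H.
Hypothesis Hkap : 0 < kap <= 1.
Hypothesis HLam : 0 < Lam.
Hypothesis Hthr : 2 <= kapc * Lamc.
Hypothesis HF : forall f, In f Fs -> Lam <= mnorm (eval th f) <= 3 * Lam.
Hypothesis Hh : forall f f', In f Fs -> In f' Fs -> In (h f f') Hs.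
Hypothesis HHs : forall w, In w Hs -> mnorm (eval th w) <= H.
Hypothesis Hal : forall f f', In f Fs -> In f' Fs ->
  kap * (mnorm (eval th f) * mnorm (eval th f')) <= mnorm (eval th (f ++ h f f' ++ f')).

(** Every factor absorbs the connector on its right, so that [cw] becomes a product to which [chain]
    applies. *)
Fixpoint cm (s : list word) : list Mat2 :=
  match s with [] => [] | f :: s' => match s' with [] => [eval th f] | f' :: _ => eval th (f ++ h f f') :: cm s' end end.
Lemma mprod_cm s : mprod (cm s) = eval th (cw s).
Proof.
  induction s as [|f s IH]; [reflexivity|]. destruct s as [|f' s]; [apply mmul_id_r|].
  change (mmul (eval th (f ++ h f f')) (mprod (cm (f' :: s))) = eval th (f ++ h f f' ++ cw (f' :: s))).
  now rewrite IH, (app_assoc f), (eval_app th (f ++ _) (cw _)).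
Qed.
Lemma cm_det s x : In x (cm s) -> mdet x = 1.
Proof.
  induction s as [|f s IH]; [intros []|]. destruct s as [|f' s]; [intros [<-|[]]; now apply mdet_eval|].
  intros [<-|Hx]; [now apply mdet_eval|]. now apply IH.
Qed.
Lemma kapc_bounds : 0 < kapc <= 1.
Proof.
  unfold kapc. assert (1 <= H * H) by nra. assert (1 <= H * H * H) by nra. split; [apply Rdiv_lt_0_compat; lra|].
  apply Rmult_le_reg_r with (8 * (H * H * H)); [lra|].
  replace (kap / (8 * (H * H * H)) * (8 * (H * H * H))) with kap by (field; lra). lra.
Qed.
Lemma factor_le f f' : In f Fs -> In f' Fs ->
  mnorm (eval th f) <= 2 * H * mnorm (eval th (f ++ h f f')) /\ mnorm (eval th (f ++ h f f')) <= 2 * H * mnorm (eval th f).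
Proof.
  intros Hf Hf'. pose proof (HHs _ (Hh f f' Hf Hf')) as Kh. rewrite eval_app.
  pose proof (mnorm_mmul (mmul (eval th f) (eval th (h f f'))) (madj (eval th (h f f')))) as A.
  rewrite mmul_madj_cancel_r, mnorm_madj in A by now apply mdet_eval.
  pose proof (mnorm_mmul (eval th f) (eval th (h f f'))) as A'.
  pose proof (mnorm_nonneg (eval th f)). pose proof (mnorm_nonneg (mmul (eval th f) (eval th (h f f')))).
  pose proof (mnorm_nonneg (eval th (h f f'))).
  set (a := mnorm (eval th f)) in *. set (b := mnorm (mmul (eval th f) (eval th (h f f')))) in *. set (c := mnorm (eval th (h f f'))) in *.
  assert (b * c <= b * H) by (apply Rmult_le_compat_l; lra). assert (a * c <= a * H) by (apply Rmult_le_compat_l; lra). lra.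
Qed.

Lemma cm_chain s : incl s Fs -> chain kapc Lamc (cm s).
Proof.
  induction s as [|f s IH]; intros Hi; [exact I|]. destruct s as [|f' s]; [exact I|].
  specialize (IH (fun x Hx => Hi x (or_intror Hx))).
  assert (Hf : In f Fs) by (apply Hi; now left). assert (Hf' : In f' Fs) by (apply Hi; right; now left).
  destruct (factor_le f f' Hf Hf') as (L1 & L2). pose proof (HF f Hf) as F1. pose proof (HF f' Hf') as F2.
  pose proof (Hal f f' Hf Hf') as K. rewrite app_assoc, eval_app in K. pose proof kapc_bounds as Kc.
  set (x := eval th (f ++ h f f')) in *. pose proof (mnorm_nonneg x) as px.
  assert (HL : Lamc <= mnorm x).
  { unfold Lamc. apply Rmult_le_reg_r with (2 * H); [lra|]. unfold Rdiv. rewrite Rmult_assoc, Rinv_l by lra. lra. }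
  assert (Hk : kapc * (8 * (H * H * H)) = kap) by (unfold kapc; field; lra).
  assert (Hxy : forall y, mnorm y <= 2 * H * mnorm (eval th f') -> mnorm (mmul x (eval th f')) <= 2 * H * mnorm (mmul x y) ->
     kapc * (mnorm x * mnorm y) <= mnorm (mmul x y)).
  { intros y Hy Hxy. pose proof (mnorm_nonneg y).
    assert (A1 : mnorm x * mnorm y <= (2 * H * mnorm (eval th f)) * (2 * H * mnorm (eval th f'))) by (apply Rmult_le_compat; lra).
    apply Rmult_le_reg_l with (2 * H); [lra|].
    apply Rle_trans with (kap * (mnorm (eval th f) * mnorm (eval th f'))); [|lra]. rewrite <- Hk.
    apply Rle_trans with (2 * H * (kapc * ((2 * H * mnorm (eval th f)) * (2 * H * mnorm (eval th f'))))); [|right; ring].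
    apply Rmult_le_compat_l; [lra|]. apply Rmult_le_compat_l; lra. }
  destruct s as [|f'' s].
  - split; [exact HL|]. split; [|exact I].
    pose proof (mnorm_nonneg (eval th f')). pose proof (mnorm_nonneg (mmul x (eval th f'))). apply Hxy; nra.
  - split; [exact HL|]. split; [|exact IH].
    assert (Hf'' : In f'' Fs) by (apply Hi; right; right; now left).
    apply Hxy; [now apply factor_le|]. rewrite eval_app, mmul_assoc. set (z := mmul x (eval th f')).
    pose proof (HHs _ (Hh f' f'' Hf' Hf'')) as Kh.
    pose proof (mnorm_mmul (mmul z (eval th (h f' f''))) (madj (eval th (h f' f'')))) as A.
    rewrite mmul_madj_cancel_r, mnorm_madj in A by now apply mdet_eval.
    pose proof (mnorm_nonneg (mmul z (eval th (h f' f'')))).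
    set (b := mnorm (mmul z (eval th (h f' f'')))) in *.
    assert (b * mnorm (eval th (h f' f'')) <= b * H) by (apply Rmult_le_compat_l; lra). lra.
Qed.

(** By [chain_step] the norm of the product is comparable to the norm of the first step times that
    of the tail; so the first factor lies near the geodesic toward the product. *)
Lemma head_track f s : incl (f :: s) Fs ->
  mnorm (eval th f) * mnorm (mmul (madj (eval th f)) (eval th (cw (f :: s)))) <= trackc * mnorm (eval th (cw (f :: s))).
Proof.
  intros Hi. assert (Hf : In f Fs) by (apply Hi; now left). pose proof kapc_bounds as Kc.
  assert (HH2 : 1 <= H * H) by nra. pose proof (mnorm_nonneg (eval th f)) as pf.
  assert (Ct : 8 <= trackc).
  { unfold trackc. apply Rmult_le_reg_r with kapc; [lra|]. unfold Rdiv. rewrite Rmult_assoc, Rinv_l by lra. nra. }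
  destruct s as [|f' s].
  - cbn [cw]. rewrite mmul_madj_l, mnorm_mid by now apply mdet_eval. nra.
  - assert (Hf' : In f' Fs) by (apply Hi; right; now left). destruct (factor_le f f' Hf Hf') as (L1 & _).
    pose proof (cm_chain _ Hi) as Hc. change (cm (f :: f' :: s)) with (eval th (f ++ h f f') :: cm (f' :: s)) in Hc.
    assert (HL0 : 0 < Lamc) by (unfold Lamc; apply Rdiv_lt_0_compat; lra).
    assert (Hne : cm (f' :: s) <> []) by (destruct s; discriminate).
    pose proof (chain_step kapc Lamc (cm (f' :: s)) (proj1 Kc) HL0 Hthr _ Hc Hne (cm_det (f :: f' :: s))) as St.
    change (eval th (f ++ h f f') :: cm (f' :: s)) with (cm (f :: f' :: s)) in St. rewrite !mprod_cm in St.
    set (T := eval th (cw (f' :: s))) in *.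
    assert (EW : eval th (cw (f :: f' :: s)) = mmul (eval th f) (mmul (eval th (h f f')) T)).
    { change (cw (f :: f' :: s)) with (f ++ h f f' ++ cw (f' :: s)). now rewrite !eval_app. }
    rewrite EW at 1. rewrite mmul_madj_cancel_l by now apply mdet_eval.
    pose proof (HHs _ (Hh f f' Hf Hf')) as Kh. pose proof (mnorm_mmul (eval th (h f f')) T) as A.
    pose proof (mnorm_nonneg T) as pT. pose proof (mnorm_nonneg (mmul (eval th (h f f')) T)) as ph.
    assert (A2 : mnorm (mmul (eval th (h f f')) T) <= 2 * H * mnorm T).
    { assert (mnorm (eval th (h f f')) * mnorm T <= H * mnorm T) by (apply Rmult_le_compat_r; lra). lra. }
    set (W := mnorm (eval th (cw (f :: f' :: s)))) in *. set (x := mnorm (eval th (f ++ h f f'))) in *.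
    apply Rle_trans with ((2 * H * x) * (2 * H * mnorm T)); [apply Rmult_le_compat; lra|].
    unfold trackc. apply Rmult_le_reg_r with kapc; [lra|].
    replace (8 * (H * H) / kapc * W * kapc) with (8 * (H * H) * W) by (field; lra).
    replace (2 * H * x * (2 * H * mnorm T) * kapc) with (8 * (H * H) * (kapc / 2 * (x * mnorm T))) by field.
    apply Rmult_le_compat_l; lra.
Qed.

(** Both first factors lie near the geodesic toward the same point, and their norms differ by a
    factor of at most 3 because they belong to one shell. [four_point] then brings them close, with
    [3 * trackc] from each of its two terms. *)
Lemma heads_close f s f' s' : incl (f :: s) Fs -> incl (f' :: s') Fs ->
  pm_eq (eval th (cw (f :: s))) (eval th (cw (f' :: s'))) -> mnorm (mmul (madj (eval th f)) (eval th f')) <= 6 * trackc.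
Proof.
  intros Hi Hi' E. pose proof (head_track f s Hi) as T1. pose proof (head_track f' s' Hi') as T2.
  set (W := eval th (cw (f :: s))) in *. set (W' := eval th (cw (f' :: s'))) in *.
  assert (E2 : mnorm (mmul (madj (eval th f')) W') = mnorm (mmul (madj (eval th f')) W)).
  { apply mnorm_pm, pm_eq_mmul; [apply pm_eq_refl|now apply pm_eq_sym]. }
  rewrite E2, <- (mnorm_pm W W' E) in T2.
  pose proof (four_point (eval th f) (eval th f') mid W) as Q. rewrite madj_mid, mmul_id_l, !mmul_id_r, !mnorm_madj in Q.
  assert (HW : / 2 < mnorm W) by (apply mnorm_det_half; now apply mdet_eval).
  pose proof (HF f (Hi f (or_introl eq_refl))) as F1. pose proof (HF f' (Hi' f' (or_introl eq_refl))) as F2.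
  set (a := mnorm (eval th f)) in *. set (b := mnorm (eval th f')) in *. set (w := mnorm W) in *.
  set (u := mnorm (mmul (madj (eval th f)) W)) in *. set (v := mnorm (mmul (madj (eval th f')) W)) in *.
  assert (pu : 0 <= u) by apply mnorm_nonneg. assert (pv : 0 <= v) by apply mnorm_nonneg.
  assert (a * v <= 3 * b * v) by (apply Rmult_le_compat_r; lra).
  assert (u * b <= u * (3 * a)) by (apply Rmult_le_compat_l; lra).
  apply Rmult_le_reg_r with w; [lra|]. lra.
Qed.

Hypothesis HB : forall f us, In f Fs -> NoDup us -> incl us Fs ->
  (forall u, In u us -> mnorm (mmul (madj (eval th f)) (eval th u)) <= 6 * trackc) -> (length us <= B)%nat.
Hypothesis HlHs : (length Hs <= 4)%nat.

Lemma nonempty_seq (s : list word) m : length s = S m -> exists f s', s = f :: s' /\ length s' = m.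
Proof. destruct s as [|f s']; [discriminate|]. intros E. injection E as E. now exists f, s'. Qed.

(** Given the product, there are at most [B] first factors and at most 4 connectors after them;
    cancelling both leaves tails that again share one product. *)
Lemma fiber_bound m : forall l, NoDup l -> (forall s, In s l -> length s = S m /\ incl s Fs) ->
  (forall s s', In s l -> In s' l -> pm_eq (eval th (cw s)) (eval th (cw s'))) ->
  (length l <= (4 * B) ^ m * B)%nat.
Proof.
  induction m as [|m IH]; intros l Hnd Hl HE.
  all: destruct l as [|s0 l0]; [cbn; lia|]; set (l := s0 :: l0) in *.
  all: destruct (nonempty_seq s0 _ (proj1 (Hl s0 (or_introl eq_refl)))) as (f0 & t0 & E0 & _).
  all: assert (Hheads : forall f s, In (f :: s) l -> In f Fs /\ mnorm (mmul (madj (eval th f0)) (eval th f)) <= 6 * trackc)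
    by (intros f s Hs0; split; [apply (Hl _ Hs0); now left|];
        apply (heads_close f0 t0 f s); rewrite <- ?E0; [apply Hl; now left|apply Hl, Hs0|apply HE; [now left|exact Hs0]]).
  all: assert (Hf0 : In f0 Fs) by (apply (Hl s0 (or_introl eq_refl)); rewrite E0; now left).
  - rewrite <- (length_map (@hd word []) l). cbn [Nat.pow]. rewrite Nat.mul_1_l. apply (HB f0); [exact Hf0| | |].
    + apply NoDup_map_NoDup_ForallPairs; [|exact Hnd]. intros s s' Hs1 Hs2 E.
      destruct (nonempty_seq s _ (proj1 (Hl s Hs1))) as (f & t & -> & Et). destruct (nonempty_seq s' _ (proj1 (Hl s' Hs2))) as (f' & t' & -> & Et').
      apply length_zero_iff_nil in Et, Et'. subst. cbn in E. now subst.
    + intros f Hf. apply in_map_iff in Hf. destruct Hf as (s & <- & Hs1).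
      destruct (nonempty_seq s _ (proj1 (Hl s Hs1))) as (f & t & -> & _). now apply (Hheads f t).
    + intros f Hf. apply in_map_iff in Hf. destruct Hf as (s & <- & Hs1).
      destruct (nonempty_seq s _ (proj1 (Hl s Hs1))) as (f & t & -> & _). now apply (Hheads f t).
  - destruct (separate eq (map (@hd word []) l) (fun x => eq_refl)) as (F1 & G1 & G2 & G3).
    assert (HF1 : (length F1 <= B)%nat).
    { assert (G : forall f, In f F1 -> exists t, In (f :: t) l).
      { intros f Hf. apply G1, in_map_iff in Hf. destruct Hf as (s & <- & Hs1).
        destruct (nonempty_seq s _ (proj1 (Hl s Hs1))) as (f & t & -> & _). now exists t. }
      apply (HB f0); [exact Hf0|now apply NoDup_iff_ForallOrdPairs| |].
      - intros f Hf. destruct (G f Hf) as (t & Ht). now apply (Hheads f t).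
      - intros f Hf. destruct (G f Hf) as (t & Ht). now apply (Hheads f t). }
    apply Nat.le_trans with (length (list_prod F1 Hs) * ((4 * B) ^ m * B))%nat.
    (* Sequences are sorted by first factor and connector, not by second factor: this suffices for
       the cancellation and keeps the bound independent of the size of [Fs]. *)
    + apply (cover_count (fun s p => exists f' t, s = fst p :: f' :: t /\ h (fst p) f' = snd p) (fun x y => x <> y)).
      * now apply NoDup_iff_ForallOrdPairs.
      * intros s Hs1. destruct (nonempty_seq s _ (proj1 (Hl s Hs1))) as (f & s' & E & Es').
        destruct (nonempty_seq s' _ Es') as (f' & t & -> & _). subst s.
        exists (f, h f f'). split; [|now exists f', t]. apply in_prod.
        -- destruct (G3 f) as (d & Hd & ->); [|exact Hd]. now apply (in_map (@hd word []) l (f :: f' :: t)).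
        -- destruct (Hl _ Hs1) as (_ & Hi). apply Hh; apply Hi; cbn; auto.
      * intros (f, w) l' _ Hnd' Hl'. apply NoDup_iff_ForallOrdPairs in Hnd'. rewrite <- (length_map (@tl word) l'). apply IH.
        -- apply NoDup_map_NoDup_ForallPairs; [|exact Hnd']. intros s s' Hs1 Hs2 E.
           destruct (Hl' s Hs1) as (_ & a & t & -> & _). destruct (Hl' s' Hs2) as (_ & a' & t' & -> & _). cbn in *. now rewrite E.
        -- intros s Hs1. apply in_map_iff in Hs1. destruct Hs1 as (s' & <- & Hs1).
           destruct (Hl' s' Hs1) as (Hsl' & a & t & -> & _). destruct (Hl _ Hsl') as (E & Hi). cbn in *. split; [lia|].
           intros x Hx. apply Hi. now right.
        -- intros s s' Hs1 Hs2. apply in_map_iff in Hs1, Hs2. destruct Hs1 as (z & <- & Hs1). destruct Hs2 as (z' & <- & Hs2).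
           destruct (Hl' z Hs1) as (Hz & a & t & -> & E1). destruct (Hl' z' Hs2) as (Hz' & a' & t' & -> & E2). cbn [fst snd tl] in *.
           pose proof (HE _ _ Hz Hz') as K.
           change (cw (f :: a :: t)) with (f ++ h f a ++ cw (a :: t)) in K.
           change (cw (f :: a' :: t')) with (f ++ h f a' ++ cw (a' :: t')) in K. rewrite E1, E2, !eval_app in K.
           apply pm_eq_cancel_l in K; [|now apply mdet_eval]. apply pm_eq_cancel_l in K; [exact K|now apply mdet_eval].
    + rewrite length_prod, Nat.pow_succ_r'. set (z := ((4 * B) ^ m)%nat).
      apply Nat.le_trans with ((B * 4) * (z * B))%nat; [|lia].
      apply Nat.mul_le_mono_r, Nat.mul_le_mono; assumption.
Qed.

Lemma many_products m : NoDup Fs -> exists D, (forall s, In s D -> length s = S m /\ incl s Fs) /\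
  ForallOrdPairs (fun s s' => ~ pm_eq (eval th (cw s)) (eval th (cw s'))) D /\
  (length Fs ^ S m <= length D * (4 * B) ^ S m)%nat.
Proof.
  intros HnF. destruct (separate (fun s s' => pm_eq (eval th (cw s)) (eval th (cw s'))) (seqs Fs (S m))) as (D & D1 & D2 & D3).
  { intros; apply pm_eq_refl. }
  exists D. split; [intros s Hs0; apply seqs_in, D1, Hs0|]. split; [exact D2|].
  rewrite <- seqs_length. eapply cover_count with (E := fun x y => x <> y).
  - apply NoDup_iff_ForallOrdPairs. now apply NoDup_seqs.
  - exact D3.
  - intros d l' Hd Hnd' Hl'. apply NoDup_iff_ForallOrdPairs in Hnd'.
    apply Nat.le_trans with ((4 * B) ^ m * B)%nat; [|rewrite Nat.pow_succ_r'; set (z := ((4 * B) ^ m)%nat); nia].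
    apply fiber_bound; [exact Hnd'| |].
    + intros s Hs0. apply seqs_in. now apply Hl'.
    + intros s s' Hs1 Hs2. cbn beta in Hl'. eapply pm_eq_trans; [apply Hl', Hs1|]. apply pm_eq_sym. now apply Hl'.
Qed.
End Products.

(** * Connectors *)

(** An entry of [f M f'] is the trace of [M] against a matrix of rank one, made of a row of [f] and
    a column of [f']. Choosing those with the largest entries makes this matrix as large as the
    product of the norms. *)
Lemma rank_one_test f f' : exists Z, (forall M, Rabs (mtr (mmul Z M)) <= mnorm (mmul f (mmul M f'))) /\
  mnorm f * mnorm f' <= mnorm Z.
Proof.
  set (Z := fun x1 x2 y1 y2 => mkMat2 (y1 * x1) (y1 * x2) (y2 * x1) (y2 * x2)).
  assert (HZ : forall x1 x2 y1 y2, (mnorm f = Rabs x1 \/ mnorm f = Rabs x2) -> (mnorm f' = Rabs y1 \/ mnorm f' = Rabs y2) ->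
    mnorm f * mnorm f' <= mnorm (Z x1 x2 y1 y2)).
  { intros x1 x2 y1 y2 Hx Hy. destruct (mnorm_entries (Z x1 x2 y1 y2)) as (h1 & h2 & h3 & h4). unfold Z in *; cbn in *.
    rewrite !Rabs_mult in *. destruct Hx as [-> | ->], Hy as [-> | ->]; lra. }
  assert (HM : forall x1 x2 y1 y2 (pr : Mat2 -> R), (forall A, Rabs (pr A) <= mnorm A) ->
    (forall M, pr (mmul f (mmul M f')) = mtr (mmul (Z x1 x2 y1 y2) M)) ->
    forall M, Rabs (mtr (mmul (Z x1 x2 y1 y2) M)) <= mnorm (mmul f (mmul M f'))).
  { intros x1 x2 y1 y2 pr Hpr E M. rewrite <- E. apply Hpr. }
  assert (Hrow : (mnorm f = Rabs (m11 f) \/ mnorm f = Rabs (m12 f)) \/ (mnorm f = Rabs (m21 f) \/ mnorm f = Rabs (m22 f)))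
    by (destruct (mnorm_attained f) as [?|[?|[?|?]]]; auto).
  assert (Hcol : (mnorm f' = Rabs (m11 f') \/ mnorm f' = Rabs (m21 f')) \/ (mnorm f' = Rabs (m12 f') \/ mnorm f' = Rabs (m22 f')))
    by (destruct (mnorm_attained f') as [?|[?|[?|?]]]; auto).
  destruct Hrow as [Hr|Hr], Hcol as [Hc|Hc].
  - exists (Z (m11 f) (m12 f) (m11 f') (m21 f')). split; [|now apply HZ]. apply (HM _ _ _ _ m11); [apply mnorm_entries|].
    intros M; unfold Z, mtr, mmul; cbn; ring.
  - exists (Z (m11 f) (m12 f) (m12 f') (m22 f')). split; [|now apply HZ]. apply (HM _ _ _ _ m12); [apply mnorm_entries|].
    intros M; unfold Z, mtr, mmul; cbn; ring.
  - exists (Z (m21 f) (m22 f) (m11 f') (m21 f')). split; [|now apply HZ]. apply (HM _ _ _ _ m21); [apply mnorm_entries|].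
    intros M; unfold Z, mtr, mmul; cbn; ring.
  - exists (Z (m21 f) (m22 f) (m12 f') (m22 f')). split; [|now apply HZ]. apply (HM _ _ _ _ m22); [apply mnorm_entries|].
    intros M; unfold Z, mtr, mmul; cbn; ring.
Qed.

(** If all four candidates failed, the rank-one matrix would have small traces against 1, [P], [Q]
    and [PQ], contrary to [trace_form_coercive]. *)
Lemma connector P Q : mdet P = 1 -> mdet Q = 1 -> mtr (mcomm P Q) <> 2 -> exists kap, 0 < kap <= 1 /\
  forall f f', exists M, In M [mid; P; Q; mmul P Q] /\ kap * (mnorm f * mnorm f') <= mnorm (mmul f (mmul M f')).
Proof.
  intros dP dQ Hne. destruct (trace_form_coercive P Q dP dQ Hne) as (C & HC & Hco).
  (* Four traces below [kap * w] add up to less than [4 * kap * w], and [C * 4 * kap] is less than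
     one. *)
  exists (/ (4 * C + 1)). split.
  { split; [apply Rinv_0_lt_compat; lra|]. rewrite <- Rinv_1. apply Rinv_le_contravar; lra. }
  intros f f'. apply NNPP. intros Hno.
  assert (Hlt : forall M, In M [mid; P; Q; mmul P Q] -> mnorm (mmul f (mmul M f')) < / (4 * C + 1) * (mnorm f * mnorm f')).
  { intros M HM. apply Rnot_le_lt. intros Hle. apply Hno. now exists M. }
  destruct (rank_one_test f f') as (Z & HZ & HZn). specialize (Hco Z). unfold trace_coords in Hco.
  pose proof (HZ mid) as t1. rewrite mmul_id_r in t1.
  pose proof (HZ P) as t2. pose proof (HZ Q) as t3. pose proof (HZ (mmul P Q)) as t4.
  pose proof (Hlt mid ltac:(cbn; auto)). pose proof (Hlt P ltac:(cbn; auto)).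
  pose proof (Hlt Q ltac:(cbn; auto)). pose proof (Hlt (mmul P Q) ltac:(cbn; auto)).
  set (w := mnorm f * mnorm f') in *. set (k := / (4 * C + 1)) in *.
  assert (Hk : k * (4 * C + 1) = 1) by (unfold k; field; lra).
  set (S := Rabs (mtr Z) + Rabs (mtr (mmul Z P)) + Rabs (mtr (mmul Z Q)) + Rabs (mtr (mmul Z (mmul P Q)))) in *.
  assert (HS : S < 4 * (k * w)) by (unfold S; lra).
  assert (C * S < C * (4 * (k * w))) by (apply Rmult_lt_compat_l; lra).
  assert (w < k * (4 * C) * w) by lra.
  assert (Hw : 0 <= w) by (unfold w; apply Rmult_le_pos; apply mnorm_nonneg).
  assert (Hk0 : 0 < k) by (unfold k; apply Rinv_0_lt_compat; lra).
  replace (k * (4 * C)) with (1 - k) in * by lra. nra.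
Qed.

Lemma pow_bracket q x : 1 < q -> q <= x -> exists m, q ^ S m <= x < q ^ S (S m).
Proof.
  intros Hq Hx. destruct (Pow_x_infinity q ltac:(rewrite Rabs_right; lra) (x + 1)) as (N & HN).
  specialize (HN N (Nat.le_refl N)). rewrite Rabs_right in HN by (apply Rle_ge, pow_le; lra).
  assert (HxN : x < q ^ S (S N)).
  { apply Rlt_le_trans with (q ^ N); [lra|]. apply Rle_pow; [lra|lia]. }
  clear HN. induction N as [|N IH].
  - destruct (Rlt_le_dec x (q ^ S (S 0))) as [|Hge]; [|lra]. exists O. cbn in *. lra.
  - destruct (Rlt_le_dec x (q ^ S (S N))) as [Hlt|Hge]; [now apply IH|]. now exists (S N).
Qed.

(** * Growth of the trace set near a point *)

Section Growth.
Variables (g : nat) (ws : nat -> word) (rho : rep).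
Hypothesis Hg : (3 <= g)%nat.
Hypothesis Hws : standard_gen_set g ws.
Hypothesis HT : Teich g rho.
Notation th := (gen ws rho).
Notation iY := (2 * (g - 2) + 1)%nat.

Definition conns : list word := [[]; [(0%nat, false)]; [(1%nat, false)]; [(0%nat, false); (1%nat, false)]].
Lemma conns_Aword w : In w conns -> Aword g w.
Proof. unfold conns, Aword. intros [<-|[<-|[<-|[<-|[]]]]]; repeat constructor; cbn [fst]; lia. Qed.

Lemma connector_fun : exists kap (h : word -> word -> word), 0 < kap <= 1 /\ (forall f f', In (h f f') conns) /\
  forall f f', kap * (mnorm (eval th f) * mnorm (eval th f')) <= mnorm (eval th (f ++ h f f' ++ f')).
Proof.
  pose proof (Teich_DFrep g rho HT) as HDF.
  pose proof (gen_comm_trace g ws rho 0 1 ltac:(lia) Hws HDF ltac:(lia) ltac:(lia) ltac:(lia)) as Hc. cbn in Hc.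
  assert (dg : forall i, mdet (th i) = 1) by (intros; apply mdet_eval, HDF).
  destruct (connector (th 0%nat) (th 1%nat) (dg _) (dg _) Hc) as (kap & Hk & Hcon). exists kap.
  set (good := fun f f' c => kap * (mnorm (eval th f) * mnorm (eval th f')) <= mnorm (eval th (f ++ c ++ f'))).
  set (dec := fun f f' c => Rle_dec (kap * (mnorm (eval th f) * mnorm (eval th f'))) (mnorm (eval th (f ++ c ++ f')))).
  exists (fun f f' => if dec f f' [] then [] else if dec f f' [(0%nat, false)] then [(0%nat, false)]
     else if dec f f' [(1%nat, false)] then [(1%nat, false)] else [(0%nat, false); (1%nat, false)]).
  split; [exact Hk|]. split.
  - intros f f'. unfold conns. destruct (dec f f' []); [cbn; auto|]. destruct (dec f f' [(0%nat, false)]); [cbn; auto|].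
    destruct (dec f f' [(1%nat, false)]); cbn; auto.
  - intros f f'. destruct (dec f f' []) as [|n1]; [assumption|]. destruct (dec f f' [(0%nat, false)]) as [|n2]; [assumption|].
    destruct (dec f f' [(1%nat, false)]) as [|n3]; [assumption|].
    destruct (Hcon (eval th f) (eval th f')) as (M & HM & K). rewrite !eval_app in *. cbn [eval] in *.
    unfold eval_letter in *. cbn [fst snd] in *. rewrite !mmul_id_r in *.
    destruct HM as [<-|[<-|[<-|[<-|[]]]]]; [contradiction|contradiction|contradiction|exact K].
Qed.

Lemma sep_sub F us : sep ws rho F -> NoDup us -> incl us F -> sep ws rho us.
Proof.
  intros HF Hnd Hi. induction Hnd as [|u us Hu Hnd IH]; constructor.
  - apply Forall_forall. intros v Hv E. assert (Hne : u <> v) by (intros ->; contradiction).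
    destruct (ForallOrdPairs_In HF u v) as [K|[K|K]]; [apply Hi; now left|apply Hi; now right|contradiction|contradiction|].
    apply K. now apply pm_eq_sym.
  - apply IH. intros x Hx. apply Hi. now right.
Qed.
Lemma sep_NoDup F : sep ws rho F -> NoDup F.
Proof.
  intros HF. induction HF as [|u us Hf HF IH]; constructor; [|exact IH]. intros Hin. rewrite Forall_forall in Hf.
  apply (Hf u Hin), pm_eq_refl.
Qed.

(** One finite family serves all lengths and a whole neighborhood. [q] bounds the norm per factor
    for every [th'] within distance 1 on the factors and connectors, and [B * q^al <= |F|] says that
    the number of distinct products per factor is at least [q^al]. *)
Lemma aligned_family al s : 0 < al < 2 * s -> ~ poincare_converges (A_image g ws rho) s ->
  exists (F : list word) (h : word -> word -> word) (q : R) (B : nat),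
    1 < q /\ (0 < B)%nat /\ INR B * Rpower q al <= INR (length F) /\ (forall f, In f F -> Aword g f) /\
    (forall f f', In (h f f') conns) /\
    (forall th', (forall w, In w (F ++ conns) -> mnorm (mdiff (eval th' w) (eval th w)) <= 1) ->
      forall t, incl t F -> mnorm (eval th' (cw h t)) <= q ^ length t) /\
    forall m, exists D, (forall t, In t D -> length t = S m /\ incl t F) /\
      ForallOrdPairs (fun t t' => ~ pm_eq (eval th (cw h t)) (eval th (cw h t'))) D /\
      (length F ^ S m <= length D * B ^ S m)%nat.
Proof.
  intros Hal Hdiv. pose proof (Teich_DFrep g rho HT) as HDF.
  assert (Hsl : SLrep th) by (intros i; apply mdet_eval, HDF).
  destruct connector_fun as (kap & h & Hk & Hh & Hal2).
  set (H := 1 + lsum (fun w => mnorm (eval th w)) conns).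
  assert (HH1 : forall w, In w conns -> mnorm (eval th w) <= H - 1).
  { intros w Hw. unfold H. pose proof (lsum_ge_term (fun w => mnorm (eval th w)) conns w (fun x _ => mnorm_nonneg _) Hw) as K.
    cbn beta in K. lra. }
  assert (HH : 1 <= H).
  { unfold H. pose proof (lsum_nonneg (fun w => mnorm (eval th w)) conns (fun x _ => mnorm_nonneg _)). lra. }
  assert (Hkc : 0 < kapc H kap) by (apply kapc_bounds; auto).
  destruct (A_ball_bound g ws rho Hg Hws HDF (6 * trackc H kap)) as (B0 & HB0). set (B := S B0).
  (* [k0] puts the shell far enough out for the chain condition. The constants [H], [B] and [C] are
     fixed before the shell is chosen, so that [C] can already include the loss [4 * B] per factor
     and the part [32 * H] of [q]. *)
  destruct (Pow_x_infinity 3 ltac:(rewrite Rabs_right; lra) (4 * H / kapc H kap)) as (k0 & Hk0).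
  set (C := INR (4 * B) * Rpower (32 * H) al).
  assert (HC : 0 < C) by (apply Rmult_lt_0_compat; [apply lt_0_INR; unfold B; lia|apply exp_pos]).
  destruct (big_shell g ws rho Hg Hws HDF al s C k0 ltac:(lra) ltac:(lra) HC Hdiv) as (k & F & Hkk & Hsep & HF & Hlen).
  set (Lam := 3 ^ k) in *.
  assert (HLam1 : 1 <= Lam) by (unfold Lam; apply pow_R1_Rle; lra).
  assert (HLam : 4 * H / kapc H kap <= Lam).
  { specialize (Hk0 k Hkk). rewrite Rabs_right in Hk0; [unfold Lam; lra|]. fold Lam. lra. }
  assert (HFn : forall f, In f F -> Lam <= mnorm (eval th f) <= 3 * Lam).
  { intros f Hf. destruct (HF f Hf) as (_ & h1 & h2). unfold Lam in *. cbn [pow] in h2. lra. }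
  (* The base is [4 * (4 * Lam) * (2 * H)] from [cw_bound]: after a perturbation of size 1, factors
     have norm at most [4 * Lam] and connectors at most [2 * H]. *)
  exists F, h, (32 * H * Lam), (4 * B)%nat.
  assert (Hq : 1 < 32 * H * Lam) by nra.
  split; [exact Hq|]. split; [unfold B; lia|]. split; [|split; [|split; [|split]]].
  - rewrite <- Rpower_mult_distr by lra. rewrite <- Rmult_assoc. unfold C in Hlen. lra.
  - intros f Hf. now apply HF.
  - exact Hh.
  - intros th' Hn t Ht. replace (32 * H * Lam) with (4 * (4 * Lam) * (2 * H)) by ring.
    apply (cw_bound F h th' (4 * Lam) (2 * H)); [lra|lra| | |exact Ht].
    + intros f Hf. pose proof (mnorm_le_mdiff (eval th' f) (eval th f)). pose proof (Hn f ltac:(apply in_app_iff; auto)).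
      pose proof (HFn f Hf). lra.
    + intros f f' _ _. pose proof (mnorm_le_mdiff (eval th' (h f f')) (eval th (h f f'))).
      pose proof (Hn (h f f') ltac:(apply in_app_iff; auto)). pose proof (HH1 (h f f') (Hh f f')). lra.
  - intros m. apply (many_products F conns h th H kap Lam B); auto.
    + lra.
    + unfold Lamc. apply Rmult_le_reg_r with (2 * H / kapc H kap); [apply Rdiv_lt_0_compat; lra|].
      replace (kapc H kap * (Lam / (2 * H)) * (2 * H / kapc H kap)) with Lam by (field; lra).
      replace (2 * (2 * H / kapc H kap)) with (4 * H / kapc H kap) by (field; lra). exact HLam.
    + intros w Hw. pose proof (HH1 w Hw). lra.
    + intros f us Hf Hnd Hi Hu. apply Nat.le_trans with B0; [|unfold B; lia].
      rewrite <- (length_map (fun u : word => (winv f ++ u : word)) us). apply HB0.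
      * intros w Hw. apply in_map_iff in Hw. destruct Hw as (u & <- & Hw). split.
        -- apply Forall_app. split; [|now apply HF, Hi]. destruct (HF f Hf) as (Af & _). unfold Aword in Af. clear - Af.
           unfold winv. apply Forall_forall. intros l Hl. apply in_rev, in_map_iff in Hl. destruct Hl as (l' & <- & Hl).
           rewrite Forall_forall in Af. exact (Af l' Hl).
        -- rewrite eval_app, eval_winv. now apply Hu.
      * pose proof (sep_sub F us Hsep Hnd Hi) as Su. clear - Su Hsl. unfold sep in *.
        induction Su as [|u us Hf' Su IH]; cbn [map]; constructor; [|exact IH].
        rewrite Forall_forall in *. intros w Hw E. apply in_map_iff in Hw. destruct Hw as (v & <- & Hv).
        apply (Hf' v Hv). rewrite !eval_app in E. apply pm_eq_cancel_l in E; [exact E|now apply mdet_eval].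
    + now apply sep_NoDup.
Qed.

(** Products that differ at [rho] are different group elements, and the rigidity hypothesis on
    [rho'] turns them into different traces there; sizes are estimated at [rho'] directly. *)
Theorem trace_growth_near eps delta : eps > 0 -> is_inf (poincare_converges (A_image g ws rho)) delta ->
  exists r, r > 0 /\ forall rho', Teich g rho' -> near g r rho rho' ->
    (forall u u', Aword g u -> Aword g u' -> ttest g ws rho' u = ttest g ws rho' u' -> geq g (subst ws u) (subst ws u')) ->
    trace_growth_gt (TrSet g rho') (2 * delta - eps).
Proof.
  intros Heps (Hinf & _). pose proof (Teich_DFrep g rho HT) as HDF.
  (* For a nonpositive exponent the single trace 2 of the empty word is enough. *)
  destruct (Rle_lt_dec (2 * delta - eps) 0) as [Hneg|Hpos].
  { exists 1. split; [lra|]. intros rho' HT' _ _. exists 1. split; [lra|]. exists 2%nat. intros n Hn _.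
    exists [2]. split; [repeat constructor; easy|]. split.
    - constructor; [|constructor]. split.
      + exists []. split; [constructor|]. left. unfold mtr; cbn. ring.
      + apply le_INR in Hn. cbn in Hn. lra.
    - cbn [length INR]. rewrite Rmult_1_l. rewrite <- (Rpower_O (INR n)); [|apply lt_0_INR; lia].
      apply Rle_Rpower; [|lra]. apply le_INR in Hn. cbn in Hn. lra. }
  (* [s] is below [delta], so the series diverges at [s], while [2 * s] exceeds [al] by
     [eps / 2]. *)
  set (al := 2 * delta - eps) in *. set (s := delta - eps / 4).
  assert (Hdiv : ~ poincare_converges (A_image g ws rho) s).
  { intros Hc. specialize (Hinf s Hc). unfold s in Hinf. lra. }
  destruct (aligned_family al s) as (F & h & q & B & Hq & HB & HFl & HFA & Hh & Hbd & HD); [unfold al, s in *; lra|exact Hdiv|].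
  assert (HYw : wf_word g [(iY, false)]) by (constructor; [cbn [fst]; lia|constructor]).
  assert (HAwf : forall u, Aword g u -> wf_word g u) by (intros u Hu; eapply Forall_impl; [|exact Hu]; cbn; intros; lia).
  assert (Hwf : Forall (wf_word g) (map (subst ws) ((F ++ conns) ++ [[(iY, false)]]))).
  { apply Forall_forall. intros w Hw. apply in_map_iff in Hw. destruct Hw as (u & <- & Hu). apply wf_subst; [apply Hws|].
    apply in_app_iff in Hu. destruct Hu as [Hu|[<-|[]]]; [|exact HYw]. apply HAwf.
    apply in_app_iff in Hu. destruct Hu; [now apply HFA|now apply conns_Aword]. }
  destruct (eval_continuous_list g rho _ Hwf 1 ltac:(lra)) as (r & Hr & Hcont).
  exists r. split; [exact Hr|]. intros rho' HT' Hn Hrig. pose proof (Teich_DFrep g rho' HT') as HDF'.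
  assert (Hth : forall w, In w ((F ++ conns) ++ [[(iY, false)]]) -> mnorm (mdiff (eval (gen ws rho') w) (eval th w)) <= 1).
  { intros w Hw. pose proof (Hcont rho' Hn (subst ws w) (in_map (subst ws) _ _ Hw)) as K. rewrite !eval_subst in K. left. exact K. }
  set (y := mnorm (eval (gen ws rho') [(iY, false)])).
  (* The factor 4 comes from the trace and from the product with [Y], each of which costs 2; the
     added 1 allows for the perturbation of [Y]. *)
  set (cY := 4 * (mnorm (eval th [(iY, false)]) + 1)).
  assert (Hy : 4 * y <= cY).
  { unfold cY, y. pose proof (mnorm_le_mdiff (eval (gen ws rho') [(iY, false)]) (eval th [(iY, false)])).
    pose proof (Hth [(iY, false)] ltac:(apply in_app_iff; cbn; auto)). lra. }
  assert (Hy0 : 0 <= y) by apply mnorm_nonneg.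
  assert (HcY : 4 <= cY) by (unfold cY; pose proof (mnorm_nonneg (eval th [(iY, false)])); lra).
  assert (HcA : forall t, incl t F -> Aword g (cw h t)).
  { intros t. induction t as [|f t IH]; intros Hi; [constructor|].
    assert (Af : Aword g f) by (apply HFA, Hi; now left). destruct t as [|f' t]; [exact Af|].
    change (cw h (f :: f' :: t)) with (f ++ h f f' ++ cw h (f' :: t)).
    apply Forall_app. split; [exact Af|]. apply Forall_app. split; [apply conns_Aword, Hh|].
    apply IH. intros x Hx. apply Hi. now right. }
  set (tr := fun t => mtr (eval rho' (subst ws (cw h t ++ [(iY, false)])))).
  exists (/ Rpower (cY * q) al). split; [apply Rinv_0_lt_compat, exp_pos|].
  destruct (INR_unbounded (cY * q)) as (N & HN). exists N. intros n HNn Hn1. apply le_INR in HNn.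
  (* The largest number of factors, [m + 1], for which the traces stay within [n]. Rounding to a
     power of [q] loses a bounded factor, which the constant [/ Rpower (cY * q) al] absorbs. *)
  destruct (pow_bracket q (INR n / cY) Hq) as (m & Hm1 & Hm2).
  { apply Rmult_le_reg_r with cY; [lra|]. unfold Rdiv. rewrite Rmult_assoc, Rinv_l by lra. lra. }
  assert (Hm1' : cY * q ^ S m <= INR n).
  { apply Rmult_le_reg_r with (/ cY); [apply Rinv_0_lt_compat; lra|]. replace (cY * q ^ S m * / cY) with (q ^ S m) by (field; lra). exact Hm1. }
  assert (Hm2' : INR n <= cY * q * q ^ S m).
  { apply Rmult_le_reg_r with (/ cY); [apply Rinv_0_lt_compat; lra|].
    replace (cY * q * q ^ S m * / cY) with (q ^ S (S m)) by (cbn [pow]; field; lra). left; exact Hm2. }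
  clear Hm1 Hm2. destruct (HD m) as (D & D1 & D2 & D3).
  exists (map tr D). split; [|split].
  - clear D3. induction D2 as [|t D Ht D2 IH]; cbn [map]; constructor.
    + intros Hin. apply in_map_iff in Hin. destruct Hin as (t' & E & Ht'). rewrite Forall_forall in Ht. apply (Ht t' Ht').
      assert (G : geq g (subst ws (cw h t)) (subst ws (cw h t'))).
      { apply Hrig; [apply HcA, (D1 t); now left|apply HcA, (D1 t'); now right|]. unfold ttest. unfold tr in E. now rewrite E. }
      apply (DF_pm g rho _ _ HDF) in G. now rewrite !eval_subst in G.
    + apply IH. intros; apply D1; now right.
  - apply Forall_forall. intros x Hx. apply in_map_iff in Hx. destruct Hx as (t & <- & Ht). destruct (D1 t Ht) as (Et & Hi).
    split.
    + exists (subst ws (cw h t ++ [(iY, false)])). split; [|now left]. apply wf_subst; [apply Hws|].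
      apply wf_app; [apply HAwf, HcA, Hi|exact HYw].
    + enough (K : Rabs (tr t) <= INR n).
      { pose proof (Rle_abs (tr t)). pose proof (Rle_abs (- tr t)) as K'. rewrite Rabs_Ropp in K'. lra. }
      unfold tr. rewrite eval_subst, eval_app.
      pose proof (Hbd (gen ws rho') (fun w Hw => Hth w (proj2 (in_app_iff _ _ _) (or_introl Hw))) t Hi) as Kt. rewrite Et in Kt.
      eapply Rle_trans; [apply mtr_mnorm|].
      pose proof (mnorm_mmul (eval (gen ws rho') (cw h t)) (eval (gen ws rho') [(iY, false)])) as Km. fold y in Km.
      pose proof (mnorm_nonneg (eval (gen ws rho') (cw h t))) as K0.
      change (fun i : nat => eval rho' (ws i)) with (gen ws rho').
      assert (mnorm (eval (gen ws rho') (cw h t)) * y <= q ^ S m * y) by (apply Rmult_le_compat_r; lra).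
      assert (q ^ S m * (4 * y) <= q ^ S m * cY) by (apply Rmult_le_compat_l; [apply pow_le; lra|lra]). lra.
  - rewrite length_map.
    assert (HnR : 0 < INR n) by (apply lt_0_INR; lia).
    assert (Pq : 0 < q ^ S m) by (apply pow_lt; lra).
    set (Q := Rpower q al). assert (HQ : 0 < Q) by apply exp_pos.
    assert (E1 : Rpower (INR n) al <= Rpower (cY * q) al * Q ^ S m).
    { apply Rle_trans with (Rpower (cY * q * q ^ S m) al); [apply Rle_Rpower_l; lra|].
      rewrite <- Rpower_mult_distr by first [exact Pq | apply Rmult_lt_0_compat; lra]. right. f_equal.
      unfold Q. rewrite <- (Rpower_pow (S m) (Rpower q al)) by apply exp_pos. rewrite <- (Rpower_pow (S m) q) by lra.
      rewrite !Rpower_mult. f_equal. ring. }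
    assert (E2 : Q ^ S m <= INR (length D)).
    { apply le_INR in D3. rewrite mult_INR, !pow_INR in D3. assert (HBR : 0 < INR B) by now apply lt_0_INR.
      assert (PB : 0 < INR B ^ S m) by (apply pow_lt; lra).
      apply Rmult_le_reg_r with (INR B ^ S m); [exact PB|]. eapply Rle_trans; [|exact D3].
      rewrite <- Rpow_mult_distr. apply pow_incr. split; [apply Rmult_le_pos; lra|]. fold Q in HFl. lra. }
    assert (PC : 0 < Rpower (cY * q) al) by apply exp_pos.
    apply Rmult_le_reg_l with (Rpower (cY * q) al); [exact PC|]. rewrite <- Rmult_assoc, Rinv_r by lra. rewrite Rmult_1_l.
    eapply Rle_trans; [exact E1|]. apply Rmult_le_compat_l; lra.
Qed.
End Growth.

(** * Enumeration of the coincidence loci *)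

Section Encoding.
Definition letter_of (n : nat) : letter := (fst (Cantor.of_nat n), Nat.eqb (snd (Cantor.of_nat n)) 0).
Fixpoint letters_of (k n : nat) : word :=
  match k with O => [] | S k => letter_of (fst (Cantor.of_nat n)) :: letters_of k (snd (Cantor.of_nat n)) end.
Definition word_of (n : nat) : word := letters_of (fst (Cantor.of_nat n)) (snd (Cantor.of_nat n)).
Definition words_of (n : nat) : word * word := (word_of (fst (Cantor.of_nat n)), word_of (snd (Cantor.of_nat n))).
Lemma word_of_surj w : exists n, word_of n = w.
Proof.
  assert (H : exists n, letters_of (length w) n = w).
  { induction w as [|(i, b) w (n & IH)]; [now exists O|].
    exists (Cantor.to_nat (Cantor.to_nat (i, if b then 0 else 1)%nat, n)). cbn [length letters_of].
    rewrite Cantor.cancel_of_to. cbn [fst snd]. rewrite IH. unfold letter_of. rewrite Cantor.cancel_of_to. cbn [fst snd].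
    now destruct b. }
  destruct H as (n & Hn). exists (Cantor.to_nat (length w, n)). unfold word_of. now rewrite Cantor.cancel_of_to.
Qed.
Lemma words_of_surj u v : exists n, words_of n = (u, v).
Proof.
  destruct (word_of_surj u) as (a & Ha). destruct (word_of_surj v) as (b & Hb).
  exists (Cantor.to_nat (a, b)). unfold words_of. rewrite Cantor.cancel_of_to. cbn [fst snd]. now rewrite Ha, Hb.
Qed.
End Encoding.

Definition tr_poly (w : word) : poly := let '(a, _, _, d) := pm_word w in PAdd a d.
Lemma tr_poly_eval g rho w : wf_word g w -> peval (coord g rho) (tr_poly w) = mtr (eval rho w).
Proof.
  intros Hw. rewrite <- (pm_word_eval g rho w Hw). unfold tr_poly, pm_eval, mtr. destruct (pm_word w) as (((a & b) & c) & d). reflexivity.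
Qed.

(* The locus where two inequivalent elements [a], [a'] of [A] give [tr (a Y) = tr (a' Y)] up to sign, [Y] being the first
   generator outside [A]. *)
Definition coincidence (g : nat) (ws : nat -> word) (u u' : word) (rho : rep) : Prop :=
  Teich g rho /\ (Aword g u /\ Aword g u' /\ ~ geq g (subst ws u) (subst ws u')) /\ ttest g ws rho u = ttest g ws rho u'.

Lemma coincidence_algebraic g ws u u' : (3 <= g)%nat -> standard_gen_set g ws -> algebraic_subset g (coincidence g ws u u').
Proof.
  intros Hg Hws. destruct (classic (Aword g u /\ Aword g u' /\ ~ geq g (subst ws u) (subst ws u'))) as [Hc|Hc].
  - set (T := fun u => tr_poly (subst ws (u ++ [((2 * (g - 2) + 1)%nat, false)]))).
    exists [PAdd (PMul (T u) (T u)) (pneg (PMul (T u') (T u')))]. intros rho.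
    assert (HT : forall v, Aword g v -> peval (coord g rho) (T v) ^ 2 = ttest g ws rho v).
    { intros v Hv. unfold T, ttest. rewrite tr_poly_eval; [reflexivity|]. apply wf_subst; [apply Hws|].
      apply wf_app; [eapply Forall_impl; [|exact Hv]; cbn; intros; lia|]. constructor; [cbn [fst]; lia|constructor]. }
    pose proof (HT u (proj1 Hc)) as E. pose proof (HT u' (proj1 (proj2 Hc))) as E'. cbn [pow] in E, E'.
    split.
    + intros (HTe & _ & Heq). split; [exact HTe|]. constructor; [|constructor]. unfold pneg. cbn [peval]. lra.
    + intros (HTe & HP). inversion HP as [|? ? Hp _]; subst. unfold pneg in Hp. cbn [peval] in Hp.
      split; [exact HTe|]. split; [exact Hc|]. lra.
  (* The enumeration runs over all pairs of words; for a pair that is not admissible the locus is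
     empty, and a nonzero constant defines it. *)
  - exists [PConst 1]. intros rho. split; [intros (_ & K & _); contradiction|].
    intros (_ & HP). inversion HP as [|? ? Hp _]; subst. cbn in Hp. lra.
Qed.
Lemma coincidence_codim g ws u u' : (3 <= g)%nat -> standard_gen_set g ws -> positive_codim g (coincidence g ws u u').
Proof.
  intros Hg Hws (rho & r & (HT & (Hu & Hu' & Hne) & _) & Hr & Hall). apply Hne.
  apply (trace_coincidence_rigid g ws Hg Hws rho r); auto. intros rho' HT' Hn. now apply Hall.
Qed.

Theorem theoremC (g : nat) (ws : nat -> word) :
  (3 <= g)%nat -> standard_gen_set g ws ->
  exists Zs : nat -> (rep -> Prop),
    (forall k, algebraic_subset g (Zs k) /\ positive_codim g (Zs k)) /\
    forall rho, Teich g rho ->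
    forall eps, eps > 0 ->
    forall delta, is_inf (poincare_converges (A_image g ws rho)) delta ->
    exists r, r > 0 /\
      forall rho', Teich g rho' -> near g r rho rho' ->
        (forall k, ~ Zs k rho') ->
        trace_growth_gt (TrSet g rho') (2 * delta - eps).
Proof.
  intros Hg Hws. exists (fun k => coincidence g ws (fst (words_of k)) (snd (words_of k))). split.
  - intros k. split; [now apply coincidence_algebraic|now apply coincidence_codim].
  - intros rho HT eps Heps delta Hd.
    destruct (trace_growth_near g ws rho Hg Hws HT eps delta Heps Hd) as (r & Hr & K).
    exists r. split; [exact Hr|]. intros rho' HT' Hn Hz. apply K; auto.
    intros u u' Hu Hu' E. apply NNPP. intros Hne. destruct (words_of_surj u u') as (k & Hk).
    apply (Hz k). rewrite Hk. cbn [fst snd]. unfold coincidence. tauto.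
Qed.
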